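(* There exists an absolute constant $C>0$ such that the following holds for all $d\in\mathbb N$, all probability measures $R$ on $\mathbb R^d$, all symmetric measurable $u:\mathbb R^d\times\mathbb R^d\to\mathbb R$ and all $n\ge2$ (with $0<\sigma_{\mathrm{full}}<\infty$). If $\nu\in(2,3]$ and $\{\phi_k\}_{k\ge1},\{\lambda_k\}_{k\ge1}$ are such that $\varepsilon_{K;\nu}\to0$ as $K\to\infty$, then $$\sup_{t\in\mathbb R}\Big|\mathbb P\Big(\tfrac{\sqrt{n(n-1)}}{\sigma_{\mathrm{full}}}D_n>t\Big)-\lim_{K\to\infty}\mathbb P\Big(\tfrac{\sqrt{n(n-1)}}{\sigma_{\mathrm{full}}}W_n^K>t\Big)\Big|$$ $$\le C\bigg(\frac1{(n-1)^{1/5}}+\Big(\frac{\sqrt{n-1}\,\sigma_{\mathrm{cond}}}{\sigma_{\mathrm{full}}}\Big)^{2/5}+n^{-\frac{\nu-2}{4\nu+2}}\Big(\frac{(M_{\mathrm{full};\nu})^\nu}{\sigma_{\mathrm{full}}^\nu}+\frac{((n-1)^{1/2}M_{\mathrm{cond};\nu})^\nu}{\sigma_{\mathrm{full}}^\nu}\Big)^{\frac1{2\nu+1}}\bigg).$$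
   Context: Let $\mathbf X_1,\dots,\mathbf X_n$ be i.i.d. with law $R$ on $\mathbb R^d$, $D=\mathbb E[u(\mathbf X_1,\mathbf X_2)]$, $D_n=\frac1{n(n-1)}\sum_{1\le i\ne j\le n}u(\mathbf X_i,\mathbf X_j)$. Write $\|Y\|_{L_\nu}=\mathbb E[|Y|^\nu]^{1/\nu}$. Define $M_{\mathrm{cond};\nu}=\|\mathbb E[u(\mathbf X_1,\mathbf X_2)|\mathbf X_2]-D\|_{L_\nu}$, $M_{\mathrm{full};\nu}=\|u(\mathbf X_1,\mathbf X_2)-D\|_{L_\nu}$, $\sigma_{\mathrm{cond}}=M_{\mathrm{cond};2}$, $\sigma_{\mathrm{full}}=M_{\mathrm{full};2}$. For functions $\phi_k:\mathbb R^d\to\mathbb R$ (with $\mathbb E[\phi_k(\mathbf X_1)^2]<\infty$) and reals $\lambda_k$, $k\ge1$, let $\varepsilon_{K;\nu}=\big\|\sum_{k=1}^K\lambda_k\phi_k(\mathbf X_1)\phi_k(\mathbf X_2)-u(\mathbf X_1,\mathbf X_2)\big\|_{L_\nu}$. For $K\in\mathbb N$ let $\Lambda^K=\mathrm{diag}\{\lambda_1,\dots,\lambda_K\}$, $\phi^K(x)=(\phi_1(x),\dots,\phi_K(x))^\top$, $\Sigma^K=\mathrm{Cov}[\phi^K(\mathbf X_1)]$, and let $\{\tau_{k;d}\}_{k=1}^K$ be the eigenvalues of $(\Sigma^K)^{1/2}\Lambda^K(\Sigma^K)^{1/2}$. With $\{\xi_k\}_{k\ge1}$ i.i.d. standard Gaussians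 on $\mathbb R$, $$W_n^K=\frac1{\sqrt{n(n-1)}}\sum_{k=1}^K\tau_{k;d}(\xi_k^2-1)+D.$$
   Formalization: The limit in K can fail to exist at t = sqrt(n(n-1)) D / sigma_full when sigma_full^2 = 2 sigma_cond^2; existence is claimed for all other t, and at that point the bound is proved for every value between the lower and upper limits (the limit itself if it exists). *)

(* Defs.v *)
From HB Require Import structures.
From mathcomp Require Export all_boot all_order all_algebra.
From mathcomp Require Export all_classical all_reals all_analysis.
Export Order.TTheory GRing.Theory Num.Theory numFieldNormedType.Exports.

Set Implicit Arguments.
Unset Strict Implicit.
Unset Printing Implicit Defensive.

Local Open Scope classical_set_scope.
Local Open Scope ring_scope.

(* Finite subfamilies are indexed by duplicate-free lists, so that the same
   definition serves finite families and infinite sequences. *)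
Definition mutually_independent d (Om : measurableType d) (R : realType)
    (P : probability Om R) (I : choiceType) d' (T : measurableType d')
    (X : I -> Om -> T) : Prop :=
  forall (J : seq I) (A : I -> set T), uniq J ->
    (forall i, measurable (A i)) ->
    P (\bigcap_(i in [set` J]) X i @^-1` A i) =
    (\prod_(i <- J) P (X i @^-1` A i))%E.

Definition iid_with_law d (Om : measurableType d) (R : realType)
    (P : probability Om R) (I : choiceType) d' (T : measurableType d')
    (X : I -> {RV P >-> T}) (law : set T -> \bar R) : Prop :=
  (forall i A, measurable A -> distribution P (X i) A = law A) /\
  mutually_independent P (fun i => X i : Om -> T).

(* [Z] is a version of the conditional expectation E[Y | X]; the second
   condition is measurability of [Z] with respect to the sigma-algebra
   generated by [X]. *)
Definition is_cond_expectation d (Om : measurableType d) (R : realType)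
    (P : probability Om R) d' (T : measurableType d')
    (Y : Om -> R) (X : Om -> T) (Z : Om -> R) : Prop :=
  [/\ P.-integrable setT (EFin \o Z),
      preimage_set_system setT Z measurable `<=`
        preimage_set_system setT X measurable
    & forall A, preimage_set_system setT X measurable A ->
        (\int[P]_(w in A) (Z w)%:E = \int[P]_(w in A) (Y w)%:E)%E].

Definition is_psd_sqrt (R : realType) K (A S : 'M[R]_K) : Prop :=
  [/\ S^T = S, forall v : 'rV[R]_K, 0 <= (v *m S *m v^T) 0 0 & S *m S = A].

(* [tau] lists the eigenvalues of [A] with multiplicity, in some order. *)
Definition eigenvalues_are (R : realType) K (A : 'M[R]_K) (tau : 'I_K -> R)
    : Prop :=
  char_poly A = \prod_(k < K) ('X - (tau k)%:P).

Definition Ustat (R : realType) (T : Type) n (u : T * T -> R) (x : 'I_n -> T)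
    : R :=
  ((n * n.-1)%:R)^-1 * \sum_(i < n) \sum_(j < n | j != i) u (x i, x j).

Section Moments.
Context d (Om : measurableType d) (R : realType) (P : probability Om R).

Definition mean (Y : Om -> R) : R := fine ('E_P[Y]).

Definition centered_norm (Y : Om -> R) (D nu : R) : \bar R :=
  ('N[P]_nu%:E[EFin \o (fun w => Y w - D)%R])%E.

Section Kernel.
Context (T : Type) (X1 X2 : Om -> T) (phi : nat -> T -> R) (lam : nat -> R).

(* The functions phi_1, phi_2, ... are numbered from 0. *)
Definition expansion_error (u : T * T -> R) (nu : R) (K : nat) : \bar R :=
  ('N[P]_nu%:E[EFin \o (fun w =>
     \sum_(k < K) lam k * phi k (X1 w) * phi k (X2 w) - u (X1 w, X2 w))%R])%E.

Definition feature_cov (K : nat) : 'M[R]_K :=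
  \matrix_(i < K, j < K) fine (covariance P (phi i \o X1) (phi j \o X1)).

Definition weight_mx (K : nat) : 'M[R]_K := diag_mx (\row_(k < K) lam k).

End Kernel.
End Moments.

Definition gauss_quad (R : realType) (Om : Type) (n : nat) (D : R)
    (tau : forall K, 'I_K -> R) (xi : nat -> Om -> R) (K : nat) (w : Om) : R :=
  (Num.sqrt (n * n.-1)%:R)^-1 *
    \sum_(k < K) tau K k * (xi k w ^+ 2 - 1) + D.

(* Main.v *)
(* The statistic is the off-diagonal sum of u - D over the sample. Up to a linear part,
   whose variance is governed by sigma_cond, and an error that is arbitrarily small in L2,
   it is the sum of the doubly centred expansion h(x, y) = sum_k lam_k f_k(x) f_k(y), with
   f_k = phi_k - E phi_k and k < K: a quadratic form in i.i.d. centred vectors of R^K.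

   Lindeberg's method, applied to a smooth step function of this quadratic form, replaces
   the vectors by Gaussian ones with the same covariance. The cost does not depend on K:
   given the other points, the form is affine in the replaced vector, and absolute moments
   of Gaussian linear forms are bounded by their variances, so that only E|h|^nu enters.
   In an eigenbasis the Gaussian form is sum_k tau_k sum_(i <> j) eta_ik eta_jk, which is
   close in L2 to n sum_k tau_k (xi_k^2 - 1).

   The width delta of the smooth step is paid for by anti-concentration. The squared
   modulus of the characteristic function of Q = sum_k tau_k (xi_k^2 - 1) at z is at most
   (1 + 4 z^2 |tau|^2)^(-1/2), whence P(|Q - t| <= delta) <= C sqrt (delta / |tau|), and
   optimising delta gives the three terms of the bound.

   The laws of the forms Q_K form a Cauchy sequence because Q_K and Q_L are limits of
   U-statistics of m Gaussian points of R^L, m -> oo, with kernels that are close in L2. *)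
Require Import Defs.
From mathcomp Require Import measurable_realfun ring lra.
Set Implicit Arguments.
Unset Strict Implicit.
Unset Printing Implicit Defensive.
Local Open Scope classical_set_scope.
Local Open Scope ring_scope.

(** Two obstacles shape the argument. First, no estimate may depend on K, although the features are
    only assumed square integrable. Everything is therefore phrased through the scalar functions v
    |-> sum_k lam_k v_k x_k: the two laws need only agree on their means and variances, and the
    nu-th moments of partial sums come from a Rosenthal-type induction in which Lyapunov's
    inequality turns variances back into nu-th moments. Second, anti-concentration needs sum_k
    tau_k^2 to be of order sigma_full^2, while sigma_full^2 is 2 sigma_cond^2 plus the variance of
    the degenerate part, and the linear part might carry it all. If (n-1) sigma_cond^2 /
    sigma_full^2 exceeds 1/48 the claim is trivial; otherwise the degenerate part dominates. The
    loss of a square root in anti-concentration reflects the unbounded density of a single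
    chi-square variable. An L2 error V costs V / delta^2 by Chebyshev, the replacement costs L /
    delta^nu; balancing each with sqrt delta gives the powers 1/5 and 1/(2 nu + 1). *)

Section Law.
Context d d' (T : measurableType d) (T' : measurableType d') (R : realType).
Variables (P : probability T R) (F : T -> T') (mF : measurable_fun [set: T] F).

Definition mfun_of : {mfun T >-> T'} := mfun_Sub (mem_set mF).

Definition law : probability T' R := distribution P mfun_of.

Lemma lawE A : law A = P (F @^-1` A).
Proof. by []. Qed.

Lemma ge0_integral_law (f : T' -> \bar R) : measurable_fun [set: T'] f ->
  (forall y, (0 <= f y)%E) -> (\int[law]_y f y = \int[P]_x f (F x))%E.
Proof. by move=> mf f0; rewrite /law ge0_integral_distribution. Qed.

Lemma integral_law (f : T' -> \bar R) : measurable_fun [set: T'] f ->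
  (\int[law]_y f y = \int[P]_x f (F x))%E.
Proof.
move=> mf; rewrite integralE [RHS]integralE; congr (_ - _)%E.
  by rewrite ge0_integral_law//; [apply: eq_integral => x _; rewrite !funeposE|exact: measurable_funepos].
by rewrite ge0_integral_law//; [apply: eq_integral => x _; rewrite !funenegE|exact: measurable_funeneg].
Qed.
End Law.

(** * Real-valued expectations, probabilities and product measures *)

Section Expectation.
Context d (T : measurableType d) (R : realType) (P : probability T R).
Implicit Types f g : T -> R.

(** Being real, it obeys ordinary linear arithmetic; the price is the default value 0 for an
    infinite integral, so most rules below ask for [intg]. *)
Definition Ex f : R := \int[P]_x f x.
Definition intg f := P.-integrable [set: T] (EFin \o f).

Lemma intg_measurable f : intg f -> measurable_fun [set: T] f.
Proof. by move=> /integrableP[/measurable_EFinP]. Qed.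

Lemma intgD f g : intg f -> intg g -> intg (fun x => f x + g x).
Proof. exact: integrableD. Qed.

Lemma intgB f g : intg f -> intg g -> intg (fun x => f x - g x).
Proof. exact: integrableB. Qed.

Lemma intgZ c f : intg f -> intg (fun x => c * f x).
Proof. exact: integrableZl. Qed.

Lemma intg_cst c : intg (fun=> c).
Proof. exact: finite_measure_integrable_cst. Qed.

Lemma intg_le f g : measurable_fun [set: T] f -> (forall x, `|f x| <= g x) ->
  intg g -> intg f.
Proof.
move=> mf fg; apply: le_integrable => //; first exact/measurable_EFinP.
by move=> x _ /=; rewrite lee_fin (le_trans (fg x))// ler_norm.
Qed.

Lemma intg_norm f : intg f -> intg (fun x => `|f x|).
Proof. exact: integrable_norm. Qed.

Lemma intg_bdd f M : measurable_fun [set: T] f -> (forall x, `|f x| <= M) ->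
  intg f.
Proof. by move=> mf fM; exact: (intg_le mf fM (intg_cst M)). Qed.

Lemma intg_sum I (s : seq I) (h : I -> T -> R) : (forall i, intg (h i)) ->
  intg (fun x => \sum_(i <- s) h i x).
Proof.
move=> ih; elim: s => [|i s IH].
  by under [X in intg X]funext do rewrite big_nil; exact: intg_cst.
by under [X in intg X]funext do rewrite big_cons; exact: intgD.
Qed.

Lemma ExD f g : intg f -> intg g -> Ex (fun x => f x + g x) = Ex f + Ex g.
Proof. exact: RintegralD. Qed.

Lemma ExB f g : intg f -> intg g -> Ex (fun x => f x - g x) = Ex f - Ex g.
Proof. exact: RintegralB. Qed.

Lemma ExZ c f : intg f -> Ex (fun x => c * f x) = c * Ex f.
Proof. exact: RintegralZl. Qed.

Lemma Ex_cst c : Ex (fun=> c) = c.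
Proof.
rewrite /Ex Rintegral_cst// -[RHS]mulr1; congr (_ * _).
by have /(congr1 fine) := @probability_setT _ _ _ P.
Qed.

Lemma Ex_sum I (s : seq I) (h : I -> T -> R) : (forall i, intg (h i)) ->
  Ex (fun x => \sum_(i <- s) h i x) = \sum_(i <- s) Ex (h i).
Proof.
move=> ih; elim: s => [|i s IH].
  by rewrite big_nil; under [X in Ex X]funext do rewrite big_nil; exact: Ex_cst.
rewrite big_cons -IH -ExD//; last exact: intg_sum.
by congr Ex; apply/funext => x; rewrite big_cons.
Qed.

Lemma Ex_le f g : intg f -> intg g -> (forall x, f x <= g x) -> Ex f <= Ex g.
Proof. by move=> f_ g_ fg; exact: le_Rintegral. Qed.

Lemma Ex_ge0 f : (forall x, 0 <= f x) -> 0 <= Ex f.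
Proof. by move=> f0; exact: Rintegral_ge0. Qed.

Lemma Ex_norm f : intg f -> `|Ex f| <= Ex (fun x => `|f x|).
Proof. by move=> ?; exact: le_normr_Rintegral. Qed.

Lemma ExE f : intg f -> (Ex f)%:E = (\int[P]_x (f x)%:E)%E.
Proof. by move=> fi; rewrite /Ex /Rintegral fineK//; exact: integrable_fin_num. Qed.

Lemma intg_ge0P f : measurable_fun [set: T] f -> (forall x, 0 <= f x) ->
  intg f <-> (\int[P]_x (f x)%:E < +oo)%E.
Proof.
move=> mf f0; have e : (\int[P]_x `|(f x)%:E| = \int[P]_x (f x)%:E)%E.
  by apply: eq_integral => x _; rewrite gee0_abs// lee_fin.
split=> [/integrableP[_]|h]; first by rewrite e.
by apply/integrableP; split; [exact/measurable_EFinP|rewrite e].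
Qed.

Lemma Ex_le_nn f M : (forall x, 0 <= f x) ->
  (\int[P]_x (f x)%:E <= M%:E)%E -> Ex f <= M.
Proof.
move=> f0 h; rewrite /Ex /Rintegral.
rewrite -lee_fin fineK// ge0_fin_numE; last first.
  by apply: integral_ge0 => x _; rewrite lee_fin.
by rewrite (le_lt_trans h)// ltry.
Qed.

Lemma nn_le f g : measurable_fun [set: T] f -> measurable_fun [set: T] g ->
  (forall x, 0 <= f x) -> (forall x, f x <= g x) ->
  (\int[P]_x (f x)%:E <= \int[P]_x (g x)%:E)%E.
Proof.
move=> mf mg f0 fg; apply: ge0_le_integral => //.
- by move=> x _; rewrite lee_fin.
- exact/measurable_EFinP.
- exact/measurable_EFinP.
- by move=> x _; rewrite lee_fin.
Qed.

Definition sq f := measurable_fun [set: T] f /\ intg (fun x => f x ^+ 2).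

Lemma sq_bdd f M : measurable_fun [set: T] f -> (forall x, `|f x| <= M) -> sq f.
Proof.
move=> mf fM; split=> //; apply: (@intg_bdd _ (M ^+ 2)).
  exact: measurable_funX.
by move=> x; rewrite normrX lerXn2r// nnegrE// (le_trans _ (fM x)).
Qed.

Lemma sq_mul f g : sq f -> sq g -> intg (fun x => f x * g x).
Proof.
move=> [mf f2] [mg g2].
apply: (@intg_le _ (fun x => f x ^+ 2 + g x ^+ 2)).
- exact: measurable_funM.
- by move=> x; rewrite ler_norml; apply/andP; split;
    have := sqr_ge0 (f x + g x); have := sqr_ge0 (f x - g x);
    have := sqr_ge0 (f x); have := sqr_ge0 (g x); nra.
- exact: intgD.
Qed.

Lemma sq_cst c : sq (fun=> c).
Proof. by split=> //; exact: intg_cst. Qed.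

Lemma sq_intg f : sq f -> intg f.
Proof.
move=> sf; have := sq_mul sf (sq_cst 1).
by under [X in intg X -> _]funext do rewrite mulr1.
Qed.

Lemma sqD f g : sq f -> sq g -> sq (fun x => f x + g x).
Proof.
move=> sf sg; split; first by apply: measurable_funD; [case: sf|case: sg].
under [X in intg X]funext do rewrite sqrrD.
apply: intgD; last by case: sg.
apply: intgD; first by case: sf.
under [X in intg X]funext do rewrite -mulr_natl.
by apply: intgZ; exact: sq_mul.
Qed.

Lemma sqZ c f : sq f -> sq (fun x => c * f x).
Proof.
move=> [mf f2]; split; first exact: measurable_funM.
by under [X in intg X]funext do rewrite exprMn; exact: intgZ.
Qed.

Lemma sqB f g : sq f -> sq g -> sq (fun x => f x - g x).
Proof.
move=> sf sg; have := sqD sf (sqZ (-1) sg).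
by under [X in sq X -> _]funext do rewrite mulN1r.
Qed.

Lemma sq_sum I (s : seq I) (h : I -> T -> R) : (forall i, sq (h i)) ->
  sq (fun x => \sum_(i <- s) h i x).
Proof.
move=> ih; elim: s => [|i s IH].
  by under [X in sq X]funext do rewrite big_nil; exact: sq_cst.
by under [X in sq X]funext do rewrite big_cons; exact: sqD.
Qed.

Lemma Ex_sqr_le f : sq f -> (Ex f) ^+ 2 <= Ex (fun x => f x ^+ 2).
Proof.
move=> sf; have fi := sq_intg sf.
have : 0 <= Ex (fun x => (f x - Ex f) ^+ 2) by apply: Ex_ge0 => x; exact: sqr_ge0.
have -> : (fun x => (f x - Ex f) ^+ 2) =
    (fun x => f x ^+ 2 + ((-2 * Ex f) * f x + (Ex f) ^+ 2)).
  by apply/funext => x; ring.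
rewrite ExD; [|by case: sf|by apply: intgD; [exact: intgZ|exact: intg_cst]].
rewrite ExD; [|exact: intgZ|exact: intg_cst].
rewrite ExZ// Ex_cst; lra.
Qed.

Definition Pr (A : set T) : R := fine (P A).

Lemma PrE A : measurable A -> (Pr A)%:E = P A.
Proof. by move=> mA; rewrite /Pr fineK// fin_num_measure. Qed.

Lemma Pr_ge0 A : 0 <= Pr A. Proof. by rewrite /Pr fine_ge0. Qed.

Lemma Pr_le1 A : measurable A -> Pr A <= 1.
Proof. by move=> mA; rewrite -lee_fin PrE// probability_le1. Qed.

Lemma Pr_indic A : measurable A -> Pr A = Ex (\1_A).
Proof. by move=> mA; rewrite /Ex /Rintegral integral_indic// setIT. Qed.

Lemma Pr_subU A B C : measurable A -> measurable B -> measurable C ->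
  A `<=` B `|` C -> Pr A <= Pr B + Pr C.
Proof.
move=> mA mB mC ABC; rewrite -lee_fin EFinD !PrE//.
apply: (le_trans (le_measure P _ _ ABC)); rewrite ?inE//; first exact: measurableU.
exact: measureU2.
Qed.

Lemma Pr_le_Ex A f : measurable A -> intg f -> (forall x, 0 <= f x) ->
  (forall x, A x -> 1 <= f x) -> Pr A <= Ex f.
Proof.
move=> mA fi f0 f1; rewrite Pr_indic//; apply: Ex_le => //.
  apply: (@intg_bdd _ 1) => [|x]; first exact: measurable_indic.
  by rewrite indicE; case: (_ \in _) => /=; rewrite ?normr1 ?normr0.
move=> x; rewrite indicE.
by case: (boolP (x \in A)) => [/set_mem|_]; [exact: f1|exact: f0].
Qed.

Lemma Ex_le_Pr A f : measurable A -> intg f -> (forall x, f x <= 1) ->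
  (forall x, ~ A x -> f x <= 0) -> Ex f <= Pr A.
Proof.
move=> mA fi f1 f0; rewrite Pr_indic//; apply: Ex_le => //.
  apply: (@intg_bdd _ 1) => [|x]; first exact: measurable_indic.
  by rewrite indicE; case: (_ \in _) => /=; rewrite ?normr1 ?normr0.
move=> x; rewrite indicE.
by case: (boolP (x \in A)) => [_|/negP xA]; [exact: f1|apply: f0 => /mem_set].
Qed.

Lemma measurable_gt f t : measurable_fun [set: T] f ->
  measurable [set x | t < f x].
Proof.
move=> mf; rewrite -[X in measurable X]setTI.
have -> : [set x | t < f x] = f @^-1` `]t, +oo[.
  by apply/seteqP; split=> x /=; rewrite in_itv/= andbT.
exact: mf.
Qed.

Lemma measurable_norm_gt f t : measurable_fun [set: T] f ->
  measurable [set x | t < `|f x|].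
Proof. by move=> mf; apply: measurable_gt; exact: measurableT_comp. Qed.

Lemma Pr_chebyshev f e : sq f -> 0 < e ->
  Pr [set x | e < `|f x|] <= Ex (fun x => f x ^+ 2) / e ^+ 2.
Proof.
move=> [mf f2] e0; rewrite mulrC -ExZ//; apply: Pr_le_Ex.
- exact: measurable_norm_gt.
- exact: intgZ.
- by move=> x; rewrite mulr_ge0 ?invr_ge0 ?sqr_ge0.
- move=> x /= ex; rewrite mulrC ler_pdivlMr ?exprn_gt0// mul1r -[f x ^+ 2]real_normK ?num_real//.
  by rewrite lerXn2r ?nnegrE ?ltW// (lt_trans e0).
Qed.
End Expectation.

Section LawEx.
Context d d' (T : measurableType d) (T' : measurableType d') (R : realType).
Variables (P : probability T R) (F : T -> T') (mF : measurable_fun [set: T] F).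
Implicit Types f : T' -> R.

Lemma Ex_law f : measurable_fun [set: T'] f -> Ex (law P mF) f = Ex P (f \o F).
Proof.
move=> mf; rewrite /Ex /Rintegral integral_law//; exact/measurable_EFinP.
Qed.

Lemma intg_law f : measurable_fun [set: T'] f ->
  intg (law P mF) f <-> intg P (f \o F).
Proof.
move=> mf; have mfF : measurable_fun [set: T] (f \o F) by exact: measurableT_comp.
have e : (\int[law P mF]_x `|(f x)%:E| = \int[P]_x `|((f \o F) x)%:E|)%E.
  rewrite ge0_integral_law//; apply: measurableT_comp => //; exact/measurable_EFinP.
split=> /integrableP[_ h]; apply/integrableP; split.
- exact/measurable_EFinP.
- by move: h; rewrite e.
- exact/measurable_EFinP.
- by rewrite e.
Qed.

Lemma Pr_law A : Pr (law P mF) A = Pr P (F @^-1` A).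
Proof. by []. Qed.
End LawEx.

Section Prod.
Context d1 d2 (T1 : measurableType d1) (T2 : measurableType d2) (R : realType).
Variables (P1 : probability T1 R) (P2 : probability T2 R).
Implicit Types f : T1 * T2 -> R.

Definition pprod : probability (T1 * T2)%type R := (P1 \x P2)%E.

Lemma pprod_rect A B : measurable A -> measurable B ->
  pprod (A `*` B) = (P1 A * P2 B)%E.
Proof. by move=> mA mB; rewrite /pprod/= product_measure1E. Qed.

Lemma tonelli (f : T1 * T2 -> \bar R) : measurable_fun [set: T1 * T2] f ->
  (forall x, (0 <= f x)%E) ->
  (\int[pprod]_z f z = \int[P1]_x \int[P2]_y f (x, y))%E.
Proof. exact: fubini_tonelli1. Qed.

Lemma tonelli2 (f : T1 * T2 -> \bar R) : measurable_fun [set: T1 * T2] f ->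
  (forall x, (0 <= f x)%E) ->
  (\int[pprod]_z f z = \int[P2]_y \int[P1]_x f (x, y))%E.
Proof. exact: fubini_tonelli2. Qed.

(** The inner extended integral is finite for almost every x only. On the exceptional null set [Ex]
    takes its default value, which the outer integral does not see. *)
Let Ex_prod_aux f : intg pprod f ->
  measurable_fun [set: T1] (fun x => Ex P2 (fun y => f (x, y))) /\
  (\int[P1]_x (Ex P2 (fun y => f (x, y)))%:E = \int[pprod]_z (f z)%:E)%E.
Proof.
move=> fi; have Fi := integrable_fubini_F fi.
have mF : measurable_fun [set: T1] (fun x => Ex P2 (fun y => f (x, y))).
  apply: measurableT_comp; first exact: fine_measurable.
  exact: (measurable_int _ Fi).
split=> //; rewrite -(integral12_prod_meas1 fi).
apply: ae_eq_integral => //; first exact/measurable_EFinP.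
  exact: (measurable_int _ Fi).
apply: filterS (integrable_ae measurableT Fi) => x /= /(_ I) h _.
by rewrite /Ex /Rintegral fineK.
Qed.

Lemma measurable_Ex_prod f : intg pprod f ->
  measurable_fun [set: T1] (fun x => Ex P2 (fun y => f (x, y))).
Proof. by case/Ex_prod_aux. Qed.

Lemma Ex_prod f : intg pprod f ->
  Ex pprod f = Ex P1 (fun x => Ex P2 (fun y => f (x, y))).
Proof. by case/Ex_prod_aux => _ e; rewrite /Ex /Rintegral -e. Qed.

Lemma intg_Ex f : intg pprod f -> intg P1 (fun x => Ex P2 (fun y => f (x, y))).
Proof.
move=> fi; have Fi := integrable_fubini_F fi; have [mF _] := Ex_prod_aux fi.
apply: le_integrable Fi => //; first exact/measurable_EFinP.
move=> x _ /=; rewrite /Ex /Rintegral /fubini_F /=.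
by case: (\int[P2]_y _)%E => //= [|]; rewrite normr0 leey.
Qed.

Lemma intg_prod f : measurable_fun [set: T1 * T2] f -> (forall z, 0 <= f z) ->
  (forall x, intg P2 (fun y => f (x, y))) ->
  intg P1 (fun x => Ex P2 (fun y => f (x, y))) -> intg pprod f.
Proof.
move=> mf f0 f2 f1; apply/intg_ge0P => //; rewrite tonelli.
- have -> : (\int[P1]_x \int[P2]_y (f (x, y))%:E =
    \int[P1]_x (Ex P2 (fun y => f (x, y)))%:E)%E.
    by apply: eq_integral => x _; rewrite ExE.
  by rewrite -ExE// ltry.
- exact/measurable_EFinP.
- by move=> x; rewrite lee_fin.
Qed.
End Prod.

Lemma integral_pprod_law d1 d2 (T1 : measurableType d1) (T2 : measurableType d2)
    (R : realType) (P1 : probability T1 R) (P2 : probability T2 R)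
    d1' d2' (T1' : measurableType d1') (T2' : measurableType d2')
    (F1 : T1 -> T1') (F2 : T2 -> T2') (m1 : measurable_fun [set: T1] F1)
    (m2 : measurable_fun [set: T2] F2) (f : T1' * T2' -> \bar R) :
  measurable_fun [set: T1' * T2'] f -> (forall z, (0 <= f z)%E) ->
  (\int[pprod (law P1 m1) (law P2 m2)]_z f z =
   \int[pprod P1 P2]_z f (F1 z.1, F2 z.2))%E.
Proof.
move=> mf f0.
have mF : measurable_fun [set: T1 * T2] (fun z => (F1 z.1, F2 z.2)).
  by apply: measurable_fun_pair; exact: measurableT_comp.
rewrite !tonelli//; last exact: measurableT_comp.
rewrite ge0_integral_law//.
- apply: eq_integral => x _; rewrite ge0_integral_law//.
  exact: measurableT_comp.
- exact: (measurable_fun_fubini_tonelli_F f).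
- by move=> x; exact: integral_ge0.
Qed.

Lemma swap_pprod d1 d2 (T1 : measurableType d1) (T2 : measurableType d2)
    (R : realType) (P1 : probability T1 R) (P2 : probability T2 R)
    (f : T1 * T2 -> \bar R) :
  measurable_fun [set: T1 * T2] f -> (forall z, (0 <= f z)%E) ->
  (\int[pprod P1 P2]_z f z = \int[pprod P2 P1]_z f (z.2, z.1))%E.
Proof.
move=> mf f0; rewrite tonelli2// [RHS]tonelli//.
by apply: measurableT_comp => //; exact: measurable_swap.
Qed.

Arguments law : simpl never.
Arguments pprod : simpl never.

(** * Products of a law and independent samples *)

Section TupleMeasure.
Context d (T : measurableType d) (R : realType) (n : nat).

Definition box (A : 'I_n -> set T) : set (n.-tuple T) :=
  [set t | forall i, A i (tnth t i)].

Lemma measurable_box A : (forall i, measurable (A i)) -> measurable (box A).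
Proof.
move=> mA.
have -> : box A = \big[setI/setT]_(i < n) ((@tnth _ T ^~ i) @^-1` A i).
  rewrite -bigcap_seq; apply/seteqP; split => t /= h i; first by move=> _; exact: h.
  by apply: (h i); rewrite /= mem_index_enum.
elim/big_ind : _ => //; first exact: measurableI.
by move=> i _; rewrite -[X in measurable X]setTI; apply: measurable_tnth.
Qed.

(** Boxes generate the coordinate sigma-algebra and are stable under intersection, so uniqueness of
    finite measures on a pi-system applies. *)
Lemma tuple_measure_unique (m1 m2 : probability (n.-tuple T) R) :
  (forall A, (forall i, measurable (A i)) -> m1 (box A) = m2 (box A)) ->
  forall B, measurable B -> m1 B = m2 B.
Proof.
move=> h; pose G := [set B | exists2 A, (forall i, measurable (A i)) & B = box A].
apply: (measure_unique G (fun=> setT)) => //.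
- apply/seteqP; split; last first.
    apply: smallest_sub; first exact: sigma_algebra_measurable.
    by move=> _ [A mA ->]; exact: measurable_box.
  apply: smallest_sub; first exact: smallest_sigma_algebra.
  move=> B; rewrite -bigcup_seq => -[i /= _ [C mC <-]].
  apply: sub_sigma_algebra; exists (fun j => if j == i then C else setT).
    by move=> j; case: ifP.
  rewrite setTI; apply/seteqP; split => t /= ht.
    by move=> j; case: eqP => // ->.
  by have := ht i; rewrite eqxx.
- move=> _ _ [A mA ->] [B mB ->]; exists (fun i => A i `&` B i).
    by move=> i; exact: measurableI.
  by apply/seteqP; split => [t [hA hB] i|t hAB]; [split|split=> i; case: (hAB i)].
- by exists (fun=> setT) => //; apply/seteqP; split.
- by rewrite bigcup_const.
- by move=> _ [A mA ->]; exact: h.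
- by move=> _; apply: (le_lt_trans (probability_le1 m1 measurableT)); rewrite ltry.
Qed.
End TupleMeasure.

Section Power.
Context d (T : measurableType d) (R : realType) (P : probability T R).

Definition mcons n (z : T * n.-tuple T) : n.+1.-tuple T := [tuple of z.1 :: z.2].

Lemma measurable_mcons n : measurable_fun [set: T * n.-tuple T] (@mcons n).
Proof. exact: measurable_cons. Qed.

(** The n-fold product of [P]. Prepending one coordinate at a time makes every induction on the
    sample size a single use of Tonelli's or Fubini's theorem. *)
Fixpoint pw n : probability (n.-tuple T) R :=
  if n is n'.+1 then law (pprod P (pw n')) (@measurable_mcons n')
  else \d_([tuple] : 0.-tuple T).

Lemma pw_box n (A : 'I_n -> set T) : (forall i, measurable (A i)) ->
  pw n (box A) = (\prod_(i < n) P (A i))%E.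
Proof.
elim: n A => [|n IH] A mA.
  by rewrite big_ord0 /= diracE mem_set// => -[].
rewrite (_ : pw n.+1 _ = pprod P (pw n) (@mcons n @^-1` box A))//.
have -> : @mcons n @^-1` box A = A ord0 `*` box (A \o lift ord0).
  apply/seteqP; split => -[x t] /=.
    move=> h; split=> [|i]; first exact: (h ord0).
    by have /= := h (lift ord0 i); rewrite tnthS.
  move=> [hx ht] i; case: (unliftP ord0 i) => [j ->|->]; last by [].
  by have := ht j; rewrite /mcons tnthS.
rewrite pprod_rect//; last by apply: measurable_box => i; exact: mA.
by rewrite big_ord_recl IH// => i; exact: mA.
Qed.

Lemma ge0_integral_pwS n (f : n.+1.-tuple T -> \bar R) :
  measurable_fun [set: n.+1.-tuple T] f -> (forall t, (0 <= f t)%E) ->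
  (\int[pw n.+1]_t f t = \int[P]_x \int[pw n]_t f (mcons (x, t)))%E.
Proof.
move=> mf f0; rewrite /= ge0_integral_law// tonelli//.
by apply: measurableT_comp => //; exact: measurable_mcons.
Qed.

Lemma intg_pwS n f : measurable_fun [set: n.+1.-tuple T] f ->
  intg (pw n.+1) f <-> intg (pprod P (pw n)) (f \o @mcons n).
Proof. by move=> mf; rewrite intg_law. Qed.

Lemma Ex_pwS n f : measurable_fun [set: n.+1.-tuple T] f ->
  Ex (pw n.+1) f = Ex (pprod P (pw n)) (f \o @mcons n).
Proof. by move=> mf; rewrite /= Ex_law. Qed.
End Power.

Section Independence.
Context d (Om : measurableType d) (R : realType) (P : probability Om R).
Context (I : choiceType) d' (T : measurableType d') (X : I -> {RV P >-> T}).
Variable mu : probability T R.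

Definition sample n (s : n.-tuple I) (w : Om) : n.-tuple T :=
  [tuple X (tnth s i) w | i < n].

Lemma measurable_sample n (s : n.-tuple I) : measurable_fun [set: Om] (sample s).
Proof.
apply/measurable_fun_tnthP => i.
have e : (fun w => tnth (sample s w) i) = X (tnth s i) :> (Om -> T).
  by apply/funext => w; rewrite tnth_mktuple.
by rewrite /comp e; exact: measurable_funPT.
Qed.

Lemma iid_sample n (s : n.-tuple I) (B : set (n.-tuple T)) :
  iid_with_law X mu -> uniq s -> measurable B ->
  P (sample s @^-1` B) = pw mu n B.
Proof.
move=> [hl hi] us mB; rewrite -(lawE P (measurable_sample s)).
apply: (tuple_measure_unique _ mB) => A mA.
rewrite pw_box// lawE.
(* Independence is stated for sets indexed by [I]. As [s] has no repetition, sets attached to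
   positions can be re-indexed by the entries; the whole space serves for the other indices. *)
pose A' x := if [pick i | tnth s i == x] is Some i then A i else setT.
have A'E i : A' (tnth s i) = A i.
  rewrite /A'; case: pickP => [j /eqP e|/(_ i)]; last by rewrite eqxx.
  by congr A; apply/(tuple_uniqP _ us).
have := hi s A' us; set LHS := P _; set RHS := (\prod_(i <- s) _)%E => h.
transitivity LHS.
  congr (P _); apply/seteqP; split => w /=.
    by move=> h' _ /tnthP[i ->]; rewrite /= A'E; have := h' i; rewrite tnth_mktuple.
  move=> h' i; rewrite tnth_mktuple -A'E; apply: (h' (tnth s i)).
  exact: mem_tnth.
rewrite h; last by move=> x; rewrite /A'; case: pickP.
rewrite /RHS big_tuple; apply: eq_bigr => i _.
by rewrite -(hl (tnth s i))// A'E.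
Qed.
End Independence.

(** * Power inequalities and a smooth step function *)

Section Powers.
Context (R : realType).
Implicit Types x y z h nu th p t a B : R.

Lemma powR_le_of_le nu x y : 0 <= nu -> 0 <= x -> x <= y -> x `^ nu <= y `^ nu.
Proof. by move=> n0 x0 xy; apply: ge0_ler_powR; rewrite ?nnegrE// (le_trans x0). Qed.

(** With u = 1 + y and m = 1 + th y = th u + (1 - th), the bounds ln (u / m) <= u / m - 1 and ln (1
    / m) <= 1 / m - 1, weighted by th and 1 - th, add up to th ln u <= ln m. *)
Lemma bernoulli_concave th y : 0 <= th <= 1 -> -1 <= y ->
  (1 + y) `^ th <= 1 + th * y.
Proof.
move=> /andP[th0 th1] y1.
have [->|yN1] := eqVneq y (-1).
  have [->|thn0] := eqVneq th 0; first by rewrite powRr0; lra.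
  by rewrite subrr powR0//; lra.
have u0 : 0 < 1 + y by move: y1; rewrite le_eqVlt eq_sym (negbTE yN1) /=; lra.
have m0 : 0 < 1 + th * y by have [h|h] := leP th (1 / 2); nra.
set u := 1 + y in u0 *; set m := 1 + th * y in m0 *.
have lnub x : 0 < x -> ln x <= x - 1.
  by move=> x0; have := @le_ln1Dx R (x - 1); rewrite addrCA subrr addr0; apply; lra.
rewrite -ler_ln ?posrE ?powR_gt0// ln_powR.
have h1 : ln u - ln m <= u / m - 1 by rewrite -ln_div ?posrE//; apply: lnub; exact: divr_gt0.
have h2 : - ln m <= m^-1 - 1 by rewrite -lnV ?posrE//; apply: lnub; rewrite invr_gt0.
have e : th * (u / m) + (1 - th) * m^-1 = 1.
  by rewrite mulrA -mulrDl /u; apply: (canLR (mulfK _)); rewrite ?gt_eqF// /m; ring.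
nra.
Qed.

(** The concave inequality with exponent 1/p at the point p (t - 1), raised to the power p; a
    negative left-hand side is trivial. *)
Lemma bernoulli_convex p t : 1 <= p -> 0 <= t -> 1 + p * (t - 1) <= t `^ p.
Proof.
move=> p1 t0; have [h|h] := leP (1 + p * (t - 1)) 0.
  by rewrite (le_trans h)// powR_ge0.
have p0 : 0 < p by lra.
have := @bernoulli_concave p^-1 (p * (t - 1)).
rewrite invr_ge0 ltW//= invf_le1// p1 => /(_ isT).
rewrite mulKf ?gt_eqF// addrCA subrr addr0 => /(_ ltac:(lra)) h'.
have := powR_le_of_le (ltW p0) (powR_ge0 _ _) h'.
by rewrite -powRrM mulVf ?gt_eqF// powRr1 // ltW.
Qed.

Lemma powR_split nu x : 2 <= nu -> 0 <= x -> x `^ nu = x ^+ 2 * x `^ (nu - 2).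
Proof.
move=> n2 x0; have [->|xn] := eqVneq x 0; first by rewrite powR0 ?expr0n ?mul0r//; lra.
by rewrite -powR_mulrn// -powRD ?xn ?implybT//; congr (_ `^ _); ring.
Qed.

Lemma powR_ge_cube nu x : nu <= 3 -> 0 <= x <= 1 -> x ^+ 3 <= x `^ nu.
Proof.
move=> n3 /andP[x0 x1]; have [->|xn] := eqVneq x 0.
  by rewrite expr0n powR_ge0.
by rewrite -powR_mulrn//; apply: ger_powR; rewrite ?x1 ?andbT// lt_neqAle eq_sym xn.
Qed.

Lemma powR_ge_sqr nu x : 2 <= nu -> 1 <= x -> x ^+ 2 <= x `^ nu.
Proof. by move=> n2 x1; rewrite -powR_mulrn; [exact: ler_powR|lra]. Qed.

Lemma powR_le_cube nu x : nu <= 3 -> 1 <= x -> x `^ nu <= x ^+ 3.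
Proof. by move=> n2 x1; rewrite -powR_mulrn; [exact: ler_powR|lra]. Qed.

Lemma powR_le_sqr nu x : 2 <= nu -> 0 <= x <= 1 -> x `^ nu <= x ^+ 2.
Proof.
move=> n2 /andP[x0 x1]; have [->|xn] := eqVneq x 0.
  by rewrite powR0 ?sqr_ge0//; lra.
by rewrite -powR_mulrn//; apply: ger_powR; rewrite ?x1 ?andbT// lt_neqAle eq_sym xn.
Qed.

Lemma powR_le_sqrD4 nu x : 2 <= nu <= 3 -> 0 <= x -> x `^ nu <= x ^+ 2 + x ^+ 4.
Proof.
move=> /andP[n2 n3] x0; have [x1|/ltW x1] := leP x 1.
  by apply: (le_trans (powR_le_sqr n2 _)); rewrite ?x0// lerDl exprn_ge0.
apply: (le_trans (powR_le_cube n3 x1)); rewrite ler_wpDl ?sqr_ge0//.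
by rewrite ler_weXn2l.
Qed.

(** A pointwise substitute for Jensen's inequality: if E h^2 <= B^2, integration gives E h^(nu-2) <=
    2 B^(nu-2). *)
Lemma powR_theta nu B h : 2 <= nu <= 3 -> 0 < B -> 0 <= h ->
  h `^ (nu - 2) <= B `^ (nu - 2) * (1 + h ^+ 2 / B ^+ 2).
Proof.
move=> /andP[n2 n3] B0 h0.
rewrite -{1}(divfK (lt0r_neq0 B0) h) powRM ?divr_ge0 ?(ltW B0)// mulrC.
rewrite ler_wpM2l ?powR_ge0// -expr_div_n; set t := h / B.
have t0 : 0 <= t by rewrite divr_ge0// ltW.
have [t1|/ltW t1] := leP t 1.
  apply: (@le_trans _ _ 1); last by rewrite lerDl sqr_ge0.
  by have := @powR_le_of_le (nu - 2) t 1; rewrite powR1; apply => //; lra.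
apply: (le_trans (ler1_powR t1 _)); first lra.
by rewrite ler_wpDl// expr2 ler_peMl.
Qed.

(** The coefficient of z must be the exact derivative, since only a linear term disappears when z is
    replaced by a centred variable. For |z| <= 1 the power is split into a square and a concave
    power; larger |z| is absorbed by the remainder. *)
Lemma powR_shift nu : 2 <= nu <= 3 -> forall z,
  `|1 + z| `^ nu <= 1 + nu * z + 8 * (z ^+ 2 + `|z| `^ nu).
Proof.
move=> /andP[n2 n3] z; have z2 := sqr_ge0 z; have pz := powR_ge0 `|z| nu.
have [z1|z1] := leP z (-1).
  have : `|1 + z| `^ nu <= `|z| `^ nu.
    apply: powR_le_of_le; rewrite ?normr_ge0//; first lra.
    by rewrite !ler0_norm; lra.
  have : 0 <= 1 + nu * z + 3 * z ^+ 2 by nra.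
  nra.
have z1' : 0 <= 1 + z by lra.
rewrite (ger0_norm z1').
have [zl|/ltW zg] := leP z 1.
  rewrite powR_split//.
  have := @bernoulli_concave (nu - 2) z; move=> /(_ ltac:(lra) ltac:(lra)) h.
  have : (1 + z) ^+ 2 * (1 + z) `^ (nu - 2) <= (1 + z) ^+ 2 * (1 + (nu - 2) * z).
    by rewrite ler_wpM2l ?sqr_ge0.
  have z3 : z ^+ 3 <= z ^+ 2 by rewrite -subr_ge0 (_ : _ - _ = z ^+ 2 * (1 - z)); [nra|ring].
  have : (nu - 2) * z ^+ 3 <= (nu - 2) * z ^+ 2 by rewrite ler_wpM2l//; lra.
  have -> : (1 + z) ^+ 2 * (1 + (nu - 2) * z) =
    1 + nu * z + (1 + 2 * (nu - 2)) * z ^+ 2 + (nu - 2) * z ^+ 3 by ring.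
  nra.
rewrite (ger0_norm (le_trans ler01 zg)).
have : (1 + z) `^ nu <= (2 * z) `^ nu by apply: powR_le_of_le; lra.
rewrite powRM//; last lra.
have : 2 `^ nu <= 2 ^+ 3 :> R by apply: powR_le_cube; lra.
rewrite (ger0_norm (le_trans ler01 zg)) in pz.
have -> : (2 : R) ^+ 3 = 8 by ring.
move=> h8 h; have : 2 `^ nu * z `^ nu <= 8 * z `^ nu by rewrite ler_wpM2r.
nra.
Qed.

(** Homogeneous form of [powR_shift], with z = y / h. The slope [s] may stay anonymous because it
    will multiply a variable of mean zero; what matters is that it does not depend on [y]. *)
Lemma powR_add nu : 2 <= nu <= 3 -> forall h, exists s, forall y,
  `|h + y| `^ nu <= `|h| `^ nu + s * y +
    8 * (`|h| `^ (nu - 2) * y ^+ 2 + `|y| `^ nu).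
Proof.
move=> n23 h; have [n2 n3] := andP n23; have [->|hn] := eqVneq h 0.
  exists 0 => y; rewrite add0r mul0r addr0 normr0 powR0; last lra.
  by rewrite add0r; have := powR_ge0 `|y| nu; have := powR_ge0 (0 : R) (nu - 2);
    have := sqr_ge0 y; nra.
exists (`|h| `^ nu * nu / h) => y.
have H := powR_shift n23 (y / h).
have nh0 : 0 < `|h| by rewrite normr_gt0.
have -> : h + y = h * (1 + y / h) by rewrite mulrDr mulr1 mulrC divfK.
rewrite normrM powRM//.
apply: (le_trans (ler_wpM2l (powR_ge0 _ _) H)).
rewrite le_eqVlt; apply/orP; left; apply/eqP.
have e : `|h|^-1 `^ nu = (`|h| `^ nu)^-1.
  have p0 : `|h| `^ nu != 0 by rewrite gt_eqF// powR_gt0.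
  by apply: (mulIf p0); rewrite mulVf// -powRM ?invr_ge0// mulVf ?gt_eqF// powR1.
rewrite normrM normfV powRM ?invr_ge0// e.
rewrite (powR_split n2 (ltW nh0)) real_normK ?num_real//.
by field; rewrite hn gt_eqF ?powR_gt0.
Qed.

(** The tangent at a^2 of the convex function w |-> w^(nu/2). Integrated against Y with E Y^2 = a^2,
    it yields Lyapunov's inequality a^nu <= E |Y|^nu. *)
Lemma powR_lyapunov nu a y : 2 <= nu -> 0 < a ->
  a `^ nu * (1 + (nu / 2) * (y ^+ 2 / a ^+ 2 - 1)) <= `|y| `^ nu.
Proof.
move=> n2 a0.
have h := @bernoulli_convex (nu / 2) (y ^+ 2 / a ^+ 2).
have := ler_wpM2l (powR_ge0 a nu) (h _ _).
move=> /(_ ltac:(lra) ltac:(rewrite divr_ge0// sqr_ge0//)) H.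
apply: (le_trans H).
have -> : nu / 2 = 2^-1 * nu by rewrite mulrC.
rewrite -(real_normK (num_real y)) -expr_div_n -powR_mulrn ?divr_ge0 ?(ltW a0)//.
rewrite -!powRrM (_ : 2 * (2^-1 * nu) = nu); last by field.
by rewrite -powRM ?divr_ge0 ?(ltW a0)// mulrC divfK ?gt_eqF.
Qed.

(** The converse comparison: with E Y^2 = a^2 and E Y^4 <= C a^4 it gives E |Y|^nu <= (1 + C) a^nu,
    which will serve for Gaussian linear forms. *)
Lemma powR_hyper nu a y : 2 <= nu <= 3 -> 0 < a ->
  `|y| `^ nu <= a `^ nu + a `^ nu / a ^+ 4 * y ^+ 4.
Proof.
move=> /andP[n2 n3] a0.
have -> : y ^+ 4 = `|y| ^+ 4 by rewrite -normrX ger0_norm// (_ : _ ^+ 4 = (y ^+ 2) ^+ 2) ?sqr_ge0//; ring.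
have : (`|y| / a) `^ nu <= 1 + (`|y| / a) ^+ 4.
  set t := _ / _; have t0 : 0 <= t by rewrite divr_ge0// ltW.
  have [t1|/ltW t1] := leP t 1.
    by rewrite ler_wpDr ?exprn_ge0//; have := @powR_le_of_le nu t 1; rewrite powR1; apply => //; lra.
  by rewrite ler_wpDl// (le_trans (powR_le_cube n3 t1))// ler_weXn2l.
move=> /(ler_wpM2l (powR_ge0 a nu)).
rewrite -powRM ?divr_ge0 ?(ltW a0)// mulrC divfK ?gt_eqF// mulrDr mulr1 => h.
by apply: (le_trans h); rewrite lerD2l expr_div_n mulrCA mulrC.
Qed.
End Powers.

Section SmoothStep.
Context (R : realType).
Implicit Types x y nu : R.

Definition ramp x : R := Num.max x 0.

Lemma rampP x : (x <= 0 /\ ramp x = 0) \/ (0 <= x /\ ramp x = x).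
Proof. by rewrite /ramp; case: leP => h; [left|right]; split=> //; exact: ltW. Qed.

(* A distribution function of the sum of three independent uniform variables,
   hence twice continuously differentiable. *)
Definition sstep x : R := 6^-1 *
  (ramp x ^+ 3 - 3 * ramp (x - 1) ^+ 3 + 3 * ramp (x - 2) ^+ 3 - ramp (x - 3) ^+ 3).
Definition sstep1 x : R := 2^-1 *
  (ramp x ^+ 2 - 3 * ramp (x - 1) ^+ 2 + 3 * ramp (x - 2) ^+ 2 - ramp (x - 3) ^+ 2).
Definition sstep2 x : R :=
  ramp x - 3 * ramp (x - 1) + 3 * ramp (x - 2) - ramp (x - 3).

Lemma measurable_ramp : measurable_fun [set: R] ramp.
Proof. exact: measurable_maxr. Qed.

Let measurable_rampX n c : measurable_fun [set: R] (fun x => ramp (x - c) ^+ n).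
Proof.
apply: measurable_funX; apply: measurableT_comp; first exact: measurable_ramp.
exact: measurable_funB.
Qed.

Let measurable_ramp0X n : measurable_fun [set: R] (fun x => ramp x ^+ n).
Proof. by apply: measurable_funX; exact: measurable_ramp. Qed.

Lemma measurable_sstep : measurable_fun [set: R] sstep.
Proof.
apply: measurable_funM => //; apply: measurable_funB => //.
apply: measurable_funD; last exact: measurable_funM.
by apply: measurable_funB => //; exact: measurable_funM.
Qed.

(** Case analysis between the knots 0, 1, 2 and 3. The predicate takes the four ramp values, so that
    each case becomes a polynomial statement. *)
Let regions x (P : R -> R -> R -> R -> Prop) :
  (x <= 0 -> P 0 0 0 0) -> (0 <= x <= 1 -> P x 0 0 0) ->
  (1 <= x <= 2 -> P x (x - 1) 0 0) ->
  (2 <= x <= 3 -> P x (x - 1) (x - 2) 0) ->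
  (3 <= x -> P x (x - 1) (x - 2) (x - 3)) ->
  P (ramp x) (ramp (x - 1)) (ramp (x - 2)) (ramp (x - 3)).
Proof.
move=> h0 h1 h2 h3 h4.
have rp z : 0 <= z -> ramp z = z by move=> z0; apply/max_idPl.
have rn z : z <= 0 -> ramp z = 0 by move=> z0; apply/max_idPr.
have [x0|/ltW x0] := leP x 0; first by rewrite !rn; [exact: h0|lra..].
rewrite (rp x)//.
have [x1|/ltW x1] := leP x 1; first by rewrite !rn; [apply: h1; lra|lra..].
rewrite (rp (x - 1)); last lra.
have [x2|/ltW x2] := leP x 2; first by rewrite !rn; [apply: h2; lra|lra..].
rewrite (rp (x - 2)); last lra.
have [x3|/ltW x3] := leP x 3; first by rewrite !rn; [apply: h3; lra|lra..].
by rewrite (rp (x - 3)); [exact: h4|lra].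
Qed.

Lemma sstep_le0 x : x <= 0 -> sstep x = 0.
Proof.
rewrite /sstep; apply: (@regions x (fun a b c e => x <= 0 -> 6^-1 * (a ^+ 3 - 3 * b ^+ 3 + 3 * c ^+ 3 - e ^+ 3) = 0)).
- by move=> _ _; ring.
- by move=> h h'; (have -> : x = 0 by lra); ring.
- by move=> h h'; lra.
- by move=> h h'; lra.
- by move=> h h'; lra.
Qed.

Lemma sstep_ge3 x : 3 <= x -> sstep x = 1.
Proof.
rewrite /sstep; apply: (@regions x (fun a b c e => 3 <= x -> 6^-1 * (a ^+ 3 - 3 * b ^+ 3 + 3 * c ^+ 3 - e ^+ 3) = 1)).
- by move=> h h'; lra.
- by move=> h h'; lra.
- by move=> h h'; lra.
- by move=> h h'; (have -> : x = 3 by lra); field.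
- by move=> _ _; field.
Qed.

Lemma sstep_bound x : 0 <= sstep x <= 1.
Proof.
rewrite /sstep; apply: (@regions x (fun a b c e =>
  0 <= 6^-1 * (a ^+ 3 - 3 * b ^+ 3 + 3 * c ^+ 3 - e ^+ 3) <= 1)).
- by move=> _; lra.
- move=> /andP[h0 h1]; have := exprn_ge0 3 h0; have := @exprn_ile1 _ 3 x h0 h1.
  by move: (x ^+ 3) => z; lra.
- move=> h; set y := x - 1; have hy : 0 <= y <= 1 by rewrite /y; lra.
  have -> : x = y + 1 by rewrite /y subrK.
  by have := andP hy => -[y0 y1]; apply/andP; split; nra.
- move=> h; set y := 3 - x; have hy : 0 <= y <= 1 by rewrite /y; lra.
  have -> : 6^-1 * (x ^+ 3 - 3 * (x - 1) ^+ 3 + 3 * (x - 2) ^+ 3 - 0 ^+ 3) = 1 - y ^+ 3 / 6.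
    by rewrite /y; field.
  have [y0 y1] := andP hy; have := exprn_ge0 3 y0; have := @exprn_ile1 _ 3 y y0 y1.
  by move: (y ^+ 3) => z; lra.
- by move=> _; apply/andP; split; lra.
Qed.

Lemma sstep1_bound x : `|sstep1 x| <= 1.
Proof.
rewrite /sstep1; apply: (@regions x (fun a b c e =>
  `|2^-1 * (a ^+ 2 - 3 * b ^+ 2 + 3 * c ^+ 2 - e ^+ 2)| <= 1)) => h;
  rewrite ler_norml; apply/andP; split; nra.
Qed.

Lemma sstep2_bound x : `|sstep2 x| <= 1.
Proof.
rewrite /sstep2; apply: (@regions x (fun a b c e =>
  `|a - 3 * b + 3 * c - e| <= 1)) => h;
  rewrite ler_norml; apply/andP; split; lra.
Qed.

(** The second derivative of the cubed ramp is six times the ramp, hence Lipschitz with constant 6,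
    and the remainder is at most 6 |y|^3 / 6. *)
Let ramp_taylor x y :
  `|ramp (x + y) ^+ 3 - ramp x ^+ 3 - 3 * ramp x ^+ 2 * y - 3 * ramp x * y ^+ 2|
  <= `|y| ^+ 3.
Proof.
have [hy0|/ltW hy0] := leP 0 y.
  rewrite (ger0_norm hy0) ler_norml.
  case: (rampP x) => -[hx ->]; case: (rampP (x + y)) => -[hxy ->].
  - by have := exprn_ge0 3 hy0; move: (y ^+ 3) => z; lra.
  - have : (x + y) ^+ 3 <= y ^+ 3 by rewrite lerXn2r ?nnegrE//; lra.
    have := exprn_ge0 3 hxy; have := exprn_ge0 3 hy0.
    by move: (y ^+ 3) ((x + y) ^+ 3) => z w; lra.
  - have -> : x = 0 by lra. have -> : y = 0 by lra.
    by lra.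
  - have -> : (x + y) ^+ 3 - x ^+ 3 - 3 * x ^+ 2 * y - 3 * x * y ^+ 2 = y ^+ 3 by ring.
    by have := exprn_ge0 3 hy0; move: (y ^+ 3) => z; lra.
have ny0 : 0 <= - y by lra.
rewrite (ler0_norm hy0) ler_norml.
case: (rampP x) => -[hx ->]; case: (rampP (x + y)) => -[hxy ->].
- by have := exprn_ge0 3 ny0; move: ((- y) ^+ 3) => z; lra.
- have -> : x = 0 by lra. have -> : y = 0 by lra.
  by lra.
- have -> : 0 ^+ 3 - x ^+ 3 - 3 * x ^+ 2 * y - 3 * x * y ^+ 2 =
     (- (x + y)) ^+ 3 - (- y) ^+ 3 by ring.
  have : (- (x + y)) ^+ 3 <= (- y) ^+ 3 by rewrite lerXn2r ?nnegrE//; lra.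
  have xy0 : 0 <= - (x + y) by lra.
  have := exprn_ge0 3 xy0; have := exprn_ge0 3 ny0.
  by move: ((- y) ^+ 3) ((- (x + y)) ^+ 3) => z w; lra.
- have -> : (x + y) ^+ 3 - x ^+ 3 - 3 * x ^+ 2 * y - 3 * x * y ^+ 2 = - (- y) ^+ 3 by ring.
  by have := exprn_ge0 3 ny0; move: ((- y) ^+ 3) => z; lra.
Qed.

(** Interpolation between two remainders: for |y| <= 1 the cubic one, of constant (1 + 3 + 3 + 1) /
    6, and for |y| >= 1 the sizes of the separate terms, each at most y^2. In both ranges the power
    nu is the larger one. *)
Lemma sstep_taylor nu x y : 2 <= nu <= 3 ->
  `|sstep (x + y) - sstep x - sstep1 x * y - sstep2 x * y ^+ 2 / 2|
  <= 4 * `|y| `^ nu.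
Proof.
move=> /andP[n2 n3]; have [y1|/ltW y1] := leP `|y| 1.
  apply: (@le_trans _ _ (4 * `|y| ^+ 3)); last first.
    by rewrite ler_pM2l// powR_ge_cube// y1 normr_ge0.
  have := ramp_taylor x y; have := ramp_taylor (x - 1) y.
  have := ramp_taylor (x - 2) y; have := ramp_taylor (x - 3) y.
  have e c : x - c + y = x + y - c by ring.
  rewrite !e /sstep /sstep1 /sstep2 !ler_norml.
  move: (`|y| ^+ 3) => z /andP[a1 a2] /andP[b1 b2] /andP[c1 c2] /andP[d1 d2].
  by apply/andP; split; lra.
apply: (@le_trans _ _ (4 * `|y| ^+ 2)); last first.
  by rewrite ler_pM2l// powR_ge_sqr.
have /andP[a0 a1] := sstep_bound x; have /andP[b0 b1] := sstep_bound (x + y).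
have := sstep1_bound x; have := sstep2_bound x; rewrite !ler_norml.
move=> /andP[c0 c1] /andP[e0 e1].
rewrite -normrX (ger0_norm (sqr_ge0 y)).
have y2 : 1 <= y ^+ 2 by rewrite -(real_normK (num_real y)) expr_ge1.
have yy : - y ^+ 2 <= y <= y ^+ 2.
  by apply/andP; split; [have := sqr_ge0 (1 + y); nra|have := sqr_ge0 (1 - y); nra].
have h1 : - y ^+ 2 <= sstep1 x * y <= y ^+ 2.
  by apply/andP; split; have := sqr_ge0 (sstep1 x + y); have := sqr_ge0 (sstep1 x - y); nra.
have h2 : - y ^+ 2 <= sstep2 x * y ^+ 2 <= y ^+ 2 by apply/andP; split; nra.
by apply/andP; split; lra.
Qed.
End SmoothStep.

(** * Lindeberg's method for quadratic forms *)

Section NonnegIntegral.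
Local Open Scope ereal_scope.
Context d (T : measurableType d) (R : realType) (P : probability T R).
Implicit Types f g : T -> \bar R.

Lemma ge0_le_integralT f g : measurable_fun [set: T] f ->
  measurable_fun [set: T] g -> (forall x, 0 <= f x) -> (forall x, f x <= g x) ->
  \int[P]_x f x <= \int[P]_x g x.
Proof. by move=> mf mg f0 fg; apply: ge0_le_integral => // x _. Qed.

Lemma ge0_integralDT f g : measurable_fun [set: T] f ->
  measurable_fun [set: T] g -> (forall x, 0 <= f x) -> (forall x, 0 <= g x) ->
  \int[P]_x (f x + g x) = \int[P]_x f x + \int[P]_x g x.
Proof. by move=> mf mg f0 g0; apply: ge0_integralD. Qed.

Lemma ge0_integralZT f (k : R) : (0 <= k)%R -> measurable_fun [set: T] f ->
  (forall x, 0 <= f x) -> \int[P]_x (k%:E * f x) = k%:E * \int[P]_x f x.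
Proof. by move=> k0 mf f0; rewrite ge0_integralZl. Qed.

Lemma integral_cstT (k : R) : \int[P]_x k%:E = k%:E.
Proof. by rewrite integral_cst// -[RHS]mule1; congr (_ * _); exact: (@probability_setT _ _ _ P). Qed.

End NonnegIntegral.

(** Equality of laws in the form that Tonelli's theorem produces and consumes. *)
Definition same_law d (T : measurableType d) (R : realType) (P Q : probability T R) :=
  forall f : T -> \bar R, measurable_fun [set: T] f -> (forall x, (0 <= f x)%E) ->
  (\int[P]_x f x = \int[Q]_x f x)%E.

Lemma same_law_Ex d (T : measurableType d) (R : realType) (P Q : probability T R) f :
  same_law P Q -> measurable_fun [set: T] f -> Ex P f = Ex Q f.
Proof.
move=> PQ mf; have mf' : measurable_fun [set: T] (EFin \o f) by exact/measurable_EFinP.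
rewrite /Ex /Rintegral integralE [in RHS]integralE !PQ//.
- exact: measurable_funeneg.
- exact: measurable_funepos.
Qed.

Section State.
Context (R : realType) (K : nat) (lam : 'I_K -> R).
Local Notation V := (K.-tuple R).
Implicit Types (x y s v : V).

Definition bil x y : R := \sum_k lam k * tnth x k * tnth y k.

Definition addt x y : V := [tuple tnth x k + tnth y k | k < K].

Lemma bilC x y : bil x y = bil y x.
Proof. by apply: eq_bigr => k _; rewrite mulrAC. Qed.

Lemma bilDl x y v : bil (addt x y) v = bil x v + bil y v.
Proof.
rewrite -big_split; apply: eq_bigr => k _ /=.
by rewrite tnth_mktuple mulrDr mulrDl.
Qed.

Lemma bilDr x y v : bil v (addt x y) = bil v x + bil v y.
Proof. by rewrite bilC bilDl !(bilC v). Qed.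

Lemma addtA x y v : addt (addt x y) v = addt (addt x v) y.
Proof.
by apply: eq_from_tnth => k; rewrite !tnth_mktuple addrAC.
Qed.

Lemma measurable_bil : measurable_fun [set: V * V] (fun z => bil z.1 z.2).
Proof.
apply: measurable_sum => k.
apply: measurable_funM.
  apply: measurable_funM => //.
  exact: (measurableT_comp (measurable_tnth k) measurable_fst).
exact: (measurableT_comp (measurable_tnth k) measurable_snd).
Qed.

Lemma measurable_bill x : measurable_fun [set: V] (fun v => bil v x).
Proof.
apply: (@measurableT_comp _ _ _ _ _ _ (fun z : V * V => bil z.1 z.2) _ (fun v => (v, x))).
  exact: measurable_bil.
exact: pair2_measurable.
Qed.

Lemma measurable_addt : measurable_fun [set: V * V] (fun z => addt z.1 z.2).
Proof.
apply/measurable_fun_tnthP => k.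
have -> : (fun t : V => tnth t k) \o (fun z : V * V => addt z.1 z.2) =
  (fun z => tnth z.1 k + tnth z.2 k).
  by apply/funext => z /=; rewrite tnth_mktuple.
apply: measurable_funD; first exact: (measurableT_comp (measurable_tnth k) measurable_fst).
exact: (measurableT_comp (measurable_tnth k) measurable_snd).
Qed.

(* A state [(a, s)] records the sum [s] of the points added so far and [c] times the
   off-diagonal part of the quadratic form [bil] at these points. *)
Definition step (c : R) (z : (R * V) * V) : R * V :=
  (z.1.1 + 2 * c * bil z.1.2 z.2, addt z.1.2 z.2).

Lemma stepC c z x y : step c (step c (z, x), y) = step c (step c (z, y), x).
Proof.
by rewrite /step /= !bilDl addtA (bilC x y); congr (_, _); ring.
Qed.

Lemma measurable_step c : measurable_fun [set: (R * V) * V] (step c).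
Proof.
have m12 : measurable_fun [set: (R * V) * V] (fun z => (z.1.2, z.2)).
  apply: measurable_fun_pair => //.
  exact: (measurableT_comp measurable_snd measurable_fst).
apply: measurable_fun_pair; last exact: (measurableT_comp measurable_addt m12).
apply: measurable_funD; first exact: (measurableT_comp measurable_fst measurable_fst).
apply: measurable_funM => //; exact: (measurableT_comp measurable_bil m12).
Qed.

Definition addlaw c (mu : probability V R) (rho : probability (R * V)%type R) :
  probability (R * V)%type R := law (pprod rho mu) (measurable_step c).

Definition state0 : probability (R * V)%type R := \d_((0, [tuple 0 | k < K]) : R * V).

Definition iterlaw c mu n := iter n (addlaw c mu) state0.

Section AddLaw.
Variable c : R.
Implicit Types (mu : probability V R) (rho : probability (R * V)%type R).

Lemma ge0_integral_addlaw mu rho (f : R * V -> \bar R) :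
  measurable_fun [set: R * V] f -> (forall z, (0 <= f z)%E) ->
  (\int[addlaw c mu rho]_z f z = \int[rho]_z \int[mu]_v f (step c (z, v)))%E.
Proof.
move=> mf f0; rewrite ge0_integral_law// tonelli//.
by apply: measurableT_comp => //; exact: measurable_step.
Qed.

Lemma same_law_addlaw mu rho rho' : same_law rho rho' ->
  same_law (addlaw c mu rho) (addlaw c mu rho').
Proof.
move=> h f mf f0; rewrite !ge0_integral_addlaw// h//.
- apply: (measurable_fun_fubini_tonelli_F (fun z => f (step c z))) => //.
  by apply: measurableT_comp => //; exact: measurable_step.
- by move=> x; exact: integral_ge0.
Qed.

(** Two additions commute pointwise by [stepC], and Tonelli's theorem exchanges the two
    integrals. *)
Lemma addlawC mu1 mu2 rho :
  same_law (addlaw c mu1 (addlaw c mu2 rho)) (addlaw c mu2 (addlaw c mu1 rho)).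
Proof.
move=> f mf f0.
have mf1 mu : measurable_fun [set: R * V] (fun z => \int[mu]_v f (step c (z, v)))%E.
  apply: (measurable_fun_fubini_tonelli_F (fun z => f (step c z))) => //.
  by apply: measurableT_comp => //; exact: measurable_step.
have p1 mu z : (0 <= \int[mu]_v f (step c (z, v)))%E by exact: integral_ge0.
rewrite !ge0_integral_addlaw//; apply: eq_integral => z _.
have mfz : measurable_fun [set: V * V] (fun w => f (step c (step c (z, w.1), w.2))).
  apply: measurableT_comp => //; apply: (measurableT_comp (measurable_step c)).
  apply: measurable_fun_pair => //; apply: (measurableT_comp (measurable_step c)).
  by apply: measurable_fun_pair.
have f0z w : (0 <= f (step c (step c (z, w.1), w.2)))%E by [].
transitivity (\int[pprod mu2 mu1]_w f (step c (step c (z, w.1), w.2)))%E.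
  exact/esym/(tonelli mu2 mu1 mfz f0z).
rewrite (tonelli2 mu2 mu1 mfz f0z).
apply: eq_integral => x _.
apply: eq_integral => y _.
exact: (congr1 f (stepC c z y x)).
Qed.

Lemma same_law_trans d (T : measurableType d) (P Q S : probability T R) :
  same_law P Q -> same_law Q S -> same_law P S.
Proof. by move=> h1 h2 f mf f0; rewrite h1// h2. Qed.

Lemma iter_addlawC mu1 mu2 rho n :
  same_law (iter n (addlaw c mu2) (addlaw c mu1 rho))
           (addlaw c mu1 (iter n (addlaw c mu2) rho)).
Proof.
elim: n => [|n IH]; first by move=> f.
rewrite !iterS; apply: (same_law_trans (same_law_addlaw mu2 IH)).
exact: addlawC.
Qed.
End AddLaw.
End State.

Lemma measurable_abspow (R : realType) nu d (T : measurableType d) (f : T -> R) :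
  measurable_fun [set: T] f -> measurable_fun [set: T] (fun x => `|f x| `^ nu).
Proof.
move=> mf; apply: (measurableT_comp (measurable_powR nu)).
exact: measurableT_comp.
Qed.

Section MomentStep.
Local Open Scope ereal_scope.
Context d (T : measurableType d) (R : realType) (P : probability T R) (nu : R).
Hypothesis nu23 : (2 <= nu <= 3)%R.
Implicit Types Y : T -> R.

Definition absmoment Y : \bar R := \int[P]_x (`|Y x| `^ nu)%:E.

Lemma absmoment_ge0 Y : 0 <= absmoment Y.
Proof. by apply: integral_ge0 => x _; rewrite lee_fin powR_ge0. Qed.

Lemma absmoment_intg Y : measurable_fun [set: T] Y -> absmoment Y < +oo ->
  intg P (fun x => (`|Y x| `^ nu)%R).
Proof.
by move=> mY; rewrite intg_ge0P//; exact: measurable_abspow.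
Qed.

(** Integration of [powR_add]: the linear term vanishes because [Y] is centred. An infinite moment
    of [Y] makes the right-hand side infinite and is dismissed first. *)
Lemma absmoment_shift Y (h : R) : sq P Y -> Ex P Y = 0%R ->
  \int[P]_x (`|h + Y x| `^ nu)%:E <=
  (`|h| `^ nu)%:E + 8%:E * ((`|h| `^ (nu - 2) * Ex P (fun x => Y x ^+ 2))%:E + absmoment Y).
Proof.
move=> sY EY; have mY : measurable_fun [set: T] Y by case: sY.
have [hoo|hfin] := leP (+oo%E) (absmoment Y).
  move: hoo; rewrite leye_eq => /eqP ->.
  by rewrite addey ?gt0_muley ?lte_fin// addey// leey.
have iY := absmoment_intg mY hfin.
have [s hs] := powR_add nu23 h.
have i2 : intg P (fun x => Y x ^+ 2)%R by case: sY.
have i3 : intg P (fun x => `|h| `^ (nu - 2) * Y x ^+ 2 + `|Y x| `^ nu)%R.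
  by apply: intgD => //; exact: intgZ.
have i1 : intg P (fun x => `|h| `^ nu + s * Y x)%R.
  by apply: intgD; [exact: intg_cst|apply: intgZ; exact: sq_intg].
have i4 : intg P (fun x => `|h| `^ nu + s * Y x +
    8 * (`|h| `^ (nu - 2) * Y x ^+ 2 + `|Y x| `^ nu))%R.
  by apply: intgD => //; exact: intgZ.
apply: (@le_trans _ _ (\int[P]_x (`|h| `^ nu + s * Y x +
    8 * (`|h| `^ (nu - 2) * Y x ^+ 2 + `|Y x| `^ nu))%:E)).
  apply: nn_le => //.
  - by apply: measurable_abspow; exact: measurable_funD.
  - exact: intg_measurable i4.
rewrite -ExE// ExD//; last exact: intgZ.
rewrite ExD; [|exact: intg_cst|by apply: intgZ; exact: sq_intg].
rewrite Ex_cst ExZ; last exact: sq_intg.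
rewrite EY mulr0 addr0 ExZ// ExD//; last exact: intgZ.
by rewrite /absmoment -(ExE iY) ExZ// -EFinD -EFinM -EFinD.
Qed.

Lemma absmoment_lyapunov Y (a : R) : sq P Y -> (0 < a)%R ->
  Ex P (fun x => Y x ^+ 2)%R = (a ^+ 2)%R -> (a `^ nu)%:E <= absmoment Y.
Proof.
move=> sY a0 EY; have mY : measurable_fun [set: T] Y by case: sY.
have [hoo|hfin] := leP (+oo%E) (absmoment Y).
  by move: hoo; rewrite leye_eq => /eqP ->; rewrite leey.
have iY := absmoment_intg mY hfin; have [n2 _] := andP nu23.
have i2 : intg P (fun x => Y x ^+ 2)%R by case: sY.
have e x : (a `^ nu * (1 + nu / 2 * (Y x ^+ 2 / a ^+ 2 - 1)) =
   a `^ nu * (1 - nu / 2) + a `^ nu * (nu / 2) / a ^+ 2 * Y x ^+ 2)%R by ring.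
rewrite /absmoment -ExE// lee_fin.
have -> : (a `^ nu = Ex P (fun x => a `^ nu * (1 - nu / 2) + a `^ nu * (nu / 2) / a ^+ 2 * Y x ^+ 2))%R.
  rewrite ExD; [|exact: intg_cst|exact: intgZ].
  by rewrite Ex_cst ExZ// EY; field; rewrite gt_eqF.
apply: Ex_le => //; first by apply: intgD; [exact: intg_cst|exact: intgZ].
by move=> x; rewrite -e; exact: powR_lyapunov.
Qed.

Lemma absmoment_hyper Y (C m : R) : sq P Y -> (0 <= m)%R -> (1 <= C)%R ->
  Ex P (fun x => Y x ^+ 2)%R = m ->
  intg P (fun x => Y x ^+ 4)%R -> (Ex P (fun x => Y x ^+ 4) <= C * m ^+ 2)%R ->
  absmoment Y <= ((1 + C) * Num.sqrt m `^ nu)%:E.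
Proof.
move=> sY m0 C1 EY i4 E4; have mY : measurable_fun [set: T] Y by case: sY.
have i2 : intg P (fun x => Y x ^+ 2)%R by case: sY.
have [m00|mn] := eqVneq m 0%R.
  (* For m = 0 there is no scale to normalise by, but the fourth moment then vanishes together with
     the second, and the two dominate the [nu]-th one. *)
  apply: (@le_trans _ _ (\int[P]_x (Y x ^+ 2 + Y x ^+ 4)%:E)).
    apply: nn_le.
    - exact: measurable_abspow.
    - by apply: measurable_funD; exact: measurable_funX.
    - by move=> x; exact: powR_ge0.
    - move=> x; have -> : (Y x ^+ 2 = `|Y x| ^+ 2)%R by rewrite real_normK ?num_real.
      have -> : (Y x ^+ 4 = `|Y x| ^+ 4)%R by rewrite -normrX ger0_norm// (exprM _ 2 2) sqr_ge0.
      exact: powR_le_sqrD4.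
  rewrite -ExE; last exact: intgD.
  rewrite ExD// EY m00 add0r lee_fin (le_trans E4)// m00 expr0n mulr0.
  by rewrite mulr_ge0 ?powR_ge0//; lra.
set a := Num.sqrt m.
have a0 : (0 < a)%R by rewrite sqrtr_gt0 lt_neqAle eq_sym mn.
have a2 : (a ^+ 2)%R = m by rewrite sqr_sqrtr.
apply: (@le_trans _ _ (\int[P]_x (a `^ nu + a `^ nu / a ^+ 4 * Y x ^+ 4)%:E)).
  apply: nn_le.
  - exact: measurable_abspow.
  - by apply: measurable_funD => //; apply: measurable_funM => //; exact: measurable_funX.
  - by move=> x; exact: powR_ge0.
  - by move=> x; exact: powR_hyper.
rewrite -ExE; last by apply: intgD; [exact: intg_cst|exact: intgZ].
rewrite ExD; [|exact: intg_cst|exact: intgZ].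
rewrite Ex_cst ExZ// lee_fin mulrDl mul1r lerD2l.
have a4 : (a ^+ 4 = m ^+ 2)%R by rewrite (exprM _ 2 2) a2.
have -> : (C * a `^ nu = a `^ nu / a ^+ 4 * (C * m ^+ 2))%R.
  by rewrite -a4; field; rewrite gt_eqF.
by rewrite ler_wpM2l// divr_ge0 ?powR_ge0// exprn_ge0// ltW.
Qed.
End MomentStep.

Section Lindeberg.
Local Open Scope ereal_scope.
Context (R : realType) (K : nat) (lam : 'I_K -> R).
Local Notation V := (K.-tuple R).
Local Notation bl := (bil lam).
Implicit Types (mu : probability V R) (rho : probability (R * V)%type R).

(** All that the replacement uses of the covariances: means and variances of the scalar forms
    [bl v x]. Vector norms, which would bring in K, never occur. *)
Definition matched (m2 : V -> R) mu :=
  forall x, [/\ sq mu (fun v => bl v x), Ex mu (fun v => bl v x) = 0%R &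
    Ex mu (fun v => bl v x ^+ 2)%R = m2 x].

Definition absbil nu mu x : \bar R := absmoment mu nu (fun v => bl v x).

Lemma measurable_bil_pow nu : measurable_fun [set: V * V]
  (fun z => (`|bl z.1 z.2| `^ nu)%:E).
Proof. by apply/measurable_EFinP; apply: measurable_abspow; exact: measurable_bil. Qed.

Lemma measurable_absbil nu mu : measurable_fun [set: V] (absbil nu mu).
Proof.
have m : measurable_fun [set: V * V] (fun z => (`|bl z.2 z.1| `^ nu)%:E).
  exact: (measurableT_comp (measurable_bil_pow nu) (@measurable_swap _ _ _ _)).
by apply: (measurable_fun_fubini_tonelli_F _ m) => z; rewrite lee_fin powR_ge0.
Qed.

Lemma absbil_ge0 nu mu x : 0 <= absbil nu mu x.
Proof. exact: absmoment_ge0. Qed.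

Section OneLaw.
Variables (c nu : R) (m2 : V -> R).
Hypothesis nu23 : (2 <= nu <= 3)%R.

Lemma measurable_bil_state x : measurable_fun [set: R * V] (fun z => bl z.2 x).
Proof. exact: (measurableT_comp (measurable_bill lam x) measurable_snd). Qed.

Lemma sqr_bil_addlaw mu rho x (r : R) : matched m2 mu -> (0 <= r)%R ->
  \int[rho]_z (bl z.2 x ^+ 2)%:E <= (r * m2 x)%:E ->
  \int[addlaw lam c mu rho]_z (bl z.2 x ^+ 2)%:E <= ((r + 1) * m2 x)%:E.
Proof.
move=> /(_ x)[sY EY E2] r0 h.
have m1 : measurable_fun [set: R * V] (fun z => bl z.2 x ^+ 2)%R.
  by apply: measurable_funX; exact: measurable_bil_state.
have m2' := m1; move/measurable_EFinP in m2'.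
rewrite ge0_integral_addlaw//; last by move=> z; rewrite lee_fin sqr_ge0.
rewrite (_ : (fun z => _) = (fun z => (bl z.2 x ^+ 2 + m2 x)%:E)); last first.
  apply/funext => z; under eq_integral do rewrite /= bilDl sqrrD.
  have sh := sq_cst mu (bl z.2 x).
  have i1 : intg mu (fun v => bl z.2 x ^+ 2 + (bl z.2 x * bl v x) *+ 2)%R.
    apply: intgD; first exact: intg_cst.
    by under [X in intg _ X]funext do rewrite -mulr_natl; apply: intgZ; exact: sq_mul.
  rewrite -ExE; last by apply: intgD => //; case: sY.
  rewrite ExD//; last by case: sY.
  rewrite ExD; [|exact: intg_cst|].
    rewrite Ex_cst E2 (_ : Ex mu (fun v => (bl z.2 x * bl v x) *+ 2)%R = 0%R) ?addr0//.
    under [X in Ex _ X]funext do rewrite -mulrnAl.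
    rewrite ExZ; last exact: sq_intg.
    by rewrite EY mulr0.
  by under [X in intg _ X]funext do rewrite -mulrnAl; apply: intgZ; exact: sq_intg.
have m20 : (0 <= m2 x)%R by rewrite -E2; apply: Ex_ge0 => v; exact: sqr_ge0.
under eq_integral do rewrite EFinD.
rewrite ge0_integralDT//; last by move=> z; rewrite lee_fin ?sqr_ge0.
by rewrite integral_cstT mulrDl mul1r EFinD leeD2r.
Qed.

(** One step of a Rosenthal-type induction. After the linear term has vanished, the quadratic term
    is E |bl s x|^(nu-2) m2 x <= 2 (n m2 x)^((nu-2)/2) m2 x, and Lyapunov's inequality for the
    reference law [mu1] turns m2^(nu/2) back into a [nu]-th moment. The factor 16 is 8 from
    [powR_add] times this 2. *)
Lemma abs_bil_addlaw mu mu1 rho x (r n : R) : matched m2 mu -> matched m2 mu1 ->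
  (0 <= r <= n)%R -> (0 < n)%R ->
  \int[rho]_z (bl z.2 x ^+ 2)%:E <= (r * m2 x)%:E ->
  \int[addlaw lam c mu rho]_z (`|bl z.2 x| `^ nu)%:E <=
  \int[rho]_z (`|bl z.2 x| `^ nu)%:E +
    (16 * n `^ ((nu - 2) / 2))%:E * absbil nu mu1 x + 8%:E * absbil nu mu x.
Proof.
move=> mt mt1 /andP[r0 rn] n0 h.
have [sY EY E2] := mt x; have [sY1 EY1 E21] := mt1 x; have [n2 n3] := andP nu23.
have m1 : measurable_fun [set: R * V] (fun z => (`|bl z.2 x| `^ nu)%:E).
  apply/measurable_EFinP; apply: measurable_abspow; exact: measurable_bil_state.
rewrite ge0_integral_addlaw//; try by move=> z; rewrite lee_fin powR_ge0.
have m20 : (0 <= m2 x)%R by rewrite -E2; apply: Ex_ge0 => v; exact: sqr_ge0.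
have mt2 : measurable_fun [set: R * V] (fun z => (`|bl z.2 x| `^ (nu - 2) * m2 x)%:E).
  apply/measurable_EFinP; apply: measurable_funM => //.
  by apply: measurable_abspow; exact: measurable_bil_state.
have key : \int[rho]_z (`|bl z.2 x| `^ (nu - 2) * m2 x)%:E <=
    (2 * n `^ ((nu - 2) / 2))%:E * absbil nu mu1 x.
  have [m2z|m2n] := eqVneq (m2 x) 0%R.
    under eq_integral do rewrite m2z mulr0.
    rewrite integral_cstT mule_ge0 ?absbil_ge0// lee_fin mulr_ge0 ?powR_ge0//.
  have m2p : (0 < m2 x)%R by rewrite lt_neqAle eq_sym m2n.
  pose a : R := Num.sqrt (m2 x); have a0 : (0 < a)%R by rewrite sqrtr_gt0.
  have a2 : (a ^+ 2 = m2 x)%R by rewrite sqr_sqrtr.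
  have ly : (a `^ nu)%:E <= absbil nu mu1 x.
    by apply: absmoment_lyapunov => //; rewrite E21 a2.
  (* The L2 size that [bl s x] can reach after [n] additions, used as the scale in [powR_theta]. *)
  pose B : R := Num.sqrt (n * m2 x); have B0 : (0 < B)%R by rewrite sqrtr_gt0 mulr_gt0.
  have B2 : (B ^+ 2 = n * m2 x)%R by rewrite sqr_sqrtr// mulr_ge0// ltW.
  have msq : measurable_fun [set: R * V] (fun z => (bl z.2 x ^+ 2))%R.
    by apply: measurable_funX; exact: measurable_bil_state.
  apply: (@le_trans _ _ (\int[rho]_z (B `^ (nu - 2) * m2 x +
      (B `^ (nu - 2) * m2 x / B ^+ 2) * (bl z.2 x ^+ 2))%:E)).
    apply: nn_le.
    - exact/measurable_EFinP.
    - by apply: measurable_funD => //; apply: measurable_funM.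
    - by move=> z; rewrite mulr_ge0 ?powR_ge0.
    - move=> z; rewrite -[in X in (_ <= X)%R](real_normK (num_real (bl z.2 x))).
      apply: (le_trans (ler_wpM2r m20 (powR_theta nu23 B0 (normr_ge0 (bl z.2 x))))).
      by rewrite le_eqVlt; apply/orP; left; apply/eqP; ring.
  under eq_integral do rewrite EFinD.
  have cb : (0 <= B `^ (nu - 2) * m2 x)%R by rewrite mulr_ge0 ?powR_ge0.
  have cb2 : (0 <= B `^ (nu - 2) * m2 x / B ^+ 2)%R by rewrite divr_ge0 ?sqr_ge0.
  rewrite ge0_integralDT//; try (by apply/measurable_EFinP; apply: measurable_funM);
    try (by move=> z; rewrite lee_fin mulr_ge0 ?sqr_ge0).
  under [X in _ + X <= _]eq_integral do rewrite EFinM.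
  rewrite integral_cstT ge0_integralZT//; try exact/measurable_EFinP;
    try (by move=> z; rewrite lee_fin sqr_ge0).
  have e1 : (B `^ (nu - 2) = n `^ ((nu - 2) / 2) * a `^ (nu - 2))%R.
    rewrite /B sqrtrM ?ltW// powRM ?sqrtr_ge0//; congr (_ * _)%R.
    by rewrite -powR12_sqrt ?ltW// -powRrM mulrC.
  have e2 : (a `^ nu = a `^ (nu - 2) * m2 x)%R by rewrite (powR_split n2 (ltW a0)) a2 mulrC.
  apply: (@le_trans _ _ ((2 * n `^ ((nu - 2) / 2))%:E * (a `^ nu)%:E)); last first.
    by apply: lee_wpmul2l => //; rewrite lee_fin mulr_ge0 ?powR_ge0.
  apply: (@le_trans _ _ ((B `^ (nu - 2) * m2 x)%:E + (B `^ (nu - 2) * m2 x / B ^+ 2)%:E * (n * m2 x)%:E)).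
    rewrite leeD2l//; apply: lee_wpmul2l; first by rewrite lee_fin.
    by apply: (le_trans h); rewrite lee_fin ler_wpM2r.
  rewrite -B2 -EFinM -EFinD -EFinM lee_fin divfK ?expf_neq0 ?gt_eqF// e2 e1.
  by rewrite le_eqVlt; apply/orP; left; apply/eqP; ring.
apply: (@le_trans _ _ (\int[rho]_z ((`|bl z.2 x| `^ nu)%:E +
    8%:E * ((`|bl z.2 x| `^ (nu - 2) * m2 x)%:E + absbil nu mu x)))).
  apply: ge0_le_integralT.
  - have mm : measurable_fun [set: (R * V) * V]
        (fun w => (`|bl (step lam c w).2 x| `^ nu)%:E).
      exact: (measurableT_comp m1 (measurable_step lam c)).
    by apply: (measurable_fun_fubini_tonelli_F _ mm) => w; rewrite lee_fin powR_ge0.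
  - apply: emeasurable_funD => //; apply: measurable_funeM.
    by apply: emeasurable_funD.
  - by move=> z; apply: integral_ge0 => v _; rewrite lee_fin powR_ge0.
  - move=> z; rewrite -E2; under eq_integral do rewrite /= bilDl.
    exact: absmoment_shift.
rewrite ge0_integralDT//;
  try (by apply: measurable_funeM; apply: emeasurable_funD);
  try (by move=> z; rewrite lee_fin powR_ge0);
  try (by move=> z; rewrite mule_ge0 ?lee_fin// adde_ge0 ?absbil_ge0// lee_fin
    mulr_ge0 ?powR_ge0).
rewrite -addeA leeD2l// ge0_integralZT//; try (by apply: emeasurable_funD);
  try (by move=> z; rewrite adde_ge0 ?absbil_ge0// lee_fin mulr_ge0 ?powR_ge0).
rewrite ge0_integralDT//; try (by move=> z; rewrite lee_fin mulr_ge0 ?powR_ge0);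
  try (by move=> z; rewrite absbil_ge0).
have -> : \int[rho]_z absbil nu mu x = absbil nu mu x.
  by rewrite integral_cst// -[RHS]mule1; congr (_ * _); exact: (@probability_setT _ _ _ rho).
rewrite ge0_muleDr ?absbil_ge0//; last first.
  by apply: integral_ge0 => z _; rewrite lee_fin mulr_ge0 ?powR_ge0.
rewrite leeD2r//; apply: le_trans (lee_wpmul2l _ key) _; first by rewrite lee_fin.
by rewrite muleA -EFinM mulrA (_ : 8 * 2 = 16 :> R)%R//; ring.
Qed.
End OneLaw.
End Lindeberg.

Section Swap.
Local Open Scope ereal_scope.
Context (R : realType) (K : nat) (lam : 'I_K -> R).
Local Notation V := (K.-tuple R).
Local Notation bl := (bil lam).
Variables (c nu delta t : R) (m2 : V -> R) (mu1 mu2 : probability V R).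
Hypotheses (nu23 : (2 <= nu <= 3)%R) (c0 : (0 <= c)%R) (d0 : (0 < delta)%R).
Hypotheses (mt1 : matched lam m2 mu1) (mt2 : matched lam m2 mu2).
Implicit Types (mu : probability V R) (rho : probability (R * V)%type R).

Definition smooth_gt (a : R) : R := sstep ((a - t) / delta).
Local Notation kap := (2 * c / delta)%R.

Lemma measurable_smooth_gt d (T : measurableType d) (f : T -> R) :
  measurable_fun [set: T] f -> measurable_fun [set: T] (fun x => smooth_gt (f x)).
Proof.
move=> mf; rewrite /smooth_gt; apply: (measurableT_comp (@measurable_sstep R)).
by apply: measurable_funM => //; exact: measurable_funB.
Qed.

Lemma smooth_gt_bound a : (`|smooth_gt a| <= 1)%R.
Proof. by have /andP[h0 h1] := sstep_bound ((a - t) / delta); rewrite ger0_norm. Qed.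

Lemma smooth_gt_intg d (T : measurableType d) (P : probability T R) (f : T -> R) :
  measurable_fun [set: T] f -> intg P (fun x => smooth_gt (f x)).
Proof.
move=> mf; apply: (@intg_bdd _ _ _ _ _ 1%R); first exact: measurable_smooth_gt.
by move=> x; exact: smooth_gt_bound.
Qed.

Let kap0 : (0 <= kap)%R.
Proof. by rewrite divr_ge0 ?mulr_ge0// ltW. Qed.

(** The Taylor polynomial has a mean that depends on the law of [Y] only through E Y = 0 and E Y^2;
    this is what cancels between matched laws. *)
Lemma taylor_mean d (T : measurableType d) (P : probability T R) (Y : T -> R) (a : R) :
  sq P Y -> Ex P Y = 0%R ->
  `|Ex P (fun v => smooth_gt (a + 2 * c * Y v)) -
    (sstep ((a - t) / delta) + sstep2 ((a - t) / delta) * kap ^+ 2 / 2 * Ex P (fun v => Y v ^+ 2))|%:E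
  <= (4 * kap `^ nu)%:E * absmoment P nu Y.
Proof.
move=> sY EY; have mY : measurable_fun [set: T] Y by case: sY.
set x := ((a - t) / delta)%R.
pose A v := (sstep1 x * kap * Y v)%R; pose B v := (sstep2 x * kap ^+ 2 / 2 * Y v ^+ 2)%R.
pose g v := smooth_gt (a + 2 * c * Y v)%R.
have gE v : g v = sstep (x + kap * Y v).
  by rewrite /g /smooth_gt; congr (sstep _); rewrite /x; ring.
have ig : intg P g.
  by apply: smooth_gt_intg; apply: measurable_funD => //; exact: measurable_funM.
have iA : intg P A by apply: intgZ; exact: sq_intg.
have iB : intg P B by apply: intgZ; case: sY.
have iAB : intg P (fun v => sstep x + A v + B v)%R.
  by apply: intgD => //; apply: intgD => //; exact: intg_cst.
have -> : (sstep x + sstep2 x * kap ^+ 2 / 2 * Ex P (fun v => Y v ^+ 2) =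
   Ex P (fun v => sstep x + A v + B v))%R.
  rewrite ExD//; last by apply: intgD => //; exact: intg_cst.
  rewrite ExD//; last exact: intg_cst.
  rewrite Ex_cst ExZ; last exact: sq_intg.
  by rewrite EY mulr0 addr0 ExZ//; case: sY.
rewrite -ExB//.
have iR : intg P (fun v => g v - (sstep x + A v + B v))%R by exact: intgB.
apply: (@le_trans _ _ (Ex P (fun v => `|g v - (sstep x + A v + B v)|))%:E).
  by rewrite lee_fin; exact: Ex_norm.
rewrite ExE; last exact: intg_norm.
have k4 : (0 <= 4 * kap `^ nu)%R by rewrite mulr_ge0 ?powR_ge0.
have mp : measurable_fun [set: T] (fun v => `|Y v| `^ nu)%R by exact: measurable_abspow.
rewrite /absmoment -ge0_integralZT//; try exact/measurable_EFinP;
  try (by move=> v; rewrite lee_fin powR_ge0).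
under [X in _ <= X]eq_integral do rewrite -EFinM.
apply: nn_le.
- by apply: measurableT_comp => //; exact: intg_measurable iR.
- exact: measurable_funM.
- by move=> v; exact: normr_ge0.
- move=> v; rewrite gE.
  have -> : (sstep (x + kap * Y v) - (sstep x + A v + B v) =
    sstep (x + kap * Y v) - sstep x - sstep1 x * (kap * Y v) - sstep2 x * (kap * Y v) ^+ 2 / 2)%R.
    by rewrite /A /B; ring.
  apply: (le_trans (sstep_taylor _ _ nu23)).
  by rewrite normrM (ger0_norm kap0) (powRM _ kap0 (normr_ge0 _)) mulrA.
Qed.

Let gst := (fun z : R * V => smooth_gt z.1).

Lemma measurable_gst : measurable_fun [set: R * V] gst.
Proof. exact: measurable_smooth_gt. Qed.

Lemma Ex_addlaw mu rho : Ex (addlaw lam c mu rho) gst =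
  Ex rho (fun z => Ex mu (fun v => smooth_gt (z.1 + 2 * c * bl v z.2))).
Proof.
have m : measurable_fun [set: (R * V) * V] (gst \o step lam c).
  exact: (measurableT_comp measurable_gst (measurable_step lam c)).
rewrite Ex_law; last exact: measurable_gst.
rewrite Ex_prod; last by apply: (intg_bdd _ m) => w; exact: smooth_gt_bound.
congr Ex; apply/funext => z; congr Ex; apply/funext => v.
by rewrite /= /gst /step /= bilC.
Qed.

(** Given the state, both expectations are close to the same number, the mean of the second order
    Taylor polynomial. The remainders are then averaged over the state, and Tonelli's theorem moves
    the integral over the new point outside. *)
Lemma swap_bound rho :
  `|Ex (addlaw lam c mu1 rho) gst - Ex (addlaw lam c mu2 rho) gst|%:E <=
  (4 * kap `^ nu)%:E *
  (\int[mu1]_x \int[rho]_z (`|bl z.2 x| `^ nu)%:E +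
   \int[mu2]_x \int[rho]_z (`|bl z.2 x| `^ nu)%:E).
Proof.
rewrite !Ex_addlaw.
have ii mu : intg rho (fun z => Ex mu (fun v => smooth_gt (z.1 + 2 * c * bl v z.2))).
  pose f := fun w : (R * V) * V => smooth_gt (w.1.1 + 2 * c * bl w.2 w.1.2).
  suff : intg (pprod rho mu) f by move=> /intg_Ex.
  apply: smooth_gt_intg; apply: measurable_funD.
    exact: (measurableT_comp measurable_fst measurable_fst).
  apply: measurable_funM => //.
  apply: (measurableT_comp (measurable_bil lam) (measurable_fun_pair _ _)) => //.
  exact: (measurableT_comp measurable_snd measurable_fst).
rewrite -ExB//; set D := (X in Ex rho X).
have iD : intg rho D by exact: intgB.
apply: (@le_trans _ _ (Ex rho (fun z => `|D z|))%:E).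
  by rewrite lee_fin; exact: Ex_norm.
rewrite ExE; last exact: intg_norm.
have k4 : (0 <= 4 * kap `^ nu)%R by rewrite mulr_ge0 ?powR_ge0.
have mab mu : measurable_fun [set: R * V] (fun z => absbil lam nu mu z.2).
  exact: (measurableT_comp (measurable_absbil lam nu mu) measurable_snd).
have swp mu : \int[mu]_x \int[rho]_z (`|bl z.2 x| `^ nu)%:E =
    \int[rho]_z absbil lam nu mu z.2.
  have mm : measurable_fun [set: V * (R * V)] (fun w => (`|bl w.2.2 w.1| `^ nu)%:E).
    apply: (measurableT_comp (measurable_bil_pow lam nu) (measurable_fun_pair _ _)) => //.
    exact: (measurableT_comp measurable_snd measurable_snd).
  have p0 (w : V * (R * V)) : 0 <= (`|bl w.2.2 w.1| `^ nu)%:E by rewrite lee_fin powR_ge0.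
  rewrite -(tonelli mu rho mm p0) (tonelli2 mu rho mm p0).
  by apply: eq_integral => z _; apply: eq_integral => x _ /=; rewrite bilC.
rewrite !swp -ge0_integralDT//; try by move=> z; exact: absbil_ge0.
rewrite -ge0_integralZT//; last 2 first.
- exact: emeasurable_funD.
- by move=> z; rewrite adde_ge0 ?absbil_ge0.
apply: ge0_le_integralT.
- by apply/measurable_EFinP; apply: measurableT_comp => //; exact: intg_measurable iD.
- by apply: measurable_funeM; exact: emeasurable_funD.
- by move=> z; rewrite lee_fin.
move=> z; have [s1 e1 v1] := mt1 z.2; have [s2 e2 v2] := mt2 z.2.
have h1 := taylor_mean z.1 s1 e1; have h2 := taylor_mean z.1 s2 e2.
rewrite ge0_muleDr ?absbil_ge0//; apply: le_trans (leeD h1 h2).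
rewrite v1 v2 -EFinD lee_fin /D [X in (_ <= _ + X)%R]distrC.
exact: ler_distD.
Qed.

(** [r] counts the points already added and [n] bounds their final number. The bounds are linear in
    [r], so that each addition contributes one more copy of the bracket. *)
Definition moments (n r : nat) rho := forall x,
  \int[rho]_z (bl z.2 x ^+ 2)%:E <= (r%:R * m2 x)%:E /\
  \int[rho]_z (`|bl z.2 x| `^ nu)%:E <= r%:R%:E *
    ((16 * n%:R `^ ((nu - 2) / 2))%:E * absbil lam nu mu1 x
      + (8%:E * absbil lam nu mu1 x + 8%:E * absbil lam nu mu2 x)).

Lemma moments_addlaw n r rho mu : (r < n)%N -> mu = mu1 \/ mu = mu2 ->
  moments n r rho -> moments n r.+1 (addlaw lam c mu rho).
Proof.
move=> rn mu12 h x; have [h1 h2] := h x.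
have mt : matched lam m2 mu by case: mu12 => ->.
split.
  by rewrite -[r.+1%:R]natr1; apply: sqr_bil_addlaw.
have rn' : (0 <= (r%:R : R) <= n%:R)%R by rewrite ler0n ler_nat ltnW.
have n0 : (0 < (n%:R : R))%R by rewrite ltr0n (leq_ltn_trans _ rn).
apply: (le_trans (abs_bil_addlaw c nu23 mt mt1 rn' n0 h1)).
rewrite -addeA -[r.+1%:R]natr1 [(r%:R + 1)%:E]EFinD.
have nn0 : 0 <= (16 * n%:R `^ ((nu - 2) / 2))%:E * absbil lam nu mu1 x.
  by rewrite mule_ge0 ?absbil_ge0// lee_fin mulr_ge0 ?powR_ge0.
have n81 i : 0 <= 8%:E * absbil lam nu i x by rewrite mule_ge0 ?absbil_ge0// lee_fin.
rewrite ge0_muleDl ?lee_fin// mul1e; apply: leeD => //.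
by rewrite leeD2l//; case: mu12 => ->; [rewrite leeDl|rewrite leeDr].
Qed.

Lemma moments0 n : moments n 0 (state0 R K).
Proof.
have b0 x : bl [tuple 0%R | k < K] x = 0%R.
  by apply: big1 => k _; rewrite tnth_mktuple mulr0 mul0r.
have mb x : measurable_fun [set: R * V] (fun z => bl z.2 x).
  exact: measurable_bil_state.
move=> x; split; rewrite integral_dirac//=.
- by rewrite diracT mul1e b0 expr0n mul0r.
- by apply/measurable_EFinP; exact: measurable_funX.
- have nun0 : nu != 0%R by have /andP[n2 _] := nu23; lra.
  by rewrite diracT mul1e b0 normr0 powR0// mul0e.
- by apply/measurable_EFinP; exact: measurable_abspow.
Qed.

(* As additions of points commute in law, Lindeberg's replacement can always be
   performed on the point added last. *)
Definition hybrid i j := iter i (addlaw lam c mu2) (iterlaw lam c mu1 j).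

Lemma moments_hybrid n i j : (i + j <= n)%N -> moments n (i + j) (hybrid i j).
Proof.
elim: i => [|i IH] ijn; last first.
  rewrite addSn /hybrid iterS; apply: moments_addlaw => //; first by right.
  by apply: IH; exact: ltnW.
rewrite add0n /hybrid /=; elim: j ijn => [|j IH] ijn; first exact: moments0.
by rewrite /iterlaw iterS; apply: moments_addlaw; [|left|exact/IH/ltnW].
Qed.

Variable M : R.
Hypothesis M11 : \int[mu1]_x absbil lam nu mu1 x <= M%:E.
Hypothesis M12 : \int[mu1]_x absbil lam nu mu2 x <= M%:E.
Hypothesis M21 : \int[mu2]_x absbil lam nu mu1 x <= M%:E.
Hypothesis M22 : \int[mu2]_x absbil lam nu mu2 x <= M%:E.

Lemma moment_mean n r rho mu : (r <= n)%N -> (0 < n)%N -> moments n r rho ->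
  mu = mu1 \/ mu = mu2 ->
  \int[mu]_x \int[rho]_z (`|bl z.2 x| `^ nu)%:E <=
  (32 * n%:R * n%:R `^ ((nu - 2) / 2) * M)%:E.
Proof.
move=> rn n0 h mu12; have [nu2 nu3] := andP nu23.
have M1 : \int[mu]_x absbil lam nu mu1 x <= M%:E by case: mu12 => ->.
have M2 : \int[mu]_x absbil lam nu mu2 x <= M%:E by case: mu12 => ->.
have mA i : measurable_fun [set: V] (absbil lam nu i) by exact: measurable_absbil.
pose th : R := (n%:R `^ ((nu - 2) / 2))%R; have th0 : (0 <= 16 * th)%R by rewrite mulr_ge0 ?powR_ge0.
(* Absorbs the terms without a power of n: 16 th + 8 + 8 <= 32 th. *)
have th1 : (1 <= th)%R.
  have n1 : (1 <= (n%:R : R))%R by rewrite ler1n.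
  have := @ler_powR R n%:R%R n1 0%R ((nu - 2) / 2)%R; rewrite powRr0; apply.
  by rewrite divr_ge0// subr_ge0.
have g8 i x : 0 <= 8%:E * absbil lam nu i x by rewrite mule_ge0 ?absbil_ge0// lee_fin.
have g16 x : 0 <= (16 * th)%:E * absbil lam nu mu1 x by rewrite mule_ge0 ?absbil_ge0// lee_fin.
apply: (@le_trans _ _ (\int[mu]_x (r%:R%:E * ((16 * th)%:E * absbil lam nu mu1 x
      + (8%:E * absbil lam nu mu1 x + 8%:E * absbil lam nu mu2 x))))).
  apply: ge0_le_integralT.
  - have mm : measurable_fun [set: V * (R * V)] (fun w => (`|bl w.2.2 w.1| `^ nu)%:E).
      apply: (measurableT_comp (measurable_bil_pow lam nu) (measurable_fun_pair _ _)) => //.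
      exact: (measurableT_comp measurable_snd measurable_snd).
    by apply: (measurable_fun_fubini_tonelli_F _ mm) => w; rewrite lee_fin powR_ge0.
  - by apply: measurable_funeM; apply: emeasurable_funD; [|apply: emeasurable_funD]; exact: measurable_funeM.
  - by move=> x; apply: integral_ge0 => z _; rewrite lee_fin powR_ge0.
  - by move=> x; case: (h x).
have m8 i : measurable_fun [set: V] (fun x => 8%:E * absbil lam nu i x) by exact: measurable_funeM.
have m16 : measurable_fun [set: V] (fun x => (16 * th)%:E * absbil lam nu mu1 x) by exact: measurable_funeM.
have m88 : measurable_fun [set: V] (fun x => 8%:E * absbil lam nu mu1 x + 8%:E * absbil lam nu mu2 x).
  exact: emeasurable_funD.
rewrite ge0_integralZT//; last 2 first.
- exact: emeasurable_funD.
- by move=> x; rewrite !adde_ge0.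
rewrite ge0_integralDT//; last by move=> x; rewrite adde_ge0.
rewrite ge0_integralDT// !ge0_integralZT//; try by move=> x; exact: absbil_ge0.
have M0 : (0 <= M)%R.
  rewrite -lee_fin; apply: le_trans M1; apply: integral_ge0 => x _; exact: absbil_ge0.
apply: (@le_trans _ _ (r%:R%:E * ((16 * th)%:E * M%:E + (8%:E * M%:E + 8%:E * M%:E)))).
  apply: lee_wpmul2l; first by rewrite lee_fin.
  by apply: leeD; [|apply: leeD]; apply: lee_wpmul2l => //; rewrite lee_fin.
rewrite -?EFinM -?EFinD -?EFinM lee_fin.
have rn' : ((r%:R : R) <= n%:R)%R by rewrite ler_nat.
apply: (@le_trans _ _ (n%:R * (16 * th * M + (8 * M + 8 * M)))%R).
  by rewrite ler_wpM2r// !addr_ge0// mulr_ge0.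
rewrite -/th (_ : (32 * n%:R * th * M = n%:R * (32 * th * M))%R); last by ring.
by rewrite ler_wpM2l//; nra.
Qed.

(** The hybrids telescope over [n] exchanges. Each costs 4 kap^nu times two averaged moments, each
    with the factor 32 of [moment_mean], whence 256. *)
Lemma lindeberg n : (0 < n)%N ->
  (`|Ex (iterlaw lam c mu1 n) gst - Ex (iterlaw lam c mu2 n) gst| <=
   n%:R * (256 * kap `^ nu * n%:R * n%:R `^ ((nu - 2) / 2) * M))%R.
Proof.
move=> n0.
set B := (256 * _ * _ * _ * _)%R.
have one i j : (i + j).+1 = n ->
    (`|Ex (hybrid i j.+1) gst - Ex (hybrid i.+1 j) gst| <= B)%R.
  move=> ijn.
  have -> : Ex (hybrid i j.+1) gst = Ex (addlaw lam c mu1 (hybrid i j)) gst.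
    by apply: same_law_Ex; [exact: iter_addlawC|exact: measurable_gst].
  rewrite -lee_fin; apply: (le_trans (swap_bound _)).
  have hm : moments n (i + j) (hybrid i j) by apply: moments_hybrid; rewrite -ijn.
  have ijn' : (i + j <= n)%N by rewrite -ijn.
  apply: (@le_trans _ _ ((4 * kap `^ nu)%:E *
    ((32 * n%:R * n%:R `^ ((nu - 2) / 2) * M)%:E + (32 * n%:R * n%:R `^ ((nu - 2) / 2) * M)%:E))).
    apply: lee_wpmul2l; first by rewrite lee_fin mulr_ge0 ?powR_ge0.
    by apply: leeD; apply: (moment_mean ijn' n0 hm); [left|right].
  by rewrite -EFinD -EFinM lee_fin /B le_eqVlt; apply/orP; left; apply/eqP; ring.
have tele i j : (i + j)%N = n ->
   (`|Ex (hybrid 0 n) gst - Ex (hybrid i j) gst| <= i%:R * B)%R.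
  elim: i j => [|i IH] j ijn.
    by rewrite -ijn add0n subrr normr0 mul0r.
  have := IH j.+1; rewrite addnS -addSn => /(_ ijn) h1.
  have := one i j; rewrite -addSn => /(_ ijn) h2.
  rewrite -natr1 mulrDl mul1r; apply: le_trans (lerD h1 h2).
  by rewrite (le_trans _ (ler_normD _ _))// addrA subrK.
exact: (tele n 0%N (addn0 n)).
Qed.
End Swap.

(** * Gaussian integrals *)

Section Density.
Local Open Scope ereal_scope.
Context d (T : measurableType d) (R : realType).
Variables (mu nu : {measure set T -> \bar R}) (p : T -> R).
Hypotheses (mp : measurable_fun [set: T] p) (p0 : forall x, (0 <= p x)%R).
Hypothesis nuE : forall A, measurable A -> nu A = \int[mu]_(x in A) (p x)%:E.

Import HBNNSimple.

Let density_nnsfun (f : {nnsfun T >-> R}) :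
  \int[nu]_x (f x)%:E = \int[mu]_x ((f x)%:E * (p x)%:E).
Proof.
under [LHS]eq_integral do rewrite fimfunE -fsumEFin//.
rewrite [LHS]ge0_integral_fsum//; last 2 first.
  - by move=> r; exact/measurable_EFinP/measurableT_comp.
  - by move=> n x _; rewrite EFinM nnfun_muleindic_ge0.
under [RHS]eq_integral.
  move=> x xD; rewrite fimfunE -fsumEFin// ge0_mule_fsuml; last first.
    by move=> r; rewrite EFinM nnfun_muleindic_ge0.
  over.
rewrite [RHS]ge0_integral_fsum//; last 2 first.
  - move=> r; apply: emeasurable_funM; first exact/measurable_EFinP/measurableT_comp.
    exact/measurable_EFinP.
  - move=> n x _; apply: mule_ge0; last by rewrite lee_fin.
    by rewrite EFinM nnfun_muleindic_ge0.
apply: eq_fsbigr => r _.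
have mf : measurable (f @^-1` [set r]) by exact: measurable_sfunP.
under eq_integral do rewrite EFinM.
rewrite integralZl_indic_nnsfun//= integral_indic// setIT nuE//.
have -> : \int[mu]_(x in f @^-1` [set r]) (p x)%:E =
    \int[mu]_x ((\1_(f @^-1` [set r]) x)%:E * (p x)%:E).
  rewrite integral_mkcond; apply: eq_integral => x _; rewrite patchE indicE.
  by case: ifPn => _; rewrite ?mul1e ?mul0e.
have mi : measurable_fun [set: T]
    (fun x => (\1_(f @^-1` [set r]) x)%:E * (p x)%:E : \bar R).
  by apply: emeasurable_funM; apply/measurable_EFinP => //; exact: measurable_indic.
have [r0|r0] := leP 0%R r.
  rewrite -ge0_integralZl//; last by move=> x _; rewrite mule_ge0 ?lee_fin.
  by apply: eq_integral => x _; rewrite EFinM muleA.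
rewrite preimage_nnfun0// !integral0_eq ?mule0// => x _.
  by rewrite indicE in_set0 mulr0 mul0e.
by rewrite indicE in_set0 mul0e.
Qed.

(** Extends the density from sets to functions: linearity for simple functions, then monotone
    convergence on both sides. *)
Lemma ge0_integral_density (f : T -> \bar R) : measurable_fun [set: T] f ->
  (forall x, 0 <= f x) -> \int[nu]_x f x = \int[mu]_x (f x * (p x)%:E).
Proof.
move=> mf f0; pose f_ := nnsfun_approx measurableT mf.
transitivity (lim (\int[nu]_x (f_ n x)%:E @[n --> \oo])).
  rewrite -monotone_convergence//=.
  - apply: eq_integral => x _; apply/esym/cvg_lim => //=.
    exact: cvg_nnsfun_approx.
  - by move=> n; exact/measurable_EFinP/measurable_funTS.
  - by move=> n ? _; rewrite lee_fin.
  - by move=> ? _ ? ? mn; rewrite lee_fin; exact/lefP/nd_nnsfun_approx.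
transitivity (lim (\int[mu]_x ((f_ n x)%:E * (p x)%:E) @[n --> \oo])).
  by apply: congr_lim; apply/funext => n /=; exact: density_nnsfun.
rewrite -monotone_convergence//=.
- apply: eq_integral => x _; apply/cvg_lim => //=.
  by apply: cvgeZr => //; exact: cvg_nnsfun_approx.
- by move=> n; apply: emeasurable_funM; exact/measurable_EFinP.
- by move=> n ? _; rewrite mule_ge0 ?lee_fin.
- move=> ? _ ? ? mn; apply: lee_wpmul2r; rewrite ?lee_fin//.
  exact/lefP/nd_nnsfun_approx.
Qed.
End Density.

Section Affine.
Local Open Scope ereal_scope.
Context (R : realType).
Local Notation leb := (@lebesgue_measure R).
Variables (a b : R).
Hypothesis a0 : (0 < a)%R.

Let aff (x : measurableTypeR R) : measurableTypeR R := (a * x + b)%R.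

Let maff : measurable_fun [set: measurableTypeR R] aff.
Proof. by apply: measurable_funD => //; exact: measurable_funM. Qed.

Lemma lebesgue_measure_affine (A : set R) : measurable A ->
  leb A = a%:E * leb (aff @^-1` A).
Proof.
move=> mA.
rewrite (@lebesgue_measure_unique R (mscale (NngNum (ltW a0)) (pushforward leb aff)))//.
move=> _ [[x y]] _ <-.
suff : leb `]x, y]%classic = a%:E * leb (aff @^-1` `]x, y]%classic) by [].
have -> : aff @^-1` `]x, y] = `]((x - b) / a)%R, ((y - b) / a)%R]%classic.
  by apply/seteqP; split => z /=; rewrite !in_itv/= /aff ltr_pdivrMr// ler_pdivlMr//
    ltrBlDr lerBrDr mulrC.
rewrite !lebesgue_measure_itv/= !lte_fin ltr_pM2r ?invr_gt0// ltrD2r.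
case: ifPn => _; last by rewrite mule0.
by rewrite -!EFinD -EFinM; congr (_%:E); field; rewrite gt_eqF.
Qed.

Lemma ge0_integral_affine (f : R -> \bar R) : measurable_fun [set: R] f ->
  (forall x, 0 <= f x) ->
  \int[leb]_x f x = a%:E * \int[leb]_x f (a * x + b)%R.
Proof.
move=> mf f0.
have := @ge0_integral_pushforward _ _ _ _ _ aff maff leb setT f measurableT mf (fun x _ => f0 x).
rewrite preimage_setT => <-.
rewrite -(ge0_integral_mscale _ measurableT (NngNum (ltW a0)))//.
by apply: eq_measure_integral => A mA _; first [exact: lebesgue_measure_affine|exact/esym/lebesgue_measure_affine].
Qed.
End Affine.

Section CosTaylor.
Context (R : realType).
Implicit Types x : R.

(** Mean value theorem. It bootstraps the bounds below: each difference has the preceding one as its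
    derivative, starting from cos <= 1. *)
Let ge0_of_derive (g g' : R -> R) : (forall x, is_derive x 1 g (g' x)) ->
  (forall x, 0 <= x -> 0 <= g' x) -> g 0 = 0 -> forall x, 0 <= x -> 0 <= g x.
Proof.
move=> dg g'0 g0 x x0.
have cg : {within `[0, x], continuous g}.
  apply: continuous_subspaceT => y; apply: differentiable_continuous.
  by apply/derivable1_diffP; have [] := dg y.
have [c] := MVT_segment x0 (fun y _ => dg y) cg.
rewrite in_itv/= => /andP[c0 _]; rewrite g0 !subr0 => ->.
by rewrite mulr_ge0// g'0.
Qed.

Let sin_le x : 0 <= x -> sin x <= x.
Proof.
move=> x0; rewrite -subr_ge0.
pose g (x : R) : R := x - sin x; pose g' (x : R) : R := 1 - cos x.
have dg (y : R) : is_derive y 1 g (g' y).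
  exact: is_deriveB.
apply: (@ge0_of_derive g g' dg _ _ x x0) => [y y0|].
  by rewrite /g' subr_ge0 cos_le1.
by rewrite /g sin0 subr0.
Qed.

Let cos_ge x : 0 <= x -> 1 - x ^+ 2 / 2 <= cos x.
Proof.
move=> x0; rewrite -subr_ge0.
pose g (x : R) : R := cos x - (1 - x ^+ 2 / 2); pose g' (x : R) : R := x - sin x.
have dg (y : R) : is_derive y 1 g (g' y).
  rewrite /g; apply: is_derive_eq.
  by rewrite /g' /GRing.scale/= ?expr1; field.
apply: (@ge0_of_derive g g' dg _ _ x x0) => [y y0|].
  by rewrite /g' subr_ge0 sin_le.
by rewrite /g cos0 expr0n /= mul0r subr0 subrr.
Qed.

Let sin_ge x : 0 <= x -> x - x ^+ 3 / 6 <= sin x.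
Proof.
move=> x0; rewrite -subr_ge0.
pose g (x : R) : R := sin x - (x - x ^+ 3 / 6); pose g' (x : R) : R := cos x - (1 - x ^+ 2 / 2).
have dg (y : R) : is_derive y 1 g (g' y).
  rewrite /g; apply: is_derive_eq.
  by rewrite /g' /GRing.scale/= ?expr1; field.
apply: (@ge0_of_derive g g' dg _ _ x x0) => [y y0|].
  by rewrite /g' subr_ge0 cos_ge.
by rewrite /g sin0 expr0n /= mul0r !subr0.
Qed.

Let cos_le x : 0 <= x -> cos x <= 1 - x ^+ 2 / 2 + x ^+ 4 / 24.
Proof.
move=> x0; rewrite -subr_ge0.
pose g (x : R) : R := 1 - x ^+ 2 / 2 + x ^+ 4 / 24 - cos x; pose g' (x : R) : R := sin x - (x - x ^+ 3 / 6).
have dg (y : R) : is_derive y 1 g (g' y).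
  rewrite /g; apply: is_derive_eq.
  by rewrite /g' /GRing.scale/= ?expr1; field.
apply: (@ge0_of_derive g g' dg _ _ x x0) => [y y0|].
  by rewrite /g' subr_ge0 sin_ge.
by rewrite /g cos0 !expr0n /= !mul0r; ring.
Qed.

Lemma cos_taylor x : `|cos x - (1 - x ^+ 2 / 2)| <= x ^+ 4 / 24.
Proof.
have e n : x ^+ n.*2 = `|x| ^+ n.*2.
  by rewrite -mul2n !exprM real_normK ?num_real.
rewrite -cos_norm (e 1%N) (e 2%N); have x0 := normr_ge0 x.
have := cos_ge x0; have := cos_le x0; rewrite -[1.*2]/2%N -[2.*2]/4%N => h1 h2.
by rewrite ler_norml; apply/andP; split; [have := exprn_ge0 4 x0; lra|lra].
Qed.

Lemma expR_taylor x : 0 <= x -> `|expR (- x) - (1 - x)| <= x ^+ 2 / 2.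
Proof.
move=> x0.
have h1 : 0 <= expR (- x) - (1 - x) by rewrite subr_ge0; exact: expR_ge1Dx.
rewrite ger0_norm// -subr_ge0.
pose g (x : R) : R := x ^+ 2 / 2 - (expR (- x) - (1 - x)).
pose g' (x : R) : R := expR (- x) - (1 - x).
have dg (y : R) : is_derive y 1 g (g' y).
  rewrite /g; apply: is_derive_eq.
  by rewrite /g' /GRing.scale/= ?expr1; field.
apply: (@ge0_of_derive g g' dg _ _ x x0) => [y y0|].
  by rewrite /g' subr_ge0; exact: expR_ge1Dx.
by rewrite /g oppr0 expR0 expr0n /= mul0r; ring.
Qed.
End CosTaylor.

Section Gauss.
Context (R : realType).
Local Notation leb := (@lebesgue_measure R).

Let gauss0 : probability (measurableTypeR R) R := normal_prob 0 1.

Let mid : measurable_fun [set: measurableTypeR R] (fun x : measurableTypeR R => x : R).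
Proof. by []. Qed.

(* [normal_prob] lives on [measurableTypeR R], an alias of [R]. *)
Definition gauss : probability R R := law gauss0 mid.

Definition gpdf (x : R) : R := normal_pdf 0 1 x.

Lemma gpdfE x : gpdf x = normal_peak 1 * expR (- (x ^+ 2 / 2)).
Proof.
rewrite /gpdf normal_pdfE ?oner_neq0// /normal_fun subr0 expr1n mulNr.
by rewrite mulr2n.
Qed.

Lemma gpdf_ge0 x : 0 <= gpdf x. Proof. exact: normal_pdf_ge0. Qed.

Lemma measurable_gpdf : measurable_fun [set: R] gpdf.
Proof. exact: measurable_normal_pdf. Qed.

Lemma gpdf_rot (c s u v : R) : c ^+ 2 + s ^+ 2 = 1 ->
  gpdf (c * u - s * v) * gpdf (c * v + s * u) = gpdf u * gpdf v.
Proof.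
move=> cs; rewrite !gpdfE [LHS]mulrACA [RHS]mulrACA -!expRD; congr (_ * expR _).
transitivity (- ((c ^+ 2 + s ^+ 2) * (u ^+ 2 + v ^+ 2) / 2)); first by field.
by rewrite cs; field.
Qed.

Lemma ge0_integral_gauss (f : R -> \bar R) : measurable_fun [set: R] f ->
  (forall x, (0 <= f x)%E) ->
  (\int[gauss]_x f x = \int[leb]_x (f x * (gpdf x)%:E))%E.
Proof.
move=> mf f0; rewrite ge0_integral_law//.
by apply: ge0_integral_density => //; [exact: measurable_gpdf|exact: gpdf_ge0].
Qed.

Local Open Scope ereal_scope.

(** The density of the pair is a function of the squared norm. The rotation is carried out as two
    one-dimensional affine substitutions whose Jacobians 1/c and c cancel; this is why c must be
    positive. *)
Lemma gauss_rotation (c s : R) (F : R * R -> \bar R) :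
  (c ^+ 2 + s ^+ 2 = 1)%R -> (0 < c)%R ->
  measurable_fun [set: R * R] F -> (forall z, 0 <= F z) ->
  \int[pprod gauss gauss]_z F (c * z.1 + s * z.2, c * z.2 - s * z.1)%R =
  \int[pprod gauss gauss]_z F z.
Proof.
move=> cs c0 mF F0.
have mp := measurable_gpdf; have p0 := gpdf_ge0.
have mp1 : measurable_fun [set: R * R] (fun z => gpdf z.1).
  exact: (measurableT_comp mp measurable_fst).
have mp2 : measurable_fun [set: R * R] (fun z => gpdf z.2).
  exact: (measurableT_comp mp measurable_snd).
have expand (G : R * R -> \bar R) : measurable_fun [set: R * R] G -> (forall z, 0 <= G z) ->
    \int[pprod gauss gauss]_z G z =
    \int[leb]_x \int[leb]_y (G (x, y) * (gpdf x * gpdf y)%:E).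
  move=> mG G0; rewrite tonelli// ge0_integral_gauss; last 2 first.
  - exact: (measurable_fun_fubini_tonelli_F G).
  - by move=> x; exact: integral_ge0.
  apply: eq_integral => x _; rewrite ge0_integral_gauss//; last first.
    by apply: measurableT_comp => //; exact: pair1_measurable.
  rewrite -ge0_integralZr//.
  - by apply: eq_integral => y _; rewrite [in RHS]EFinM -muleA; congr (_ * _); rewrite muleC.
  - apply: emeasurable_funM; last exact/measurable_EFinP.
    by apply: measurableT_comp => //; exact: pair1_measurable.
  - by move=> y _; rewrite mule_ge0// lee_fin.
  - by rewrite lee_fin.
have rotm (a b a' b' : R) : measurable_fun [set: R * R]
    (fun z => (a * z.1 + b * z.2, a' * z.2 + b' * z.1)%R).
  by apply: measurable_fun_pair; apply: measurable_funD; apply: measurable_funM.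
rewrite (expand (fun z => F (c * z.1 + s * z.2, c * z.2 - s * z.1)%R)); last 2 first.
- have := measurableT_comp mF (rotm c s c (- s)%R).
  by apply: eq_measurable_fun => z _ /=; rewrite mulNr.
- by move=> z; exact: F0.
rewrite (expand F mF F0) /=.
pose H (x y : R) : \bar R := F (c * x + s * y, c * y - s * x)%R * (gpdf x * gpdf y)%:E.
have mH : measurable_fun [set: R * R] (fun z => H z.1 z.2).
  apply: emeasurable_funM; last first.
    by apply/measurable_EFinP; exact: measurable_funM.
  have := measurableT_comp mF (rotm c s c (- s)%R).
  by apply: eq_measurable_fun => z _ /=; rewrite mulNr.
have H0 x y : 0 <= H x y by rewrite mule_ge0// lee_fin mulr_ge0.
have ic : (0 < c^-1)%R by rewrite invr_gt0.
have leb_swap (G : R * R -> \bar R) : measurable_fun [set: R * R] G ->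
    (forall z, 0 <= G z) -> \int[leb]_x \int[leb]_y G (x, y) =
    \int[leb]_y \int[leb]_x G (x, y).
  by move=> mG G0; exact: (@fubini_tonelli _ _ _ _ R leb leb G mG G0).
transitivity (\int[leb]_y \int[leb]_x H x y).
  exact: (leb_swap (fun z => H z.1 z.2) mH (fun z => H0 _ _)).
(* First substitution, at fixed y: u = c x + s y. *)
pose H1 (u y : R) : \bar R := H (c^-1 * u + (- (s * y) / c))%R y.
have mH1 : measurable_fun [set: R * R] (fun z => H1 z.1 z.2).
  apply: (measurableT_comp mH (measurable_fun_pair _ _)) => //.
  apply: measurable_funD; first exact: measurable_funM.
  apply: measurable_funM => //; apply: measurableT_comp => //.
  exact: measurable_funM.
transitivity (\int[leb]_y (c^-1%:E * \int[leb]_u H1 u y)).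
  apply: eq_integral => y _.
  rewrite (ge0_integral_affine (- (s * y) / c)%R ic)//.
  by apply: (measurableT_comp mH (measurable_fun_pair _ _)).
rewrite ge0_integralZl//; last 3 first.
- exact: (@measurable_fun_fubini_tonelli_G _ _ _ _ R leb (fun z => H1 z.1 z.2) mH1 (fun z => H0 _ _)).
- by move=> y _; apply: integral_ge0 => u _; exact: H0.
- by rewrite lee_fin ltW.
transitivity (c^-1%:E * \int[leb]_u \int[leb]_y H1 u y).
  have sw := leb_swap (fun z => H1 z.1 z.2) mH1 (fun z => H0 _ _).
  exact: (congr1 (fun X => c^-1%:E * X) (esym sw)).
rewrite -ge0_integralZl//; last 3 first.
- exact: (@measurable_fun_fubini_tonelli_F _ _ _ _ R leb (fun z => H1 z.1 z.2) mH1 (fun z => H0 _ _)).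
- by move=> y _; apply: integral_ge0 => u _; exact: H0.
- by rewrite lee_fin ltW.
apply: eq_integral => u _.
have mH1u : measurable_fun [set: R] (H1 u).
  exact: (measurableT_comp mH1 (pair1_measurable (u : R))).
(* Second substitution, at fixed u: y = c v + s u, after which x = c u - s v and the argument of [F]
   is (u, v). *)
rewrite (ge0_integral_affine (s * u)%R c0 mH1u (fun x => H0 _ _)).
rewrite muleA -EFinM mulVf ?gt_eqF// mul1e; apply: eq_integral => v _.
have s2 : (s ^+ 2 = 1 - c ^+ 2)%R by rewrite -cs addrC addKr.
have cn : c != 0%R by rewrite gt_eqF.
have e1 : (c^-1 * u + - (s * (c * v + s * u)) / c = c * u - s * v)%R.
  transitivity (c^-1 * (u - s ^+ 2 * u) - s * v)%R; first by field.
  by rewrite s2; field.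
have e2 : (c * (c * u - s * v) + s * (c * v + s * u) = u)%R.
  transitivity ((c ^+ 2 + s ^+ 2) * u)%R; first by ring.
  by rewrite cs mul1r.
have e3 : (c * (c * v + s * u) - s * (c * u - s * v) = v)%R.
  transitivity ((c ^+ 2 + s ^+ 2) * v)%R; first by ring.
  by rewrite cs mul1r.
by rewrite /H1 /H e1 gpdf_rot// e2 e3.
Qed.
End Gauss.

Section GaussMoments.
Context (R : realType).
Local Notation leb := (@lebesgue_measure R).
Local Notation g := (gauss R).

(** The integrand times the density is the density at r x, whose total mass is 1/r. Negative a above
    -1/2 are covered. *)
Lemma gauss_exp_sqr_nn (a r : R) : 1 + 2 * a = r ^+ 2 -> 0 < r ->
  (\int[g]_x (expR (- (a * x ^+ 2)))%:E = (r^-1)%:E)%E.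
Proof.
move=> ar r0.
have mf : measurable_fun [set: R] (fun x : R => (expR (- (a * x ^+ 2)))%:E).
  apply/measurable_EFinP; apply: measurableT_comp => //; apply: measurableT_comp => //.
  by apply: measurable_funM => //; exact: measurable_funX.
rewrite ge0_integral_gauss//.
have gp0 (x : R) : (0 <= (gpdf x)%:E)%E by rewrite lee_fin; exact: gpdf_ge0.
have mp : measurable_fun [set: R] (fun x : R => (gpdf x)%:E).
  by apply/measurable_EFinP; exact: measurable_gpdf.
have := ge0_integral_affine 0 r0 mp gp0.
rewrite integral_normal_pdf => /(congr1 (fun X => (r^-1)%:E * X)%E).
rewrite mule1 muleA -EFinM mulVf ?gt_eqF// mul1e => ->.
apply: eq_integral => x _; rewrite -EFinM; congr (_%:E).
rewrite !gpdfE mulrCA -expRD; congr (_ * expR _).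
by rewrite addr0 exprMn -ar; field.
Qed.

Lemma gauss_exp_sqr (a r : R) : 1 + 2 * a = r ^+ 2 -> 0 < r ->
  intg g (fun x => expR (- (a * x ^+ 2))) /\ Ex g (fun x => expR (- (a * x ^+ 2))) = r^-1.
Proof.
move=> ar r0; have h := gauss_exp_sqr_nn ar r0.
split; last by rewrite /Ex /Rintegral h.
apply/intg_ge0P; last by rewrite h ltry.
  apply: measurableT_comp => //; apply: measurableT_comp => //.
  by apply: measurable_funM => //; exact: measurable_funX.
by move=> x; exact: expR_ge0.
Qed.

(** Symmetry is drawn from rotations: the rotation by pi/4 applied twice is a quarter turn, not
    directly available because its cosine is 0, and two quarter turns change the sign of both
    coordinates. *)
Lemma gauss_neg (f : R -> \bar R) : measurable_fun [set: R] f ->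
  (forall x, (0 <= f x)%E) -> (\int[g]_x f (- x)%R = \int[g]_x f x)%E.
Proof.
move=> mf f0.
pose c : R := Num.sqrt 2^-1.
have c0 : 0 < c by rewrite sqrtr_gt0 invr_gt0.
have c2 : c ^+ 2 = 2^-1 by rewrite sqr_sqrtr// invr_ge0.
have cc : c ^+ 2 + c ^+ 2 = 1 by rewrite c2; field.
have rot (F : R * R -> \bar R) : measurable_fun [set: R * R] F -> (forall z, (0 <= F z)%E) ->
    (\int[pprod g g]_z F (z.2, - z.1)%R = \int[pprod g g]_z F z)%E.
  move=> mF F0; rewrite -[RHS](gauss_rotation cc c0)//.
  have mF' : measurable_fun [set: R * R] (fun z => F (c * z.1 + c * z.2, c * z.2 - c * z.1)).
    apply: (measurableT_comp mF); apply: measurable_fun_pair.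
      by apply: measurable_funD; exact: measurable_funM.
    by apply: measurable_funB; exact: measurable_funM.
  rewrite -[RHS](gauss_rotation cc c0)//=.
  apply: eq_integral => z _; congr (F (_, _)).
    by rewrite -[LHS]mul1r -cc; ring.
  by rewrite -[LHS]mul1r -cc; ring.
have marg (h : R -> \bar R) : measurable_fun [set: R] h -> (forall x, (0 <= h x)%E) ->
    (\int[pprod g g]_z h z.1 = \int[g]_x h x)%E.
  move=> mh h0; rewrite tonelli//; last exact: measurableT_comp.
  apply: eq_integral => x _ /=.
  by rewrite integral_cst// -[RHS]mule1; congr (_ * _)%E; exact: (@probability_setT _ _ _ g).
have mfN : measurable_fun [set: R] (fun x => f (- x)%R) by exact: measurableT_comp.
rewrite -marg// -[RHS]marg//.
have m2 : measurable_fun [set: R * R] (fun z => f z.1) by exact: measurableT_comp.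
rewrite -[RHS]rot// -[RHS](rot (fun z => f z.2))//.
exact: measurableT_comp.
Qed.

Lemma gauss_neg_Ex (f : R -> R) : intg g f -> Ex g (fun x => f (- x)) = Ex g f.
Proof.
move=> fi; have mf := intg_measurable fi.
rewrite /Ex /Rintegral integralE [in RHS]integralE.
have mfE : measurable_fun [set: R] (EFin \o f) by exact/measurable_EFinP.
have mp := measurable_funepos mfE; have mn := measurable_funeneg mfE.
rewrite -(gauss_neg mp)// -(gauss_neg mn)//.
congr (fine (_ - _)); apply: eq_integral => x _; rewrite ?funeposE ?funenegE //.
Qed.

Lemma gauss_odd (f : R -> R) : intg g f -> (forall x, f (- x) = - f x) -> Ex g f = 0.
Proof.
move=> fi fo; have := gauss_neg_Ex fi.
have -> : (fun x => f (- x)) = (fun x => -1 * f x) by apply/funext => x; rewrite fo mulN1r.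
by rewrite ExZ//; lra.
Qed.

Lemma gauss_pow_intg n : (n <= 4)%N -> intg g (fun x => x ^+ n).
Proof.
move=> n4.
(* exp (x^2 / 4) is integrable, and by its expansion it is at least 1 + x^4 / 32, so that 33 times
   it dominates 1 + x^4. *)
have r1 : 1 + 2 * - 4^-1 = Num.sqrt 2^-1 ^+ 2 :> R.
  by rewrite sqr_sqrtr ?invr_ge0//; field.
have r2 : 0 < Num.sqrt 2^-1 :> R by rewrite sqrtr_gt0 invr_gt0.
have [h _] := gauss_exp_sqr r1 r2.
apply: (intg_le _ _ (intgZ 33 h)); first exact: measurable_funX.
move=> x; rewrite normrX mulNr opprK.
have y0 : 0 <= 4^-1 * x ^+ 2 by rewrite mulr_ge0 ?invr_ge0 ?sqr_ge0.
have e2 := expR_ge1Dxn 1 y0; rewrite !factS fact0 !muln1 in e2.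
have e4 : (4^-1 * x ^+ 2) ^+ 2 / 2 = `|x| ^+ 4 / 32.
  by rewrite -(real_normK (num_real x)); field.
rewrite e4 in e2.
have : `|x| ^+ n <= 1 + `|x| ^+ 4.
  have [x1|/ltW x1] := leP `|x| 1.
    by rewrite (le_trans (exprn_ile1 _ _ x1))// lerDl exprn_ge0.
  by rewrite ler_wpDl// ler_weXn2l.
have := exprn_ge0 4 (normr_ge0 x).
by move: e2; move: (`|x| ^+ 4) (`|x| ^+ n) => u v; lra.
Qed.

Lemma gauss_m1 : Ex g (fun x => x) = 0.
Proof. by apply: gauss_odd => //; exact: (@gauss_pow_intg 1). Qed.

(** The transform E exp (- a x^2) = (1 + 2 a)^(-1/2) differs by O(a^2) both from 1 - a m2 and from 1
    - a; hence m2 - 1 = O(a) for every small a > 0. *)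
Lemma gauss_m2 : Ex g (fun x => x ^+ 2) = 1.
Proof.
have i2 := @gauss_pow_intg 2 isT; have i4 := @gauss_pow_intg 4 isT.
set m2 := Ex g _; set m4 := Ex g (fun x => x ^+ 4).
have m40 : 0 <= m4 by apply: Ex_ge0 => x; rewrite (exprM _ 2 2) sqr_ge0.
have key a : 0 < a <= 1 -> `|m2 - 1| <= a * (m4 + 2).
  move=> /andP[a0 a1]; pose r := Num.sqrt (1 + 2 * a).
  have r2 : r ^+ 2 = 1 + 2 * a by rewrite sqr_sqrtr//; lra.
  have r0 : 0 < r by rewrite sqrtr_gt0; lra.
  have r1 : 1 <= r by have := sqr_ge0 (1 - r); nra.
  have ra : r - 1 <= a by nra.
  have [ie Ee] := gauss_exp_sqr (esym r2) r0.
  have h : `|r^-1 - (1 - a * m2)| <= a ^+ 2 / 2 * m4.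
    have i1 : intg g (fun x => 1 - a * x ^+ 2) by apply: intgB; [exact: intg_cst|exact: intgZ].
    have -> : r^-1 - (1 - a * m2) = Ex g (fun x => expR (- (a * x ^+ 2)) - (1 - a * x ^+ 2)).
      by rewrite ExB// Ee ExB ?Ex_cst ?ExZ//; [exact: intg_cst|exact: intgZ].
    apply: (le_trans (Ex_norm _)); first exact: intgB.
    rewrite -ExZ//; apply: Ex_le; [apply: intg_norm; exact: intgB|exact: intgZ|].
    move=> x; have y0 : 0 <= a * x ^+ 2 by rewrite mulr_ge0 ?sqr_ge0 ?ltW.
    by apply: (le_trans (expR_taylor y0)); rewrite le_eqVlt; apply/orP; left; apply/eqP; ring.
  have h2 : `|r^-1 - (1 - a)| <= 2 * a ^+ 2.
    have rn : r != 0 by rewrite gt_eqF.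
    have -> : r^-1 - (1 - a) = a * ((r - 1) * (r + 2)) / (r * (r + 1)).
      have -> : a = (r ^+ 2 - 1) / 2 by rewrite r2; field.
      by field; apply/andP; split => //; rewrite gt_eqF//; lra.
    rewrite ger0_norm; last by rewrite divr_ge0 ?mulr_ge0//; lra.
    rewrite ler_pdivrMr; last by rewrite mulr_gt0//; lra.
    have : (r - 1) * (r + 2) <= a * (2 * (r * (r + 1))) by nra.
    by move=> /(ler_wpM2l (ltW a0)); rewrite expr2; nra.
  have : `|a * (m2 - 1)| <= a * (a * (m4 + 2)).
    have -> : a * (m2 - 1) = (r^-1 - (1 - a * m2)) - (r^-1 - (1 - a)) by ring.
    apply: (le_trans (ler_normB _ _)); apply: (le_trans (lerD h h2)).
    by rewrite expr2; nra.
  by rewrite normrM gtr0_norm// ler_pM2l.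
apply/eqP; rewrite -subr_eq0 -normr_eq0 eq_le normr_ge0 andbT.
apply/ler_addgt0Pl => e e0; rewrite addr0.
pose a := Num.min 1 (e / (m4 + 2)).
have a01 : 0 < a <= 1 by rewrite lt_min ltr01 divr_gt0 ?ge_min ?lexx//; lra.
apply: (le_trans (key a a01)); rewrite -ler_pdivlMr; last lra.
by rewrite ge_min lexx orbT.
Qed.
End GaussMoments.

(** * Anti-concentration of Gaussian quadratic forms *)

Section ProductExpectation.
Context d1 d2 (T1 : measurableType d1) (T2 : measurableType d2) (R : realType).
Variables (P1 : probability T1 R) (P2 : probability T2 R).

Lemma intg_prodM (f : T1 -> R) (h : T2 -> R) : intg P1 f -> intg P2 h ->
  intg (pprod P1 P2) (fun z => f z.1 * h z.2).
Proof.
move=> fi hi; have mf := intg_measurable fi; have mh := intg_measurable hi.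
have m : measurable_fun [set: T1 * T2] (fun z => f z.1 * h z.2).
  by apply: measurable_funM; exact: measurableT_comp.
apply: (intg_le m (g := fun z => `|f z.1| * `|h z.2|)) => [z|]; first by rewrite normrM.
apply: intg_prod.
- by apply: measurable_funM; do 2 apply: measurableT_comp => //.
- by move=> z; rewrite mulr_ge0.
- by move=> x /=; apply: intgZ; exact: intg_norm.
- rewrite (_ : (fun x => _) = (fun x => Ex P2 (fun y => `|h y|) * `|f x|)).
    by apply: intgZ; exact: intg_norm.
  by apply/funext => x /=; rewrite ExZ 1?mulrC//; exact: intg_norm.
Qed.

Lemma Ex_prodM (f : T1 -> R) (h : T2 -> R) : intg P1 f -> intg P2 h ->
  Ex (pprod P1 P2) (fun z => f z.1 * h z.2) = Ex P1 f * Ex P2 h.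
Proof.
move=> fi hi; rewrite Ex_prod; last exact: intg_prodM.
rewrite (_ : (fun x => _) = (fun x => Ex P2 h * f x)); first by rewrite ExZ// mulrC.
by apply/funext => x /=; rewrite ExZ// mulrC.
Qed.

Lemma intg_fst (f : T1 -> R) : intg P1 f -> intg (pprod P1 P2) (fun z => f z.1).
Proof.
move=> fi; have := intg_prodM fi (intg_cst P2 1).
by under [X in intg _ X -> _]funext do rewrite mulr1.
Qed.

Lemma Ex_fst (f : T1 -> R) : intg P1 f -> Ex (pprod P1 P2) (fun z => f z.1) = Ex P1 f.
Proof.
move=> fi; have := Ex_prodM fi (intg_cst P2 1).
by under [X in Ex _ X = _ -> _]funext do rewrite mulr1; rewrite Ex_cst mulr1.
Qed.

Lemma intg_snd (f : T2 -> R) : intg P2 f -> intg (pprod P1 P2) (fun z => f z.2).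
Proof.
move=> fi; have := intg_prodM (intg_cst P1 1) fi.
by under [X in intg _ X -> _]funext do rewrite mul1r.
Qed.

Lemma Ex_snd (f : T2 -> R) : intg P2 f -> Ex (pprod P1 P2) (fun z => f z.2) = Ex P2 f.
Proof.
move=> fi; have := Ex_prodM (intg_cst P1 1) fi.
by under [X in Ex _ X = _ -> _]funext do rewrite mul1r; rewrite Ex_cst mul1r.
Qed.

Lemma sq_fst (f : T1 -> R) : sq P1 f -> sq (pprod P1 P2) (fun z => f z.1).
Proof.
by move=> [mf f2]; split; [exact: measurableT_comp|exact: intg_fst f2].
Qed.

Lemma sq_snd (f : T2 -> R) : sq P2 f -> sq (pprod P1 P2) (fun z => f z.2).
Proof.
by move=> [mf f2]; split; [exact: measurableT_comp|exact: intg_snd f2].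
Qed.
End ProductExpectation.

Section CharacteristicFunction.
Context (R : realType).
Local Notation g := (gauss R).

Section Gen.
Context d (T : measurableType d) (P : probability T R).

Lemma intg_cos (f : T -> R) : measurable_fun [set: T] f -> intg P (fun x => cos (f x)).
Proof.
move=> mf; apply: (@intg_bdd _ _ _ _ _ 1); last by move=> x; exact: cos_max.
by apply: measurableT_comp => //; apply: continuous_measurable_fun; exact: continuous_cos.
Qed.

Lemma intg_sin (f : T -> R) : measurable_fun [set: T] f -> intg P (fun x => sin (f x)).
Proof.
move=> mf; apply: (@intg_bdd _ _ _ _ _ 1); last by move=> x; exact: sin_max.
by apply: measurableT_comp => //; apply: continuous_measurable_fun; exact: continuous_sin.
Qed.

(** The squared modulus of the characteristic function of [f] at [z], in real terms. *)
Definition cfsqr (f : T -> R) (z : R) : R :=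
  Ex P (fun x => cos (z * f x)) ^+ 2 + Ex P (fun x => sin (z * f x)) ^+ 2.

(** The left-hand side is the real part of the characteristic function times a number of modulus
    one. *)
Lemma Ex_cos_shift_le (f : T -> R) (z t : R) : measurable_fun [set: T] f ->
  Ex P (fun x => cos (z * (f x - t))) <= Num.sqrt (cfsqr f z).
Proof.
move=> mf; have mzf : measurable_fun [set: T] (fun x => z * f x) by exact: measurable_funM.
have -> : Ex P (fun x => cos (z * (f x - t))) =
    cos (z * t) * Ex P (fun x => cos (z * f x)) + sin (z * t) * Ex P (fun x => sin (z * f x)).
  rewrite -!ExZ; [|exact: intg_sin|exact: intg_cos].
  rewrite -ExD; [|by apply: intgZ; exact: intg_cos|by apply: intgZ; exact: intg_sin].
  by congr Ex; apply/funext => x; rewrite mulrBr cosB; ring.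
set C := Ex P _; set S := Ex P _; set a := cos _; set b := sin _.
have ab : a ^+ 2 + b ^+ 2 = 1 by exact: cos2Dsin2.
apply: (le_trans (ler_norm _)); rewrite -sqrtr_sqr ler_wsqrtr//.
rewrite /cfsqr -/C -/S -subr_ge0.
have -> : C ^+ 2 + S ^+ 2 - (a * C + b * S) ^+ 2 =
   (C ^+ 2 + S ^+ 2) * (1 - (a ^+ 2 + b ^+ 2)) + (a * S - b * C) ^+ 2 by ring.
by rewrite ab subrr mulr0 add0r sqr_ge0.
Qed.
End Gen.

Lemma cfsqr_pprod d1 d2 (T1 : measurableType d1) (T2 : measurableType d2)
    (P1 : probability T1 R) (P2 : probability T2 R) (f : T1 -> R) (h : T2 -> R) z :
  measurable_fun [set: T1] f -> measurable_fun [set: T2] h ->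
  cfsqr (pprod P1 P2) (fun w => f w.1 + h w.2) z = cfsqr P1 f z * cfsqr P2 h z.
Proof.
move=> mf mh.
have mzf : measurable_fun [set: T1] (fun x => z * f x) by exact: measurable_funM.
have mzh : measurable_fun [set: T2] (fun x => z * h x) by exact: measurable_funM.
have cf := intg_cos P1 mzf; have sf := intg_sin P1 mzf.
have ch := intg_cos P2 mzh; have sh := intg_sin P2 mzh.
rewrite /cfsqr.
have -> : Ex (pprod P1 P2) (fun w => cos (z * (f w.1 + h w.2))) =
    Ex P1 (fun x => cos (z * f x)) * Ex P2 (fun x => cos (z * h x)) -
    Ex P1 (fun x => sin (z * f x)) * Ex P2 (fun x => sin (z * h x)).
  rewrite -!Ex_prodM// -ExB; [|exact: (intg_prodM cf ch)|exact: (intg_prodM sf sh)].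
  by congr Ex; apply/funext => w; rewrite mulrDr cosD.
have -> : Ex (pprod P1 P2) (fun w => sin (z * (f w.1 + h w.2))) =
    Ex P1 (fun x => sin (z * f x)) * Ex P2 (fun x => cos (z * h x)) +
    Ex P1 (fun x => cos (z * f x)) * Ex P2 (fun x => sin (z * h x)).
  rewrite -!Ex_prodM// -ExD; [|exact: (intg_prodM sf ch)|exact: (intg_prodM cf sh)].
  by congr Ex; apply/funext => w; rewrite mulrDr sinD.
ring.
Qed.

Lemma gauss_rotation_Ex (c s : R) (f : R * R -> R) :
  c ^+ 2 + s ^+ 2 = 1 -> 0 < c -> measurable_fun [set: R * R] f ->
  Ex (pprod g g) (fun z => f (c * z.1 + s * z.2, c * z.2 - s * z.1)) = Ex (pprod g g) f.
Proof.
move=> cs c0 mf; have mfE : measurable_fun [set: R * R] (EFin \o f) by exact/measurable_EFinP.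
have mp := measurable_funepos mfE; have mn := measurable_funeneg mfE.
rewrite /Ex /Rintegral integralE [in RHS]integralE.
rewrite -(gauss_rotation cs c0 mp)// -(gauss_rotation cs c0 mn)//.
by congr (fine (_ - _)); apply: eq_integral => z _; rewrite ?funeposE ?funenegE.
Qed.

Let c : R := Num.sqrt 2^-1.
Let c0 : 0 < c. Proof. by rewrite sqrtr_gt0 invr_gt0. Qed.
Let c2 : c ^+ 2 = 2^-1. Proof. by rewrite sqr_sqrtr// invr_ge0. Qed.
Let cc : c ^+ 2 + c ^+ 2 = 1. Proof. by rewrite c2; field. Qed.

(** The rotation by pi/4 turns x^2 y^2 into (y^2 - x^2)^2 / 4; taking means, 1 = (m4 - 1) / 2. *)
Lemma gauss_m4 : Ex g (fun x => x ^+ 4) = 3.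
Proof.
have i2 := @gauss_pow_intg R 2 isT; have i4 := @gauss_pow_intg R 4 isT.
have mf : measurable_fun [set: R * R] (fun z => z.1 ^+ 2 * z.2 ^+ 2 : R).
  by apply: measurable_funM; apply: measurable_funX.
have := gauss_rotation_Ex cc c0 mf.
rewrite (Ex_prodM i2 i2) gauss_m2 mulr1 /=.
have -> : (fun z : R * R => (c * z.1 + c * z.2) ^+ 2 * (c * z.2 - c * z.1) ^+ 2) =
    (fun z => 4^-1 * (z.1 ^+ 4 + z.2 ^+ 4) + (- 2^-1) * (z.1 ^+ 2 * z.2 ^+ 2)).
  apply/funext => z; have -> : (c * z.1 + c * z.2) ^+ 2 * (c * z.2 - c * z.1) ^+ 2 =
    (c ^+ 2) ^+ 2 * (z.2 ^+ 2 - z.1 ^+ 2) ^+ 2 by ring.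
  by rewrite c2; field.
have i41 := intg_fst g i4; have i42 := intg_snd g i4.
have i22 := intg_prodM i2 i2; have i44 := intgD i41 i42.
rewrite (ExD (intgZ _ i44) (intgZ _ i22)) (ExZ _ i44) (ExZ _ i22) (ExD i41 i42).
by rewrite (Ex_fst g i4) (Ex_snd g i4) (Ex_prodM i2 i2) gauss_m2; lra.
Qed.

Let mlin (a : R) : measurable_fun [set: R] (fun x : R => a * x).
Proof. exact: measurable_funM. Qed.

Let cos_double a : Ex g (fun x => cos (a * x)) = Ex g (fun x => cos (a * c * x)) ^+ 2.
Proof.
have iC b := intg_cos g (mlin b); have iS b := intg_sin g (mlin b).
have mf : measurable_fun [set: R * R] (fun z : R * R => cos (a * z.1)).
  exact: intg_measurable (intg_fst g (iC a)).
have := gauss_rotation_Ex cc c0 mf; rewrite (Ex_fst g (iC a)) => <- /=.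
have -> : (fun z : R * R => cos (a * (c * z.1 + c * z.2))) =
  (fun z => cos (a * c * z.1) * cos (a * c * z.2) - sin (a * c * z.1) * sin (a * c * z.2)).
  by apply/funext => z; rewrite -cosD; congr cos; ring.
rewrite ExB; [|exact: (intg_prodM (iC _) (iC _))|exact: (intg_prodM (iS _) (iS _))].
rewrite (Ex_prodM (iC _) (iC _)) (Ex_prodM (iS _) (iS _)).
have -> : Ex g (fun x => sin (a * c * x)) = 0.
  by apply: gauss_odd => // x; rewrite mulrN sinN.
by rewrite mulr0 subr0 expr2.
Qed.

(** Both sides satisfy f(b) = f(b / sqrt 2)^2 and are bounded by 1, so their distance D obeys D(b)
    <= 2 D(b / sqrt 2). They agree to fourth order at 0; iterating k times gives D(a) <= a^4 / (4 *
    2^k). *)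
Lemma gauss_cos a : Ex g (fun x => cos (a * x)) = expR (- (a ^+ 2 / 2)).
Proof.
have iC b := intg_cos g (mlin b).
pose D (b : R) : R := `|Ex g (fun x => cos (b * x)) - expR (- (b ^+ 2 / 2))|.
have D4 b : D b <= b ^+ 4 / 4.
  have i2 := @gauss_pow_intg R 2 isT; have i4 := @gauss_pow_intg R 4 isT.
  have i1 : intg g (fun x => 1 - b ^+ 2 / 2 * x ^+ 2).
    by apply: intgB; [exact: intg_cst|exact: intgZ].
  have h1 : `|Ex g (fun x => cos (b * x)) - (1 - b ^+ 2 / 2)| <= b ^+ 4 / 8.
    have -> : 1 - b ^+ 2 / 2 = Ex g (fun x => 1 - b ^+ 2 / 2 * x ^+ 2).
      by rewrite ExB ?Ex_cst ?ExZ ?gauss_m2 ?mulr1//; [exact: intg_cst|exact: intgZ].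
    rewrite -ExB//; apply: (le_trans (Ex_norm _)); first exact: intgB.
    have -> : b ^+ 4 / 8 = Ex g (fun x => b ^+ 4 / 24 * x ^+ 4).
      by rewrite ExZ// gauss_m4; field.
    apply: Ex_le; [by apply: intg_norm; exact: intgB|exact: intgZ|] => x.
    have := cos_taylor (b * x).
    by rewrite !exprMn (_ : b ^+ 2 * x ^+ 2 / 2 = b ^+ 2 / 2 * x ^+ 2)
      1?(_ : b ^+ 4 * x ^+ 4 / 24 = b ^+ 4 / 24 * x ^+ 4)//; ring.
  have h2 := @expR_taylor R (b ^+ 2 / 2) (divr_ge0 (sqr_ge0 b) (ler0n _ 2)).
  rewrite /D (_ : _ - _ = (Ex g (fun x => cos (b * x)) - (1 - b ^+ 2 / 2)) -
    (expR (- (b ^+ 2 / 2)) - (1 - b ^+ 2 / 2))); last by ring.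
  apply: (le_trans (ler_normB _ _)); apply: (le_trans (lerD h1 h2)).
  by rewrite le_eqVlt; apply/orP; left; apply/eqP; field.
have Dc b : D b <= 2 * D (b * c).
  rewrite /D cos_double (_ : - (b ^+ 2 / 2) = - ((b * c) ^+ 2 / 2) + - ((b * c) ^+ 2 / 2)); last first.
    by rewrite exprMn c2; field.
  rewrite expRD -expr2 subr_sqr normrM mulrC ler_wpM2r//.
  have h : `|Ex g (fun x => cos (b * c * x))| <= 1.
    apply: (le_trans (Ex_norm (iC _))); rewrite -[leRHS](Ex_cst g 1).
    by apply: Ex_le; [exact: intg_norm|exact: intg_cst|move=> x; exact: cos_max].
  have h' : `|expR (- ((b * c) ^+ 2 / 2))| <= 1.
    rewrite ger0_norm ?expR_ge0// expR_le1 oppr_le0 divr_ge0 ?sqr_ge0//.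
  by apply: (le_trans (ler_normD _ _)); rewrite (_ : 2 = 1 + 1 :> R) ?lerD//; ring.
have Dk k : D a <= a ^+ 4 / 4 / 2 ^+ k.
  suff [h1] : D a <= 2 ^+ k * D (a * c ^+ k) /\ (c ^+ k) ^+ 4 * (2 ^+ k) ^+ 2 = 1.
    move=> h2; apply: (le_trans h1).
    apply: (le_trans (ler_wpM2l _ (D4 _))); first by rewrite exprn_ge0.
    rewrite exprMn le_eqVlt; apply/orP; left; apply/eqP.
    have k0 : (2 : R) ^+ k != 0 by rewrite expf_neq0.
    rewrite (_ : (c ^+ k) ^+ 4 = ((2 ^+ k) ^+ 2)^-1); first by field.
    by apply: (mulIf (expf_neq0 2 k0)); rewrite h2 mulVf// expf_neq0.
  split; last first.
    rewrite -!exprM mulnC exprM (mulnC k 2) exprM -exprMn (exprM _ 2 2) c2.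
    by rewrite (_ : _ * _ = 1) ?expr1n//; field.
  elim: k => [|k IH]; first by rewrite !expr0 mulr1 mul1r.
  apply: (le_trans IH); rewrite exprS (mulrC 2) -mulrA ler_wpM2l ?exprn_ge0//.
  by rewrite exprSr mulrA.
apply/eqP; rewrite -subr_eq0 -normr_eq0 eq_le normr_ge0 andbT -/(D a).
apply/ler_addgt0Pl => e e0; rewrite addr0.
have a4 : 0 <= a ^+ 4 / 4 by rewrite divr_ge0// (exprM _ 2 2) sqr_ge0.
have := archi_boundP (divr_ge0 a4 (ltW e0)); set k := Num.bound _ => hk.
apply: (le_trans (Dk k)); rewrite ler_pdivrMr ?exprn_gt0//.
rewrite -ler_pdivrMl// mulrC (le_trans (ltW hk))// -natrX ler_nat.
exact: ltnW (ltn_expl _ _).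
Qed.

(** With an independent copy y of x, the squared modulus is E cos (z tau (x^2 - y^2)). A rotation by
    pi/4 makes x^2 - y^2 a product 2 x y up to sign, and integrating y out leaves E exp (- 2 (z
    tau)^2 x^2). *)
Lemma cfsqr_chi2 (tau z : R) :
  cfsqr g (fun x => tau * (x ^+ 2 - 1)) z = (Num.sqrt (1 + 4 * (z * tau) ^+ 2))^-1.
Proof.
pose h (x : R) := z * (tau * (x ^+ 2 - 1)).
have mh : measurable_fun [set: R] h.
  apply: measurable_funM => //; apply: measurable_funM => //.
  by apply: measurable_funB => //; exact: measurable_funX.
have iC := intg_cos g mh; have iS := intg_sin g mh.
rewrite /cfsqr -/h !expr2 -(Ex_prodM iC iC) -(Ex_prodM iS iS).
rewrite -ExD; [|exact: (intg_prodM iC iC)|exact: (intg_prodM iS iS)].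
have mf : measurable_fun [set: R * R] (fun w : R * R => 2 * (z * tau) * w.1 * w.2).
  by apply: measurable_funM => //; exact: measurable_funM.
have ic := intg_cos (pprod g g) mf.
have := gauss_rotation_Ex cc c0 (intg_measurable ic) => /=.
have -> : (fun w : R * R => cos (2 * (z * tau) * (c * w.1 + c * w.2) * (c * w.2 - c * w.1))) =
    (fun w => cos (h w.1) * cos (h w.2) + sin (h w.1) * sin (h w.2)).
  apply/funext => w; rewrite -cosB -cosN; congr cos.
  have -> : - (2 * (z * tau) * (c * w.1 + c * w.2) * (c * w.2 - c * w.1)) =
    - (2 * c ^+ 2 * (z * tau) * (w.2 ^+ 2 - w.1 ^+ 2)) by ring.
  by rewrite c2 /h; field.
move=> ->; rewrite Ex_prod//.
have -> : (fun x : R => Ex g (fun y => cos (2 * (z * tau) * x * y))) =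
    (fun x => expR (- ((2 * (z * tau) ^+ 2) * x ^+ 2))).
  by apply/funext => x; rewrite gauss_cos; congr expR; field.
have r0 : 0 < 1 + 4 * (z * tau) ^+ 2 by have := sqr_ge0 (z * tau); lra.
by apply: (gauss_exp_sqr _ _).2; rewrite ?sqrtr_gt0// sqr_sqrtr ?ltW//; ring.
Qed.

Definition gquad K (tau : 'I_K -> R) (t : K.-tuple R) : R :=
  \sum_(k < K) tau k * (tnth t k ^+ 2 - 1).

Lemma measurable_gquad K (tau : 'I_K -> R) : measurable_fun [set: K.-tuple R] (gquad tau).
Proof.
apply: measurable_sum => k; apply: measurable_funM => //.
by apply: measurable_funB => //; apply: measurable_funX; exact: measurable_tnth.
Qed.

Lemma gquad_cons K (tau : 'I_K.+1 -> R) x t : gquad tau (mcons (x, t)) =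
  tau ord0 * (x ^+ 2 - 1) + gquad (tau \o lift ord0) t.
Proof.
rewrite /gquad big_ord_recl; congr (_ * (_ ^+ 2 - 1) + _).
by apply: eq_bigr => k _; rewrite /mcons tnthS.
Qed.

(** The exact value is a product over k; (1 + A) (1 + B) >= 1 + A + B replaces it by a bound that
    depends on the sum of squares alone, whatever K is. *)
Lemma cfsqr_gquad K (tau : 'I_K -> R) z :
  cfsqr (pw g K) (gquad tau) z <= (Num.sqrt (1 + 4 * z ^+ 2 * \sum_k tau k ^+ 2))^-1.
Proof.
elim: K tau => [|K IH] tau.
  rewrite big_ord0 mulr0 addr0 sqrtr1 invr1 /cfsqr.
  have e (t : 0.-tuple R) : gquad tau t = 0 by rewrite /gquad big_ord0.
  under [X in Ex _ X ^+ 2 + _]funext do rewrite e mulr0.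
  under [X in _ + Ex _ X ^+ 2]funext do rewrite e mulr0.
  by rewrite !Ex_cst cos0 sin0; lra.
have mq := measurable_gquad tau.
have -> : cfsqr (pw g K.+1) (gquad tau) z = cfsqr (pprod g (pw g K))
    (fun w => tau ord0 * (w.1 ^+ 2 - 1) + gquad (tau \o lift ord0) w.2) z.
  rewrite /cfsqr; congr (_ ^+ 2 + _ ^+ 2); rewrite Ex_pwS.
  - by congr Ex; apply/funext => -[x t]; rewrite /= gquad_cons.
  - by apply: (intg_measurable (intg_cos (pw g K.+1) _)); exact: measurable_funM.
  - by congr Ex; apply/funext => -[x t]; rewrite /= gquad_cons.
  - by apply: (intg_measurable (intg_sin (pw g K.+1) _)); exact: measurable_funM.
rewrite (@cfsqr_pprod _ _ _ _ g (pw g K) (fun x => tau ord0 * (x ^+ 2 - 1))); last exact: measurable_gquad.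
  rewrite cfsqr_chi2 big_ord_recl.
  set A := tau ord0; set S := \sum_(k < K) tau (lift ord0 k) ^+ 2.
  have S0 : 0 <= S by apply: sumr_ge0 => k _; exact: sqr_ge0.
  have z2 := sqr_ge0 z; have a2 := sqr_ge0 A.
  have pA : 0 < 1 + 4 * (z * A) ^+ 2 by have := sqr_ge0 (z * A); lra.
  have pS : 0 < 1 + 4 * z ^+ 2 * S by have := mulr_ge0 z2 S0; lra.
  apply: (le_trans (ler_wpM2l _ (IH _))); first by rewrite invr_ge0.
  rewrite -invfM -sqrtrM ?(ltW pA)// lef_pV2 ?posrE ?sqrtr_gt0 ?mulr_gt0//; last first.
    by have := mulr_ge0 z2 (addr_ge0 a2 S0); lra.
  apply: ler_wsqrtr.
  have := mulr_ge0 (sqr_ge0 (z * A)) (mulr_ge0 z2 S0).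
  rewrite (_ : \sum_k (tau \o lift ord0) k ^+ 2 = S)//.
  by rewrite exprMn; nra.
by apply: measurable_funM => //; apply: measurable_funB => //; exact: measurable_funX.
Qed.
End CharacteristicFunction.

Lemma Ex_swap d1 d2 (T1 : measurableType d1) (T2 : measurableType d2)
    (R : realType) (P1 : probability T1 R) (P2 : probability T2 R) (f : T1 * T2 -> R) :
  measurable_fun [set: T1 * T2] f ->
  Ex (pprod P1 P2) f = Ex (pprod P2 P1) (fun z => f (z.2, z.1)).
Proof.
move=> mf; have mfE : measurable_fun [set: T1 * T2] (EFin \o f) by exact/measurable_EFinP.
have mp := measurable_funepos mfE; have mn := measurable_funeneg mfE.
rewrite /Ex /Rintegral integralE [in RHS]integralE (swap_pprod _ _ mp)// (swap_pprod _ _ mn)//.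
by congr (fine (_ - _)); apply: eq_integral => z _; rewrite ?funeposE ?funenegE.
Qed.

Lemma measurable_inv_ge0 d (T : measurableType d) (R : realType) (f : T -> R) :
  measurable_fun [set: T] f -> (forall x, 0 <= f x) -> measurable_fun [set: T] (fun x => (f x)^-1).
Proof.
move=> mf f0; under eq_fun do rewrite -powR_inv1//.
exact: (measurableT_comp (@measurable_powR R (-1))).
Qed.

Section AntiConcentration.
Context (R : realType).
Local Notation g := (gauss R).
Local Notation leb := (@lebesgue_measure R).

Lemma integral_inv_sqrt (e : R) : 0 < e ->
  (\int[leb]_(x in `[0%R, 1%R]%classic) ((Num.sqrt (x + e))^-1)%:E <= 2%:E)%E.
Proof.
move=> e0.
have dF (y : R) : 0 <= y -> is_derive y 1 (fun x => 2 * Num.sqrt (x + e) : R) (Num.sqrt (y + e))^-1.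
  move=> y0; have ye : 0 < y + e by rewrite ltr_wpDl.
  have h : is_derive (y + e) 1 Num.sqrt (2 * Num.sqrt (y + e))^-1 := is_derive1_sqrt ye.
  have h2 : is_derive y 1 (fun x : R => x + e) 1.
    by apply: is_derive_eq; rewrite addr0.
  have := is_derive1_comp (h : is_derive ((fun x => x + e) y) 1 _ _) h2.
  move=> h3; have h4 := @is_deriveZ R R R (Num.sqrt \o (fun x => x + e)) 2 y 1 _ h3.
  apply: is_derive_eq h4 _.
  have sn : Num.sqrt (y + e) != 0 by rewrite gt_eqF// sqrtr_gt0.
  by rewrite /GRing.scale /= mulr1; field.
have cF (y : R) : 0 <= y -> {for y, continuous (fun x => 2 * Num.sqrt (x + e) : R)}.
  move=> y0; apply: differentiable_continuous; apply/derivable1_diffP.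
  by have [] := dF y y0.
have cf (y : R) : 0 <= y -> {for y, continuous (fun x => (Num.sqrt (x + e))^-1 : R)}.
  move=> y0; have ye : 0 < y + e by rewrite ltr_wpDl.
  apply: cvgV; first by rewrite gt_eqF// sqrtr_gt0.
  apply: (@continuous_comp _ _ _ (fun x => x + e) Num.sqrt).
    by apply: cvgD; [exact: cvg_id|exact: cvg_cst].
  exact: sqrt_continuous.
rewrite (continuous_FTC2 (F := fun x => 2 * Num.sqrt (x + e) : R)) ?ltr01//.
- rewrite add0r -EFinB lee_fin.
  have := sqrtr_ge0 e; have h : Num.sqrt (1 + e) <= 1 + Num.sqrt e.
    rewrite -[leRHS]ger0_norm ?addr_ge0 ?sqrtr_ge0// -sqrtr_sqr ler_wsqrtr//.
    rewrite sqrrD expr1n mul1r sqr_sqrtr ?(ltW e0)//.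
    by have := sqrtr_ge0 e; rewrite mulr2n; lra.
  by lra.
- apply/continuous_within_itvP; rewrite ?ltr01//; split.
  + by move=> x; rewrite in_itv/= => /andP[x0 _]; exact: cf (ltW x0).
  + exact: cvg_at_right_filter (cf 0 (lexx 0)).
  + exact: cvg_at_left_filter (cf 1 ler01).
- split.
  + by move=> x; rewrite in_itv/= => /andP[x0 _]; have [] := dF x (ltW x0).
  + exact: cvg_at_right_filter (cF 0 (lexx 0)).
  + exact: cvg_at_left_filter (cF 1 ler01).
- move=> x; rewrite in_itv/= => /andP[x0 _]; rewrite derive1E.
  by have [_ ->] := dF x (ltW x0).
Qed.

Lemma gpdf_le1 (x : R) : gpdf x <= 1.
Proof.
rewrite gpdfE -[leRHS]mulr1; apply: ler_pM; rewrite ?expR_ge0//.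
- exact: normal_peak_ge0.
- rewrite /normal_peak invf_le1; last by rewrite sqrtr_gt0 mulrn_wgt0// mulr_gt0 ?pi_gt0// exprn_gt0.
  rewrite -[leLHS]sqrtr1 ler_wsqrtr// expr1n mul1r.
  by have := @pi_ge2 R; rewrite mulr2n; lra.
- by rewrite expR_le1 oppr_le0 divr_ge0 ?sqr_ge0.
Qed.

(** The integrand is of order (b |z|)^(-1/2). On |z| <= 1 it is compared with (|z| + 1/b)^(-1/2), of
    integral at most 2 on each side; beyond, the latter is at most 1. This gives 2 (1 + 2 + 2) /
    sqrt b. *)
Lemma Ex_gauss_decay (b : R) : 0 < b ->
  Ex g (fun z => Num.sqrt (Num.sqrt (1 + b ^+ 2 * z ^+ 2))^-1) <= 10 / Num.sqrt b.
Proof.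
move=> b0; have e0 : 0 < b^-1 by rewrite invr_gt0.
pose k (z : R) : R := \1_(`[0, 1]%classic) z * (Num.sqrt (z + b^-1))^-1.
have k0 z : 0 <= k z by rewrite mulr_ge0.
have ms : measurable_fun [set: R] (Num.sqrt : R -> R).
  by apply: continuous_measurable_fun; exact: sqrt_continuous.
have mk : measurable_fun [set: R] k.
  apply: measurable_funM; first exact: measurable_indic.
  by apply: measurable_inv_ge0 => //; apply: measurableT_comp => //; exact: measurable_funD.
have kE : (\int[g]_x (k x)%:E <= 2%:E)%E.
  rewrite ge0_integral_gauss//; last first.
    by apply/measurable_EFinP.
  apply: le_trans (integral_inv_sqrt e0).
  have -> : (\int[leb]_(x in `[0%R, 1%R]%classic) ((Num.sqrt (x + b^-1))^-1)%:E = \int[leb]_x (k x)%:E)%E.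
    rewrite [LHS]integral_mkcond; apply: eq_integral => x _.
    by rewrite patchE /k indicE mem_setE; case: ifP => _; rewrite ?mul0r ?mul1r.
  apply: ge0_le_integral => //.
  - by move=> x _; rewrite mule_ge0// lee_fin; [exact: k0|exact: gpdf_ge0].
  - apply: emeasurable_funM; first by apply/measurable_EFinP.
    by apply/measurable_EFinP; exact: measurable_gpdf.
  - by apply/measurable_EFinP.
  - by move=> x _; rewrite -EFinM lee_fin ler_piMr ?gpdf_le1//; exact: k0.
have ik : intg g k by apply/intg_ge0P => //; apply: le_lt_trans kE _; rewrite ltry.
have Ek : Ex g k <= 2 by exact: Ex_le_nn.
have mN : measurable_fun [set: R] (fun x : R => - x) by exact: measurable_funN.
have ikN : intg g (fun x => k (- x)).
  apply/intg_ge0P => //; first exact: measurableT_comp.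
  by rewrite (gauss_neg (f := fun x => (k x)%:E))//; [apply: le_lt_trans kE _; rewrite ltry|apply/measurable_EFinP].
have sb0 : 0 < Num.sqrt b by rewrite sqrtr_gt0.
have ib : intg g (fun x => 2 / Num.sqrt b * (1 + (k x + k (- x)))).
  by apply: intgZ; apply: intgD; [exact: intg_cst|exact: intgD].
have main x : Num.sqrt (Num.sqrt (1 + b ^+ 2 * x ^+ 2))^-1 <= 2 / Num.sqrt b * (1 + (k x + k (- x))).
  have pos y : 0 <= y -> Num.sqrt (Num.sqrt (1 + b ^+ 2 * y ^+ 2))^-1 <= 2 / Num.sqrt b * (1 + k y).
    move=> y0.
    have A : Num.sqrt (Num.sqrt (1 + b ^+ 2 * y ^+ 2))^-1 <= 2 / Num.sqrt b * (Num.sqrt (y + b^-1))^-1.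
      have yb : 0 < y + b^-1 by rewrite ltr_wpDl.
      have h0 : 0 < b / 4 * (y + b^-1) by rewrite mulr_gt0// divr_gt0.
      have h1 : b / 4 * (y + b^-1) <= Num.sqrt (1 + b ^+ 2 * y ^+ 2).
        rewrite -[leLHS]ger0_norm ?(ltW h0)// -sqrtr_sqr ler_wsqrtr//.
        have -> : b / 4 * (y + b^-1) = (1 + b * y) / 4 by field; rewrite gt_eqF.
        have := mulr_ge0 (ltW b0) y0; rewrite -exprMn; set w := b * y => w0.
        by have := sqr_ge0 w; have := sqr_ge0 (w - 1); rewrite !expr2; lra.
      have -> : 2 / Num.sqrt b * (Num.sqrt (y + b^-1))^-1 = Num.sqrt (b / 4 * (y + b^-1))^-1.
        rewrite sqrtrV ?(ltW h0)// sqrtrM ?divr_ge0 ?(ltW b0)// sqrtrM ?(ltW b0)// invfM invfM.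
        rewrite sqrtrV// invrK (_ : 4 = 2 ^+ 2) ?sqrtr_sqr ?ger0_norm//; first by rewrite [_ * 2]mulrC.
        by ring.
      by rewrite ler_wsqrtr// lef_pV2// posrE// (lt_le_trans h0).
    have [y1|y1] := leP y 1.
      apply: (le_trans A); rewrite ler_wpM2l ?divr_ge0//.
      by rewrite /k indicE mem_set ?mul1r ?lerDr//= in_itv/= y0 y1.
    apply: (le_trans A); rewrite ler_wpM2l ?divr_ge0//.
    rewrite -[leLHS]addr0 lerD//.
    rewrite invf_le1 ?sqrtr_gt0 ?ltr_wpDl// -[leLHS]sqrtr1 ler_wsqrtr//.
    by have := ltW e0; lra.
  have c0 : 0 <= 2 / Num.sqrt b by rewrite divr_ge0// ltW.
  have [x0|x0] := leP 0 x.
    apply: (le_trans (pos x x0)); rewrite ler_wpM2l// lerD2l lerDl//.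
  have := pos (- x); rewrite oppr_ge0 sqrrN => /(_ (ltW x0)) h; apply: (le_trans h).
  by rewrite ler_wpM2l// lerD2l lerDr.
apply: (@le_trans _ _ (Ex g (fun x => 2 / Num.sqrt b * (1 + (k x + k (- x)))))).
  apply: Ex_le => //; apply: (intg_le _ _ ib); last first.
    by move=> x; rewrite ger0_norm.
  apply: measurableT_comp => //; apply: measurable_inv_ge0 => //; apply: measurableT_comp => //.
  by apply: measurable_funD => //; apply: measurable_funM => //; exact: measurable_funX.
rewrite ExZ; last by apply: intgD; [exact: intg_cst|exact: intgD].
rewrite ExD; [|exact: intg_cst|exact: intgD]; rewrite ExD// Ex_cst gauss_neg_Ex//.
rewrite (_ : 10 / Num.sqrt b = 2 / Num.sqrt b * 5); last by field; rewrite gt_eqF.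
by rewrite ler_wpM2l ?divr_ge0 ?(ltW sb0)//; lra.
Qed.

(* Esseen's argument: [1_{|x| <= d}] is at most [2 exp(-x^2/2d^2)], which is
   the average of [2 cos(Zx/d)] over a standard Gaussian [Z]. *)
Lemma anticoncentration d (T : measurableType d) (P : probability T R) (f : T -> R) (V e t : R) :
  measurable_fun [set: T] f -> 0 < V -> 0 < e ->
  (forall z, cfsqr P f z <= (Num.sqrt (1 + 4 * z ^+ 2 * V))^-1) ->
  Pr P [set x | `|f x - t| <= e] <= 20 * Num.sqrt (e / Num.sqrt V).
Proof.
move=> mf V0 e0 hf.
have mft : measurable_fun [set: T] (fun x => f x - t) by exact: measurable_funB.
have mA : measurable [set x | `|f x - t| <= e].
  have -> : [set x | `|f x - t| <= e] = ~` [set x | e < `|f x - t|].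
    by apply/seteqP; split => x /=; rewrite leNgt => /negP.
  by apply: measurableC; exact: measurable_norm_gt.
have mq : measurable_fun [set: T * R] (fun w : T * R => w.2 / e * (f w.1 - t)).
  apply: measurable_funM; first exact: measurable_funM.
  exact: (measurableT_comp mft).
have ic := intg_cos (pprod P g) mq.
have step1 : Pr P [set x | `|f x - t| <= e] <= 2 * Ex (pprod P g) (fun w => cos (w.2 / e * (f w.1 - t))).
  rewrite (Ex_prod ic) -ExZ; last exact: (intg_Ex ic).
  have hE x : Ex g (fun y => cos (y / e * (f x - t))) = expR (- (((f x - t) / e) ^+ 2 / 2)).
    rewrite -gauss_cos; congr Ex; apply/funext => y; congr cos.
    by field; rewrite gt_eqF.
  apply: Pr_le_Ex => //; [by apply: intgZ; exact: (intg_Ex ic)|..].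
    by move=> x; rewrite hE mulr_ge0// expR_ge0.
  move=> x /= hx; rewrite hE.
  have h : 1 - ((f x - t) / e) ^+ 2 / 2 <= expR (- (((f x - t) / e) ^+ 2 / 2)).
    exact: expR_ge1Dx.
  have : ((f x - t) / e) ^+ 2 <= 1.
    rewrite -real_normK ?num_real// expr_le1// normrM normfV (ger0_norm (ltW e0)).
    by rewrite ler_pdivrMr// mul1r.
  by lra.
apply: (le_trans step1).
have -> : 20 * Num.sqrt (e / Num.sqrt V) = 2 * (10 * Num.sqrt (e / Num.sqrt V)) by ring.
rewrite ler_wpM2l// Ex_swap; last exact: intg_measurable ic.
(* Chosen so that b^2 z^2 = 4 (z / e)^2 V, the quantity in the bound on the characteristic function
   at z / e. *)
pose b : R := 2 * Num.sqrt V / e.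
have sV : 0 < Num.sqrt V by rewrite sqrtr_gt0.
have b0 : 0 < b by rewrite divr_gt0// mulr_gt0.
have hb := Ex_gauss_decay b0.
have ms : measurable_fun [set: R] (Num.sqrt : R -> R).
  by apply: continuous_measurable_fun; exact: sqrt_continuous.
have id : intg g (fun z => Num.sqrt (Num.sqrt (1 + b ^+ 2 * z ^+ 2))^-1).
  apply: (@intg_bdd _ _ _ _ _ 1).
    apply: measurableT_comp => //; apply: measurable_inv_ge0 => //; apply: measurableT_comp => //.
    by apply: measurable_funD => //; apply: measurable_funM => //; exact: measurable_funX.
  move=> z; rewrite ger0_norm ?sqrtr_ge0// -[leRHS]sqrtr1 ler_wsqrtr// invf_le1; last first.
    by rewrite sqrtr_gt0 ltr_wpDr// mulr_ge0 ?sqr_ge0.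
  by rewrite -[leLHS]sqrtr1 ler_wsqrtr// lerDl mulr_ge0 ?sqr_ge0.
have mqs : measurable_fun [set: R * T] (fun w : R * T => w.1 / e * (f w.2 - t)).
  apply: measurable_funM; first exact: measurable_funM.
  exact: (measurableT_comp mft).
have ics := intg_cos (pprod g P) mqs.
rewrite (Ex_prod ics).
have h1 : Ex g (fun z => Ex P (fun x => cos (z / e * (f x - t)))) <=
    Ex g (fun z => Num.sqrt (Num.sqrt (1 + b ^+ 2 * z ^+ 2))^-1).
  apply: Ex_le => //; first exact: (intg_Ex ics).
  move=> z; apply: (le_trans (Ex_cos_shift_le _ _ _ mf)); apply: ler_wsqrtr.
  apply: (le_trans (hf _)); rewrite le_eqVlt; apply/orP; left; apply/eqP; congr ((Num.sqrt (1 + _))^-1).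
  rewrite /b; have := sqr_sqrtr (ltW V0); set s := Num.sqrt V => <-.
  by field; rewrite gt_eqF.
apply: (le_trans h1); apply: (le_trans hb); rewrite ler_wpM2l//.
rewrite -sqrtrV ?(ltW b0)// ler_wsqrtr// /b.
have -> : (2 * Num.sqrt V / e)^-1 = e / Num.sqrt V / 2 by field; rewrite !gt_eqF.
by rewrite ler_pdivrMr// ler_peMr ?divr_ge0 ?(ltW e0)// ler1n.
Qed.
End AntiConcentration.

(** * Gaussian linear forms *)

Lemma integral_cste d (T : measurableType d) (R : realType) (P : probability T R) (c : \bar R) :
  (\int[P]_x c = c)%E.
Proof. by rewrite integral_cst// -[RHS]mule1; congr (_ * _)%E; exact: (@probability_setT _ _ _ P). Qed.

Section GaussianLinear.
Context (R : realType).
Local Notation g := (gauss R).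
Local Open Scope ereal_scope.

Lemma ge0_gauss_scale (a : R) (f : R -> \bar R) : measurable_fun [set: R] f ->
  (forall x, 0 <= f x) -> \int[g]_x f (a * x)%R = \int[g]_x f (`|a| * x)%R.
Proof.
move=> mf f0; have [a0|a0] := leP 0%R a; first by rewrite ger0_norm.
rewrite ltr0_norm// -(gauss_neg (f := fun x => f (- a * x)%R))//; last first.
  by apply: measurableT_comp => //; exact: measurable_funM.
by apply: eq_integral => x _; rewrite mulrNN.
Qed.

Let lin2_pos (a b : R) (f : R -> \bar R) : measurable_fun [set: R] f ->
  (forall x, 0 <= f x) -> (0 < a)%R ->
  \int[pprod g g]_z f (a * z.1 + b * z.2)%R = \int[g]_x f (Num.sqrt (a ^+ 2 + b ^+ 2) * x)%R.
Proof.
move=> mf f0 a0; set r := Num.sqrt _.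
have r2 : (r ^+ 2 = a ^+ 2 + b ^+ 2)%R by rewrite sqr_sqrtr// addr_ge0 ?sqr_ge0.
have r0 : (0 < r)%R by rewrite sqrtr_gt0 ltr_wpDr ?sqr_ge0// exprn_gt0.
have mF : measurable_fun [set: R * R] (fun z : R * R => f (r * z.1)%R).
  by apply: measurableT_comp => //; exact: measurable_funM.
have cs : ((a / r) ^+ 2 + (b / r) ^+ 2 = 1)%R.
  by rewrite !expr_div_n -mulrDl -r2 divff// expf_neq0// gt_eqF.
have := gauss_rotation cs (divr_gt0 a0 r0) mF (fun z => f0 _).
rewrite [X in _ = X -> _](tonelli _ _ mF)//.
under [X in _ = X -> _]eq_integral => x _.
  rewrite (_ : \int[g]_y _ = f (r * x)%R); last first.
    exact: (integral_cste g (f (r * x)%R)).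
  over.
by rewrite /= => <-; apply: eq_integral => z _; congr f; field; rewrite gt_eqF.
Qed.

(** For a > 0 this is the rotation with cosine a / r; a negative a is reflected, and a = 0 only
    scales. *)
Lemma gauss_lin2 (a b : R) (f : R -> \bar R) : measurable_fun [set: R] f ->
  (forall x, 0 <= f x) ->
  \int[pprod g g]_z f (a * z.1 + b * z.2)%R = \int[g]_x f (Num.sqrt (a ^+ 2 + b ^+ 2) * x)%R.
Proof.
move=> mf f0; have mF (a' b' : R) : measurable_fun [set: R * R] (fun z : R * R => f (a' * z.1 + b' * z.2)%R).
  by apply: measurableT_comp => //; apply: measurable_funD; exact: measurable_funM.
have [a0|a0|a0] := ltgtP 0%R a; first exact: lin2_pos.
- rewrite -sqrrN -lin2_pos ?oppr_gt0// (tonelli2 _ _ (mF a b))// (tonelli2 _ _ (mF (- a)%R b))//.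
  apply: eq_integral => y _; rewrite -(gauss_neg (f := fun x => f (a * x + b * y)%R))//.
    by apply: eq_integral => x _; rewrite mulrN mulNr.
  by apply: measurableT_comp => //; apply: measurable_funD => //; exact: measurable_funM.
- rewrite -a0 expr0n/= add0r sqrtr_sqr -ge0_gauss_scale// (tonelli2 _ _ (mF 0%R b))//.
  apply: eq_integral => y _; under eq_integral do rewrite mul0r add0r.
  exact: (integral_cste g (f (b * y)%R)).
Qed.

Definition lform K (al : 'I_K -> R) (t : K.-tuple R) : R := (\sum_k al k * tnth t k)%R.

Lemma measurable_lform K (al : 'I_K -> R) : measurable_fun [set: K.-tuple R] (lform al).
Proof. by apply: measurable_sum => k; apply: measurable_funM => //; exact: measurable_tnth. Qed.

Lemma lform_cons K (al : 'I_K.+1 -> R) x t :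
  lform al (mcons (x, t)) = (al ord0 * x + lform (al \o lift ord0) t)%R.
Proof.
rewrite /lform big_ord_recl; congr (_ * _ + _)%R.
by apply: eq_bigr => k _; rewrite /mcons tnthS.
Qed.

Lemma ge0_gauss_lform K (al : 'I_K -> R) (f : R -> \bar R) : measurable_fun [set: R] f ->
  (forall x, 0 <= f x) ->
  \int[pw g K]_t f (lform al t) = \int[g]_x f (Num.sqrt (\sum_k al k ^+ 2) * x)%R.
Proof.
move=> + f0; elim: K al f f0 => [|K IH] al f f0 mf.
  rewrite big_ord0 sqrtr0; transitivity (\int[pw g 0]_t f 0%R).
    by apply: eq_integral => t _; rewrite /lform big_ord0.
  under [RHS]eq_integral do rewrite mul0r.
  by rewrite [LHS]integral_cste [RHS]integral_cste.
have mfl (x : R) : measurable_fun [set: K.-tuple R] (fun t => f (al ord0 * x + lform (al \o lift ord0) t)%R).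
  by apply: measurableT_comp => //; apply: measurable_funD => //; exact: measurable_lform.
rewrite ge0_integral_pwS//; last by apply: measurableT_comp => //; exact: measurable_lform.
rewrite big_ord_recl; set s := Num.sqrt (\sum_(i < K) al (lift ord0 i) ^+ 2)%R.
transitivity (\int[g]_x \int[g]_y f (al ord0 * x + s * y)%R).
  apply: eq_integral => x _; under eq_integral do rewrite lform_cons.
  rewrite (IH _ (fun w => f (al ord0 * x + w)%R))//.
  by apply: measurableT_comp => //; exact: measurable_funD.
transitivity (\int[pprod g g]_z f (al ord0 * z.1 + s * z.2)%R).
  rewrite tonelli//; apply: measurableT_comp => //.
  by apply: measurable_funD; exact: measurable_funM.
rewrite gauss_lin2// /s sqr_sqrtr//; first by apply: sumr_ge0 => i _; exact: sqr_ge0.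
Qed.

Definition scalet K (a : R) (t : K.-tuple R) : K.-tuple R := [tuple a * tnth t k | k < K]%R.

Lemma measurable_scalet K (a : R) : measurable_fun [set: K.-tuple R] (@scalet K a).
Proof.
apply/measurable_fun_tnthP => k.
have -> : (fun t : K.-tuple R => tnth t k) \o scalet a = (fun t => a * tnth t k)%R.
  by apply/funext => t /=; rewrite tnth_mktuple.
by apply: measurable_funM => //; exact: measurable_tnth.
Qed.

Lemma measurable_lincomb K (a b : R) :
  measurable_fun [set: K.-tuple R * K.-tuple R] (fun z => addt (scalet a z.1) (scalet b z.2)).
Proof.
have h : measurable_fun [set: K.-tuple R * K.-tuple R] (fun z => (scalet a z.1, scalet b z.2)).
  by apply: measurable_fun_pair; apply: (measurableT_comp (@measurable_scalet K _)).
exact: (measurableT_comp (@measurable_addt R K) h).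
Qed.

(** Stability of the Gaussian law for vectors, by induction on the dimension: the tails are combined
    at fixed first coordinates, then the first coordinates by [gauss_lin2]. The work lies in
    reordering the integrals. *)
Lemma ge0_gauss_lincomb K (a b : R) (f : K.-tuple R -> \bar R) :
  measurable_fun [set: K.-tuple R] f -> (forall x, 0 <= f x) ->
  \int[pw g K]_x \int[pw g K]_y f (addt (scalet a x) (scalet b y)) =
  \int[pw g K]_x f (scalet (Num.sqrt (a ^+ 2 + b ^+ 2)) x).
Proof.
set r := Num.sqrt _; elim: K f => [|K IH] f mf f0.
  transitivity (\int[pw g 0]_x \int[pw g 0]_y f [tuple]).
    by apply: eq_integral => x _; apply: eq_integral => y _; congr f; rewrite [LHS]tuple0.
  transitivity (\int[pw g 0]_x f [tuple]); last by apply: eq_integral => x _; congr f; rewrite [RHS]tuple0.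
  by apply: eq_integral => x _; exact: (integral_cste (pw g 0) (f [tuple])).
have mcC (x y : R) (s t : K.-tuple R) : addt (scalet a (mcons (x, s))) (scalet b (mcons (y, t))) =
    mcons (a * x + b * y, addt (scalet a s) (scalet b t))%R.
  apply: eq_from_tnth => i; rewrite !tnth_mktuple.
  case: (unliftP ord0 i) => [j ->|->]; last by [].
  by rewrite /mcons !tnthS !tnth_mktuple.
have mcS (x : R) (s : K.-tuple R) : scalet r (mcons (x, s)) = mcons (r * x, scalet r s)%R.
  apply: eq_from_tnth => i; rewrite !tnth_mktuple.
  case: (unliftP ord0 i) => [j ->|->]; last by [].
  by rewrite /mcons !tnthS !tnth_mktuple.
have mL := measurable_lincomb (K := K.+1) a b; have mL' := measurable_lincomb (K := K) a b.
have mc := @measurable_mcons _ R K.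
transitivity (\int[g]_x \int[pw g K]_s \int[g]_y \int[pw g K]_t
    f (mcons (a * x + b * y, addt (scalet a s) (scalet b t))%R)).
  rewrite ge0_integral_pwS; first last.
  - by move=> s; apply: integral_ge0.
  - apply: (measurable_fun_fubini_tonelli_F (fun z => f (addt (scalet a z.1) (scalet b z.2)))) => //.
    exact: (measurableT_comp mf mL).
  apply: eq_integral => x _; apply: eq_integral => s _; rewrite ge0_integral_pwS//.
    by apply: eq_integral => y _; apply: eq_integral => t _; rewrite mcC.
  have h : measurable_fun [set: K.+1.-tuple R] (fun t => (mcons (x, s), t)) by exact: measurable_fun_pair.
  exact: (measurableT_comp mf (measurableT_comp mL h)).
pose Phi (w : R) := \int[pw g K]_s f (mcons (w, scalet r s)).
have IHw (w : R) : \int[pw g K]_s \int[pw g K]_t f (mcons (w, addt (scalet a s) (scalet b t))) = Phi w.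
  rewrite (IH (fun t => f (mcons (w, t))))//.
  by apply: (measurableT_comp mf); apply: (measurableT_comp mc); exact: measurable_fun_pair.
transitivity (\int[g]_x \int[g]_y Phi (a * x + b * y)%R).
  apply: eq_integral => x _.
  pose G (z : K.-tuple R * R) := \int[pw g K]_t f (mcons (a * x + b * z.2, addt (scalet a z.1) (scalet b t))%R).
  have mG : measurable_fun [set: K.-tuple R * R] G.
    apply: (measurable_fun_fubini_tonelli_F (fun zt : (K.-tuple R * R) * K.-tuple R =>
      f (mcons (a * x + b * zt.1.2, addt (scalet a zt.1.1) (scalet b zt.2))%R))) => //.
    apply: (measurableT_comp mf); apply: (measurableT_comp mc); apply: measurable_fun_pair.
      apply: measurable_funD => //; apply: measurable_funM => //.
      exact: (measurableT_comp measurable_snd measurable_fst).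
    have h : measurable_fun [set: (K.-tuple R * R) * K.-tuple R] (fun z => (z.1.1, z.2)).
      by apply: measurable_fun_pair => //; exact: (measurableT_comp measurable_fst measurable_fst).
    exact: (measurableT_comp mL' h).
  have G0 z : 0 <= G z by exact: integral_ge0.
  transitivity (\int[pprod (pw g K) g]_z G z); first exact/esym/(tonelli _ _ mG G0).
  transitivity (\int[g]_y \int[pw g K]_s G (s, y)); first exact: (tonelli2 _ _ mG G0).
  by apply: eq_integral => y _; rewrite /G /=; exact: IHw.
have mfr : measurable_fun [set: R * K.-tuple R] (fun z => f (mcons (z.1, scalet r z.2))).
  apply: (measurableT_comp mf); apply: (measurableT_comp mc); apply: measurable_fun_pair => //.
  exact: (measurableT_comp (@measurable_scalet K r)).
have mPhi : measurable_fun [set: R] Phi.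
  exact: (measurable_fun_fubini_tonelli_F (fun z => f (mcons (z.1, scalet r z.2)))).
have Phi0 w : 0 <= Phi w by exact: integral_ge0.
transitivity (\int[pprod g g]_z Phi (a * z.1 + b * z.2)%R).
  apply/esym/(tonelli g g (f := fun z : R * R => Phi (a * z.1 + b * z.2)%R)) => //.
  by apply: (measurableT_comp mPhi); apply: measurable_funD; exact: measurable_funM.
rewrite gauss_lin2// ge0_integral_pwS//; last by apply: (measurableT_comp mf); exact: measurable_scalet.
by apply: eq_integral => x _; apply: eq_integral => s _; rewrite mcS.
Qed.

Lemma same_law_intg d (T : measurableType d) (P Q : probability T R) (f : T -> R) :
  same_law P Q -> measurable_fun [set: T] f -> intg P f -> intg Q f.
Proof.
move=> PQ mf /integrableP[m h]; apply/integrableP; split => //.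
by rewrite -PQ//; apply: measurableT_comp => //; exact/measurable_EFinP.
Qed.

Section Moments.
Variables (K : nat) (al : 'I_K -> R).
Let s2 : R := (\sum_k al k ^+ 2)%R.
Let s : R := Num.sqrt s2.
Let s2E : (s ^+ 2 = s2)%R.
Proof. by rewrite sqr_sqrtr// sumr_ge0// => k _; exact: sqr_ge0. Qed.
Let ms : measurable_fun [set: R] (fun x => s * x)%R.
Proof. exact: measurable_funM. Qed.

Let lform_law : same_law (law g ms) (law (pw g K) (measurable_lform al)).
Proof.
move=> f mf f0; transitivity (\int[g]_x f (s * x)%R); first exact: ge0_integral_law.
transitivity (\int[pw g K]_t f (lform al t)); first exact/esym/ge0_gauss_lform.
exact/esym/ge0_integral_law.
Qed.

Lemma intg_lform_exp n : (n <= 4)%N -> intg (pw g K) (fun t => lform al t ^+ n)%R.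
Proof.
move=> n4; have mX : measurable_fun [set: R] (fun x : R => x ^+ n)%R by exact: measurable_funX.
apply/(intg_law (pw g K) (measurable_lform al) mX).1.
apply: (same_law_intg lform_law mX); apply/(intg_law g ms mX).2.
rewrite (_ : _ \o _ = (fun x => s ^+ n * x ^+ n)%R).
  by apply: intgZ; exact: gauss_pow_intg.
by apply/funext => x /=; rewrite exprMn.
Qed.

Lemma Ex_lform_exp n : (n <= 4)%N ->
  Ex (pw g K) (fun t => lform al t ^+ n)%R = (s ^+ n * Ex g (fun x => x ^+ n))%R.
Proof.
move=> n4; have mX : measurable_fun [set: R] (fun x : R => x ^+ n)%R by exact: measurable_funX.
have := same_law_Ex lform_law mX; rewrite (Ex_law g ms mX) (Ex_law (pw g K) (measurable_lform al) mX).
rewrite /comp => <-; rewrite -ExZ; last exact: gauss_pow_intg.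
by congr Ex; apply/funext => x; rewrite exprMn.
Qed.

Lemma sq_lform : sq (pw g K) (lform al).
Proof. by split; [exact: measurable_lform|exact: (@intg_lform_exp 2)]. Qed.

Lemma Ex_lform : Ex (pw g K) (lform al) = 0%R.
Proof.
have := @Ex_lform_exp 1 isT.
under [X in Ex _ X = _ -> _]funext do rewrite expr1.
under [X in _ = (_ * Ex _ X)%R -> _]funext do rewrite expr1.
by rewrite gauss_m1 mulr0.
Qed.

Lemma Ex_lform2 : Ex (pw g K) (fun t => lform al t ^+ 2)%R = s2.
Proof. by rewrite (@Ex_lform_exp 2)// gauss_m2 mulr1 s2E. Qed.

Lemma Ex_lform4 : Ex (pw g K) (fun t => lform al t ^+ 4)%R = (3 * s2 ^+ 2)%R.
Proof. by rewrite (@Ex_lform_exp 4)// gauss_m4 (exprM _ 2 2) s2E mulrC. Qed.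
End Moments.
End GaussianLinear.

Section StateLaw.
Context (R : realType) (K : nat) (lam : 'I_K -> R).
Context d (T : measurableType d) (mu : probability T R) (c : R).
Local Notation V := (K.-tuple R).
Variables (F : T -> V) (mF : measurable_fun [set: T] F).
Local Notation bl := (bil lam).

(** The off-diagonal sum, written as the form at the total minus the diagonal, in which shape it is
    easily updated when a point is prepended. *)
Definition qsum n (t : n.-tuple T) : R :=
  bl [tuple \sum_i tnth (F (tnth t i)) k | k < K] [tuple \sum_i tnth (F (tnth t i)) k | k < K]
  - \sum_i bl (F (tnth t i)) (F (tnth t i)).

Definition state n (t : n.-tuple T) : R * V :=
  (c * qsum t, [tuple \sum_i tnth (F (tnth t i)) k | k < K]).

Lemma bil_suml n (t : 'I_n -> V) x :
  bl [tuple \sum_i tnth (t i) k | k < K] x = \sum_i bl (t i) x.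
Proof.
rewrite /bil exchange_big; apply: eq_bigr => k _.
by rewrite tnth_mktuple mulr_sumr mulr_suml.
Qed.

Lemma bil_sumr n (t : 'I_n -> V) x :
  bl x [tuple \sum_i tnth (t i) k | k < K] = \sum_i bl x (t i).
Proof. by rewrite bilC bil_suml; apply: eq_bigr => i _; rewrite bilC. Qed.

Lemma qsumE n (t : n.-tuple T) :
  qsum t = \sum_i \sum_(j | j != i) bl (F (tnth t i)) (F (tnth t j)).
Proof.
rewrite /qsum bil_suml -sumrB; apply: eq_bigr => i _.
by rewrite bil_sumr (bigD1 i)//= addrC addrK.
Qed.

Lemma state_cons n x (t : n.-tuple T) :
  state (mcons (x, t)) = step lam c (state t, F x).
Proof.
have e : [tuple \sum_i tnth (F (tnth (mcons (x, t)) i)) k | k < K] =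
    addt [tuple \sum_i tnth (F (tnth t i)) k | k < K] (F x).
  apply: eq_from_tnth => k; rewrite !tnth_mktuple big_ord_recl addrC; congr (_ + _).
  by apply: eq_bigr => i _; rewrite /mcons tnthS.
rewrite /state /step /= e; congr pair; rewrite /qsum e big_ord_recl.
have -> : \sum_(i < n) bl (F (tnth (mcons (x, t)) (lift ord0 i))) (F (tnth (mcons (x, t)) (lift ord0 i))) =
    \sum_i bl (F (tnth t i)) (F (tnth t i)).
  by apply: eq_bigr => i _; rewrite /mcons tnthS.
rewrite (_ : tnth (mcons (x, t)) ord0 = x)// bilDl !bilDr.
set s := [tuple _ | _ < _]; rewrite (bilC _ (F x) s); ring.
Qed.

Lemma measurable_state n : measurable_fun [set: n.-tuple T] (@state n).
Proof.
have ms k : measurable_fun [set: n.-tuple T] (fun t => \sum_i tnth (F (tnth t i)) k).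
  apply: measurable_sum => i.
  exact: (measurableT_comp (measurable_tnth k) (measurableT_comp mF (measurable_tnth i))).
have mS : measurable_fun [set: n.-tuple T] (fun t => [tuple \sum_i tnth (F (tnth t i)) k | k < K]).
  apply/measurable_fun_tnthP => k; rewrite (_ : _ \o _ = (fun t => \sum_i tnth (F (tnth t i)) k))//.
  by apply/funext => t /=; rewrite tnth_mktuple.
apply: measurable_fun_pair => //; apply: measurable_funM => //; apply: measurable_funB.
  exact: (measurableT_comp (measurable_bil lam) (measurable_fun_pair mS mS)).
apply: measurable_sum => i; have h := measurableT_comp mF (measurable_tnth (n := n) i).
exact: (measurableT_comp (measurable_bil lam) (measurable_fun_pair h h)).
Qed.

(** Prepending a point to the sample performs one [step] on its state, so the iterated laws of the
    replacement argument are laws of the statistic itself. *)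
Lemma iterlaw_state n :
  same_law (iterlaw lam c (law mu mF) n) (law (pw mu n) (@measurable_state n)).
Proof.
elim: n => [|n IH] f mf f0.
  rewrite ge0_integral_law// /iterlaw/= /state0 !integral_dirac//; last first.
    exact: (measurableT_comp mf (@measurable_state 0)).
  rewrite !diracT !mul1e; congr f; rewrite /state /qsum big_ord0 subr0; congr pair.
    rewrite /bil big1 ?mulr0// => k _; by rewrite !tnth_mktuple big_ord0 mulr0.
  by apply: eq_from_tnth => k; rewrite !tnth_mktuple big_ord0.
have mstep : measurable_fun [set: (R * V) * T] (fun z => f (step lam c (z.1, F z.2))).
  have h : measurable_fun [set: (R * V) * T] (fun z => (z.1, F z.2)).
    by apply: measurable_fun_pair => //; exact: (measurableT_comp mF measurable_snd).
  exact: (measurableT_comp mf (measurableT_comp (measurable_step lam c) h)).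
pose h (z : R * V) := (\int[mu]_x f (step lam c (z, F x)))%E.
have mh : measurable_fun [set: R * V] h.
  exact: (measurable_fun_fubini_tonelli_F (fun z => f (step lam c (z.1, F z.2)))).
have h0 z : (0 <= h z)%E by exact: integral_ge0.
transitivity (\int[iterlaw lam c (law mu mF) n]_z h z)%E.
  transitivity (\int[iterlaw lam c (law mu mF) n]_z \int[law mu mF]_v f (step lam c (z, v)))%E.
    exact: (@ge0_integral_addlaw _ _ lam c (law mu mF) (iterlaw lam c (law mu mF) n) f mf f0).
  apply: eq_integral => z _; rewrite ge0_integral_law//.
  have h' : measurable_fun [set: V] (fun v => (z, v)) by exact: measurable_fun_pair.
  exact: (measurableT_comp mf (measurableT_comp (measurable_step lam c) h')).
have mfs : measurable_fun [set: n.+1.-tuple T] (fun t => f (state t)).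
  exact: (measurableT_comp mf (@measurable_state n.+1)).
transitivity (\int[law (pw mu n) (@measurable_state n)]_z h z)%E; first exact: IH.
transitivity (\int[pw mu n]_t h (state t))%E; first exact: ge0_integral_law.
transitivity (\int[pw mu n.+1]_t f (state t))%E; last exact/esym/ge0_integral_law.
transitivity (\int[mu]_x \int[pw mu n]_t f (state (mcons (x, t))))%E; last first.
  exact/esym/(@ge0_integral_pwS _ _ _ mu n _ mfs).
pose G (z : T * n.-tuple T) := f (step lam c (state z.2, F z.1)).
have mG : measurable_fun [set: T * n.-tuple T] G.
  have h' : measurable_fun [set: T * n.-tuple T] (fun z => (state z.2, F z.1)).
    apply: measurable_fun_pair; first exact: (measurableT_comp (@measurable_state n) measurable_snd).
    exact: (measurableT_comp mF measurable_fst).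
  exact: (measurableT_comp mf (measurableT_comp (measurable_step lam c) h')).
have G0 z : (0 <= G z)%E by exact: f0.
transitivity (\int[pprod mu (pw mu n)]_z G z)%E; first exact/esym/(tonelli2 _ _ mG G0).
rewrite (tonelli _ _ mG G0); apply: eq_integral => x _; apply: eq_integral => t _.
by rewrite state_cons.
Qed.
End StateLaw.

(** * Diagonalisation of symmetric matrices *)

Section Spectral.
Context (R : rcfType).

Lemma char_poly_orthogonal n (Q A : 'M[R]_n) : Q *m Q^T = 1%:M ->
  char_poly (Q *m A *m Q^T) = char_poly A.
Proof.
move=> QQ; pose f := map_mx (@polyC R).
have fQ : f _ _ Q *m f _ _ Q^T = 1%:M by rewrite /f -map_mxM QQ map_mx1.
have e : char_poly_mx (Q *m A *m Q^T) = f _ _ Q *m char_poly_mx A *m f _ _ Q^T.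
  rewrite /char_poly_mx mulmxBr mulmxBl mul_mx_scalar -scalemxAl fQ scalemx1.
  by rewrite /f !map_mxM.
by rewrite /char_poly e !det_mulmx mulrC mulrA -det_mulmx mulmx1C// det1 mul1r.
Qed.

(* [Q] is a Householder reflection. *)
Lemma orthogonal_first_row n (v : 'rV[R]_n.+1) : v *m v^T = 1%:M ->
  exists2 Q : 'M[R]_n.+1, Q *m Q^T = 1%:M & row 0 Q = v.
Proof.
move=> vv; pose e0 : 'rV[R]_n.+1 := delta_mx 0 0.
have [->|ve] := eqVneq v e0.
  by exists 1%:M; rewrite ?trmx1 ?mulmx1// rowE mulmx1.
pose w := v - e0; pose q : R := (w *m w^T) 0 0.
have q0 : q != 0.
  apply: contra ve => /eqP h; rewrite -subr_eq0 -/w; move: h; rewrite /q mxE => h.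
  apply/eqP/rowP => j; rewrite [RHS]mxE; apply/eqP; rewrite -sqrf_eq0 expr2.
  have h2 : \sum_k w 0 k * w 0 k = 0 by rewrite -[RHS]h; apply: eq_bigr => k _; rewrite [w^T _ _]mxE.
  have := psumr_eq0P (F := fun k => w 0 k * w 0 k) (P := xpredT) _ h2.
  by move=> ->//; move=> k _; rewrite -expr2 sqr_ge0.
have wwE : w *m w^T = q%:M by rewrite [LHS]mx11_scalar.
have ee : e0 *m e0^T = 1%:M.
  by rewrite trmx_delta mul_delta_mx; apply/matrixP => i j; rewrite !ord1 !mxE.
pose Q : 'M[R]_n.+1 := 1%:M - (2 / q) *: (w^T *m w).
have Qt : Q^T = Q by rewrite /Q linearB /= trmx1 linearZ /= trmx_mul trmxK.
exists Q; last first.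
  rewrite rowE -/e0 /Q mulmxBr mulmx1 -scalemxAr mulmxA.
  have ev : e0 *m v^T = v *m e0^T.
    by rewrite -[LHS]trmxK trmx_mul trmxK [LHS]mx11_scalar [RHS]mx11_scalar mxE.
  have h : e0 *m w^T = (- (q / 2))%:M.
    have : w *m w^T = - 2 *: (e0 *m w^T).
      rewrite /w linearB /= mulmxBl !mulmxBr vv ee ev.
      by set X := v *m _; move: X => X; apply/matrixP => i j; rewrite !mxE; ring.
    rewrite wwE => h; apply: (scalerI (a := - 2)); first by rewrite oppr_eq0 pnatr_eq0.
    by rewrite -h scale_scalar_mx; congr (_%:M); field.
  rewrite h mul_scalar_mx scalerA (_ : 2 / q * - (q / 2) = -1) ?scaleN1r ?opprK; last by field.
  by rewrite /w addrC subrK.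
rewrite Qt /Q mulmxBr mulmx1 mulmxBl mul1mx -scalemxAl -scalemxAr mulmxA.
rewrite -(mulmxA w^T) wwE mul_mx_scalar -scalemxAl !scalerA.
set W := w^T *m w; rewrite -addrA -[RHS]addr0; congr (_ + _).
rewrite -opprD -scalerBl -scalerDl (_ : _ + _ = 0) ?scale0r ?oppr0//.
by field.
Qed.

Lemma diag_mx_split n (tau : 'I_(1 + n) -> R) : diag_mx (\row_k tau k) =
  block_mx (tau (lshift n 0))%:M 0 0 (diag_mx (\row_k tau (rshift 1 k))).
Proof.
pose rt : 'rV[R]_n := \row_k tau (rshift 1 k).
have -> : (\row_k tau k) = row_mx (tau (lshift n 0))%:M rt.
  apply/rowP => j; rewrite mxE; case: (split_ordP j) => i ->.
    by rewrite row_mxEl !ord1 mxE eqxx mulr1n.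
  by rewrite row_mxEr mxE.
rewrite diag_mx_row; congr block_mx.
by apply/matrixP => i j; rewrite !mxE !ord1 eqxx.
Qed.

(** The factorisation supplies the real eigenvalues. A unit eigenvector is completed to an
    orthogonal matrix, conjugation by which splits off a 1 x 1 block; cancelling its factor leaves
    the characteristic polynomial of the other block. *)
Lemma spectral n (A : 'M[R]_n) (tau : 'I_n -> R) : A^T = A ->
  char_poly A = \prod_(k < n) ('X - (tau k)%:P) ->
  exists2 O : 'M[R]_n, O *m O^T = 1%:M & A = O *m diag_mx (\row_k tau k) *m O^T.
Proof.
elim: n A tau => [|n IH] A tau At pA.
  by exists 1%:M; [rewrite trmx1 mulmx1|apply/matrixP => -[]].
have /eigenvalueP[v0 v0A v00] : eigenvalue A (tau ord0).
  by rewrite eigenvalue_root_char pA big_ord_recl rootM root_XsubC eqxx.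
have n0 : 0 < (v0 *m v0^T) 0 0.
  rewrite lt_neqAle mxE; apply/andP; split; last first.
    by apply: sumr_ge0 => k _; rewrite [v0^T _ _]mxE -expr2 sqr_ge0.
  apply: contra v00; rewrite eq_sym => /eqP h; apply/eqP/rowP => j; rewrite mxE; apply/eqP.
  rewrite -sqrf_eq0 expr2.
  have h2 : \sum_k v0 0 k * v0 0 k = 0 by rewrite -[RHS]h; apply: eq_bigr => k _; rewrite [v0^T _ _]mxE.
  have := psumr_eq0P (F := fun k => v0 0 k * v0 0 k) (P := xpredT) _ h2.
  by move=> ->//; move=> k _; rewrite -expr2 sqr_ge0.
set N := (v0 *m v0^T) 0 0 in n0; pose v := (Num.sqrt N)^-1 *: v0.
have vv : v *m v^T = 1%:M.
  rewrite /v linearZ /= -scalemxAl -scalemxAr scalerA [v0 *m _]mx11_scalar -/N scale_scalar_mx.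
  by rewrite -invfM -expr2 sqr_sqrtr ?(ltW n0)// mulVf// gt_eqF.
have vA : v *m A = tau ord0 *: v by rewrite /v -scalemxAl v0A !scalerA mulrC.
have [Q QQ Qv] := orthogonal_first_row vv.
have [B defB] : {B : 'M[R]_(1 + n) | B = Q *m A *m Q^T} by exists (Q *m A *m Q^T).
have Bt : B^T = B by rewrite defB !trmx_mul trmxK At mulmxA.
have rB : row 0 B = tau ord0 *: delta_mx 0 0.
  rewrite defB !row_mul Qv vA -scalemxAl -Qv -row_mul QQ.
  by congr (_ *: _); apply/rowP => j; rewrite !mxE eqxx /= eq_sym.
have B0j (j : 'I_n) : B 0 (rshift 1 j) = 0.
  have /rowP/(_ (rshift 1 j)) := rB; rewrite !mxE => ->.
  by rewrite (_ : (rshift 1 j == 0) = false) ?mulr0.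
pose B' : 'M[R]_n := drsubmx B.
have Bblock : B = block_mx (tau ord0)%:M 0 0 B'.
  rewrite -[LHS]submxK; congr block_mx.
  - rewrite [LHS]mx11_scalar; congr (_%:M); have <- : row 0 B 0 0 = tau ord0 by rewrite rB !mxE !eqxx mulr1.
    rewrite !mxE; congr (B _ _); exact: val_inj.
  - by apply/rowP => j; rewrite !mxE -[RHS](B0j j); congr (B _ _); exact: val_inj.
  - apply/colP => j; rewrite !mxE -[in LHS]Bt mxE -[RHS](B0j j).
    by congr (B _ _); exact: val_inj.
have B't : B'^T = B' by rewrite /B' -[in LHS]Bt trmx_drsub trmxK.
have pB' : char_poly B' = \prod_(k < n) ('X - (tau (lift ord0 k))%:P).
  have := char_poly_orthogonal A QQ; rewrite -defB pA big_ord_recl.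
  have -> : char_poly B = ('X - (tau ord0)%:P) * char_poly B'.
    rewrite Bblock /char_poly /char_poly_mx map_block_mx !map_mx0 scalar_mx_block.
    rewrite opp_block_mx add_block_mx !oppr0 !addr0 det_ublock; congr (_ * _).
    by rewrite det_mx11 !mxE eqxx !mulr1n.
  by apply: mulfI; rewrite polyXsubC_eq0.
have [J1 OO1 EB1] := IH B' (fun k => tau (lift ord0 k)) B't pB'.
pose E : 'M[R]_(1 + n) := block_mx 1%:M 0 0 J1.
have Et : E^T = block_mx 1%:M 0 0 J1^T by rewrite /E tr_block_mx trmx1 !trmx0.
have EE : E *m E^T = 1%:M.
  rewrite Et /E mulmx_block !mulmx0 !mul0mx !addr0 add0r mulmx1 OO1.
  by rewrite -scalar_mx_block.
have Q'Q : Q^T *m Q = 1%:M by exact: mulmx1C.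
exists (Q^T *m E).
  by rewrite trmx_mul trmxK mulmxA -(mulmxA Q^T) EE mulmx1.
pose L : 'M[R]_n := diag_mx (\row_k tau (lift ord0 k)).
have eL : diag_mx (\row_k tau k) = (block_mx (tau ord0)%:M 0 0 L : 'M[R]_(1 + n)).
  have e1 : tau (@lshift 1 n 0) = tau ord0 by congr tau; exact: val_inj.
  have e2 : diag_mx (\row_k tau (rshift 1 k)) = L.
    by congr diag_mx; apply/rowP => k; rewrite !mxE; congr tau; exact: val_inj.
  by apply: etrans (diag_mx_split (n := n) tau) _; rewrite e1 e2.
rewrite eL; have -> : A = Q^T *m B *m Q.
  by rewrite defB !mulmxA Q'Q mul1mx -mulmxA Q'Q mulmx1.
rewrite trmx_mul trmxK !mulmxA; congr (_ *m _); rewrite -!mulmxA; congr (_ *m _).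
have eE : E *m ((block_mx (tau ord0)%:M 0 0 L : 'M[R]_(1 + n)) *m E^T) =
    block_mx (tau ord0)%:M 0 0 (J1 *m L *m J1^T).
  rewrite Et /E !mulmx_block !mulmx0 !mul0mx !addr0 !add0r !mulmx1 ?mul1mx.
  by rewrite ?mulmx0 ?mul0mx mulmxA.
by rewrite Bblock EB1; exact/esym/eE.
Qed.
End Spectral.

(** * U-statistics *)

Lemma intg_swap d1 d2 (T1 : measurableType d1) (T2 : measurableType d2)
    (R : realType) (P1 : probability T1 R) (P2 : probability T2 R) (f : T1 * T2 -> R) :
  intg (pprod P1 P2) f -> intg (pprod P2 P1) (fun z => f (z.2, z.1)).
Proof.
move=> fi; have mf := intg_measurable fi; have mfE : measurable_fun [set: T1 * T2] (EFin \o f).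
  by apply/measurable_EFinP.
have [_ h] := integrableP _ _ _ fi; apply/integrableP; split.
  apply/measurable_EFinP.
  exact: (measurableT_comp mf (measurable_fun_pair measurable_snd measurable_fst)).
apply: le_lt_trans h; rewrite le_eqVlt; apply/orP; left; apply/eqP.
have ma : measurable_fun [set: T1 * T2] (fun z => `|(f z)%:E|%E) by exact: measurableT_comp.
exact/esym/(swap_pprod P1 P2 ma (fun z => abse_ge0 _)).
Qed.

Section SampleSums.
Context d (T : measurableType d) (R : realType) (P : probability T R).

Lemma sq_pwS n (f : n.+1.-tuple T -> R) : measurable_fun [set: n.+1.-tuple T] f ->
  sq (pprod P (pw P n)) (f \o @mcons _ _ n) -> sq (pw P n.+1) f.
Proof.
move=> mf [_ h]; split => //; apply/intg_pwS; first exact: measurable_funX.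
exact: h.
Qed.

Lemma measurable_tsum n (f : T -> R) : measurable_fun [set: T] f ->
  measurable_fun [set: n.-tuple T] (fun t => \sum_i f (tnth t i)).
Proof.
by move=> mf; apply: measurable_sum => i; exact: (measurableT_comp mf (measurable_tnth i)).
Qed.

Lemma tsum_cons n (f : T -> R) x (t : n.-tuple T) :
  \sum_i f (tnth (mcons (x, t)) i) = f x + \sum_i f (tnth t i).
Proof.
by rewrite big_ord_recl; congr (_ + _); apply: eq_bigr => i _; rewrite /mcons tnthS.
Qed.

Lemma pw_tsum n (f : T -> R) : sq P f -> Ex P f = 0 ->
  [/\ sq (pw P n) (fun t => \sum_i f (tnth t i)),
      Ex (pw P n) (fun t => \sum_i f (tnth t i)) = 0 &
      Ex (pw P n) (fun t => (\sum_i f (tnth t i)) ^+ 2) = n%:R * Ex P (fun x => f x ^+ 2)].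
Proof.
move=> sf f0; have mf := sf.1.
elim: n => [|n [IH1 IH2 IH3]].
  have e (t : 0.-tuple T) : \sum_i f (tnth t i) = 0 by rewrite big_ord0.
  split.
  - by apply: (@sq_bdd _ _ _ _ _ 0); [exact: measurable_tsum|move=> t; rewrite e normr0].
  - by under [X in Ex _ X]funext do rewrite e; rewrite Ex_cst.
  - by under [X in Ex _ X]funext do rewrite e expr0n/=; rewrite Ex_cst mul0r.
pose S (t : n.-tuple T) := \sum_i f (tnth t i).
have s1 := sq_fst (pw P n) sf; have s2 := sq_snd P IH1.
have mS := @measurable_tsum n.+1 f mf.
have eS : (fun t => \sum_i f (tnth t i)) \o @mcons _ _ n = (fun z => f z.1 + S z.2).
  by apply/funext => -[x t]; rewrite /= tsum_cons.
split.
- by apply: sq_pwS => //; rewrite eS; exact: sqD.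
- rewrite Ex_pwS// eS ExD; [|exact: (sq_intg s1)|exact: (sq_intg s2)].
  by rewrite (Ex_fst _ (sq_intg sf)) (Ex_snd _ (sq_intg IH1)) f0 IH2 addr0.
- rewrite Ex_pwS; last exact: measurable_funX.
  have -> : (fun t => (\sum_i f (tnth t i)) ^+ 2) \o @mcons _ _ n =
      (fun z => (f z.1 ^+ 2 + 2 * (f z.1 * S z.2)) + S z.2 ^+ 2).
    by apply/funext => -[x t]; rewrite /= tsum_cons -/(S t); ring.
  have i12 := intg_prodM (sq_intg sf) (sq_intg IH1).
  have i1 := intg_fst (pw P n) sf.2; have i2 := intg_snd P IH1.2.
  rewrite (ExD (intgD i1 (intgZ 2 i12)) i2) (ExD i1 (intgZ 2 i12)) (ExZ _ i12).
  rewrite (Ex_prodM (sq_intg sf) (sq_intg IH1)) (Ex_fst _ sf.2) (Ex_snd _ IH1.2) f0 mul0r mulr0 addr0.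
  by rewrite IH3 -natr1 mulrDl mul1r addrC.
Qed.

Definition usum (r : T * T -> R) n (t : n.-tuple T) : R :=
  \sum_i \sum_(j | j != i) r (tnth t i, tnth t j).

Lemma measurable_usum (r : T * T -> R) n : measurable_fun [set: T * T] r ->
  measurable_fun [set: n.-tuple T] (@usum r n).
Proof.
move=> mr; apply: measurable_sum => i; rewrite /=.
under eq_fun do rewrite big_mkcond /=.
apply: measurable_sum => j; case: (j != i) => //.
exact: (measurableT_comp mr (measurable_fun_pair (measurable_tnth i) (measurable_tnth j))).
Qed.

Lemma usum_cons (r : T * T -> R) n x (t : n.-tuple T) : (forall x y, r (x, y) = r (y, x)) ->
  usum r (mcons (x, t)) = 2 * (\sum_i r (x, tnth t i)) + usum r t.
Proof.
move=> rs; rewrite /usum big_ord_recl.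
have tS (i : 'I_n) : tnth (mcons (x, t)) (lift ord0 i) = tnth t i by rewrite /mcons tnthS.
have -> : \sum_(j < n.+1 | j != ord0) r (tnth (mcons (x, t)) ord0, tnth (mcons (x, t)) j) =
    \sum_i r (x, tnth t i).
  by rewrite big_mkcond big_ord_recl /= add0r; apply: eq_bigr => i _; rewrite tS.
rewrite mulr_natl mulr2n -addrA; congr (_ + _); rewrite -big_split; apply: eq_bigr => i _ /=.
rewrite big_mkcond big_ord_recl /= tS rs; congr (_ + _).
rewrite [RHS]big_mkcond; apply: eq_bigr => j _; rewrite tS (inj_eq lift_inj).
by [].
Qed.

(** A prepended point adds twice its row sum. By degeneracy this is orthogonal to the earlier pairs
    and has second moment 4 n V, and 2 n^2 + 4 n <= 2 (n + 1)^2. *)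
Lemma pw_usum (r : T * T -> R) n : (forall x y, r (x, y) = r (y, x)) -> sq (pprod P P) r ->
  (forall x, sq P (fun y => r (x, y))) -> (forall x, Ex P (fun y => r (x, y)) = 0) ->
  sq (pw P n) (@usum r n) /\
  Ex (pw P n) (fun t => usum r t ^+ 2) <= 2 * n%:R ^+ 2 * Ex (pprod P P) (fun z => r z ^+ 2).
Proof.
move=> rs sr srx r0; have mr := sr.1; set V := Ex (pprod P P) _.
have V0 : 0 <= V by apply: Ex_ge0 => z; exact: sqr_ge0.
elim: n => [|n [IH1 IH2]].
  have e (t : 0.-tuple T) : usum r t = 0 by rewrite /usum big_ord0.
  split; first by apply: (@sq_bdd _ _ _ _ _ 0); [exact: measurable_usum|move=> t; rewrite e normr0].
  by under [X in Ex _ X]funext do rewrite e expr0n/=; rewrite Ex_cst expr0n/= mulr0 mul0r.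
pose S (z : T * n.-tuple T) := \sum_i r (z.1, tnth z.2 i).
have mS : measurable_fun [set: T * n.-tuple T] S.
  apply: measurable_sum => i.
  have h := measurableT_comp (measurable_tnth (n := n) (T := T) i) (@measurable_snd _ _ T (n.-tuple T)).
  exact: (measurableT_comp mr (measurable_fun_pair measurable_fst h)).
have hS x := pw_tsum n (srx x) (r0 x).
have iV : intg P (fun x => n%:R * Ex P (fun y => r (x, y) ^+ 2)).
  by apply: intgZ; exact: (intg_Ex sr.2).
have iS2 : intg (pprod P (pw P n)) (fun z => S z ^+ 2).
  apply: intg_prod; first exact: measurable_funX.
  - by move=> z; exact: sqr_ge0.
  - by move=> x; have [[]] := hS x.
  - rewrite (_ : (fun x => _) = (fun x => n%:R * Ex P (fun y => r (x, y) ^+ 2)))//.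
    by apply/funext => x; have [_ _ ->] := hS x.
have sS : sq (pprod P (pw P n)) S by [].
have ES : Ex (pprod P (pw P n)) (fun z => S z ^+ 2) = n%:R * V.
  rewrite (Ex_prod iS2) /V (Ex_prod sr.2) -ExZ; last exact: (intg_Ex sr.2).
  by congr Ex; apply/funext => x; have [_ _ ->] := hS x.
have sU := sq_snd P IH1; have iUS := sq_mul sS sU.
have EUS : Ex (pprod P (pw P n)) (fun z => S z * usum r z.2) = 0.
  rewrite (Ex_swap _ _ (intg_measurable iUS)).
  have iUS' : intg (pprod (pw P n) P) (fun z => S (z.2, z.1) * usum r z.1).
    exact: (intg_swap iUS).
  rewrite (Ex_prod iUS') -[RHS](Ex_cst (pw P n) 0); congr Ex; apply/funext => t /=.
  have ir i : intg P (fun x => r (x, tnth t i)).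
    by under eq_fun do rewrite rs; exact: (sq_intg (srx _)).
  under [X in Ex _ X]funext do rewrite mulrC.
  rewrite ExZ; last exact: intg_sum.
  rewrite Ex_sum// big1 ?mulr0// => i _.
  by rewrite -[RHS](r0 (tnth t i)); congr Ex; apply/funext => x; rewrite /= rs.
have mU := @measurable_usum r n.+1 mr.
have e : @usum r n.+1 \o @mcons _ _ n = (fun z => 2 * S z + usum r z.2).
  by apply/funext => -[x t]; rewrite /= usum_cons.
split; first by apply: sq_pwS => //; rewrite e; apply: sqD => //; exact: sqZ.
rewrite Ex_pwS; last exact: measurable_funX.
have -> : (fun t => usum r t ^+ 2) \o @mcons _ _ n =
    (fun z => (4 * S z ^+ 2 + 4 * (S z * usum r z.2)) + usum r z.2 ^+ 2).
  by apply/funext => -[x t]; rewrite /= usum_cons// -/(S (x, t)); ring.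
have i1 := intgZ 4 sS.2; have i2 := intgZ 4 iUS.
rewrite (ExD (intgD i1 i2) sU.2) (ExD i1 i2) (ExZ _ sS.2) (ExZ _ iUS) EUS mulr0 addr0 ES.
rewrite (Ex_snd _ IH1.2) -natr1.
have n0 : 0 <= n%:R :> R by [].
move: IH2; set E := Ex _ _; nra.
Qed.
End SampleSums.

(** * Universality of quadratic forms *)

Lemma Pr_shift d (T : measurableType d) (R : realType) (P : probability T R) (f h : T -> R) (t e : R) :
  measurable_fun [set: T] f -> measurable_fun [set: T] h -> sq P (fun x => f x - h x) -> 0 < e ->
  Pr P [set x | t < f x] <= Pr P [set x | t - e < h x] + Ex P (fun x => (f x - h x) ^+ 2) / e ^+ 2.
Proof.
move=> mf mh sfh e0.
apply: (@le_trans _ _ (Pr P [set x | t - e < h x] + Pr P [set x | e < `|f x - h x|])); last first.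
  by rewrite lerD2l; exact: Pr_chebyshev.
apply: Pr_subU; [exact: measurable_gt|exact: measurable_gt|exact: (measurable_norm_gt e sfh.1)|].
move=> x /= tf; have [h1|h1] := ltP (t - e) (h x); [by left|right].
have := ler_norm (f x - h x); lra.
Qed.

Lemma same_law_Pr d (T : measurableType d) (R : realType) (P Q : probability T R) (A : set T) :
  same_law P Q -> measurable A -> Pr P A = Pr Q A.
Proof.
move=> PQ mA; rewrite !Pr_indic//; apply: (same_law_Ex PQ); exact: measurable_indic.
Qed.

Section GaussianSums.
Context (R : realType).
Local Notation g := (gauss R).

Lemma sq_gquad K (tau : 'I_K -> R) : [/\ sq (pw g K) (gquad tau), Ex (pw g K) (gquad tau) = 0 &
  Ex (pw g K) (fun t => gquad tau t ^+ 2) = 2 * \sum_k tau k ^+ 2].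
Proof.
elim: K tau => [|K IH] tau.
  have e (t : 0.-tuple R) : gquad tau t = 0 by rewrite /gquad big_ord0.
  split.
  - by apply: (@sq_bdd _ _ _ _ _ 0); [exact: measurable_gquad|move=> t; rewrite e normr0].
  - by under [X in Ex _ X]funext do rewrite e; rewrite Ex_cst.
  - by under [X in Ex _ X]funext do rewrite e expr0n/=; rewrite Ex_cst big_ord0 mulr0.
have [IH1 IH2 IH3] := IH (tau \o lift ord0).
pose f (x : R) := tau ord0 * (x ^+ 2 - 1); pose S := gquad (tau \o lift ord0).
have i2 := @gauss_pow_intg R 2 isT; have i4 := @gauss_pow_intg R 4 isT.
have i1 := intg_cst g (1 : R); have i21 := intgB i2 i1.
have mf : measurable_fun [set: R] f.
  by apply: measurable_funM => //; apply: measurable_funB => //; exact: measurable_funX.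
have f2E : (fun x => f x ^+ 2) = (fun x => tau ord0 ^+ 2 * ((x ^+ 4 - 2 * x ^+ 2) + 1)).
  by apply/funext => x; rewrite /f; ring.
have i42 := intgB i4 (intgZ 2 i2).
have sf : sq g f by split => //; rewrite f2E; apply: intgZ; exact: intgD.
have f0 : Ex g f = 0 by rewrite /f (ExZ _ i21) (ExB i2 i1) gauss_m2 Ex_cst subrr mulr0.
have Ef2 : Ex g (fun x => f x ^+ 2) = 2 * tau ord0 ^+ 2.
  rewrite f2E (ExZ _ (intgD i42 i1)) (ExD i42 i1) (ExB i4 (intgZ 2 i2)) (ExZ _ i2).
  by rewrite gauss_m4 gauss_m2 Ex_cst; ring.
have s1 := sq_fst (pw g K) sf; have s2 := sq_snd g IH1.
have mS := measurable_gquad tau.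
have eS : gquad tau \o @mcons _ _ K = (fun z => f z.1 + S z.2).
  by apply/funext => -[x t]; rewrite /= gquad_cons.
split.
- by apply: sq_pwS => //; rewrite eS; exact: sqD.
- rewrite Ex_pwS// eS ExD; [|exact: (sq_intg s1)|exact: (sq_intg s2)].
  by rewrite (Ex_fst _ (sq_intg sf)) (Ex_snd _ (sq_intg IH1)) f0 IH2 addr0.
- rewrite Ex_pwS; last exact: measurable_funX.
  have -> : (fun t => gquad tau t ^+ 2) \o @mcons _ _ K =
      (fun z => (f z.1 ^+ 2 + 2 * (f z.1 * S z.2)) + S z.2 ^+ 2).
    by apply/funext => -[x t]; rewrite /= gquad_cons -/(S t) /f; ring.
  have i12 := intg_prodM (sq_intg sf) (sq_intg IH1).
  have j1 := intg_fst (pw g K) sf.2; have j2 := intg_snd g IH1.2.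
  rewrite (ExD (intgD j1 (intgZ 2 i12)) j2) (ExD j1 (intgZ 2 i12)) (ExZ _ i12).
  rewrite (Ex_prodM (sq_intg sf) (sq_intg IH1)) (Ex_fst _ sf.2) (Ex_snd _ IH1.2) f0 mul0r mulr0 addr0.
  by rewrite Ef2 IH3 big_ord_recl mulrDr.
Qed.

Definition vsum K n (t : n.-tuple (K.-tuple R)) : K.-tuple R :=
  [tuple \sum_i tnth (tnth t i) k | k < K].

Lemma measurable_vsum K n : measurable_fun [set: n.-tuple (K.-tuple R)] (@vsum K n).
Proof.
apply/measurable_fun_tnthP => k.
have -> : (fun t : K.-tuple R => tnth t k) \o @vsum K n = (fun t => \sum_i tnth (tnth t i) k).
  by apply/funext => t /=; rewrite tnth_mktuple.
apply: measurable_sum => i; exact: (measurableT_comp (measurable_tnth k) (measurable_tnth i)).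
Qed.

Lemma ge0_gauss_vsum K n (f : K.-tuple R -> \bar R) : measurable_fun [set: K.-tuple R] f ->
  (forall x, (0 <= f x)%E) ->
  (\int[pw (pw g K) n]_t f (vsum t) = \int[pw g K]_x f (scalet (Num.sqrt n%:R) x))%E.
Proof.
elim: n f => [|n IH] f mf f0.
  pose z0 : K.-tuple R := [tuple 0 | k < K].
  transitivity (f z0); last first.
    rewrite -[LHS](integral_cste (pw g K)); apply: eq_integral => x _; congr f.
    by apply: eq_from_tnth => k; rewrite !tnth_mktuple sqrtr0 mul0r.
  rewrite -[RHS](integral_cste (pw (pw g K) 0)); apply: eq_integral => x _; congr f.
  by apply: eq_from_tnth => k; rewrite !tnth_mktuple big_ord0.
have mfs : measurable_fun [set: n.+1.-tuple (K.-tuple R)] (fun t => f (vsum t)).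
  exact: (measurableT_comp mf (@measurable_vsum K n.+1)).
rewrite (ge0_integral_pwS _ mfs)//.
transitivity (\int[pw g K]_x \int[pw g K]_y f (addt (scalet 1 x) (scalet (Num.sqrt n%:R) y)))%E.
  apply: eq_integral => x _.
  rewrite -(IH (fun y => f (addt (scalet 1 x) y)))//; last first.
    apply: (measurableT_comp mf).
    have h : measurable_fun [set: K.-tuple R] (fun y : K.-tuple R => (scalet 1 x, y)) by exact: measurable_fun_pair.
    exact: (measurableT_comp (@measurable_addt R K) h).
  apply: eq_integral => t _; congr f; apply: eq_from_tnth => k.
  rewrite !tnth_mktuple big_ord_recl mul1r; congr (_ + _).
  by apply: eq_bigr => i _; rewrite /mcons tnthS.
by rewrite ge0_gauss_lincomb// expr1n sqr_sqrtr// -natr1 addrC.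
Qed.

(* [gquad tau] at [sqrt n] times a Gaussian, against the off-diagonal part of the
   quadratic form at a sum of [n] independent Gaussians. *)
Lemma gquad_vs_qsum K (tau : 'I_K -> R) n (c x e : R) : 0 < e ->
  let D := 2 * c ^+ 2 * n%:R * (\sum_k tau k ^+ 2) / e ^+ 2 in
  let q (t : n.-tuple (K.-tuple R)) := c * qsum tau id t in
  Pr (pw (pw g K) n) [set t | x < q t] <=
    Pr (pw g K) [set y | x - e < c * n%:R * gquad tau y] + D /\
  Pr (pw g K) [set y | x < c * n%:R * gquad tau y] <=
    Pr (pw (pw g K) n) [set t | x - e < q t] + D.
Proof.
move=> e0 D q.
(* The form at the total with its diagonal replaced by the mean: it has the law of [c n gquad tau],
   and differs from [q] by [c] times a sum of n independent copies of [gquad tau], of variance 2 c^2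
   n |tau|^2. *)
pose B (t : n.-tuple (K.-tuple R)) := c * \sum_k tau k * (tnth (vsum t) k ^+ 2 - n%:R).
have mV k : measurable_fun [set: n.-tuple (K.-tuple R)] (fun t => tnth (vsum t) k).
  exact: (measurableT_comp (measurable_tnth k) (@measurable_vsum K n)).
have mB : measurable_fun [set: n.-tuple (K.-tuple R)] B.
  apply: measurable_funM => //; apply: measurable_sum => k; apply: measurable_funM => //.
  by apply: measurable_funB => //; exact: measurable_funX.
have qB t : q t = B t - c * \sum_i gquad tau (tnth t i).
  rewrite /q /B -mulrBr; congr (_ * _); rewrite /qsum /gquad exchange_big [in RHS]exchange_big /=.
  rewrite /bil -!sumrB; apply: eq_bigr => k _; rewrite !tnth_mktuple.
  set S := \sum_(i < n) tnth (tnth t i) k.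
  rewrite [X in _ = _ - X](eq_bigr (fun i => tau k * tnth (tnth t i) k * tnth (tnth t i) k - tau k)) => [|i _].
    by rewrite sumrB sumr_const card_ord -mulr_natl; ring.
  by ring.
have [s0 E0 E2] := sq_gquad tau; have [sS ES ES2] := pw_tsum n s0 E0.
have Pr_B z : Pr (pw (pw g K) n) [set t | z < B t] = Pr (pw g K) [set y | z < c * n%:R * gquad tau y].
  pose A := [set y : K.-tuple R | z < c * \sum_k tau k * (tnth y k ^+ 2 - n%:R)].
  have mA : measurable A.
    apply: measurable_gt; apply: measurable_funM => //; apply: measurable_sum => k.
    apply: measurable_funM => //; apply: measurable_funB => //; apply: measurable_funX; exact: measurable_tnth.
  have -> : [set t | z < B t] = vsum (n := n) @^-1` A by [].
  have e' : [set y : K.-tuple R | z < c * n%:R * gquad tau y] = scalet (Num.sqrt n%:R) @^-1` A.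
    apply/seteqP; split => y; rewrite /A /= => h.
    - move: h; congr (_ < _); rewrite -mulrA; congr (_ * _); rewrite /gquad mulr_sumr; apply: eq_bigr => k _.
      by rewrite tnth_mktuple exprMn sqr_sqrtr//; ring.
    - move: h; congr (_ < _); rewrite -mulrA; congr (_ * _); rewrite /gquad mulr_sumr; apply: eq_bigr => k _.
      by rewrite tnth_mktuple exprMn sqr_sqrtr//; ring.
  rewrite e' -(Pr_law _ (@measurable_vsum K n)) -(Pr_law _ (@measurable_scalet R K (Num.sqrt n%:R))).
  apply: same_law_Pr => // f mf f0.
  transitivity (\int[pw (pw g K) n]_t f (vsum t))%E; first exact: ge0_integral_law.
  transitivity (\int[pw g K]_y f (scalet (Num.sqrt n%:R) y))%E; first exact: ge0_gauss_vsum.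
  exact/esym/ge0_integral_law.
have mq : measurable_fun [set: n.-tuple (K.-tuple R)] q.
  rewrite (_ : q = fun t => B t - c * \sum_i gquad tau (tnth t i)); last by apply/funext.
  by apply: measurable_funB => //; exact: (sqZ c sS).1.
have sd : sq (pw (pw g K) n) (fun t => q t - B t).
  rewrite (_ : (fun t => _) = fun t => (- c) * \sum_i gquad tau (tnth t i)); first exact: sqZ.
  by apply/funext => t; rewrite qB; ring.
have sd' : sq (pw (pw g K) n) (fun t => B t - q t).
  rewrite (_ : (fun t => _) = fun t => c * \sum_i gquad tau (tnth t i)); first exact: sqZ.
  by apply/funext => t; rewrite qB; ring.
have Ed : Ex (pw (pw g K) n) (fun t => (q t - B t) ^+ 2) = 2 * c ^+ 2 * n%:R * \sum_k tau k ^+ 2.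
  rewrite (_ : (fun t => _) = fun t => c ^+ 2 * (\sum_i gquad tau (tnth t i)) ^+ 2).
    by rewrite (ExZ _ sS.2) ES2 E2; ring.
  by apply/funext => t; rewrite qB; ring.
have Ed' : Ex (pw (pw g K) n) (fun t => (B t - q t) ^+ 2) = 2 * c ^+ 2 * n%:R * \sum_k tau k ^+ 2.
  by rewrite -Ed; congr Ex; apply/funext => t; rewrite -sqrrN opprB.
split.
- by have h := Pr_shift x mq mB sd e0; rewrite Ed Pr_B in h; exact: h.
- by have h := Pr_shift x mB mq sd' e0; rewrite Ed' Pr_B in h; exact: h.
Qed.
End GaussianSums.

Lemma sq_law d d' (T : measurableType d) (T' : measurableType d') (R : realType)
    (P : probability T R) (F : T -> T') (mF : measurable_fun [set: T] F) (f : T' -> R) :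
  measurable_fun [set: T'] f -> sq P (f \o F) -> sq (law P mF) f.
Proof. by move=> mf [_ h]; split => //; apply/(intg_law P mF) => //; exact: measurable_funX. Qed.

Section Universality.
Context (R : realType) d (T : measurableType d) (rho : probability T R) (K : nat).
Variables (lam tau : 'I_K -> R) (F : T -> K.-tuple R) (mF : measurable_fun [set: T] F).
Variable M : 'M[R]_K.
Local Notation g := (gauss R).
Local Notation V := (K.-tuple R).
Local Notation bl := (bil lam).
Hypothesis Fsq : forall k, sq rho (fun x => tnth (F x) k).
Hypothesis F0 : forall k, Ex rho (fun x => tnth (F x) k) = 0.
Hypothesis FM : forall k l, Ex rho (fun x => tnth (F x) k * tnth (F x) l) = (M *m M^T) k l.
Hypothesis Mtau : M^T *m diag_mx (\row_k lam k) *m M = diag_mx (\row_k tau k).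

(* Maps a standard Gaussian vector to one with the covariance of the features [F],
   and turns the form [diag lam] into [diag tau]. *)
Definition gim (t : V) : V := [tuple \sum_j M k j * tnth t j | k < K].

Lemma measurable_gim : measurable_fun [set: V] gim.
Proof.
apply/measurable_fun_tnthP => k.
have -> : (fun t : V => tnth t k) \o gim = (fun t => \sum_j M k j * tnth t j).
  by apply/funext => t /=; rewrite tnth_mktuple.
by apply: measurable_sum => j; apply: measurable_funM => //; exact: measurable_tnth.
Qed.

Definition gcoef (x : V) (j : 'I_K) : R := \sum_k lam k * tnth x k * M k j.

Lemma bil_gim_lform t x : bl (gim t) x = lform (gcoef x) t.
Proof.
rewrite /bil /lform /gcoef; under [RHS]eq_bigr do rewrite mulr_suml.
rewrite exchange_big; apply: eq_bigr => k _ /=; rewrite tnth_mktuple mulr_sumr mulr_suml.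
by apply: eq_bigr => j _; ring.
Qed.

Lemma bil_gim s t : bl (gim s) (gim t) = bil tau s t.
Proof.
rewrite bil_gim_lform /lform /bil; apply: eq_bigr => j _.
rewrite [RHS]mulrAC; congr (_ * _); rewrite /gcoef.
transitivity (\sum_i tnth t i * (M^T *m diag_mx (\row_k lam k) *m M) i j).
  under eq_bigr do rewrite tnth_mktuple mulr_sumr mulr_suml.
  rewrite exchange_big; apply: eq_bigr => i _ /=; rewrite mxE mulr_sumr; apply: eq_bigr => k _.
  by rewrite mul_mx_diag !mxE; ring.
rewrite Mtau (bigD1 j)//= big1 ?addr0 => [|i ij]; first by rewrite !mxE eqxx mulr1n mulrC.
by rewrite !mxE (negbTE ij) mulr0n mulr0.
Qed.

(** The common variance of [bl v x] under the law of the features and under its Gaussian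
    counterpart. *)
Let m2 (x : V) : R := \sum_j gcoef x j ^+ 2.
Let mu1 := law rho mF.
Let mu2 := law (pw g K) measurable_gim.

Let bilF v x : bl (F v) x = \sum_k lam k * tnth x k * tnth (F v) k.
Proof. by apply: eq_bigr => k _; ring. Qed.

Lemma matched_features : matched lam m2 mu1.
Proof.
move=> x; have mb := measurable_bill lam x.
have sF : sq rho (fun v => bl (F v) x).
  rewrite (_ : (fun v => _) = (fun v => \sum_k lam k * tnth x k * tnth (F v) k)).
    by apply: sq_sum => k; exact: sqZ.
  by apply/funext => v; rewrite bilF.
split; first exact: sq_law.
- rewrite Ex_law// (_ : _ \o _ = (fun v => \sum_k lam k * tnth x k * tnth (F v) k)); last first.
    by apply/funext => v /=; rewrite bilF.
  rewrite Ex_sum; last by move=> k; apply: intgZ; exact: (sq_intg (Fsq k)).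
  by rewrite big1// => k _; rewrite ExZ ?F0 ?mulr0//; exact: (sq_intg (Fsq k)).
- rewrite Ex_law; last exact: measurable_funX.
  rewrite (_ : _ \o _ = (fun v => \sum_k \sum_l (lam k * tnth x k * (lam l * tnth x l)) * (tnth (F v) k * tnth (F v) l))); last first.
    apply/funext => v /=; rewrite bilF expr2 mulr_suml; apply: eq_bigr => k _.
    by rewrite mulr_sumr; apply: eq_bigr => l _; ring.
  have ikl k l : intg rho (fun v => tnth (F v) k * tnth (F v) l) by exact: sq_mul.
  rewrite Ex_sum; last by move=> k; apply: intg_sum => l; exact: intgZ.
  under eq_bigr => k _.
    rewrite Ex_sum; last by move=> l; exact: intgZ.
    under eq_bigr => l _ do rewrite ExZ// FM mxE mulr_sumr.
    rewrite exchange_big; over.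
  rewrite exchange_big /m2; apply: eq_bigr => j _ /=.
  rewrite /gcoef expr2 mulr_suml; apply: eq_bigr => k _; rewrite mulr_sumr; apply: eq_bigr => l _.
  by rewrite mxE; ring.
Qed.

Let lawG n (x : V) : (fun v => bl v x ^+ n) \o gim = (fun t => lform (gcoef x) t ^+ n).
Proof. by apply/funext => t /=; rewrite bil_gim_lform. Qed.

Lemma matched_gim : matched lam m2 mu2.
Proof.
move=> x; have mb := measurable_bill lam x.
have e : (fun v => bl v x) \o gim = lform (gcoef x) by apply/funext => t /=; rewrite bil_gim_lform.
split.
- by apply: sq_law => //; rewrite e; exact: sq_lform.
- by rewrite Ex_law// e Ex_lform.
- by rewrite Ex_law ?lawG ?Ex_lform2//; exact: measurable_funX.
Qed.

(** Integrating one variable out gives the sum over j of [bl (F x) (col j)] squared, [col j] being a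
    column of [M]; integrating the other gives the sum of [m2 (col j)], and [Mtau] evaluates
    [m2 (col j)] to tau_j^2. *)
Lemma sq_bil_features : sq (pprod rho rho) (fun z => bl (F z.1) (F z.2)) /\
  Ex (pprod rho rho) (fun z => bl (F z.1) (F z.2) ^+ 2) = \sum_k tau k ^+ 2.
Proof.
have mf : measurable_fun [set: T * T] (fun z => bl (F z.1) (F z.2)).
  have h : measurable_fun [set: T * T] (fun z => (F z.1, F z.2)).
    by apply: measurable_fun_pair; [exact: (measurableT_comp mF measurable_fst)|exact: (measurableT_comp mF measurable_snd)].
  exact: (measurableT_comp (measurable_bil lam) h).
pose col (j : 'I_K) : V := [tuple M k j | k < K].
have gE x j : gcoef (F x) j = bl (F x) (col j).
  by apply: eq_bigr => k _; rewrite tnth_mktuple.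
have gcol j i : gcoef (col j) i = tau j * (i == j)%:R.
  transitivity ((M^T *m diag_mx (\row_k lam k) *m M) i j).
    by rewrite mxE; apply: eq_bigr => k _; rewrite mul_mx_diag tnth_mktuple !mxE; ring.
  by rewrite Mtau !mxE eq_sym; case: eqVneq => [->|_]; rewrite ?mulr1n ?mulr1 ?mulr0n ?mulr0.
have m2col j : m2 (col j) = tau j ^+ 2.
  rewrite /m2 (bigD1 j)//= big1 ?addr0 => [|i ij]; rewrite gcol ?eqxx ?mulr1//.
  by rewrite (negbTE ij) mulr0 expr0n.
have sF x : sq rho (fun y => bl (F y) x) /\ Ex rho (fun y => bl (F y) x ^+ 2) = m2 x.
  have [[_ h1] _ h2] := matched_features x; have mX := measurable_funX 2 (measurable_bill lam x).
  split; last by rewrite -h2 Ex_law.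
  split; last exact/(intg_law rho mF mX).
  exact: (measurableT_comp (measurable_bill lam x) mF).
have e : (fun x => Ex rho (fun y => bl (F x) (F y) ^+ 2)) =
    (fun x => \sum_j bl (F x) (col j) ^+ 2).
  apply/funext => x; under [X in Ex _ X]funext do rewrite bilC.
  by rewrite (sF _).2 /m2; apply: eq_bigr => j _; rewrite gE.
have i2 : intg (pprod rho rho) (fun z => bl (F z.1) (F z.2) ^+ 2).
  apply: intg_prod; first exact: measurable_funX.
  - by move=> z; exact: sqr_ge0.
  - by move=> x /=; under eq_fun do rewrite bilC; exact: (sF _).1.2.
  - by rewrite /= e; apply: intg_sum => j; exact: (sF _).1.2.
split => //; rewrite (Ex_prod i2) /= e Ex_sum; last by move=> j; exact: (sF _).1.2.
by apply: eq_bigr => j _; rewrite (sF _).2 m2col.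
Qed.

Variable nu : R.
Hypothesis nu23 : 2 <= nu <= 3.
Local Open Scope ereal_scope.

Let m2_ge0 x : (0 <= m2 x)%R. Proof. by apply: sumr_ge0 => j _; exact: sqr_ge0. Qed.

(** The fourth moment of a Gaussian linear form is 3 times its squared variance, so its [nu]-th
    moment is at most 1 + 3 times the power of the variance, which Lyapunov's inequality bounds by
    the moment under the features. No moment of a Gaussian vector is needed. *)
Lemma absbil_gim_le x : absbil lam nu mu2 x <= 4%:E * absbil lam nu mu1 x.
Proof.
have [sG _ G2] := matched_gim x; have [sF _ F2] := matched_features x.
have mX n : measurable_fun [set: V] (fun v => bl v x ^+ n)%R by apply: measurable_funX; exact: measurable_bill.
have h4 : intg mu2 (fun v => bl v x ^+ 4)%R by apply/intg_law => //; rewrite lawG; exact: intg_lform_exp.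
have e4 : (Ex mu2 (fun v => bl v x ^+ 4) <= 3 * m2 x ^+ 2)%R by rewrite Ex_law// lawG Ex_lform4.
apply: (le_trans (absmoment_hyper nu23 sG (m2_ge0 x) _ G2 h4 e4)); first by rewrite ler1n.
rewrite (_ : 1 + 3 = 4 :> R)%R; last by ring.
rewrite EFinM lee_wpmul2l ?lee_fin//.
have [m0|m0] := eqVneq (m2 x) 0%R.
  rewrite m0 sqrtr0 powR0 ?absbil_ge0// gt_eqF//; case/andP: nu23 => + _.
  by apply: lt_le_trans; rewrite ltr0n.
apply: (absmoment_lyapunov nu23 sF); last by rewrite F2 sqr_sqrtr.
by rewrite sqrtr_gt0 lt_neqAle eq_sym m0 m2_ge0.
Qed.

Variable N : R.
Hypothesis hN : \int[pprod rho rho]_z (`|bl (F z.1) (F z.2)| `^ nu)%:E <= N%:E.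

Let H (z : V * V) : \bar R := (`|bl z.1 z.2| `^ nu)%:E.
Let mH : measurable_fun [set: V * V] H. Proof. exact: measurable_bil_pow. Qed.
Let H0 z : 0 <= H z. Proof. by rewrite lee_fin powR_ge0. Qed.
Let mA (mu : probability V R) : measurable_fun [set: V] (absbil lam nu mu).
Proof. exact: measurable_absbil. Qed.

Let int_absbil (mu mu' : probability V R) : \int[mu]_x absbil lam nu mu' x = \int[mu']_x absbil lam nu mu x.
Proof.
transitivity (\int[pprod mu' mu]_z H z); first exact/esym/(tonelli2 mu' mu mH H0).
transitivity (\int[mu']_x \int[mu]_y H (x, y)); first exact: (tonelli mu' mu mH H0).
by apply: eq_integral => x _; apply: eq_integral => y _; rewrite /H /= bilC.
Qed.

Let M11 : \int[mu1]_x absbil lam nu mu1 x <= N%:E.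
Proof.
apply: le_trans hN; rewrite le_eqVlt; apply/orP; left; apply/eqP.
transitivity (\int[pprod mu1 mu1]_z H z); first exact/esym/(tonelli2 mu1 mu1 mH H0).
exact: (integral_pprod_law rho rho mF mF mH H0).
Qed.

Let int_gim_le (mu : probability V R) (B : R) : \int[mu]_x absbil lam nu mu1 x <= B%:E ->
  \int[mu]_x absbil lam nu mu2 x <= (4 * B)%:E.
Proof.
move=> h; apply: (@le_trans _ _ (\int[mu]_x (4%:E * absbil lam nu mu1 x))).
  apply: ge0_le_integralT => //; [exact: measurable_funeM|move=> x; exact: absbil_ge0|exact: absbil_gim_le].
rewrite ge0_integralZT//; last by move=> x; exact: absbil_ge0.
by rewrite EFinM lee_wpmul2l// lee_fin.
Qed.

Local Close Scope ereal_scope.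

Lemma universality n (c delta t : R) : (0 < n)%N -> 0 <= c -> 0 < delta ->
  `|Ex (pw rho n) (fun w => smooth_gt delta t (c * qsum lam F w)) -
    Ex (pw (pw g K) n) (fun w => smooth_gt delta t (c * qsum tau id w))| <=
  n%:R * (256 * (2 * c / delta) `^ nu * n%:R * n%:R `^ ((nu - 2) / 2) * (16 * N)).
Proof.
move=> n0 c0 d0.
have N0 : 0 <= N.
  by rewrite -lee_fin; apply: le_trans hN; apply: integral_ge0 => z _; rewrite lee_fin powR_ge0.
have M12 := int_gim_le M11; have M21 := M12; rewrite int_absbil in M21.
have M22 := int_gim_le M21.
have le1 : (N%:E <= (16 * N)%:E :> \bar R)%E by rewrite lee_fin ler_peMl// ler1n.
have le4 : ((4 * N)%:E <= (16 * N)%:E :> \bar R)%E by rewrite lee_fin ler_wpM2r// ler_nat.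
have le16 : ((4 * (4 * N))%:E <= (16 * N)%:E :> \bar R)%E by rewrite lee_fin mulrA -natrM.
have := lindeberg t nu23 c0 d0 matched_features matched_gim (le_trans M11 le1) (le_trans M12 le4)
  (le_trans M21 le4) (le_trans M22 le16) n0.
have ms : measurable_fun [set: R * V] (fun z : R * V => smooth_gt delta t z.1).
  by apply: measurable_smooth_gt.
rewrite (same_law_Ex (iterlaw_state lam rho c mF n) ms).
rewrite (same_law_Ex (iterlaw_state lam (pw g K) c measurable_gim n) ms).
rewrite !Ex_law//.
rewrite (_ : (fun z => _) \o state lam c gim (n := n) = (fun w => smooth_gt delta t (c * qsum tau id w))).
  by [].
apply/funext => w /=; congr smooth_gt; congr (_ * _); rewrite !qsumE.
by apply: eq_bigr => i _; apply: eq_bigr => j _; rewrite bil_gim.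
Qed.

(** The threshold moves by 3 delta, the width of the smooth step, and by delta for the passage from
    the off-diagonal Gaussian sum to [gquad tau]. The second summand of [E] is the Chebyshev cost of
    the latter. *)
Lemma universality_Pr n (c delta t : R) : (0 < n)%N -> 0 <= c -> 0 < delta ->
  let E := n%:R * (256 * (2 * c / delta) `^ nu * n%:R * n%:R `^ ((nu - 2) / 2) * (16 * N)) +
    2 * c ^+ 2 * n%:R * (\sum_k tau k ^+ 2) / delta ^+ 2 in
  Pr (pw rho n) [set w | t < c * qsum lam F w] <=
    Pr (pw g K) [set y | t - 4 * delta < c * n%:R * gquad tau y] + E /\
  Pr (pw g K) [set y | t < c * n%:R * gquad tau y] <=
    Pr (pw rho n) [set w | t - 4 * delta < c * qsum lam F w] + E.
Proof.
move=> n0 c0 d0 E.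
have sm d' (T' : measurableType d') (P : probability T' R) (f : T' -> R) s : measurable_fun [set: T'] f ->
    Pr P [set w | s + 3 * delta < f w] <= Ex P (fun w => smooth_gt delta s (f w)) /\
    Ex P (fun w => smooth_gt delta s (f w)) <= Pr P [set w | s < f w].
  move=> mf; have sb a := sstep_bound ((a - s) / delta); split.
  - apply: Pr_le_Ex; [exact: measurable_gt|exact: smooth_gt_intg|..].
      by move=> w; case/andP: (sb (f w)).
    move=> w /= h; rewrite /smooth_gt sstep_ge3// ler_pdivlMr//; lra.
  - apply: Ex_le_Pr; [exact: measurable_gt|exact: smooth_gt_intg|..].
      by move=> w; case/andP: (sb (f w)).
    move=> w /= /negP; rewrite -leNgt => h; rewrite /smooth_gt sstep_le0//.
    by rewrite mulr_le0_ge0 ?subr_le0// invr_ge0 ltW.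
have mq : measurable_fun [set: n.-tuple T] (fun w => c * qsum lam F w).
  by have := measurableT_comp measurable_fst (measurable_state lam c mF (n := n)).
have mqt : measurable_fun [set: n.-tuple V] (fun w => c * qsum tau id w).
  have mid : measurable_fun [set: V] (@id V) by [].
  by have := measurableT_comp measurable_fst (measurable_state tau c mid (n := n)).
have U s := universality s n0 c0 d0.
split.
- have [h1 _] := sm _ _ (pw rho n) _ (t - 3 * delta) mq.
  have [_ h2] := sm _ _ (pw (pw g K) n) _ (t - 3 * delta) mqt.
  have [h3 _] := gquad_vs_qsum tau n c (t - 3 * delta) d0.
  have := U (t - 3 * delta); rewrite ler_norml => /andP[_ h4].
  rewrite subrK in h1; rewrite (_ : t - 4 * delta = t - 3 * delta - delta); last by ring.
  rewrite /E; lra.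
- have [h1 _] := sm _ _ (pw (pw g K) n) _ (t - 4 * delta) mqt.
  have [_ h2] := sm _ _ (pw rho n) _ (t - 4 * delta) mq.
  have [_ h3] := gquad_vs_qsum tau n c t d0.
  have := U (t - 4 * delta); rewrite ler_norml => /andP[h4 _].
  rewrite (_ : t - 4 * delta + 3 * delta = t - delta) in h1; last by ring.
  rewrite /E; lra.
Qed.
End Universality.

(** * Hoeffding decomposition of kernels *)

Section AbsMoments.
Context d (T : measurableType d) (R : realType) (P : probability T R) (nu : R).
Hypothesis nu23 : 2 <= nu <= 3.
Local Open Scope ereal_scope.

Let nu0 : (0 <= nu)%R. Proof. by case/andP: nu23 => h _; apply: le_trans h. Qed.

Lemma powR_normD (a b : R) : (`|a + b| `^ nu <= 8 * (`|a| `^ nu + `|b| `^ nu))%R.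
Proof.
wlog ab : a b / (`|a| <= `|b|)%R => [h|].
  by have [/h//|/ltW/h] := leP `|a|%R `|b|%R; rewrite addrC [X in (_ * X)%R]addrC.
apply: (@le_trans _ _ ((2 * `|b|) `^ nu)%R).
  by apply: powR_le_of_le => //; apply: (le_trans (ler_normD _ _)); rewrite mulr_natl mulr2n lerD2r.
rewrite powRM//; apply: ler_pM; rewrite ?powR_ge0// ?lerDr ?powR_ge0//.
have [_ n3] := andP nu23; apply: (le_trans (powR_le_cube n3 _)); first by rewrite ler1n.
by rewrite -natrX ler_nat.
Qed.

Lemma absmomentD (f h : T -> R) : measurable_fun [set: T] f -> measurable_fun [set: T] h ->
  absmoment P nu (fun x => f x + h x)%R <= 8%:E * (absmoment P nu f + absmoment P nu h).
Proof.
move=> mf mh; have mp (k : T -> R) : measurable_fun [set: T] k -> measurable_fun [set: T] (fun x => (`|k x| `^ nu)%:E).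
  by move=> mk; apply/measurable_EFinP; exact: measurable_abspow.
have p0 (k : T -> R) x : 0 <= (`|k x| `^ nu)%:E by rewrite lee_fin powR_ge0.
rewrite /absmoment -ge0_integralDT//; [|exact: mp|exact: mp].
rewrite -ge0_integralZT//; last 2 first.
- by apply: emeasurable_funD; exact: mp.
- by move=> x; rewrite adde_ge0.
apply: ge0_le_integralT => //.
- by apply: mp; exact: measurable_funD.
- by apply: measurable_funeM; apply: emeasurable_funD; exact: mp.
- by move=> x; rewrite -EFinD -EFinM lee_fin powR_normD.
Qed.

Lemma absmomentN (f : T -> R) : absmoment P nu (fun x => - f x)%R = absmoment P nu f.
Proof. by apply: eq_integral => x _; rewrite normrN. Qed.

Lemma absmoment_cst (c : R) : absmoment P nu (fun=> c) = (`|c| `^ nu)%:E.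
Proof. exact: integral_cstT. Qed.

Lemma absmoment_sqr (f : T -> R) : sq P f ->
  (Num.sqrt (Ex P (fun x => f x ^+ 2)%R) `^ nu)%:E <= absmoment P nu f.
Proof.
move=> sf; set v := Ex P _; have v0 : (0 <= v)%R by apply: Ex_ge0 => x; exact: sqr_ge0.
have [e|vn] := eqVneq v 0%R.
  rewrite e sqrtr0 powR0 ?absmoment_ge0// gt_eqF//.
  by case/andP: nu23 => h _; apply: lt_le_trans h.
by apply: (absmoment_lyapunov nu23 sf); rewrite ?sqr_sqrtr// sqrtr_gt0 lt_neqAle eq_sym vn.
Qed.

Lemma absmoment_mean (f : T -> R) : sq P f -> (`|Ex P f| `^ nu)%:E <= absmoment P nu f.
Proof.
move=> sf; apply: le_trans (absmoment_sqr sf); rewrite lee_fin.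
by apply: powR_le_of_le => //; rewrite -sqrtr_sqr ler_wsqrtr//; exact: Ex_sqr_le.
Qed.
End AbsMoments.

Section Kernels.
Context (R : realType) d (T : measurableType d) (rho : probability T R).
Implicit Types (w : T * T -> R).
Local Notation rr := (pprod rho rho).

(** Every slice, and not just almost every one, is square integrable, so that [wbar w] is a genuine
    integral at each point and the identities below hold pointwise. *)
Definition kernel w := [/\ forall x y, w (x, y) = w (y, x), sq rr w &
  forall x, sq rho (fun y => w (x, y))].

Definition wbar w (x : T) : R := Ex rho (fun y => w (x, y)).

Definition dcenter w (z : T * T) : R := (w z - wbar w z.1) + (Ex rr w - wbar w z.2).

Lemma sq_wbar w : kernel w -> sq rho (wbar w).
Proof.
move=> [_ sw sx]; split; first exact: (measurable_Ex_prod (sq_intg sw)).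
apply: (intg_le _ _ (intg_Ex sw.2)).
  by apply: measurable_funX; exact: (measurable_Ex_prod (sq_intg sw)).
by move=> x; rewrite ger0_norm ?sqr_ge0//; exact: Ex_sqr_le.
Qed.

Lemma Ex_wbar w : kernel w -> Ex rho (wbar w) = Ex rr w.
Proof. by move=> [_ sw _]; rewrite (Ex_prod (sq_intg sw)). Qed.

Lemma kernelD w w' : kernel w -> kernel w' -> kernel (fun z => w z + w' z).
Proof.
move=> [a b c] [a' b' c']; split; [by move=> x y; rewrite a a'|exact: sqD|].
by move=> x; exact: sqD.
Qed.

Lemma kernelZ c w : kernel w -> kernel (fun z => c * w z).
Proof. by move=> [a b e]; split; [move=> x y; rewrite a|exact: sqZ|move=> x; exact: sqZ]. Qed.

Lemma kernel_cst c : kernel (fun=> c).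
Proof. by split => // [|x]; exact: sq_cst. Qed.

Lemma kernelB w w' : kernel w -> kernel w' -> kernel (fun z => w z - w' z).
Proof.
move=> k k'; rewrite (_ : (fun z => _) = (fun z => w z + (-1) * w' z)).
  by apply: kernelD => //; exact: kernelZ.
by apply/funext => z; rewrite mulN1r.
Qed.

Lemma kernel_sep f : sq rho f -> kernel (fun z => f z.1 + f z.2).
Proof.
move=> sf; split; first by move=> x y; rewrite addrC.
- by apply: sqD; [exact: sq_fst|exact: sq_snd].
- by move=> x; exact: (sqD (sq_cst rho (f x)) sf).
Qed.

Lemma dcenterE w : dcenter w = (fun z => (w z - (wbar w z.1 + wbar w z.2)) + Ex rr w).
Proof. by apply/funext => z; rewrite /dcenter; ring. Qed.

Lemma kernel_dcenter w : kernel w -> kernel (dcenter w).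
Proof.
move=> kw; rewrite dcenterE; apply: kernelD; last exact: kernel_cst.
by apply: kernelB => //; apply: kernel_sep; exact: sq_wbar.
Qed.

Lemma dcenter_mean0 w x : kernel w -> Ex rho (fun y => dcenter w (x, y)) = 0.
Proof.
move=> kw; have [_ _ sx] := kw; have sb := sq_wbar kw; rewrite /dcenter /=.
have i1 := sq_intg (sx x); have i2 := intg_cst rho (wbar w x).
have i3 := intg_cst rho (Ex rr w); have i4 := sq_intg sb.
rewrite (ExD (intgB i1 i2) (intgB i3 i4)) (ExB i1 i2) (ExB i3 i4) !Ex_cst Ex_wbar//.
by rewrite -/(wbar w x) !subrr addr0.
Qed.

Lemma wbarD w w' x : kernel w -> kernel w' -> wbar (fun z => w z + w' z) x = wbar w x + wbar w' x.
Proof. by move=> [_ _ s] [_ _ s']; rewrite /wbar ExD//; exact: sq_intg. Qed.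

Lemma dcenterD w w' z : kernel w -> kernel w' ->
  dcenter (fun z => w z + w' z) z = dcenter w z + dcenter w' z.
Proof.
move=> k k'; rewrite /dcenter !wbarD// ExD; first by ring.
- by have [_ s _] := k; exact: sq_intg.
- by have [_ s _] := k'; exact: sq_intg.
Qed.

Lemma dcenterZ c w z : kernel w -> dcenter (fun z => c * w z) z = c * dcenter w z.
Proof.
move=> [_ s sx]; rewrite /dcenter /wbar !ExZ; first by ring.
all: exact: sq_intg.
Qed.

Lemma dcenter_cst c z : dcenter (fun=> c) z = 0.
Proof. by rewrite /dcenter /wbar !Ex_cst !subrr addr0. Qed.

Lemma dcenterB w w' z : kernel w -> kernel w' ->
  dcenter (fun z => w z - w' z) z = dcenter w z - dcenter w' z.
Proof.
move=> k k'; rewrite (_ : (fun z => _) = (fun z => w z + (-1) * w' z)).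
  by rewrite dcenterD ?dcenterZ ?mulN1r//; exact: kernelZ.
by apply/funext => t; rewrite mulN1r.
Qed.

(** By Jensen's inequality each of the four terms of [dcenter w] has [nu]-th moment at most that of
    [w]. Two rounds of [absmomentD] give 8 (8 * 2 + 8 * 2) = 256. *)
Lemma absmoment_dcenter w nu : 2 <= nu <= 3 -> kernel w ->
  (absmoment rr nu (dcenter w) <= 256%:E * absmoment rr nu w)%E.
Proof.
move=> nu23 kw; have [ws sw sx] := kw; have [mb _] := sq_wbar kw.
set A := absmoment rr nu w; have A0 : (0 <= A)%E by exact: absmoment_ge0.
have mp : measurable_fun [set: T] (fun x => (`|wbar w x| `^ nu)%:E).
  by apply/measurable_EFinP; exact: measurable_abspow.
have p0 x : (0 <= (`|wbar w x| `^ nu)%:E)%E by rewrite lee_fin powR_ge0.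
have mw : measurable_fun [set: T * T] (fun z => (`|w z| `^ nu)%:E).
  by apply/measurable_EFinP; apply: measurable_abspow; exact: sw.1.
have w0 z : (0 <= (`|w z| `^ nu)%:E)%E by rewrite lee_fin powR_ge0.
have bA : (\int[rho]_x (`|wbar w x| `^ nu)%:E <= A)%E.
  rewrite /A /absmoment (tonelli rho rho mw w0); apply: ge0_le_integralT => //.
    exact: (measurable_fun_fubini_tonelli_F _ mw).
  by move=> x; exact: absmoment_mean.
have m1 : measurable_fun [set: T * T] (fun z => wbar w z.1) by exact: (measurableT_comp mb measurable_fst).
have m2 : measurable_fun [set: T * T] (fun z => wbar w z.2) by exact: (measurableT_comp mb measurable_snd).
have m1p : measurable_fun [set: T * T] (fun z => (`|wbar w z.1| `^ nu)%:E).
  exact: (measurableT_comp mp measurable_fst).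
have m2p : measurable_fun [set: T * T] (fun z => (`|wbar w z.2| `^ nu)%:E).
  exact: (measurableT_comp mp measurable_snd).
have A1 : (absmoment rr nu (fun z => - wbar w z.1)%R <= A)%E.
  rewrite absmomentN; apply: le_trans bA; rewrite /absmoment.
  rewrite le_eqVlt; apply/orP; left; apply/eqP.
  transitivity (\int[rho]_x \int[rho]_y (`|wbar w x| `^ nu)%:E)%E.
    exact: (tonelli rho rho m1p (fun z => p0 z.1)).
  by apply: eq_integral => x _; exact: integral_cste.
have A2 : (absmoment rr nu (fun z => - wbar w z.2)%R <= A)%E.
  rewrite absmomentN; apply: le_trans bA; rewrite /absmoment.
  rewrite le_eqVlt; apply/orP; left; apply/eqP.
  transitivity (\int[rho]_y \int[rho]_x (`|wbar w y| `^ nu)%:E)%E.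
    exact: (tonelli2 rho rho m2p (fun z => p0 z.2)).
  by apply: eq_integral => x _; exact: integral_cste.
have A3 : (absmoment rr nu (fun=> Ex rr w) <= A)%E.
  by rewrite absmoment_cst; exact: absmoment_mean.
have mN1 : measurable_fun [set: T * T] (fun z => - wbar w z.1) by exact: measurable_funN.
have mN2 : measurable_fun [set: T * T] (fun z => - wbar w z.2) by exact: measurable_funN.
pose X1 (z : T * T) : R := w z - wbar w z.1; pose X2 (z : T * T) : R := Ex rr w - wbar w z.2.
have mX1 : measurable_fun [set: T * T] X1 by apply: measurable_funB => //; exact: sw.1.
have mX2 : measurable_fun [set: T * T] X2 by exact: measurable_funB.
have e8 : (0 <= 8%:E :> \bar R)%E by rewrite lee_fin.
have B1 : (absmoment rr nu X1 <= 8%:E * (A + A))%E.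
  apply: (le_trans (absmomentD rr nu23 sw.1 mN1)); apply: lee_wpmul2l => //.
  exact: (leeD (lexx A) A1).
have B2 : (absmoment rr nu X2 <= 8%:E * (A + A))%E.
  apply: (le_trans (absmomentD rr nu23 (measurable_cst (Ex rr w)) mN2)); apply: lee_wpmul2l => //.
  exact: (leeD A3 A2).
apply: (le_trans (absmomentD rr nu23 mX1 mX2)).
apply: (@le_trans _ _ (8%:E * (8%:E * (A + A) + 8%:E * (A + A)))%E).
  by apply: lee_wpmul2l => //; exact: (leeD B1 B2).
clear bA A1 A2 A3 B1 B2; clearbody A; case: A A0 => [a| |] A0 //.
  by rewrite !(=^~ EFinD, =^~ EFinM) lee_fin le_eqVlt; apply/orP; left; apply/eqP; ring.
by rewrite [leRHS]gt0_muley ?leey// lte_fin.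
Qed.

(* Orthogonality of the projections in the Hoeffding decomposition. *)
Lemma Ex_hoeffding w : kernel w ->
  Ex rr (fun z => (w z - Ex rr w) ^+ 2) =
  2 * Ex rho (fun x => (wbar w x - Ex rr w) ^+ 2) + Ex rr (fun z => dcenter w z ^+ 2).
Proof.
move=> kw; set D := Ex rr w; pose g x := wbar w x - D.
have sg : sq rho g by apply: sqB; [exact: sq_wbar|exact: sq_cst].
have g0 : Ex rho g = 0.
  by rewrite /g ExB ?Ex_cst ?Ex_wbar ?subrr//; [exact: (sq_intg (sq_wbar kw))|exact: intg_cst].
have [hs sh shx] := kernel_dcenter kw.
have e z : w z - D = (g z.1 + g z.2) + dcenter w z by rewrite /g /dcenter -/D; ring.
have s1 := sq_fst rho sg; have s2 := sq_snd rho sg.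
have i11 := s1.2; have i22 := s2.2; have i12 := sq_mul s1 s2; have ihh := sh.2.
have i1h := sq_mul s1 sh; have i2h := sq_mul s2 sh.
have E1h : Ex rr (fun z => g z.1 * dcenter w z) = 0.
  rewrite (Ex_prod i1h) -[RHS](Ex_cst rho 0); congr Ex; apply/funext => x /=.
  by rewrite ExZ ?dcenter_mean0 ?mulr0//; exact: sq_intg.
have E2h : Ex rr (fun z => g z.2 * dcenter w z) = 0.
  rewrite (Ex_swap _ _ (intg_measurable i2h)) -[RHS]E1h; congr Ex; apply/funext => -[x y] /=.
  by rewrite hs.
have E12 : Ex rr (fun z => g z.1 * g z.2) = 0.
  by rewrite (Ex_prodM (sq_intg sg) (sq_intg sg)) g0 mul0r.
rewrite (_ : (fun z => _) = (fun z => ((g z.1 ^+ 2 + g z.2 ^+ 2) + 2 * (g z.1 * g z.2)) +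
    (2 * (g z.1 * dcenter w z) + (2 * (g z.2 * dcenter w z) + dcenter w z ^+ 2)))); last first.
  by apply/funext => z; rewrite e; ring.
have j1 := intgD i11 i22; have j2 := intgZ 2 i12; have j3 := intgZ 2 i1h; have j4 := intgZ 2 i2h.
rewrite (ExD (intgD j1 j2) (intgD j3 (intgD j4 ihh))) (ExD j1 j2) (ExD i11 i22).
rewrite (ExD j3 (intgD j4 ihh)) (ExD j4 ihh) (ExZ _ i12) (ExZ _ i1h) (ExZ _ i2h).
rewrite E1h E2h E12 (Ex_fst _ sg.2) (Ex_snd _ sg.2) -/g.
ring.
Qed.

Lemma Ex_sqrD_le (f h : T * T -> R) : sq rr f -> sq rr h ->
  Ex rr (fun z => (f z + h z) ^+ 2) <= 2 * Ex rr (fun z => f z ^+ 2) + 2 * Ex rr (fun z => h z ^+ 2).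
Proof.
move=> sf sh; rewrite -(ExZ _ sf.2) -(ExZ _ sh.2) -ExD; [|exact: (intgZ 2 sf.2)|exact: (intgZ 2 sh.2)].
apply: Ex_le; [exact: (sqD sf sh).2|by apply: intgD; apply: intgZ; [exact: sf.2|exact: sh.2]|].
by move=> z; have := sqr_ge0 (f z - h z); rewrite sqrrB sqrrD !mulr2n; lra.
Qed.

(** Double centring is an orthogonal projection: drop the linear part in [Ex_hoeffding], then the
    square of the mean. *)
Lemma Ex_dcenter2_le w : kernel w -> Ex rr (fun z => dcenter w z ^+ 2) <= Ex rr (fun z => w z ^+ 2).
Proof.
move=> kw; have [_ sw _] := kw; set D := Ex rr w.
apply: (@le_trans _ _ (Ex rr (fun z => (w z - D) ^+ 2))).
  rewrite Ex_hoeffding// lerDr mulr_ge0// Ex_ge0// => x; exact: sqr_ge0.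
have i := sq_intg sw; have i2 := sw.2; have ic := intg_cst rr (D ^+ 2).
rewrite (_ : (fun z => _) = (fun z => (w z ^+ 2 + (- (2 * D)) * w z) + D ^+ 2)); last first.
  by apply/funext => z; ring.
rewrite (ExD (intgD i2 (intgZ _ i)) ic) (ExD i2 (intgZ _ i)) (ExZ _ i) Ex_cst -/D.
by have := sqr_ge0 D; rewrite expr2; lra.
Qed.
End Kernels.

Section Usum.
Context (R : realType) d (T : measurableType d).
Implicit Types (r : T * T -> R) (f : T -> R).

Lemma usumB r r' n (t : n.-tuple T) : usum (fun z => r z - r' z) t = usum r t - usum r' t.
Proof. by rewrite /usum -sumrB; apply: eq_bigr => i _; rewrite -sumrB. Qed.

Lemma usum_sep f n (t : n.-tuple T) :
  usum (fun z => f z.1 + f z.2) t = 2 * n.-1%:R * \sum_i f (tnth t i).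
Proof.
rewrite /usum; under eq_bigr do rewrite big_split /=; rewrite big_split /=.
have c i : \sum_(j < n | j != i) f (tnth t i) = n.-1%:R * f (tnth t i).
  by rewrite sumr_const cardC1 card_ord mulr_natl.
have -> : \sum_(i < n) \sum_(j < n | j != i) f (tnth t j) =
    \sum_(i < n) \sum_(j < n | j != i) f (tnth t i).
  rewrite (exchange_big_dep xpredT)//=; apply: eq_bigr => i _; apply: eq_bigl => j.
  by rewrite eq_sym.
under eq_bigr do rewrite c; rewrite -mulr_sumr; ring.
Qed.
End Usum.

(** * Arithmetic of the error terms *)

Section Numerics.
Context (R : realType).

(** With sqrt (n (n-1)) >= n/2 and delta >= v^2 the bracketed power is at most 4^nu / (sigma n
    v^2)^nu. The powers of n then combine to n^(1 - nu/2), and the hypothesis on [v] leaves a single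
    factor v. The constant is 2^8 2^4 2^12 4^3 = 2^30. *)
Lemma lindeberg_term (n : nat) (nu sigma delta v N : R) : (1 < n)%N -> 2 <= nu <= 3 ->
  0 < sigma -> 0 < v -> v ^+ 2 <= delta -> 0 <= N ->
  n%:R `^ (1 - nu / 2) * (N / sigma `^ nu) <= v `^ (2 * nu + 1) ->
  n%:R * (256 * (2 * (sigma * Num.sqrt (n * n.-1)%:R)^-1 / delta) `^ nu * n%:R *
    n%:R `^ ((nu - 2) / 2) * (16 * (4096 * N))) <= 2 ^+ 30 * v.
Proof.
move=> n1 /andP[nu2 nu3] s0 v0 vd N0 hv.
have nu0 : 0 <= nu by lra.
set X : R := n%:R; have X0 : 0 < X by rewrite ltr0n; apply: ltn_trans n1.
set q := Num.sqrt _; have d0 : 0 < delta by apply: lt_le_trans vd; rewrite exprn_gt0.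
have qX : X / 2 <= q.
  have X2 : 0 <= X / 2 by rewrite divr_ge0 ?(ltW X0).
  rewrite -[X / 2]ger0_norm// -sqrtr_sqr ler_wsqrtr// natrM -/X.
  have -> : n.-1%:R = X - 1 :> R by rewrite /X -subn1 natrB// ltnW.
  have X2' : 2 <= X by rewrite ler_nat.
  by rewrite expr2; nra.
have q0 : 0 < q by apply: lt_le_trans qX; rewrite divr_gt0.
set y := (2 * _ / delta) `^ nu.
have Bn : 0 < X `^ nu by rewrite powR_gt0.
have Sn : 0 < sigma `^ nu by rewrite powR_gt0.
have Vn : 0 < v `^ (2 * nu) by rewrite powR_gt0.
have hy : y <= 64 / (sigma `^ nu * X `^ nu * v `^ (2 * nu)).
  have -> : v `^ (2 * nu) = (v ^+ 2) `^ nu by rewrite -powR_mulrn ?(ltW v0)// -powRrM.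
  have v2 : 0 < v ^+ 2 by rewrite exprn_gt0.
  have sX0 : 0 <= sigma * X by exact: (mulr_ge0 (ltW s0) (ltW X0)).
  rewrite -(powRM nu (ltW s0) (ltW X0)) -(powRM nu sX0 (ltW v2)).
  set w := sigma * X * v ^+ 2; have w0 : 0 < w by rewrite !mulr_gt0.
  apply: (@le_trans _ _ ((4 / w) `^ nu)).
    apply: powR_le_of_le => //; first by rewrite !divr_ge0 ?mulr_ge0 ?invr_ge0 ?mulr_ge0 ?(ltW s0) ?(ltW q0) ?(ltW d0).
    rewrite ler_pdivlMr// /w.
    have -> : 2 / (sigma * q) / delta * (sigma * X * v ^+ 2) = (2 * X / q) * (v ^+ 2 / delta).
      by field; rewrite !gt_eqF.
    have h1 : v ^+ 2 / delta <= 1 by rewrite ler_pdivrMr// mul1r.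
    have h2 : 2 * X / q <= 4 by rewrite ler_pdivrMr//; lra.
    have h3 : 0 <= 2 * X / q by rewrite divr_ge0 ?mulr_ge0 ?(ltW X0) ?(ltW q0).
    by apply: (le_trans (ler_wpM2l h3 h1)); rewrite mulr1.
  rewrite powRM ?invr_ge0 ?(ltW w0)//; apply: ler_pM; rewrite ?powR_ge0//.
    apply: (le_trans (powR_le_cube nu3 _)); first by rewrite ler1n.
    by rewrite -natrX ler_nat.
  by rewrite -powR_inv1 ?(ltW w0)// -powRrM mulrC powRrM powR_inv1// powR_ge0.
have AB : X * X * X `^ ((nu - 2) / 2) = X `^ (1 - nu / 2) * X `^ nu.
  rewrite -[in X in X * _]expr2 -powR_mulrn ?(ltW X0)// -!powRD ?(gt_eqF X0) ?implybT//.
  by congr (_ `^ _); field.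
have hv' : X `^ (1 - nu / 2) * (N / sigma `^ nu) <= v `^ (2 * nu) * v.
  apply: (le_trans hv); rewrite powRD ?powRr1 ?(ltW v0)//; rewrite (gt_eqF v0) implybT//.
set A := X `^ (1 - nu / 2) in AB hv'; set B := X `^ nu in Bn hy AB.
set Sg := sigma `^ nu in Sn hy hv'; set W := v `^ (2 * nu) in Vn hy hv'.
have A0 : 0 <= A by exact: powR_ge0.
have -> : X * (256 * y * X * X `^ ((nu - 2) / 2) * (16 * (4096 * N))) =
    2 ^+ 24 * N * (X * X * X `^ ((nu - 2) / 2)) * y by rewrite -!natrX; ring.
rewrite AB; apply: (@le_trans _ _ (2 ^+ 24 * N * (A * B) * (64 / (Sg * B * W)))).
  by rewrite ler_wpM2l// !mulr_ge0// ltW.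
have -> : 2 ^+ 24 * N * (A * B) * (64 / (Sg * B * W)) = 2 ^+ 30 * (A * (N / Sg) / W).
  by rewrite -!natrX; field; rewrite !gt_eqF.
by rewrite ler_wpM2l ?exprn_ge0// ler_pdivrMr// [v * _]mulrC.
Qed.

Lemma pow5_div (p delta : R) : 0 <= p -> p ^+ 2 <= delta -> 0 < delta -> p ^+ 5 / delta ^+ 2 <= p.
Proof.
move=> p0 pd d0; rewrite ler_pdivrMr ?exprn_gt0// exprS ler_wpM2l// (exprM p 2 2).
by rewrite ler_pXn2r// nnegrE ?sqr_ge0// ltW.
Qed.
End Numerics.

(** * Truncated expansions as quadratic forms in centred features *)

Section Features.
Context (R : realType) d (T : measurableType d) (rho : probability T R) (K : nat).
Variables (phi : 'I_K -> T -> R) (lam tau : 'I_K -> R) (S : 'M[R]_K).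
Local Notation rr := (pprod rho rho).
Local Notation g := (gauss R).
Hypothesis phi2 : forall k, sq rho (phi k).

Definition centered (k : 'I_K) (x : T) : R := phi k x - Ex rho (phi k).
Definition feature (x : T) : K.-tuple R := [tuple centered k x | k < K].
Definition expansion (z : T * T) : R := \sum_k lam k * phi k z.1 * phi k z.2.

Hypothesis St : S^T = S.
Hypothesis SS : forall i j, (S *m S) i j = Ex rho (fun x => centered i x * centered j x).
Hypothesis Stau : char_poly (S *m diag_mx (\row_k lam k) *m S) = \prod_(k < K) ('X - (tau k)%:P).

Lemma sq_centered k : sq rho (centered k).
Proof. by apply: sqB => //; exact: sq_cst. Qed.

Lemma Ex_centered k : Ex rho (centered k) = 0.
Proof. by rewrite ExB ?Ex_cst ?subrr//; [exact: sq_intg|exact: intg_cst]. Qed.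

Lemma featureE x k : tnth (feature x) k = centered k x.
Proof. by rewrite tnth_mktuple. Qed.

Lemma measurable_feature : measurable_fun [set: T] feature.
Proof.
apply/measurable_fun_tnthP => k.
have -> : (fun t : K.-tuple R => tnth t k) \o feature = centered k.
  by apply/funext => x /=; rewrite featureE.
exact: (sq_centered k).1.
Qed.

Lemma kernel_expansion : kernel rho expansion.
Proof.
have e : expansion = (fun z => \sum_k lam k * (phi k z.1 * phi k z.2)).
  by apply/funext => z; apply: eq_bigr => k _; rewrite mulrA.
rewrite e; split.
- by move=> x y; apply: eq_bigr => k _ /=; rewrite [phi k x * _]mulrC.
- apply: sq_sum => k; apply: sqZ; split.
    exact: (intg_measurable (intg_prodM (sq_intg (phi2 k)) (sq_intg (phi2 k)))).
  by under eq_fun do rewrite exprMn; exact: (intg_prodM (phi2 k).2 (phi2 k).2).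
- by move=> x /=; apply: sq_sum => k; apply: sqZ; exact: sqZ.
Qed.

Lemma dcenter_expansion z : dcenter rho expansion z = bil lam (feature z.1) (feature z.2).
Proof.
pose m k := Ex rho (phi k).
have ik k := sq_intg (phi2 k).
have wE x : wbar rho expansion x = \sum_k lam k * phi k x * m k.
  rewrite /wbar /expansion /= Ex_sum; last by move=> k; apply: intgZ.
  by apply: eq_bigr => k _; rewrite ExZ.
have DE : Ex rr expansion = \sum_k lam k * m k * m k.
  rewrite -(Ex_wbar kernel_expansion); under [X in Ex _ X]funext do rewrite wE.
  have e : (fun x => \sum_k lam k * phi k x * m k) = (fun x => \sum_k (lam k * m k) * phi k x).
    by apply/funext => x; apply: eq_bigr => k _; ring.
  rewrite e Ex_sum; last by move=> k; apply: intgZ.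
  by apply: eq_bigr => k _; rewrite ExZ.
rewrite /dcenter !wE DE /expansion /bil -!sumrB -big_split; apply: eq_bigr => k _ /=.
by rewrite !featureE /centered -/(m k); ring.
Qed.

(** Take M = S J with J orthogonal and S Lambda S = J diag(tau) J^T. Then M M^T = S S is the
    covariance and M^T Lambda M is diagonal. No inverse of S is involved, so singular covariances
    are allowed. *)
Lemma feature_factor : exists2 M : 'M[R]_K,
  (forall i j, Ex rho (fun x => tnth (feature x) i * tnth (feature x) j) = (M *m M^T) i j) &
  M^T *m diag_mx (\row_k lam k) *m M = diag_mx (\row_k tau k).
Proof.
have At : (S *m diag_mx (\row_k lam k) *m S)^T = S *m diag_mx (\row_k lam k) *m S.
  by rewrite !trmx_mul tr_diag_mx St mulmxA.
have [J JJ AE] := spectral At Stau; have J'J := mulmx1C JJ.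
exists (S *m J).
  move=> i j; rewrite trmx_mul St mulmxA -(mulmxA S) JJ mulmx1 SS.
  by congr Ex; apply/funext => x; rewrite !featureE.
rewrite trmx_mul St; set L := diag_mx (\row_k lam k).
have -> : J^T *m S *m L *m (S *m J) = J^T *m (S *m L *m S) *m J by rewrite !mulmxA.
by rewrite AE !mulmxA J'J mul1mx -mulmxA J'J mulmx1.
Qed.

Let Fsq k : sq rho (fun x => tnth (feature x) k).
Proof. by under eq_fun do rewrite featureE; exact: sq_centered. Qed.
Let F0 k : Ex rho (fun x => tnth (feature x) k) = 0.
Proof. by under [X in Ex _ X]funext do rewrite featureE; exact: Ex_centered. Qed.

Lemma Ex_dcenter_expansion2 :
  Ex rr (fun z => dcenter rho expansion z ^+ 2) = \sum_k tau k ^+ 2.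
Proof.
have [M FM Mtau] := feature_factor.
have [_ <-] := sq_bil_features measurable_feature Fsq F0 FM Mtau.
by congr Ex; apply/funext => z; rewrite dcenter_expansion.
Qed.

Lemma features_Pr (nu N : R) n (c delta t : R) : 2 <= nu <= 3 ->
  (absmoment rr nu (dcenter rho expansion) <= N%:E)%E -> (0 < n)%N -> 0 <= c -> 0 < delta ->
  let E := n%:R * (256 * (2 * c / delta) `^ nu * n%:R * n%:R `^ ((nu - 2) / 2) * (16 * N)) +
    2 * c ^+ 2 * n%:R * (\sum_k tau k ^+ 2) / delta ^+ 2 in
  Pr (pw rho n) [set w | t < c * usum (dcenter rho expansion) w] <=
    Pr (pw g K) [set y | t - 4 * delta < c * n%:R * gquad tau y] + E /\
  Pr (pw g K) [set y | t < c * n%:R * gquad tau y] <=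
    Pr (pw rho n) [set w | t - 4 * delta < c * usum (dcenter rho expansion) w] + E.
Proof.
move=> nu23 hN n0 c0 d0 E; have [M FM Mtau] := feature_factor.
have hN' : (\int[rr]_z (`|bil lam (feature z.1) (feature z.2)| `^ nu)%:E <= N%:E)%E.
  by apply: le_trans hN; under [leRHS]eq_integral do rewrite dcenter_expansion.
have e : usum (dcenter rho expansion) (n := n) = qsum lam feature (n := n).
  apply/funext => w; rewrite qsumE; apply: eq_bigr => i _; apply: eq_bigr => j _.
  by rewrite dcenter_expansion.
by rewrite e; exact: (universality_Pr measurable_feature Fsq F0 FM Mtau nu23 hN' t n0 c0 d0).
Qed.
End Features.

(** * The bound for kernels with square integrable slices *)

Lemma gquad_anticoncentration (R : realType) K (tau : 'I_K -> R) (x e : R) :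
  0 < \sum_k tau k ^+ 2 -> 0 < e ->
  Pr (pw (gauss R) K) [set y | `|gquad tau y - x| <= e] <=
    20 * Num.sqrt (e / Num.sqrt (\sum_k tau k ^+ 2)).
Proof.
move=> V0 e0; apply: anticoncentration => //; first exact: measurable_gquad.
exact: cfsqr_gquad.
Qed.

Lemma gquadZ (R : realType) K (a : R) (tau : 'I_K -> R) y :
  gquad (fun k => a * tau k) y = a * gquad tau y.
Proof. by rewrite /gquad mulr_sumr; apply: eq_bigr => k _; rewrite mulrA. Qed.

Lemma measurable_near (R : realType) d (T : measurableType d) (f : T -> R) (x e : R) :
  measurable_fun [set: T] f -> measurable [set y | `|f y - x| <= e].
Proof.
move=> mf; have -> : [set y | `|f y - x| <= e] = ~` [set y | e < `|f y - x|].
  by apply/seteqP; split => y /=; rewrite leNgt => /negP.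
by apply: measurableC; apply: (measurable_norm_gt e); exact: measurable_funB.
Qed.

(** The shape of both chains in [core_bound]. Apart from [B] the coefficients of each variable add
    up to less than 200, so 2 B, that is 2^31 for B = 2^30, covers all. *)
Lemma error_sum (R : realType) (A C B p s v : R) : 0 <= p -> 0 <= s -> 0 <= v -> 200 <= B ->
  A <= C + (8 * s + p) + (B * v + 8 * p) + 8 * p + 80 * (p + s + v) ->
  A - C <= 2 * B * (p + s + v).
Proof.
move=> p0 s0 v0 B200.
have bp := ler_wpM2r p0 B200; have bs := ler_wpM2r s0 B200; have bv := ler_wpM2r v0 B200.
by rewrite -mulrA !mulrDr; lra.
Qed.

Section Core.
Context (R : realType) d (T : measurableType d) (rho : probability T R) (K : nat).
Variables (phi : 'I_K -> T -> R) (lam tau : 'I_K -> R) (S : 'M[R]_K) (u : T * T -> R).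
Local Notation rr := (pprod rho rho).
Local Notation g := (gauss R).
Hypothesis phi2 : forall k, sq rho (phi k).
Hypothesis St : S^T = S.
Hypothesis SS : forall i j, (S *m S) i j = Ex rho (fun x => centered rho phi i x * centered rho phi j x).
Hypothesis Stau : char_poly (S *m diag_mx (\row_k lam k) *m S) = \prod_(k < K) ('X - (tau k)%:P).
Hypothesis ku : kernel rho u.

Local Notation uK := (expansion phi lam).
Local Notation h := (dcenter rho uK).
Let kK : kernel rho uK := kernel_expansion lam phi2.
Let e z := uK z - u z.
Let D := Ex rr u.
Let V : R := \sum_k tau k ^+ 2.
Let Ee2 := Ex rr (fun z => e z ^+ 2).

Let ke : kernel rho e. Proof. exact: kernelB. Qed.

Let VE : V = Ex rr (fun z => h z ^+ 2).
Proof. by rewrite (Ex_dcenter_expansion2 phi2 St SS Stau). Qed.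

Let heq z : h z = dcenter rho u z + dcenter rho e z.
Proof. by rewrite dcenterB// addrC subrK. Qed.

Let sqdc w : kernel rho w -> sq rr (dcenter rho w).
Proof. by move=> kw; have [_ + _] := kernel_dcenter kw. Qed.

(** [h] and the double centring of [u] differ by that of the error [e], whose L2 norm is at most
    that of [e]. This and its counterpart transfer size estimates between [u] and the
    eigenvalues. *)
Lemma tau2_le : V <= 2 * Ex rr (fun z => dcenter rho u z ^+ 2) + 2 * Ee2.
Proof.
rewrite VE; under [X in Ex _ X]funext do rewrite heq.
apply: (le_trans (Ex_sqrD_le (sqdc ku) (sqdc ke))).
by rewrite lerD2l ler_wpM2l//; exact: Ex_dcenter2_le.
Qed.

Lemma tau2_ge : Ex rr (fun z => dcenter rho u z ^+ 2) <= 2 * V + 2 * Ee2.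
Proof.
rewrite VE; have -> : dcenter rho u = (fun z => h z + (-1) * dcenter rho e z).
  by apply/funext => z; rewrite heq mulN1r addrK.
apply: (le_trans (Ex_sqrD_le (sqdc kK) (sqZ (-1) (sqdc ke)))).
rewrite lerD2l ler_wpM2l//.
rewrite (_ : (fun z => _) = (fun z => dcenter rho e z ^+ 2)); first exact: Ex_dcenter2_le.
by apply/funext => z; rewrite mulN1r sqrrN.
Qed.

Variables (n : nat) (sigma nu N p s v : R).
Hypothesis n1 : (1 < n)%N.
Hypothesis nu23 : 2 <= nu <= 3.
Hypothesis sigma0 : 0 < sigma.
Let n' : R := n.-1%:R.
Let sc2 := Ex rho (fun x => (wbar rho u x - D) ^+ 2).
Hypothesis sigma2 : Ex rr (fun z => (u z - D) ^+ 2) = sigma ^+ 2.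
(** True for large K. The factor n' lets the expansion error be charged to the term [p]. *)
Hypothesis eN2 : Ee2 <= sigma ^+ 2 / (1000 * n').
Hypothesis uN : (absmoment rr nu (fun z => (u z - D)%R) <= N%:E)%E.
Hypothesis eN : (absmoment rr nu e <= N%:E)%E.
Hypotheses (p0 : 0 < p) (s0 : 0 <= s) (v0 : 0 < v).
Hypothesis pE : p ^+ 5 = n'^-1.
Hypothesis sE : s ^+ 5 = n' * sc2 / sigma ^+ 2.
Hypothesis vE : n%:R `^ (1 - nu / 2) * (N / sigma `^ nu) <= v `^ (2 * nu + 1).
Hypothesis s48 : s ^+ 5 <= 48^-1.

Let c : R := (sigma * Num.sqrt (n * n.-1)%:R)^-1.
(* The smoothing errors are of order [p^5 / delta^2], [s^5 / delta^2] and
   [v^(2 nu + 1) / delta^nu], the anti-concentration error of order [sqrt delta];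
   for this choice of [delta] all of them are [O(p + s + v)]. *)
Let delta : R := p ^+ 2 + s ^+ 2 + v ^+ 2.
Let n'1 : 1 <= n'. Proof. by rewrite ler1n -subn1 subn_gt0. Qed.
Let n'0 : 0 < n'. Proof. exact: lt_le_trans n'1. Qed.
Let nE : n%:R = n' + 1 :> R. Proof. by rewrite natr1 prednK// ltnW. Qed.
Let n0 : (0 < n)%N. Proof. exact: ltnW. Qed.
Let sg2 : 0 < sigma ^+ 2. Proof. by rewrite exprn_gt0. Qed.
Let delta0 : 0 < delta.
Proof. by rewrite ltr_wpDr ?sqr_ge0// ltr_wpDr ?sqr_ge0// exprn_gt0. Qed.
Let pd : p ^+ 2 <= delta. Proof. by rewrite /delta -addrA lerDl addr_ge0 ?sqr_ge0. Qed.
Let sd : s ^+ 2 <= delta. Proof. by rewrite /delta addrAC lerDr addr_ge0 ?sqr_ge0. Qed.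
Let vd : v ^+ 2 <= delta. Proof. by rewrite lerDr addr_ge0 ?sqr_ge0. Qed.
Let pdiv : p ^+ 5 / delta ^+ 2 <= p. Proof. exact: pow5_div (ltW p0) pd delta0. Qed.
Let sdiv : s ^+ 5 / delta ^+ 2 <= s. Proof. exact: pow5_div s0 sd delta0. Qed.
Let d2 : 0 < delta ^+ 2. Proof. by rewrite exprn_gt0. Qed.
Let p5 : 0 < p ^+ 5. Proof. by rewrite exprn_gt0. Qed.

Let c2E : c ^+ 2 = (sigma ^+ 2 * (n%:R * n'))^-1.
Proof. by rewrite /c exprVn exprMn sqr_sqrtr// natrM. Qed.

Let Ee2' : Ee2 <= sigma ^+ 2 / 1000 * p ^+ 5.
Proof. by rewrite pE; apply: (le_trans eN2); rewrite invfM mulrA. Qed.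

Let p51 : p ^+ 5 <= 1. Proof. by rewrite pE invf_le1. Qed.

Let sc48 : sc2 <= sigma ^+ 2 / 48.
Proof.
have sc0 : 0 <= sc2 by apply: Ex_ge0 => x; exact: sqr_ge0.
have : n' * sc2 <= sigma ^+ 2 / 48 by move: s48; rewrite sE ler_pdivrMr// [_^-1 * _]mulrC.
by apply: le_trans; rewrite ler_peMl.
Qed.

Let dcu : Ex rr (fun z => dcenter rho u z ^+ 2) = sigma ^+ 2 - 2 * sc2.
Proof. by rewrite -sigma2 (Ex_hoeffding ku) addrC addKr. Qed.

Let V_le : V <= 4 * sigma ^+ 2.
Proof.
have := tau2_le; rewrite dcu; have := Ee2'; have := sg2; have := p51; have := p5.
have sc0 : 0 <= sc2 by apply: Ex_ge0 => x; exact: sqr_ge0.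
nra.
Qed.

(** The lower bound that anti-concentration requires. By the Hoeffding identity and [sc48] the
    degenerate part of [u] keeps at least 23/24 of sigma^2; [tau2_ge] halves this and subtracts a
    small error. *)
Let V_ge : sigma ^+ 2 / 6 <= V.
Proof.
have := tau2_ge; rewrite dcu; have := Ee2'; have := sc48; have := sg2; have := p51; have := p5.
nra.
Qed.

Let E1 := n%:R * (256 * (2 * c / delta) `^ nu * n%:R * n%:R `^ ((nu - 2) / 2) * (16 * (4096 * N))).

Let N0 : 0 <= N. Proof. by rewrite -lee_fin; apply: le_trans uN; exact: absmoment_ge0. Qed.

Let hN : (absmoment rr nu h <= (4096 * N)%:E)%E.
Proof.
have kuD : kernel rho (fun z => u z - D) by apply: kernelB => //; exact: kernel_cst.
have kw := kernelD kuD ke.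
have eh : h = dcenter rho (fun z => (u z - D) + e z).
  apply/funext => z; rewrite dcenterD// dcenterB ?dcenter_cst ?subr0//; exact: kernel_cst.
rewrite eh; apply: (le_trans (absmoment_dcenter nu23 kw)).
have [_ [m1 _] _] := kuD; have [_ [m2 _] _] := ke.
apply: (@le_trans _ _ (256%:E * (8%:E * (N%:E + N%:E)))%E).
  apply: lee_wpmul2l; first by rewrite lee_fin.
  apply: (le_trans (absmomentD rr nu23 m1 m2)); apply: lee_wpmul2l; first by rewrite lee_fin.
  exact: leeD.
by rewrite !(=^~ EFinD, =^~ EFinM) lee_fin; have := N0; lra.
Qed.

Let E1_le : E1 <= 2 ^+ 30 * v.
Proof. exact: lindeberg_term. Qed.

Let E2_le : 2 * c ^+ 2 * n%:R * V / delta ^+ 2 <= 8 * p.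
Proof.
apply: (@le_trans _ _ (8 * (p ^+ 5 / delta ^+ 2))); last by rewrite ler_wpM2l.
rewrite mulrA ler_wpM2r ?invr_ge0 ?(ltW d2)// c2E pE.
have nn : 0 < n%:R :> R by rewrite ltr0n.
have -> : 2 * (sigma ^+ 2 * (n%:R * n'))^-1 * n%:R * V = 2 * (V / sigma ^+ 2) * n'^-1.
  by field; rewrite !gt_eqF.
rewrite ler_wpM2r ?invr_ge0 ?(ltW n'0)// (_ : 8 = 2 * 4) ?ler_wpM2l//; last by ring.
by rewrite ler_pdivrMr.
Qed.

Let f (y : K.-tuple R) := sigma^-1 * gquad tau y.
Let b (y : K.-tuple R) := c * n%:R * gquad tau y.
(** The normalisations differ by the factor n / q with q = sqrt (n (n-1)). As n - 1 <= q <= n, the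
    squared relative error is at most 1 / (n (n-1)). *)
Let sf : sq (pw g K) (fun y => f y - b y) /\
  Ex (pw g K) (fun y => (f y - b y) ^+ 2) / delta ^+ 2 <= 8 * p.
Proof.
have [sq0 _ E2] := sq_gquad tau.
have e1 : (fun y => f y - b y) = (fun y => (sigma^-1 - c * n%:R) * gquad tau y).
  by apply/funext => y; rewrite /f /b; ring.
split; first by rewrite e1; exact: sqZ.
have -> : (fun y => (f y - b y) ^+ 2) = (fun y => (sigma^-1 - c * n%:R) ^+ 2 * gquad tau y ^+ 2).
  by apply/funext => y; rewrite /f /b; ring.
rewrite (ExZ _ sq0.2) E2 -/V.
apply: (@le_trans _ _ (8 * (p ^+ 5 / delta ^+ 2))); last by rewrite ler_wpM2l.
rewrite [8 * (_ / _)]mulrA ler_wpM2r ?invr_ge0 ?(ltW d2)// pE.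
pose q : R := Num.sqrt (n * n.-1)%:R.
have q2 : q ^+ 2 = n%:R * n' by rewrite sqr_sqrtr// natrM.
have q0 : 0 < q by rewrite sqrtr_gt0 ltr0n muln_gt0 n0 -subn1 subn_gt0.
have qn' : n' <= q.
  by rewrite -[n']ger0_norm ?(ltW n'0)// -sqrtr_sqr ler_wsqrtr// natrM -/n' nE expr2; have := n'0; nra.
have qn : q <= n%:R.
  by rewrite -[leRHS]ger0_norm ?ler0n// -sqrtr_sqr ler_wsqrtr// natrM -/n' nE expr2; have := n'0; nra.
have -> : sigma^-1 - c * n%:R = - (sigma^-1 * ((n%:R - q) / q)).
  by rewrite /c -/q; field; rewrite !gt_eqF.
rewrite sqrrN exprMn exprVn expr_div_n q2.
have a1 : (n%:R - q) ^+ 2 <= 1 by rewrite expr_le1// ?subr_ge0//; rewrite nE; lra.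
have nn : 0 < n%:R :> R by rewrite ltr0n.
have -> : (sigma ^+ 2)^-1 * ((n%:R - q) ^+ 2 / (n%:R * n')) * (2 * V) =
   2 * (V / sigma ^+ 2) * ((n%:R - q) ^+ 2 / n%:R) * n'^-1 by field; rewrite !gt_eqF.
rewrite ler_wpM2r ?invr_ge0 ?(ltW n'0)//.
have V4 : V / sigma ^+ 2 <= 4 by rewrite ler_pdivrMr.
have V0 : 0 <= V / sigma ^+ 2 by rewrite divr_ge0 ?(ltW sg2)// sumr_ge0// => k _; exact: sqr_ge0.
have a2 : (n%:R - q) ^+ 2 / n%:R <= 1.
  by rewrite ler_pdivrMr// mul1r (le_trans a1)// ler1n.
have a3 : 0 <= (n%:R - q) ^+ 2 / n%:R by rewrite divr_ge0 ?sqr_ge0.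
nra.
Qed.

Let W (w : n.-tuple T) := c * usum (fun z => u z - D) w.
Let Wh (w : n.-tuple T) := c * usum h w.
(** The difference consists of the linear part of the Hoeffding decomposition, with weight 2 (n-1)
    per point, and of the degenerate U-statistic of the expansion error. Their normalised variances
    are charged to s^5 and p^5. *)
Let sW : sq (pw rho n) (fun w => W w - Wh w) /\
  Ex (pw rho n) (fun w => (W w - Wh w) ^+ 2) / delta ^+ 2 <= 8 * s + p.
Proof.
pose gg x := wbar rho u x - D.
have sgg : sq rho gg by apply: sqB; [exact: sq_wbar|exact: sq_cst].
have gg0 : Ex rho gg = 0.
  by rewrite /gg ExB ?Ex_cst ?Ex_wbar ?subrr//; [exact: (sq_intg (sq_wbar ku))|exact: intg_cst].
have [sG _ EG] := pw_tsum n sgg gg0.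
have [dsym dsq dx] := kernel_dcenter ke.
have [sU EU] := pw_usum n dsym dsq dx (fun x => dcenter_mean0 x ke).
set U := usum (dcenter rho e) (n := n) in sU EU.
pose G (w : n.-tuple T) := \sum_i gg (tnth w i).
have WE w : W w - Wh w = c * (2 * n' * G w + (-1) * U w).
  rewrite /W /Wh -mulrBr -usumB; congr (_ * _).
  rewrite (_ : 2 * n' * G w = usum (fun z => gg z.1 + gg z.2) w); last by rewrite usum_sep.
  rewrite mulN1r /U -usumB; apply: (f_equal (fun r => usum r w)); apply/funext => z.
  by rewrite heq /dcenter /gg -/D; ring.
have sR := sqD (sqZ (2 * n') sG) (sqZ (-1) sU).
split; first by under eq_fun do rewrite WE; exact: sqZ.
under [X in Ex _ X]funext do rewrite WE exprMn.
rewrite (ExZ _ sR.2).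
have h1 : Ex (pw rho n) (fun w => (2 * n' * G w + (-1) * U w) ^+ 2) <=
    8 * n' ^+ 2 * (n%:R * sc2) + 4 * n%:R ^+ 2 * Ee2.
  have i1 : intg (pw rho n) (fun w => 8 * n' ^+ 2 * G w ^+ 2) by apply: intgZ; exact: sG.2.
  have i2 : intg (pw rho n) (fun w => 2 * U w ^+ 2) by apply: intgZ; exact: sU.2.
  apply: (@le_trans _ _ (Ex (pw rho n) (fun w => 8 * n' ^+ 2 * G w ^+ 2 + 2 * U w ^+ 2))).
    apply: Ex_le; [exact: sR.2|exact: intgD|move=> w].
    by have := sqr_ge0 (2 * n' * G w + U w); rewrite !expr2; lra.
  rewrite (ExD i1 i2) (ExZ _ sG.2) (ExZ _ sU.2) EG; apply: lerD => //.
  rewrite (_ : 4 = 2 * 2) -?mulrA ?ler_wpM2l//; last by ring.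
  apply: (le_trans EU); rewrite (_ : 2 * (n%:R * (n%:R * Ee2)) = 2 * n%:R ^+ 2 * Ee2); last by ring.
  apply: ler_wpM2l; first by rewrite mulr_ge0// sqr_ge0.
  exact: Ex_dcenter2_le.
apply: (@le_trans _ _ (8 * (s ^+ 5 / delta ^+ 2) + p ^+ 5 / delta ^+ 2)); last first.
  by apply: lerD => //; rewrite ler_wpM2l.
rewrite [8 * (_ / _)]mulrA -mulrDl ler_wpM2r ?invr_ge0 ?(ltW d2)//.
have c20 : 0 <= c ^+ 2 by exact: sqr_ge0.
apply: (le_trans (ler_wpM2l c20 h1)).
have nn : 0 < n%:R :> R by rewrite ltr0n.
have -> : c ^+ 2 * (8 * n' ^+ 2 * (n%:R * sc2) + 4 * n%:R ^+ 2 * Ee2) =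
    8 * s ^+ 5 + 4 * (n%:R / n') * (Ee2 / sigma ^+ 2).
  by rewrite c2E sE; field; rewrite !gt_eqF.
rewrite lerD2l.
have r2 : n%:R / n' <= 2 by rewrite ler_pdivrMr// nE; have := n'1; lra.
have r0 : 0 <= n%:R / n' by rewrite divr_ge0 ?ler0n ?(ltW n'0).
have e3 : Ee2 / sigma ^+ 2 <= p ^+ 5 / 1000.
  by rewrite ler_pdivrMr//; have := Ee2'; rewrite mulrC mulrA mulrAC.
have e0 : 0 <= Ee2 / sigma ^+ 2 by rewrite divr_ge0 ?(ltW sg2)// Ex_ge0// => z; exact: sqr_ge0.
have := p5; nra.
Qed.

(** The normalised eigenvalues have norm at least sqrt (1/6) >= 2/5, so 6 delta / q <= 15 delta <=
    (4 (p + s + v))^2, and 20 * 4 = 80. *)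
Let near_le t : Pr (pw g K) [set y | `|f y - t| <= 6 * delta] <= 80 * (p + s + v).
Proof.
have V6 : 6^-1 <= \sum_k (sigma^-1 * tau k) ^+ 2.
  under eq_bigr do rewrite exprMn; rewrite -mulr_sumr -/V exprVn mulrC ler_pdivlMr// mulrC.
  exact: V_ge.
have fE y : f y = gquad (fun k => sigma^-1 * tau k) y by rewrite gquadZ.
rewrite (_ : [set y | _] = [set y | `|gquad (fun k => sigma^-1 * tau k) y - t| <= 6 * delta]); last first.
  by apply/seteqP; split => y /=; rewrite fE.
have V0 : 0 < \sum_k (sigma^-1 * tau k) ^+ 2 by apply: lt_le_trans V6.
have d6 : 0 < 6 * delta by rewrite mulr_gt0.
apply: (le_trans (gquad_anticoncentration t V0 d6)).
set q := Num.sqrt (\sum_k _ ^+ 2).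
have q0 : 0 < q by rewrite sqrtr_gt0.
have qge : 2 / 5 <= q.
  have h0 : 0 <= 2 / 5 :> R by rewrite divr_ge0.
  rewrite -[leLHS]ger0_norm// -sqrtr_sqr ler_wsqrtr//; apply: le_trans V6.
  by rewrite expr2; lra.
have dl : 6 * delta / q <= (4 * (p + s + v)) ^+ 2.
  apply: (@le_trans _ _ (15 * delta)).
    by rewrite ler_pdivrMr//; have := delta0; nra.
  have := mulr_ge0 (ltW p0) s0; have := mulr_ge0 (ltW p0) (ltW v0); have := mulr_ge0 s0 (ltW v0).
  have := sqr_ge0 p; have := sqr_ge0 s; have := sqr_ge0 v; rewrite /delta !expr2; lra.
rewrite (_ : 80 * (p + s + v) = 20 * (4 * (p + s + v))); last by ring.
rewrite ler_wpM2l//; have P0 : 0 <= 4 * (p + s + v) by rewrite mulr_ge0// !addr_ge0// ltW.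
by rewrite -[leRHS]ger0_norm// -sqrtr_sqr ler_wsqrtr.
Qed.

(** Each direction follows the chain [W], [Wh], [b], [f], moving the threshold by delta, 4 delta and
    delta. Anti-concentration of [f] pays for the total of 6 delta. *)
Lemma core_bound t : `|Pr (pw rho n) [set w | t < W w] - Pr (pw g K) [set y | t < f y]| <=
  2 ^+ 31 * (p + s + v).
Proof.
have c0 : 0 <= c by rewrite invr_ge0 mulr_ge0 ?(ltW sigma0) ?sqrtr_ge0.
have mf : measurable_fun [set: K.-tuple R] f by apply: measurable_funM => //; exact: measurable_gquad.
have mb : measurable_fun [set: K.-tuple R] b by apply: measurable_funM => //; exact: measurable_gquad.
have [_ [mh _] _] := kernel_dcenter kK.
have mWh : measurable_fun [set: n.-tuple T] Wh by apply: measurable_funM => //; exact: measurable_usum.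
have mW : measurable_fun [set: n.-tuple T] W.
  apply: measurable_funM => //; apply: measurable_usum; apply: measurable_funB => //.
  by have [_ [+ _] _] := ku.
have [sW1 EW] := sW; have [sf1 Ef] := sf.
have sW2 : sq (pw rho n) (fun w => Wh w - W w).
  by have := sqZ (-1) sW1; under [X in sq _ X -> _]eq_fun do rewrite mulN1r opprB.
have EW2 : Ex (pw rho n) (fun w => (Wh w - W w) ^+ 2) / delta ^+ 2 <= 8 * s + p.
  by apply: le_trans EW; under [X in Ex _ X / _ <= _]funext do rewrite -sqrrN opprB.
have sf2 : sq (pw g K) (fun w => b w - f w).
  by have := sqZ (-1) sf1; under [X in sq _ X -> _]eq_fun do rewrite mulN1r opprB.
have Ef2 : Ex (pw g K) (fun w => (b w - f w) ^+ 2) / delta ^+ 2 <= 8 * p.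
  by apply: le_trans Ef; under [X in Ex _ X / _ <= _]funext do rewrite -sqrrN opprB.
have hE1 := E1_le; have nt := near_le t.
have mN : measurable [set y | `|f y - t| <= 6 * delta] by exact: measurable_near.
have B200 : 200 <= 2 ^+ 30 :> R.
  by apply: (@le_trans _ _ (2 ^+ 8)); [rewrite -natrX ler_nat|rewrite ler_weXn2l// ler1n].
rewrite exprS; move: hE1 B200; set B : R := 2 ^+ 30 => hE1 B200.
have U x : Pr (pw rho n) [set w | x < Wh w] <=
      Pr (pw g K) [set y | x - 4 * delta < b y] + (B * v + 8 * p) /\
    Pr (pw g K) [set y | x < b y] <= Pr (pw rho n) [set w | x - 4 * delta < Wh w] + (B * v + 8 * p).
  have [a1 a2] := features_Pr phi2 St SS Stau x nu23 hN n0 c0 delta0.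
  split; [apply: (le_trans a1)|apply: (le_trans a2)]; rewrite lerD2l; exact: (lerD hE1 E2_le).
have sh d' (T' : measurableType d') (P : probability T' R) (f1 f2 : T' -> R) x y z :
    measurable_fun [set: T'] f1 -> measurable_fun [set: T'] f2 -> sq P (fun w => f1 w - f2 w) ->
    Ex P (fun w => (f1 w - f2 w) ^+ 2) / delta ^+ 2 <= z -> x - delta = y ->
    Pr P [set w | x < f1 w] <= Pr P [set w | y < f2 w] + z.
  move=> m1 m2 s12 E12 <-; apply: (le_trans (Pr_shift x m1 m2 s12 delta0)).
  by rewrite lerD2l.
rewrite ler_norml; apply/andP; split.
- have h1 : Pr (pw g K) [set y | t < f y] <= Pr (pw g K) [set y | t + 6 * delta < f y] +
      Pr (pw g K) [set y | `|f y - t| <= 6 * delta].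
    apply: Pr_subU => //; [exact: measurable_gt|exact: measurable_gt|].
    move=> y /= ty; have [hy|hy] := ltP (t + 6 * delta) (f y); [by left|right].
    by rewrite ger0_norm ?subr_ge0 ?(ltW ty)//; lra.
  have h2 : Pr (pw g K) [set y | t + 6 * delta < f y] <= Pr (pw g K) [set y | t + 5 * delta < b y] + 8 * p.
    by apply: sh mf mb sf1 Ef _; ring.
  have [_ h3] := U (t + 5 * delta).
  rewrite (_ : t + 5 * delta - 4 * delta = t + delta) in h3; last by ring.
  have h4 : Pr (pw rho n) [set w | t + delta < Wh w] <= Pr (pw rho n) [set w | t < W w] + (8 * s + p).
    by apply: sh mWh mW sW2 EW2 _; ring.
  have ch := le_trans h1 (lerD (le_trans h2 (lerD (le_trans h3 (lerD h4 (lexx _))) (lexx _))) nt).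
  by rewrite lerNl opprB; exact: (error_sum (ltW p0) s0 (ltW v0) B200 ch).
- have h1 : Pr (pw g K) [set y | t - 6 * delta < f y] <= Pr (pw g K) [set y | t < f y] +
      Pr (pw g K) [set y | `|f y - t| <= 6 * delta].
    apply: Pr_subU => //; [exact: measurable_gt|exact: measurable_gt|].
    move=> y /= ty; have [hy|hy] := ltP t (f y); [by left|right].
    by rewrite ler0_norm ?subr_le0//; lra.
  have h2 : Pr (pw g K) [set y | t - 5 * delta < b y] <= Pr (pw g K) [set y | t - 6 * delta < f y] + 8 * p.
    by apply: sh mb mf sf2 Ef2 _; ring.
  have [h3 _] := U (t - delta).
  rewrite (_ : t - delta - 4 * delta = t - 5 * delta) in h3; last by ring.
  have h4 : Pr (pw rho n) [set w | t < W w] <= Pr (pw rho n) [set w | t - delta < Wh w] + (8 * s + p).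
    by apply: sh mW mWh sW1 EW _; ring.
  have ch := le_trans h4 (lerD (le_trans h3 (lerD (le_trans h2 (lerD (le_trans h1 (lerD (lexx _) nt)) (lexx _))) (lexx _))) (lexx _)).
  apply: (error_sum (ltW p0) s0 (ltW v0) B200); apply: (le_trans ch).
  by rewrite le_eqVlt; apply/orP; left; apply/eqP; ring.
Qed.
End Core.

(** * Convergence of the Gaussian quadratic forms *)

Section ExpansionMoments.
Context (R : realType) d (T : measurableType d) (rho : probability T R) (K : nat).
Variables (phi : 'I_K -> T -> R) (lam : 'I_K -> R).
Local Notation rr := (pprod rho rho).
Hypothesis phi2 : forall k, sq rho (phi k).

(** The L2 norm of an expansion sees the functions only through their Gram matrix; it is therefore
    the same for Gaussian features with that Gram matrix. *)
Lemma Ex_expansion2 : Ex rr (fun z => expansion phi lam z ^+ 2) =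
  \sum_k \sum_l lam k * lam l * Ex rho (fun x => phi k x * phi l x) ^+ 2.
Proof.
have ikl k l : intg rho (fun x => phi k x * phi l x) by exact: sq_mul.
rewrite (_ : (fun z => _) = (fun z => \sum_k \sum_l lam k * lam l *
    ((phi k z.1 * phi l z.1) * (phi k z.2 * phi l z.2)))); last first.
  apply/funext => z; rewrite /expansion expr2 mulr_suml; apply: eq_bigr => k _.
  by rewrite mulr_sumr; apply: eq_bigr => l _; ring.
have i2 k l := intg_prodM (ikl k l) (ikl k l).
rewrite Ex_sum; last by move=> k; apply: intg_sum => l; exact: intgZ.
apply: eq_bigr => k _; rewrite Ex_sum; last by move=> l; exact: intgZ.
by apply: eq_bigr => l _; rewrite (ExZ _ (i2 k l)) (Ex_prodM (ikl k l) (ikl k l)) expr2.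
Qed.

Lemma absmoment_expansion_fin : (forall k, intg rho (fun x => phi k x ^+ 4)) ->
  (absmoment rr 3 (expansion phi lam) < +oo)%E.
Proof.
move=> phi4; have n3 : 2 <= (3 : R) <= (3 : R) by rewrite !ler_nat.
have m1 k : measurable_fun [set: T] (phi k) := (phi2 k).1.
have a3 k : intg rho (fun x => `|phi k x| `^ 3).
  apply: (intg_le _ _ (intgD (phi2 k).2 (phi4 k))); first exact: measurable_abspow.
  move=> x; rewrite ger0_norm ?powR_ge0//.
  have h : `|phi k x| ^+ 4 = phi k x ^+ 4 by rewrite -normrX ger0_norm// (exprM _ 2 2) sqr_ge0.
  by apply: (le_trans (powR_le_sqrD4 n3 (normr_ge0 _))); rewrite h real_normK ?num_real.
have mk k : measurable_fun [set: T * T] (fun z => lam k * phi k z.1 * phi k z.2).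
  apply: measurable_funM; last exact: (measurableT_comp (m1 k) measurable_snd).
  by apply: measurable_funM => //; exact: (measurableT_comp (m1 k) measurable_fst).
have term k : (absmoment rr 3 (fun z => lam k * phi k z.1 * phi k z.2)%R < +oo)%E.
  have i : intg rr (fun z => `|lam k * phi k z.1 * phi k z.2| `^ 3).
    rewrite (_ : (fun z => _) = (fun z => `|lam k| `^ 3 * (`|phi k z.1| `^ 3 * `|phi k z.2| `^ 3))).
      by apply: intgZ; exact: (intg_prodM (a3 k) (a3 k)).
    by apply/funext => z; rewrite !normrM !powRM// mulrA.
  by have [h _] := intg_ge0P rr (intg_measurable i) (fun z => powR_ge0 _ _); exact: h i.
have sum_fin (s : seq 'I_K) : measurable_fun [set: T * T] (fun z => \sum_(k <- s) lam k * phi k z.1 * phi k z.2) /\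
    (absmoment rr 3 (fun z => \sum_(k <- s) lam k * phi k z.1 * phi k z.2)%R < +oo)%E.
  elim: s => [|k s [ms IH]].
    split; first by apply: measurable_sum.
    rewrite (_ : (fun z => _) = (fun=> 0%R)); first by rewrite absmoment_cst ltry.
    by apply/funext => z; rewrite big_nil.
  have e : (fun z : T * T => \sum_(j <- k :: s) lam j * phi j z.1 * phi j z.2) =
      (fun z => lam k * phi k z.1 * phi k z.2 + \sum_(k <- s) lam k * phi k z.1 * phi k z.2).
    by apply/funext => z; rewrite big_cons.
  split; first by apply: measurable_sum => j; exact: mk.
  rewrite e; apply: (le_lt_trans (absmomentD rr n3 (mk k) ms)).
  by rewrite lte_mul_pinfty ?lee_fin// lte_add_pinfty.
by have [_] := sum_fin (index_enum 'I_K).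
Qed.
End ExpansionMoments.

(** For exponent 3 and c = 1/m the error is of order m^(-1/2). Choosing m = k^2 keeps all powers
    integral and gives a bound A / k. *)
Lemma universality_error_small (R : realType) (N V delta eps : R) : 0 <= N -> 0 <= V -> 0 < delta -> 0 < eps ->
  exists2 m : nat, (0 < m)%N & forall c : R, c = m%:R^-1 ->
  m%:R * (256 * (2 * c / delta) `^ 3 * m%:R * m%:R `^ ((3 - 2) / 2) * (16 * N)) +
    2 * c ^+ 2 * m%:R * V / delta ^+ 2 <= eps.
Proof.
move=> N0 V0 d0 e0; pose A : R := 256 * 8 * 16 * N / delta ^+ 3 + 2 * V / delta ^+ 2.
have A0 : 0 <= A by rewrite addr_ge0// divr_ge0 ?mulr_ge0 ?exprn_ge0// ltW.
have := archi_boundP (divr_ge0 A0 (ltW e0)); set k0 := Num.bound _ => hk0.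
pose k : nat := k0.+1; have kA : A / eps <= k%:R by apply: (le_trans (ltW hk0)); rewrite ler_nat.
have kp : 0 < k%:R :> R by rewrite ltr0n.
exists (k ^ 2)%N => // c ->.
have -> : (k ^ 2)%:R `^ ((3 - 2) / 2) = k%:R :> R.
  rewrite natrX -powR_mulrn ?ler0n// -powRrM (_ : 2%:R * ((3 - 2) / 2) = 1) ?powRr1 ?ler0n//.
  by field.
rewrite natrX powR_mulrn; last by rewrite !divr_ge0 ?mulr_ge0 ?invr_ge0 ?sqr_ge0// ltW.
set x : R := k%:R in kp kA *; have x1 : 1 <= x by rewrite ler1n.
apply: (@le_trans _ _ (A / x)); last by rewrite ler_pdivrMr// mulrC -ler_pdivrMr.
have -> : x ^+ 2 * (256 * (2 * (x ^+ 2)^-1 / delta) ^+ 3 * x ^+ 2 * x * (16 * N)) +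
    2 * (x ^+ 2)^-1 ^+ 2 * x ^+ 2 * V / delta ^+ 2 =
  256 * 8 * 16 * N / delta ^+ 3 / x + 2 * V / delta ^+ 2 / x / x by field; rewrite !gt_eqF.
have -> : A / x = 256 * 8 * 16 * N / delta ^+ 3 / x + 2 * V / delta ^+ 2 / x by rewrite /A; ring.
rewrite lerD2l ler_pdivrMr// ler_peMr//.
by rewrite !divr_ge0 ?mulr_ge0 ?exprn_ge0// ltW.
Qed.

Section Convergence.
Context (R : realType) d (T : measurableType d) (rho : probability T R).
Variables (phi : nat -> T -> R) (lam : nat -> R) (S : forall K, 'M[R]_K) (tau : forall K, 'I_K -> R).
Variable u : T * T -> R.
Local Notation rr := (pprod rho rho).
Local Notation g := (gauss R).
Local Notation phiK K := (fun k : 'I_K => phi k).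
Local Notation lamK K := (fun k : 'I_K => lam k).
Hypothesis phi2 : forall k, sq rho (phi k).
Hypothesis St : forall K, (S K)^T = S K.
Hypothesis SS : forall K i j, (S K *m S K) i j =
  Ex rho (fun x => centered rho (phiK K) i x * centered rho (phiK K) j x).
Hypothesis Stau : forall K,
  char_poly (S K *m diag_mx (\row_k lamK K k) *m S K) = \prod_(k < K) ('X - (tau k)%:P).
Hypothesis ku : kernel rho u.

Definition exp_error K := Ex rr (fun z => (expansion (phiK K) (lamK K) z - u z) ^+ 2).

Section Compare.
Variables (K L : nat) (KL : (K <= L)%N).
Let w (k : 'I_K) : 'I_L := widen_ord KL k.
(** Gaussian features: the rows of the symmetric square root produce the covariance of phi_1, ...,
    phi_L. Both truncations live on the same space R^L, the shorter one using the first K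
    functions. *)
Let psi (k : 'I_L) (y : L.-tuple R) : R := lform (fun j => S L k j) y.
Let psiK (k : 'I_K) := psi (w k).
Let gL := pw g L.
Let gg := pprod gL gL.

Let psi2 k : sq gL (psi k). Proof. exact: sq_lform. Qed.
Let psi0 k : Ex gL (psi k) = 0. Proof. exact: Ex_lform. Qed.
Let psi_centered k y : centered gL psi k y = psi k y. Proof. by rewrite /centered psi0 subr0. Qed.
Let psiK_centered k y : centered gL psiK k y = psi (w k) y.
Proof. by rewrite /centered /psiK psi0 subr0. Qed.

Let psi_cov k l : Ex gL (fun y => psi k y * psi l y) = (S L *m S L) k l.
Proof.
have E4 : Ex gL (fun y => (psi k y + psi l y) ^+ 2) = \sum_j (S L k j + S L l j) ^+ 2.
  rewrite -(Ex_lform2 (fun j => S L k j + S L l j)); congr Ex; apply/funext => y.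
  by rewrite /psi /lform -big_split; congr (_ ^+ 2); apply: eq_bigr => j _; rewrite mulrDl.
have Ek := Ex_lform2 (fun j => S L k j); have El := Ex_lform2 (fun j => S L l j).
have ikk := (psi2 k).2; have ill := (psi2 l).2; have ikl := sq_mul (psi2 k) (psi2 l).
move: E4; rewrite (_ : (fun y => _) = (fun y => (psi k y ^+ 2 + psi l y ^+ 2) + 2 * (psi k y * psi l y))); last first.
  by apply/funext => y; ring.
rewrite (ExD (intgD ikk ill) (intgZ 2 ikl)) (ExD ikk ill) (ExZ _ ikl) Ek El.
have -> : (S L *m S L) k l = \sum_j S L k j * S L l j.
  by rewrite mxE; apply: eq_bigr => j _; rewrite -[in S L j l](St L) mxE.
have -> : \sum_j (S L k j + S L l j) ^+ 2 =
    \sum_j S L k j ^+ 2 + \sum_j S L l j ^+ 2 + 2 * \sum_j S L k j * S L l j.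
  by rewrite mulr_sumr -!big_split; apply: eq_bigr => j _ /=; ring.
by move/addrI/mulfI; apply.
Qed.

Let SL i j : (S L *m S L) i j = Ex gL (fun y => centered gL psi i y * centered gL psi j y).
Proof. by rewrite -psi_cov; congr Ex; apply/funext => y; rewrite !psi_centered. Qed.

Let SK i j : (S K *m S K) i j = Ex gL (fun y => centered gL psiK i y * centered gL psiK j y).
Proof.
rewrite SS (_ : (fun y => centered gL psiK i y * _) = (fun y => psi (w i) y * psi (w j) y)).
  by rewrite psi_cov SS.
by apply/funext => y; rewrite !psiK_centered.
Qed.

Let uK := expansion psiK (lamK K).
Let uL := expansion psi (lamK L).
Let kuK : kernel gL uK. Proof. by apply: kernel_expansion => k; exact: psi2. Qed.
Let kuL : kernel gL uL. Proof. exact: kernel_expansion. Qed.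
Let hK := dcenter gL uK.
Let hL := dcenter gL uL.

Let diffE z : hL z - hK z = expansion psi (fun k : 'I_L => lam k * (K <= k)%:R) z.
Proof.
rewrite /hK /hL !dcenter_expansion// /bil; [|by move=> k; exact: psi2].
have -> : \sum_(k < K) lam k * tnth (feature gL psiK z.1) k * tnth (feature gL psiK z.2) k =
    \sum_(k < L | (k < K)%N) lam k * psi k z.1 * psi k z.2.
  rewrite (big_ord_narrow KL); apply: eq_bigr => k _.
  by rewrite !featureE !psiK_centered.
rewrite (bigID (fun k : 'I_L => (k < K)%N)) /= /expansion.
rewrite [X in X + _ - _](eq_bigr (fun k : 'I_L => lam k * psi k z.1 * psi k z.2)); last first.
  by move=> k _; rewrite !featureE !psi_centered.
rewrite [X in X - _]addrC addrK [RHS](bigID (fun k : 'I_L => (k < K)%N)) /= [X in _ = X + _]big1 ?add0r.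
  by apply: eq_bigr => k kK; rewrite !featureE !psi_centered leqNgt kK mulr1.
by move=> k kK; rewrite leqNgt kK mulr0 !mul0r.
Qed.

(** The difference is an expansion in the Gaussian features with indices from K on. Through
    [Ex_expansion2] its norm is carried back to the centred features of [rho], where it is the
    double centring of the difference of the two expansion errors. *)
Let Ediff : Ex gg (fun z => (hL z - hK z) ^+ 2) <= 2 * exp_error K + 2 * exp_error L.
Proof.
have kEK : kernel rho (fun z => expansion (phiK K) (lamK K) z - u z).
  by apply: kernelB => //; exact: kernel_expansion.
have kEL : kernel rho (fun z => expansion (phiK L) (lamK L) z - u z).
  by apply: kernelB => //; exact: kernel_expansion.
under [X in Ex _ X <= _]funext do rewrite diffE.
rewrite Ex_expansion2//; under eq_bigr => k _ do under eq_bigr => l _ do rewrite psi_cov SS.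
rewrite -Ex_expansion2; last by move=> k; exact: sq_centered.
pose r z := (expansion (phiK L) (lamK L) z - u z) + (-1) * (expansion (phiK K) (lamK K) z - u z).
have kr : kernel rho r by apply: kernelD => //; exact: kernelZ.
have e z : expansion (centered rho (phiK L)) (fun k : 'I_L => lam k * (K <= k)%:R) z = dcenter rho r z.
  have kxL : kernel rho (expansion (phiK L) (lamK L)) by exact: kernel_expansion.
  have kxK : kernel rho (expansion (phiK K) (lamK K)) by exact: kernel_expansion.
  rewrite (dcenterD z kEL (kernelZ (-1) kEK)) (dcenterZ (-1) z kEK) (dcenterB z kxL ku) (dcenterB z kxK ku).
  rewrite mulN1r opprB addrA subrK !dcenter_expansion// /bil /expansion.
  have -> : \sum_(k < K) lam k * tnth (feature rho (phiK K) z.1) k * tnth (feature rho (phiK K) z.2) k =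
      \sum_(k < L | (k < K)%N) lam k * centered rho (phiK L) k z.1 * centered rho (phiK L) k z.2.
    by rewrite (big_ord_narrow KL); apply: eq_bigr => k _; rewrite !featureE.
  rewrite [X in _ = X - _](bigID (fun k : 'I_L => (k < K)%N)) /=.
  rewrite [X in _ = X + _ - _](eq_bigr (fun k : 'I_L => lam k * centered rho (phiK L) k z.1 * centered rho (phiK L) k z.2)); last first.
    by move=> k _; rewrite !featureE.
  rewrite [X in _ = X - _]addrC addrK (bigID (fun k : 'I_L => (k < K)%N)) /= [X in X + _]big1 ?add0r.
    by apply: eq_bigr => k kK; rewrite !featureE leqNgt kK mulr1.
  by move=> k kK; rewrite leqNgt kK mulr0 !mul0r.
under [X in Ex _ X <= _]funext do rewrite e.
apply: (le_trans (Ex_dcenter2_le kr)).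
have [_ s1 _] := kEL; have [_ s2 _] := kEK.
apply: (le_trans (Ex_sqrD_le s1 (sqZ (-1) s2))); rewrite addrC lerD2r ler_wpM2l//.
by under [X in Ex _ X <= _]funext do rewrite mulN1r sqrrN.
Qed.

(* Both quadratic forms are limits of U-statistics of [m] independent Gaussian points
   of [R^L], as [m] tends to infinity, and the kernels of these U-statistics differ
   in L2 by at most the expansion errors. *)
Lemma gquad_compare (x delta : R) : 0 < delta ->
  let E := 2 * (2 * exp_error K + 2 * exp_error L) / delta ^+ 2 in
  Pr (pw g K) [set y | x < gquad (@tau K) y] <=
    Pr (pw g L) [set y | x - 9 * delta < gquad (@tau L) y] + E /\
  Pr (pw g L) [set y | x < gquad (@tau L) y] <=
    Pr (pw g K) [set y | x - 9 * delta < gquad (@tau K) y] + E.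
Proof.
move=> d0 E; have n3 : 2 <= (3 : R) <= (3 : R) by rewrite !ler_nat.
have psiK2 k : sq gL (psiK k) by exact: psi2.
have fin (w' : L.-tuple R * L.-tuple R -> R) : kernel gL w' -> (absmoment gg 3 w' < +oo)%E ->
    exists2 N : R, 0 <= N & (absmoment gg 3 (dcenter gL w') <= N%:E)%E.
  move=> kw fw; have h := absmoment_dcenter n3 kw.
  have f2 : (absmoment gg 3 (dcenter gL w') < +oo)%E.
    by apply: (le_lt_trans h); rewrite lte_mul_pinfty ?lee_fin// absmoment_ge0.
  exists (fine (absmoment gg 3 (dcenter gL w'))); first by rewrite fine_ge0// absmoment_ge0.
  by rewrite fineK// ge0_fin_numE// absmoment_ge0.
have [N1 N10 hN1] := fin _ kuK (absmoment_expansion_fin (lamK K) psiK2 (fun k => intg_lform_exp _ (leqnn 4))).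
have [N2 N20 hN2] := fin _ kuL (absmoment_expansion_fin (lamK L) psi2 (fun k => intg_lform_exp _ (leqnn 4))).
pose VK := \sum_k (tau (K := K) k) ^+ 2; pose VL := \sum_k (tau (K := L) k) ^+ 2.
have VK0 : 0 <= VK by apply: sumr_ge0 => k _; exact: sqr_ge0.
have VL0 : 0 <= VL by apply: sumr_ge0 => k _; exact: sqr_ge0.
suff main (eps : R) : 0 < eps ->
  Pr (pw g K) [set y | x < gquad (@tau K) y] <=
    Pr (pw g L) [set y | x - 9 * delta < gquad (@tau L) y] + E + 2 * eps /\
  Pr (pw g L) [set y | x < gquad (@tau L) y] <=
    Pr (pw g K) [set y | x - 9 * delta < gquad (@tau K) y] + E + 2 * eps.
  split; apply/ler_addgt0Pr => eps e0; have e2 : 0 < eps / 2 by rewrite divr_gt0.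
    by have [h _] := main (eps / 2) e2; rewrite mulrCA divff// mulr1 in h.
  by have [_ h] := main (eps / 2) e2; rewrite mulrCA divff// mulr1 in h.
move=> e0.
(* One [m] serves both truncations, thanks to common bounds on the moments and on the sums of
   squares. With c = 1/m the Gaussian counterparts are exactly the two forms; 9 delta is 4 delta
   twice and delta for exchanging the kernels. *)
have [m m0 hm] := universality_error_small (addr_ge0 N10 N20) (addr_ge0 VK0 VL0) d0 e0.
pose c : R := m%:R^-1; have mR : 0 < m%:R :> R by rewrite ltr0n.
have c0 : 0 <= c by rewrite invr_ge0 ltW.
have cm : c * m%:R = 1 by rewrite mulVf// gt_eqF.
have hN1' : (absmoment gg 3 hK <= (N1 + N2)%:E)%E by apply: (le_trans hN1); rewrite lee_fin lerDl.
have hN2' : (absmoment gg 3 hL <= (N1 + N2)%:E)%E by apply: (le_trans hN2); rewrite lee_fin lerDr.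
pose Er (V : R) := m%:R * (256 * (2 * c / delta) `^ 3 * m%:R * m%:R `^ ((3 - 2) / 2) * (16 * (N1 + N2))) +
    2 * c ^+ 2 * m%:R * V / delta ^+ 2.
have ErV V : V <= VK + VL -> Er V <= eps.
  move=> hV; apply: le_trans (hm c erefl); rewrite lerD2l ler_wpM2r ?invr_ge0 ?sqr_ge0//.
  by rewrite ler_wpM2l// !mulr_ge0 ?sqr_ge0// ltW.
pose WK (z : m.-tuple (L.-tuple R)) := c * usum hK z.
pose WL (z : m.-tuple (L.-tuple R)) := c * usum hL z.
have UK y : Pr (pw gL m) [set z | y < WK z] <= Pr (pw g K) [set z | y - 4 * delta < gquad (@tau K) z] + eps /\
    Pr (pw g K) [set z | y < gquad (@tau K) z] <= Pr (pw gL m) [set z | y - 4 * delta < WK z] + eps.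
  have := features_Pr psiK2 (@St K) SK (@Stau K) y n3 hN1' m0 c0 d0; rewrite -/VK -/(Er VK) => -[a1 a2].
  have hV : Er VK <= eps by apply: ErV; rewrite lerDl.
  have e1 z : c * m%:R * gquad (@tau K) z = gquad (@tau K) z by rewrite cm mul1r.
  split.
  - by apply: (le_trans a1); under [X in Pr _ X]eq_set do rewrite e1; rewrite lerD2l.
  - by move: a2; under [X in Pr _ X <= _]eq_set do rewrite e1; move=> a2; apply: (le_trans a2); rewrite lerD2l.
have UL y : Pr (pw gL m) [set z | y < WL z] <= Pr (pw g L) [set z | y - 4 * delta < gquad (@tau L) z] + eps /\
    Pr (pw g L) [set z | y < gquad (@tau L) z] <= Pr (pw gL m) [set z | y - 4 * delta < WL z] + eps.
  have := features_Pr psi2 (@St L) SL (@Stau L) y n3 hN2' m0 c0 d0; rewrite -/VL -/(Er VL) => -[a1 a2].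
  have hV : Er VL <= eps by apply: ErV; rewrite lerDr.
  have e1 z : c * m%:R * gquad (@tau L) z = gquad (@tau L) z by rewrite cm mul1r.
  split.
  - by apply: (le_trans a1); under [X in Pr _ X]eq_set do rewrite e1; rewrite lerD2l.
  - by move: a2; under [X in Pr _ X <= _]eq_set do rewrite e1; move=> a2; apply: (le_trans a2); rewrite lerD2l.
have [_ [mhK _] _] := kernel_dcenter kuK; have [_ [mhL _] _] := kernel_dcenter kuL.
have mWK : measurable_fun [set: m.-tuple (L.-tuple R)] WK by apply: measurable_funM => //; exact: measurable_usum.
have mWL : measurable_fun [set: m.-tuple (L.-tuple R)] WL by apply: measurable_funM => //; exact: measurable_usum.
have kd := kernelB (kernel_dcenter kuL) (kernel_dcenter kuK); have [ds dsq dx] := kd.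
have dm0 y : Ex gL (fun y' => hL (y, y') - hK (y, y')) = 0.
  have [_ _ xL] := kernel_dcenter kuL; have [_ _ xK] := kernel_dcenter kuK.
  by rewrite ExB ?dcenter_mean0 ?subrr//; [exact: sq_intg (xL y)|exact: sq_intg (xK y)].
have [sU EU] := pw_usum m ds dsq dx dm0.
have WE z : WL z - WK z = c * usum (fun z => hL z - hK z) z by rewrite /WL /WK usumB mulrBr.
have sW : sq (pw gL m) (fun z => WL z - WK z) by under eq_fun do rewrite WE; exact: sqZ.
have EW : Ex (pw gL m) (fun z => (WL z - WK z) ^+ 2) / delta ^+ 2 <= E.
  rewrite ler_wpM2r ?invr_ge0 ?sqr_ge0//.
  under [X in Ex _ X <= _]funext do rewrite WE exprMn.
  rewrite (ExZ _ sU.2); apply: (le_trans (ler_wpM2l (sqr_ge0 c) EU)).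
  rewrite (_ : c ^+ 2 * (2 * m%:R ^+ 2 * _) = 2 * (c * m%:R) ^+ 2 * Ex gg (fun z => (hL z - hK z) ^+ 2)); last by ring.
  by rewrite cm expr1n mulr1 ler_wpM2l.
have sW' : sq (pw gL m) (fun z => WK z - WL z).
  by have := sqZ (-1) sW; under [X in sq _ X -> _]eq_fun do rewrite mulN1r opprB.
have EW' : Ex (pw gL m) (fun z => (WK z - WL z) ^+ 2) / delta ^+ 2 <= E.
  by apply: le_trans EW; under [X in Ex _ X / _ <= _]funext do rewrite -sqrrN opprB.
split.
- have [_ h1] := UK x; have [h3 _] := UL (x - 5 * delta).
  have h2 := Pr_shift (x - 4 * delta) mWK mWL sW' d0.
  rewrite (_ : x - 4 * delta - delta = x - 5 * delta) in h2; last by ring.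
  rewrite (_ : x - 5 * delta - 4 * delta = x - 9 * delta) in h3; last by ring.
  have ch := le_trans h1 (lerD (le_trans h2 (lerD h3 EW')) (lexx eps)).
  by apply: (le_trans ch); rewrite le_eqVlt; apply/orP; left; apply/eqP; ring.
- have [_ h1] := UL x; have [h3 _] := UK (x - 5 * delta).
  have h2 := Pr_shift (x - 4 * delta) mWL mWK sW d0.
  rewrite (_ : x - 4 * delta - delta = x - 5 * delta) in h2; last by ring.
  rewrite (_ : x - 5 * delta - 4 * delta = x - 9 * delta) in h3; last by ring.
  have ch := le_trans h1 (lerD (le_trans h2 (lerD h3 EW)) (lexx eps)).
  by apply: (le_trans ch); rewrite le_eqVlt; apply/orP; left; apply/eqP; ring.
Qed.
End Compare.

Let v0 := Ex rr (fun z => dcenter rho u z ^+ 2).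
Let V K := \sum_k tau (K := K) k ^+ 2.
Let a x K := Pr (pw g K) [set y | x < gquad (@tau K) y].
Hypothesis err0 : forall eta : R, 0 < eta -> exists K0, forall K, (K0 <= K)%N -> exp_error K <= eta.

(** If v0 > 0, the forms are eventually anti-concentrated uniformly in K, and the shift in
    [gquad_compare] can be absorbed. If v0 = 0, they tend to 0 in L2, so the probabilities tend to 0
    or 1 according to the sign of x, which must not be 0. *)
Lemma gquad_cauchy (x : R) : 0 < v0 \/ x <> 0 -> forall eps : R, 0 < eps ->
  exists K0, forall K L, (K0 <= K)%N -> (K0 <= L)%N -> `|a x K - a x L| <= eps.
Proof.
have [v0p _|v0n] := ltP 0 v0.
  (* Solves 20 sqrt (9 delta / (sqrt v0 / 2)) = eps / 2, sqrt v0 / 2 being an eventual lower bound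
     for the norm of the eigenvalues. *)
  move=> eps e0; pose delta : R := (eps / 40) ^+ 2 * Num.sqrt v0 / 18.
  have sv : 0 < Num.sqrt v0 by rewrite sqrtr_gt0.
  have e40 : 0 < eps / 40 by rewrite divr_gt0.
  have d0 : 0 < delta by rewrite divr_gt0// mulr_gt0// exprn_gt0.
  have h1 : 0 < v0 / 4 by rewrite divr_gt0.
  have h2 : 0 < eps * delta ^+ 2 / 16 by rewrite divr_gt0// mulr_gt0// exprn_gt0.
  have [K1 hK1] := err0 h1; have [K2 hK2] := err0 h2.
  have AC K : (K1 <= K)%N -> Pr (pw g K) [set y | x - 9 * delta < gquad (@tau K) y] <= a x K + eps / 2.
    move=> /hK1 hK; have := tau2_ge (fun k : 'I_K => phi2 k) (@St K) (@SS K) (@Stau K) ku.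
    rewrite -/v0 -/(V K) -/(exp_error K) => hV.
    have V4 : v0 / 4 <= V K by lra.
    have V0 : 0 < V K by apply: lt_le_trans V4.
    have d9 : 0 < 9 * delta by rewrite mulr_gt0.
    have mq := measurable_gquad (@tau K).
    apply: (@le_trans _ _ (a x K + Pr (pw g K) [set y | `|gquad (@tau K) y - x| <= 9 * delta])).
      apply: Pr_subU; [exact: measurable_gt|exact: measurable_gt|exact: measurable_near|].
      move=> y /= hy; have [ty|ty] := ltP x (gquad (@tau K) y); [by left|right].
      by rewrite ler0_norm ?subr_le0//; lra.
    rewrite lerD2l; apply: (le_trans (gquad_anticoncentration x V0 d9)).
    rewrite (_ : eps / 2 = 20 * (eps / 40)); last by field.
    rewrite ler_wpM2l//; rewrite -[leRHS]ger0_norm ?(ltW e40)// -sqrtr_sqr ler_wsqrtr//.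
    have sV : Num.sqrt v0 / 2 <= Num.sqrt (V K).
      have s2 : 0 <= Num.sqrt v0 / 2 by rewrite divr_ge0 ?(ltW sv).
      rewrite -[leLHS]ger0_norm// -sqrtr_sqr ler_wsqrtr// expr_div_n sqr_sqrtr ?(ltW v0p)//.
      by rewrite (_ : 2 ^+ 2 = 4)// -natrX.
    rewrite ler_pdivrMr; last by apply: lt_le_trans sV; rewrite divr_gt0.
    apply: (@le_trans _ _ ((eps / 40) ^+ 2 * (Num.sqrt v0 / 2))); last by rewrite ler_wpM2l ?sqr_ge0.
    by rewrite le_eqVlt; apply/orP; left; apply/eqP; rewrite /delta; field.
  have EB K L : (K2 <= K)%N -> (K2 <= L)%N ->
      2 * (2 * exp_error K + 2 * exp_error L) / delta ^+ 2 <= eps / 2.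
    move=> /hK2 a1 /hK2 a2; rewrite ler_pdivrMr ?exprn_gt0//; lra.
  have le K L : (K <= L)%N -> (maxn K1 K2 <= K)%N -> (maxn K1 K2 <= L)%N -> `|a x K - a x L| <= eps.
    rewrite !geq_max => KL /andP[k1 k2] /andP[l1 l2].
    have [c1 c2] := gquad_compare KL x d0; have b1 := AC K k1; have b2 := AC L l1.
    have b3 := EB K L k2 l2.
    have d1 := le_trans c1 (lerD b2 b3); have d2 := le_trans c2 (lerD b1 b3).
    rewrite -/(a x K) in d1; rewrite -/(a x L) in d2.
    by rewrite ler_norml; apply/andP; split; lra.
  exists (maxn K1 K2) => K L hK hL; have [KL|/ltnW LK] := leqP K L; first exact: le.
  by rewrite distrC; exact: le.
move=> [//|x0].
move=> eps e0; have h1 : 0 < eps * x ^+ 2 / 16.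
  by rewrite divr_gt0// mulr_gt0// exprn_even_gt0//; apply/eqP.
have [K0 hK0] := err0 h1; exists K0.
have sm K : (K0 <= K)%N -> V K <= eps * x ^+ 2 / 8.
  move=> /hK0 hK; have := tau2_le (fun k : 'I_K => phi2 k) (@St K) (@SS K) (@Stau K) ku.
  rewrite -/v0 -/(V K) -/(exp_error K) => hV; lra.
have x2 : 0 < x ^+ 2 by rewrite exprn_even_gt0//; apply/eqP.
have le01 K : 0 <= a x K <= 1.
  rewrite Pr_ge0 Pr_le1//; apply: measurable_gt; exact: measurable_gquad.
suff dich : (forall K, (K0 <= K)%N -> a x K <= eps) \/ (forall K, (K0 <= K)%N -> 1 - a x K <= eps).
  move=> K L hK hL; have /andP[p1 p2] := le01 K; have /andP[p3 p4] := le01 L.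
  rewrite ler_norml; case: dich => dd; have := dd K hK; have := dd L hL => *; apply/andP; split; lra.
have m0 K : measurable_fun [set: K.-tuple R] (fun=> 0 : R) by [].
have [xp|xn|xe] := ltgtP 0 x; last by case: x0.
- left => K hK; have [s0 _ E2] := sq_gquad (@tau K); have mq := measurable_gquad (@tau K).
  have s1 : sq (pw g K) (fun y => gquad (@tau K) y - 0) by under eq_fun do rewrite subr0.
  have := Pr_shift x mq (m0 K) s1 xp; rewrite subrr -/(a x K).
  rewrite (_ : [set y : K.-tuple R | 0 < 0] = set0); last by apply/seteqP; split => y //=; rewrite ltxx.
  rewrite /Pr measure0 add0r; under [X in Ex _ X]funext do rewrite subr0.
  rewrite E2 -/(V K) => h; apply: (le_trans h); rewrite ler_pdivrMr//.
  by have := sm K hK; have := mulr_gt0 e0 x2; lra.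
- right => K hK; have [s0 _ E2] := sq_gquad (@tau K); have mq := measurable_gquad (@tau K).
  have s1 : sq (pw g K) (fun y => 0 - gquad (@tau K) y).
    by have := sqZ (-1) s0; under [X in sq _ X -> _]eq_fun do rewrite mulN1r -sub0r.
  have xh : 0 < - (x / 2) by rewrite oppr_gt0 pmulr_llt0// invr_gt0.
  have := Pr_shift (x / 2) (m0 K) mq s1 xh; rewrite opprK (_ : x / 2 + x / 2 = x); last by field.
  rewrite -/(a x K) (_ : [set y : K.-tuple R | x / 2 < 0] = setT); last first.
    by apply/seteqP; split => y //= _; rewrite pmulr_llt0// invr_gt0.
  rewrite /Pr probability_setT /=; under [X in Ex _ X]funext do rewrite sub0r sqrrN.
  rewrite E2 -/(V K) sqrrN -lerBlDl => h; apply: (le_trans h).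
  rewrite ler_pdivrMr; last by rewrite expr_div_n divr_gt0// exprn_gt0.
  rewrite expr_div_n (_ : 2 ^+ 2 = 4); last by rewrite -natrX.
  by have := sm K hK; have := mulr_gt0 e0 x2; lra.
Qed.
End Convergence.

Lemma cvg_of_cauchy (R : realType) (a : nat -> R) :
  (forall eps : R, 0 < eps -> exists K0, forall K L, (K0 <= K)%N -> (K0 <= L)%N -> `|a K - a L| <= eps) ->
  cvgn a.
Proof.
move=> h; apply/cauchy_cvgP/cauchy_exP => e e0.
have [K0 hK] := h (e / 2) (divr_gt0 e0 (ltr0Sn R 1)); exists (a K0).
exists K0 => // K /= KK; rewrite -ball_normE /ball_ /=.
by apply: (le_lt_trans (hK K0 K (leqnn _) KK)); rewrite ltr_pdivrMr// ltr_pMr// ltr1n.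
Qed.

Lemma Ex_sqr_small d (T : measurableType d) (R : realType) (P : probability T R) (nu eta : R) (f : T -> R) :
  2 <= nu <= 3 -> 0 < eta -> sq P f -> (absmoment P nu f <= (Num.sqrt eta `^ nu)%:E)%E ->
  Ex P (fun x => f x ^+ 2) <= eta.
Proof.
move=> nu23 e0 sf h; rewrite leNgt; apply/negP => h2.
have nu0 : 0 < nu by case/andP: nu23 => n2 _; apply: lt_le_trans n2.
have := le_trans (absmoment_sqr nu23 sf) h; rewrite lee_fin leNgt => /negP; apply.
by apply: gt0_ltr_powR; rewrite ?nnegrE ?sqrtr_ge0// ltr_sqrt// (lt_trans e0).
Qed.

Section Main.
Context (R : realType) d (T : measurableType d) (rho : probability T R).
Variables (phi : nat -> T -> R) (lam : nat -> R) (S : forall K, 'M[R]_K) (tau : forall K, 'I_K -> R).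
Variable u : T * T -> R.
Local Notation rr := (pprod rho rho).
Local Notation g := (gauss R).
Local Notation phiK K := (fun k : 'I_K => phi k).
Local Notation lamK K := (fun k : 'I_K => lam k).
Hypothesis phi2 : forall k, sq rho (phi k).
Hypothesis St : forall K, (S K)^T = S K.
Hypothesis SS : forall K i j, (S K *m S K) i j =
  Ex rho (fun x => centered rho (phiK K) i x * centered rho (phiK K) j x).
Hypothesis Stau : forall K,
  char_poly (S K *m diag_mx (\row_k lamK K k) *m S K) = \prod_(k < K) ('X - (tau k)%:P).
Hypothesis ku : kernel rho u.
Variable nu : R.
Hypothesis nu23 : 2 <= nu <= 3.
Hypothesis cvg0 : forall eta : R, 0 < eta -> exists K0, forall K, (K0 <= K)%N ->
  (absmoment rr nu (fun z => (expansion (phiK K) (lamK K) z - u z)%R) <= eta%:E)%E.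

Let ke K : kernel rho (fun z => expansion (phiK K) (lamK K) z - u z).
Proof. by apply: kernelB => //; exact: kernel_expansion. Qed.

Lemma exp_error_cvg0 (eta : R) : 0 < eta ->
  exists K0, forall K, (K0 <= K)%N -> exp_error rho phi lam u K <= eta.
Proof.
move=> e0; have h : 0 < Num.sqrt eta `^ nu by rewrite powR_gt0// sqrtr_gt0.
have [K0 hK] := cvg0 h; exists K0 => K /hK hh.
by have [_ se _] := ke K; exact: (Ex_sqr_small nu23 e0 se hh).
Qed.

Let D := Ex rr u.

(** [K0] precedes [t]: it only has to make the expansion error small against sigma^2 / (n-1) in mean
    square and against [N] in the [nu]-th moment. *)
Lemma main_bound (n : nat) (sigma N : R) : (1 < n)%N -> 0 < sigma ->
  Ex rr (fun z => (u z - D) ^+ 2) = sigma ^+ 2 ->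
  absmoment rr nu (fun z => (u z - D)%R) = N%:E ->
  let p := (n.-1%:R `^ (5^-1))^-1 in
  let s := (n.-1%:R * Ex rho (fun x => (wbar rho u x - D) ^+ 2) / sigma ^+ 2) `^ (5^-1) in
  let v := n%:R `^ (- ((nu - 2) / (4 * nu + 2))) * (N / sigma `^ nu) `^ ((2 * nu + 1)^-1) in
  exists K0, forall K, (K0 <= K)%N -> forall t,
   `|Pr (pw rho n) [set w | t < (sigma * Num.sqrt (n * n.-1)%:R)^-1 * usum (fun z => u z - D) w] -
     Pr (pw g K) [set y | t < sigma^-1 * gquad (@tau K) y]| <= 2 ^+ 31 * (p + s + v).
Proof.
move=> n1 s0 sE NE p s v; have [nu2 nu3] := andP nu23.
have n'0 : 0 < n.-1%:R :> R by rewrite ltr0n -subn1 subn_gt0.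
have nn : 0 < n%:R :> R by rewrite ltr0n ltnW.
have sg2 : 0 < sigma ^+ 2 by rewrite exprn_gt0.
set sc2 := Ex rho (fun x => _) in s *.
have sc0 : 0 <= sc2 by apply: Ex_ge0 => x; exact: sqr_ge0.
have kuD : kernel rho (fun z => u z - D) by apply: kernelB => //; exact: kernel_cst.
have Npos : 0 < N.
  have [_ suD _] := kuD; have := absmoment_sqr nu23 suD; rewrite NE sE sqrtr_sqr ger0_norm ?(ltW s0)// lee_fin.
  by apply: lt_le_trans; rewrite powR_gt0.
have p0 : 0 < p by rewrite invr_gt0 powR_gt0.
have s_0 : 0 <= s by exact: powR_ge0.
have pw5 (x : R) : 0 <= x -> (x `^ (5^-1)) ^+ 5 = x.
  by move=> x0; rewrite -powR_mulrn ?powR_ge0// -powRrM mulVf// powRr1.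
have pE : p ^+ 5 = n.-1%:R^-1 by rewrite exprVn pw5// ltW.
have sE5 : s ^+ 5 = n.-1%:R * sc2 / sigma ^+ 2.
  by rewrite pw5//; apply: divr_ge0; [apply: mulr_ge0 => //; exact: ltW|exact: ltW].
have v_0 : 0 < v by rewrite mulr_gt0// powR_gt0// divr_gt0// powR_gt0.
have vE : n%:R `^ (1 - nu / 2) * (N / sigma `^ nu) <= v `^ (2 * nu + 1).
  rewrite powRM ?powR_ge0// -!powRrM mulVf ?powRr1; last 2 first.
  - by rewrite divr_ge0 ?(ltW Npos)// powR_ge0.
  - by rewrite gt_eqF//; lra.
  rewrite (_ : - ((nu - 2) / (4 * nu + 2)) * (2 * nu + 1) = 1 - nu / 2)//.
  by field; rewrite gt_eqF//; lra.
(* If the linear part is not small, then 48 s >= 1 and the bound exceeds 1, the largest possible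
   difference of probabilities. *)
have [s48|s48] := leP (s ^+ 5) 48^-1; last first.
  have s1 : 1 <= 48 * s.
    have [h|h] := leP s 1; last by lra.
    have : s ^+ 5 <= s by rewrite exprS ler_piMr// exprn_ile1.
    by move: s48; lra.
  exists 0%N => K _ t; apply: (@le_trans _ _ 1).
    have mu : measurable_fun [set: n.-tuple T] (fun w => (sigma * Num.sqrt (n * n.-1)%:R)^-1 * usum (fun z => u z - D) w).
      apply: measurable_funM => //; apply: measurable_usum; by have [_ [+ _] _] := kuD.
    have mq : measurable_fun [set: K.-tuple R] (fun y => sigma^-1 * gquad (@tau K) y).
      by apply: measurable_funM => //; exact: measurable_gquad.
    have a1 := Pr_ge0 (pw rho n) [set w | t < (sigma * Num.sqrt (n * n.-1)%:R)^-1 * usum (fun z => u z - D) w].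
    have a2 := Pr_le1 (pw rho n) (measurable_gt t mu).
    have a3 := Pr_ge0 (pw g K) [set y | t < sigma^-1 * gquad (@tau K) y].
    have a4 := Pr_le1 (pw g K) (measurable_gt t mq).
    by rewrite ler_norml; apply/andP; split; lra.
  apply: (le_trans s1); apply: (@le_trans _ _ (2 ^+ 31 * s)).
    rewrite ler_wpM2r//; apply: (@le_trans _ _ (2 ^+ 6)); first by rewrite -natrX ler_nat.
    by rewrite ler_weXn2l// ler1n.
  by rewrite ler_wpM2l ?exprn_ge0//; have := ltW p0; have := ltW v_0; lra.
have h1 : 0 < sigma ^+ 2 / (1000 * n.-1%:R).
  by apply: (divr_gt0 sg2); apply: (mulr_gt0 _ n'0); rewrite ltr0n.
have [K1 hK1] := exp_error_cvg0 h1; have [K2 hK2] := cvg0 Npos.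
exists (maxn K1 K2) => K; rewrite geq_max => /andP[/hK1 e1 /hK2 e2] t.
have uN : (absmoment rr nu (fun z => (u z - D)%R) <= N%:E)%E by rewrite NE.
exact: (core_bound (fun k : 'I_K => phi2 k) (@St K) (@SS K) (@Stau K) ku n1 nu23 s0 sE e1 uN e2 p0 s_0 v_0 pE sE5 vE s48).
Qed.
End Main.

(** * From the sample space to products of the law *)

Lemma same_law_eq d (T : measurableType d) (R : realType) (P1 P2 : probability T R) :
  (forall A, measurable A -> P1 A = P2 A) -> same_law P1 P2.
Proof. by move=> h f mf f0; apply: eq_measure_integral => A mA _; exact: h. Qed.

Section Transfer.
Context dOm (Om : measurableType dOm) (R : realType) (P : probability Om R).
Context d (T : measurableType d) (rho : probability T R) (n : nat).
Variable X : 'I_n -> {RV P >-> T}.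
Hypothesis hX : iid_with_law X rho.
Local Notation rr := (pprod rho rho).

Lemma measurable_RV i : measurable_fun [set: Om] (X i : Om -> T).
Proof. exact: measurable_funPT. Qed.

Lemma RV_law i (A : set T) : measurable A -> P (X i @^-1` A) = rho A.
Proof. by move=> mA; have [h _] := hX; exact: (h i A mA). Qed.

Lemma measurable_pair i j : measurable_fun [set: Om] (fun w => (X i w, X j w)).
Proof. exact: (measurable_fun_pair (measurable_RV i) (measurable_RV j)). Qed.

Lemma single_law i : same_law (law P (measurable_RV i)) rho.
Proof. by apply: same_law_eq => A mA; exact: RV_law. Qed.

Lemma pair_law i j : i != j -> same_law (law P (measurable_pair i j)) rr.
Proof.
move=> ij f mf f0; pose s : 2.-tuple 'I_n := [tuple i; j].
have us : uniq s by rewrite /= inE ij.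
have sl : same_law (law P (measurable_sample X s)) (pw rho 2).
  by apply: same_law_eq => A mA; rewrite lawE; exact: (iid_sample hX us mA).
pose F (t : 2.-tuple T) := f (tnth t ord0, tnth t (lift ord0 ord0)).
have mF : measurable_fun [set: 2.-tuple T] F.
  exact: (measurableT_comp mf (measurable_fun_pair (measurable_tnth _) (measurable_tnth _))).
transitivity (\int[P]_w f (X i w, X j w))%E; first exact: ge0_integral_law.
transitivity (\int[law P (measurable_sample X s)]_t F t)%E.
  rewrite ge0_integral_law//; last by move=> t; exact: f0.
  by apply: eq_integral => w _; rewrite /F !tnth_mktuple.
transitivity (\int[pw rho 2]_t F t)%E; first by apply: sl => // t; exact: f0.
transitivity (\int[rho]_x \int[pw rho 1]_t F (mcons (x, t)))%E.
  exact: (ge0_integral_pwS rho mF (fun t => f0 _)).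
transitivity (\int[rho]_x \int[rho]_y f (x, y))%E; last exact/esym/tonelli.
apply: eq_integral => x _.
have mFx : measurable_fun [set: 1.-tuple T] (fun t => F (mcons (x, t))).
  have h : measurable_fun [set: 1.-tuple T] (fun t => (x, t)) by exact: measurable_fun_pair.
  exact: (measurableT_comp mF (measurableT_comp (@measurable_mcons _ T 1) h)).
transitivity (\int[rho]_y \int[pw rho 0]_t F (mcons (x, mcons (y, t))))%E.
  exact: (ge0_integral_pwS rho mFx (fun t => f0 _)).
by apply: eq_integral => y _; exact: (integral_cste (pw rho 0) (f (x, y))).
Qed.

Lemma sample_law (B : set (n.-tuple T)) : measurable B ->
  P [set w | B [tuple X i w | i < n]] = pw rho n B.
Proof.
move=> mB; rewrite -(iid_sample (s := [tuple i | i < n]) hX _ mB); last first.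
  by rewrite (_ : tval _ = enum 'I_n) ?enum_uniq//= map_id.
congr (P _); apply/seteqP; split => w /=; rewrite /sample.
  by congr B; apply: eq_from_tnth => i; rewrite !tnth_mktuple.
by congr B; apply: eq_from_tnth => i; rewrite !tnth_mktuple.
Qed.

Variable G : set T.
Hypotheses (mG : measurable G) (G1 : rho (~` G) = 0%E).

Lemma ae_RV i j : \forall w \ae P, G (X i w) /\ G (X j w).
Proof.
have mi k : measurable (X k @^-1` (~` G)).
  have := measurable_RV k measurableT (measurableC mG); by rewrite setTI.
have z k : P (X k @^-1` (~` G)) = 0%E by rewrite RV_law//; exact: measurableC.
exists (X i @^-1` (~` G) `|` X j @^-1` (~` G)); split.
- exact: measurableU.
- apply/eqP; rewrite -measure_le0; apply: (le_trans (measureU2 _ (mi i) (mi j))).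
  by rewrite -[leRHS]adde0; apply: leeD; rewrite le_eqVlt; apply/orP; left; apply/eqP; exact: z.
- move=> w /= h; have [gi|gi] := pselect (G (X i w)); last by left.
  by right => gj; apply: h.
Qed.

Lemma transfer i j (f f' : T * T -> \bar R) : i != j ->
  measurable_fun [set: T * T] f -> measurable_fun [set: T * T] f' ->
  (forall z, (0 <= f z)%E) -> (forall z, (0 <= f' z)%E) ->
  (forall z, G z.1 -> G z.2 -> f z = f' z) ->
  (\int[P]_w f (X i w, X j w) = \int[rr]_z f' z)%E.
Proof.
move=> ij mf mf' f0 f0' ff'.
transitivity (\int[P]_w f' (X i w, X j w))%E.
  apply: ge0_ae_eq_integral => //.
  - exact: (measurableT_comp mf (measurable_pair i j)).
  - exact: (measurableT_comp mf' (measurable_pair i j)).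
  - by apply: filterS (ae_RV i j) => w [g1 g2] _; exact: ff'.
transitivity (\int[law P (measurable_pair i j)]_z f' z)%E; last exact: pair_law.
exact/esym/ge0_integral_law.
Qed.

Lemma transfer_Ex i j (f f' : T * T -> R) : i != j ->
  measurable_fun [set: T * T] f -> measurable_fun [set: T * T] f' ->
  (forall z, G z.1 -> G z.2 -> f z = f' z) ->
  Ex P (fun w => f (X i w, X j w)) = Ex rr f'.
Proof.
move=> ij mf mf' ff'; rewrite -(same_law_Ex (pair_law ij) mf') Ex_law//.
rewrite /Ex /Rintegral; congr fine; apply: ae_eq_integral => //.
- by apply/measurable_EFinP; exact: (measurableT_comp mf (measurable_pair i j)).
- by apply/measurable_EFinP; exact: (measurableT_comp mf' (measurable_pair i j)).
- by apply: filterS (ae_RV i j) => w [g1 g2] _ /=; rewrite ff'.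
Qed.
End Transfer.

Section Truncation.
Context d (T : measurableType d) (R : realType) (rho : probability T R).
Local Notation rr := (pprod rho rho).
Variable u : T * T -> R.
Hypotheses (usym : forall x y, u (x, y) = u (y, x)) (u2 : sq rr u).

(* Square integrability of [u] controls almost all of its slices only; the truncation
   makes every slice square integrable and changes [u] on a null set. *)
Definition good : set T := [set x | (\int[rho]_y (u (x, y) ^+ 2)%:E < +oo)%E].
Definition truncated (z : T * T) : R := u z * (\1_good z.1 * \1_good z.2).

Let mu2 : measurable_fun [set: T * T] (fun z => (u z ^+ 2)%:E).
Proof. by apply/measurable_EFinP; apply: measurable_funX; exact: u2.1. Qed.

Let mh : measurable_fun [set: T] (fun x => \int[rho]_y (u (x, y) ^+ 2)%:E)%E.
Proof. by apply: (measurable_fun_fubini_tonelli_F _ mu2) => z; rewrite lee_fin sqr_ge0. Qed.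

Lemma measurable_good : measurable good.
Proof. by rewrite /good -[X in measurable X]setTI; exact: emeasurable_fun_infty_o. Qed.

Lemma good_full : rho (~` good) = 0%E.
Proof.
have ih : rho.-integrable [set: T] (fun x => \int[rho]_y (u (x, y) ^+ 2)%:E)%E.
  apply/integrableP; split => //.
  have [_] := integrableP _ _ _ u2.2; apply: le_lt_trans; rewrite le_eqVlt; apply/orP; left; apply/eqP.
  transitivity (\int[rr]_z (u z ^+ 2)%:E)%E; last first.
    by apply: eq_integral => z _; rewrite gee0_abs// lee_fin sqr_ge0.
  transitivity (\int[rho]_x \int[rho]_y (u (x, y) ^+ 2)%:E)%E; last first.
    by apply/esym/(tonelli rho rho mu2) => z; rewrite lee_fin sqr_ge0.
  apply: eq_integral => x _; rewrite gee0_abs//.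
  by apply: integral_ge0 => y _; rewrite lee_fin sqr_ge0.
have [N [mN N0 hN]] := integrable_ae measurableT ih.
apply: (@subset_measure0 _ _ _ rho _ N) => //; first by apply: measurableC; exact: measurable_good.
move=> x /= gx; apply: hN => /= h; apply: gx; rewrite /good /=.
have := h Logic.I; rewrite fin_numE => /andP[_ h2].
by rewrite ltey.
Qed.

Lemma truncatedE z : good z.1 -> good z.2 -> truncated z = u z.
Proof. by move=> g1 g2; rewrite /truncated !indicE !mem_set// !mulr1. Qed.

Lemma kernel_truncated : kernel rho truncated.
Proof.
have mt : measurable_fun [set: T * T] truncated.
  apply: measurable_funM; first exact: u2.1.
  have mi := @measurable_indic _ T R [set: T] good measurable_good.
  by apply: measurable_funM; [exact: (measurableT_comp mi measurable_fst)|exact: (measurableT_comp mi measurable_snd)].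
have i01 x : 0 <= (\1_good x : R) <= (1 : R) by rewrite indicE; case: (x \in good); rewrite ?lexx ?ler01.
have le2 z : truncated z ^+ 2 <= u z ^+ 2.
  rewrite /truncated exprMn ler_piMr ?sqr_ge0//.
split.
- by move=> x y; rewrite /truncated /= usym [X in _ * X]mulrC.
- split => //; apply: (intg_le _ _ u2.2); first exact: measurable_funX.
  by move=> z; rewrite ger0_norm ?sqr_ge0.
- move=> x; have mx : measurable_fun [set: T] (fun y => truncated (x, y)).
    exact: (measurableT_comp mt (measurable_fun_pair (measurable_cst x) (@measurable_id _ _ _))).
  split => //; apply/intg_ge0P => //; first exact: measurable_funX.
    by move=> y; exact: sqr_ge0.
  have [gx|gx] := pselect (good x); last first.
    under eq_integral do rewrite /truncated /= indicE memNset// mul0r mulr0 expr0n/=.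
    by rewrite integral_cste ltry.
  apply: le_lt_trans gx; apply: ge0_le_integralT.
  - by apply/measurable_EFinP; exact: measurable_funX.
  - exact: (measurableT_comp mu2 (measurable_fun_pair (measurable_cst x) (@measurable_id _ _ _))).
  - by move=> y; rewrite lee_fin sqr_ge0.
  - by move=> y; rewrite lee_fin.
Qed.
End Truncation.

Section Norms.
Context d (T : measurableType d) (R : realType) (P : probability T R).

Lemma Lnorm_absmoment (nu : R) (f : T -> R) : 0 < nu ->
  ('N[P]_nu%:E[EFin \o f] = absmoment P nu f `^ nu^-1)%E.
Proof. by move=> n0; rewrite unlock; congr (_ `^ _)%E; apply: eq_integral => x _. Qed.

Lemma absmoment2 (f : T -> R) : absmoment P 2 f = (\int[P]_x (f x ^+ 2)%:E)%E.
Proof.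
apply: eq_integral => x _; congr EFin.
by rewrite powR_mulrn// real_normK// num_real.
Qed.
End Norms.

Section ConditionalExpectation.
Context dOm (Om : measurableType dOm) (R : realType) (P : probability Om R).
Context d (T : measurableType d) (rho : probability T R).
Variables (X1 X2 : Om -> T) (u u' : T * T -> R) (Z : Om -> R).
Local Notation rr := (pprod rho rho).
Hypotheses (mX1 : measurable_fun [set: Om] X1) (mX2 : measurable_fun [set: Om] X2).
Hypothesis ku : kernel rho u'.
Hypothesis X2_law : same_law (law P mX2) rho.
Hypothesis uu' : forall B, measurable B ->
  Ex P (fun w => \1_B (X2 w) * u (X1 w, X2 w)) = Ex rr (fun z => \1_B z.2 * u' z).
Hypothesis hZ : is_cond_expectation P (fun w => u (X1 w, X2 w)) X2 Z.

(** The explicit version of the conditional expectation: partial integration of the kernel, by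
    independence of X1 and X2. *)
Let W w := wbar rho u' (X2 w).

Let iZ : intg P Z. Proof. by case: hZ. Qed.

Let iW : intg P W.
Proof.
have sb := sq_wbar ku; have ib := sq_intg sb.
have h := same_law_intg (P := rho) (Q := law P mX2) _ (sq_wbar ku).1 ib.
have sl : same_law rho (law P mX2) by move=> f mf f0; rewrite X2_law.
by have := h sl; move/(intg_law P mX2 sb.1).
Qed.

Let intg_indic (A : set Om) (f : Om -> R) : measurable A -> intg P f -> intg P (fun w => \1_A w * f w).
Proof.
move=> mA fi; apply: (intg_le _ _ (intg_norm fi)).
  apply: measurable_funM; [exact: measurable_indic|exact: intg_measurable fi].
move=> w; rewrite normrM ler_piMl//.
by rewrite indicE; case: (w \in A); rewrite ?normr1 ?normr0.
Qed.

Let Ex_set B : measurable B ->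
  Ex P (fun w => \1_B (X2 w) * Z w) = Ex P (fun w => \1_B (X2 w) * W w).
Proof.
move=> mB; have [_ sw sx] := ku; have sb := sq_wbar ku.
have mi := @measurable_indic _ T R [set: T] B mB.
have A : preimage_set_system setT X2 measurable (X2 @^-1` B) by exists B => //; rewrite setTI.
have h : Ex P (fun w => \1_B (X2 w) * Z w) = Ex P (fun w => \1_B (X2 w) * u (X1 w, X2 w)).
  have [_ _ /(_ _ A) h] := hZ; rewrite /Ex /Rintegral; congr fine.
  have e (f : Om -> R) : (\int[P]_w (\1_B (X2 w) * f w)%:E = \int[P]_(w in X2 @^-1` B) (f w)%:E)%E.
    rewrite [RHS]integral_mkcond; apply: eq_integral => w _; rewrite patchE indicE.
    rewrite (_ : (w \in X2 @^-1` B) = (X2 w \in B)); last by apply/idP/idP; rewrite !inE.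
    by case: ifP => _; rewrite ?mul1r ?mul0r.
  by rewrite !e.
rewrite h uu'//.
have mb : measurable_fun [set: T] (fun y => \1_B y * wbar rho u' y) by apply: measurable_funM => //; exact: sb.1.
rewrite (_ : (fun w => \1_B (X2 w) * W w) = (fun y => \1_B y * wbar rho u' y) \o X2)//.
rewrite -(Ex_law P mX2 mb) (same_law_Ex X2_law mb).
have mu : measurable_fun [set: T * T] (fun z => \1_B z.2 * u' z).
  by apply: measurable_funM; [exact: (measurableT_comp mi measurable_snd)|exact: sw.1].
have iu : intg rr (fun z => \1_B z.2 * u' z).
  apply: (intg_le mu _ (intg_norm (sq_intg sw))) => z; rewrite normrM ler_piMl//.
  by rewrite indicE; case: (z.2 \in B); rewrite ?normr1 ?normr0.
rewrite (Ex_swap _ _ mu) (Ex_prod (intg_swap iu)); congr Ex; apply/funext => y /=.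
have [us _ _] := ku.
have -> : (fun x => \1_B y * u' (x, y)) = (fun x => \1_B y * u' (y, x)).
  by apply/funext => x; rewrite us.
by rewrite ExZ//; exact: (sq_intg (sx y)).
Qed.

(** H < F means H < q < F for some rational q, so the event is a countable union of events
    determined by [X2], hence itself a preimage under [X2]. *)
Let gt_set (F H : Om -> R) (BF BH : rat -> set T) :
  (forall q, measurable (BF q)) -> (forall q, measurable (BH q)) ->
  (forall q, X2 @^-1` BF q = [set w | ratr q < F w]) ->
  (forall q, X2 @^-1` BH q = [set w | H w < ratr q]) ->
  exists2 B, measurable B & X2 @^-1` B = [set w | H w < F w].
Proof.
move=> mF mH eF eH; exists (\bigcup_(q in [set: rat]) (BF q `&` BH q)).
  by apply: bigcupT_measurable_rat => q; exact: measurableI.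
apply/seteqP; split => w /=.
  move=> [q _ [h1 h2]]; have a1 : (X2 @^-1` BF q) w by [].
  have a2 : (X2 @^-1` BH q) w by []. rewrite eF in a1; rewrite eH in a2.
  exact: lt_trans a2 a1.
move=> h; have [q /andP[]] := rat_in_itvoo h; rewrite !bnd_simp => q1 q2.
exists q => //; split.
  by have : [set w | ratr q < F w] w by []; rewrite -eF.
by have : [set w | H w < ratr q] w by []; rewrite -eH.
Qed.

Let ae_eq_ZW : \forall w \ae P, Z w = W w.
Proof.
have [_ mZ _] := hZ; have sb := sq_wbar ku.
have genZ (A : set R) : measurable A -> exists2 B : set T, measurable B & X2 @^-1` B = Z @^-1` A.
  move=> mA; have : preimage_set_system setT Z measurable (Z @^-1` A) by exists A => //; rewrite setTI.
  by move/mZ => [B mB]; rewrite setTI => h; exists B.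
have genW (A : set R) : measurable A -> exists2 B : set T, measurable B & X2 @^-1` B = W @^-1` A.
  move=> mA; exists (wbar rho u' @^-1` A) => //.
  by have := sb.1 measurableT A mA; rewrite setTI.
have gen (F : Om -> R) : (forall A : set R, measurable A -> exists2 B : set T, measurable B & X2 @^-1` B = F @^-1` A) ->
    exists BB : (rat -> set T) * (rat -> set T),
      [/\ forall q, measurable (BB.1 q), forall q, measurable (BB.2 q),
      forall q, X2 @^-1` BB.1 q = [set w | ratr q < F w] &
      forall q, X2 @^-1` BB.2 q = [set w | F w < ratr q]].
  move=> h.
  have h1 q : exists B : set T, measurable B /\ X2 @^-1` B = [set w | ratr q < F w].
    have [B mB e] := h `]ratr q, +oo[%classic (measurable_itv _); exists B; split => //.
    by rewrite e; apply/seteqP; split => w /=; rewrite in_itv/= andbT.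
  have h2 q : exists B : set T, measurable B /\ X2 @^-1` B = [set w | F w < ratr q].
    have [B mB e] := h `]-oo, ratr q[%classic (measurable_itv _); exists B; split => //.
  exists (fun q => projT1 (cid (h1 q)), fun q => projT1 (cid (h2 q))).
  by split => q /=; [case: cid => B []|case: cid => B []|case: cid => B []|case: cid => B []].
have [BZ [z1 z2 z3 z4]] := gen Z genZ; have [BW [w1 w2 w3 w4]] := gen W genW.
have [B1 mB1 e1] := gt_set z1 w2 z3 w4; have [B2 mB2 e2] := gt_set w1 z2 w3 z4.
(* With B1 and B2 cutting out {W < Z} and {Z < W}, this is |Z - W|. Its mean is 0, since [Z] and [W]
   have equal integrals over events determined by [X2]. *)
pose k w := \1_B1 (X2 w) * (Z w - W w) + \1_B2 (X2 w) * (W w - Z w).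
have mi B : measurable B -> measurable (X2 @^-1` B).
  by move=> mB; have := mX2 measurableT mB; rewrite setTI.
have ik : intg P k.
  apply: intgD; [exact: (intg_indic (mi _ mB1) (intgB iZ iW))|exact: (intg_indic (mi _ mB2) (intgB iW iZ))].
have kE w : k w = `|Z w - W w|.
  rewrite /k !indicE.
  have -> : (X2 w \in B1) = (W w < Z w).
    apply/idP/idP; rewrite inE => h; last by have : [set w | W w < Z w] w by []; rewrite -e1.
    by have : (X2 @^-1` B1) w by []; rewrite e1.
  have -> : (X2 w \in B2) = (Z w < W w).
    apply/idP/idP; rewrite inE => h; last by have : [set w | Z w < W w] w by []; rewrite -e2.
    by have : (X2 @^-1` B2) w by []; rewrite e2.
  have [h|h|->] := ltgtP (W w) (Z w); rewrite /= ?mulr1n ?mulr0n ?mul1r ?mul0r ?addr0 ?add0r.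
  - by rewrite gtr0_norm// subr_gt0.
  - by rewrite ltr0_norm ?opprB// subr_lt0.
  - by rewrite subrr normr0.
have Ek : Ex P k = 0.
  have j1 := intg_indic (mi _ mB1) iZ; have j2 := intg_indic (mi _ mB1) iW.
  have j3 := intg_indic (mi _ mB2) iZ; have j4 := intg_indic (mi _ mB2) iW.
  rewrite (_ : k = (fun w => (\1_B1 (X2 w) * Z w - \1_B1 (X2 w) * W w) + (\1_B2 (X2 w) * W w - \1_B2 (X2 w) * Z w))).
    rewrite (ExD (intgB j1 j2) (intgB j4 j3)) (ExB j1 j2) (ExB j4 j3).
    by rewrite (Ex_set mB1) (Ex_set mB2) !subrr addr0.
  by apply/funext => w; rewrite /k !mulrBr.
have h0 : (\int[P]_w `|(k w)%:E| = 0)%E.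
  rewrite -[RHS]/(0%:E) -Ek (ExE ik); apply: eq_integral => w _.
  by rewrite gee0_abs// lee_fin kE.
have mk : measurable_fun [set: Om] (EFin \o k) by apply/measurable_EFinP; exact: intg_measurable ik.
have := (ae_eq_integral_abs P measurableT mk).1 h0.
apply: filterS => w /(_ Logic.I) /= [kw]; apply/eqP; rewrite -subr_eq0 -normr_eq0 -kE.
by rewrite kw.
Qed.

Lemma cond_expectation_sqr D : (\int[P]_w ((Z w - D) ^+ 2)%:E =
  (Ex rho (fun x => (wbar rho u' x - D) ^+ 2))%:E)%E.
Proof.
have sb := sq_wbar ku; have sbD := sqB sb (sq_cst rho D).
have mb := (measurable_funX 2 sbD.1).
transitivity (\int[P]_w ((W w - D) ^+ 2)%:E)%E.
  apply: ge0_ae_eq_integral => //.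
  - by apply/measurable_EFinP; apply: measurable_funX; apply: measurable_funB => //; exact: intg_measurable iZ.
  - by apply/measurable_EFinP; apply: measurable_funX; apply: measurable_funB => //; exact: intg_measurable iW.
  - by move=> w _; rewrite lee_fin sqr_ge0.
  - by move=> w _; rewrite lee_fin sqr_ge0.
  - by apply: filterS ae_eq_ZW => w -> _.
rewrite (ExE sbD.2) -X2_law; last 2 first.
- by apply/measurable_EFinP.
- by move=> x; rewrite lee_fin sqr_ge0.
rewrite ge0_integral_law//; first by apply/measurable_EFinP.
by move=> x; rewrite lee_fin sqr_ge0.
Qed.
End ConditionalExpectation.

(** * Limits in K, normalisation of the statistics and laws of the samples *)

Section Limits.
Context (R : realType).
Local Open Scope ereal_scope.

Lemma limn_esup_le (u : nat -> \bar R) (M : \bar R) K0 :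
  (forall K, (K0 <= K)%N -> u K <= M) -> limn_esup u <= M.
Proof.
move=> h; rewrite /limn_esup /limf_esup; apply: ge_ereal_inf.
exists (ereal_sup (u @` [set K | (K0 <= K)%N])).
  by exists [set K | (K0 <= K)%N] => //; exists K0.
by apply: ge_ereal_sup => _ [K /= hK <-]; exact: h.
Qed.

(** A bound valid from some K on passes to the lower and the upper limit, hence to everything
    between them, whether or not the limit exists. *)
Lemma dist_between_limits (b : nat -> R) (a B : R) (F : \bar R) :
  (exists K0, forall K, (K0 <= K)%N -> (`|a - b K| <= B)%R) ->
  limn_einf (EFin \o b) <= F <= limn_esup (EFin \o b) -> `|a%:E - F| <= B%:E.
Proof.
move=> [K0 hK] /andP[h1 h2].
have u1 : F <= (a + B)%:E.
  apply: (le_trans h2); apply: (@limn_esup_le _ _ K0) => K /hK; rewrite lee_fin ler_norml => /andP[h _] /=.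
  by move: h; lra.
have u2 : (a - B)%:E <= F.
  apply: le_trans h1; rewrite /limn_einf leeNr -EFinN; apply: (@limn_esup_le _ _ K0) => K /hK.
  rewrite ler_norml => /andP[_ h]; rewrite -[leLHS]/((- b K)%:E) lee_fin.
  by move: h; lra.
case: F u1 u2 {h1 h2} => [f| |] //=; rewrite !lee_fin => u1 u2.
by rewrite ler_norml; apply/andP; split; lra.
Qed.

(** Passes from norms to moments. Finitely many moments may be infinite, hence the extended
    reals. *)
Lemma eventually_small_power (A : nat -> \bar R) (r : R) : (0 < r)%R -> (forall K, 0 <= A K) ->
  (A K `^ r^-1 @[K --> \oo] --> 0)%classic ->
  forall eta : R, (0 < eta)%R -> exists K0, forall K, (K0 <= K)%N -> A K <= eta%:E.
Proof.
move=> r0 A0 h eta e0; have r1 : (0 < r^-1)%R by rewrite invr_gt0.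
have e1 : (0 < eta `^ r^-1)%R by rewrite powR_gt0.
have := h [set x | x < (eta `^ r^-1)%:E]%classic; case.
  by apply: (@open_ereal_lt' R 0); rewrite lte_fin.
move=> K0 _ hK; exists K0 => K /hK /=; rewrite leNgt => hA; apply/negP => lA; move: hA; apply/negP.
rewrite -leNgt -poweR_EFin; apply: (gt0_ler_poweR (ltW r1)); rewrite ?in_itv/= ?A0 ?leey//.
- by rewrite lee_fin ltW.
- exact: ltW.
Qed.

Lemma poweRVK (A : \bar R) (r : R) : (0 < r)%R -> 0 <= A -> (A `^ r^-1) `^ r = A.
Proof. by move=> r0 A0; rewrite -poweRrM mulVf ?gt_eqF// poweRe1. Qed.

End Limits.

Section Statistic.
Context (R : realType) d (T : measurableType d) (n : nat).
Hypothesis n1 : (1 < n)%N.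
Variables (sigma D : R).
Hypothesis s0 : 0 < sigma.
Let scale := Num.sqrt (n * n.-1)%:R / sigma.

Let q2 : Num.sqrt (n * n.-1)%:R ^+ 2 = (n * n.-1)%:R :> R. Proof. by rewrite sqr_sqrtr. Qed.
Let q0 : 0 < Num.sqrt (n * n.-1)%:R :> R.
Proof. by rewrite sqrtr_gt0 ltr0n muln_gt0 -subn1 subn_gt0 n1 ltnW. Qed.

(** Centring the kernel turns the mean into the shift [scale * D]. The limit variable carries the
    same shift, so both sides are compared at the threshold t - scale D. *)
Lemma Ustat_usum (u : T * T -> R) (x : n.-tuple T) :
  scale * Ustat u (tnth x) = (sigma * Num.sqrt (n * n.-1)%:R)^-1 * usum (fun z => u z - D) x + scale * D.
Proof.
rewrite usumB /Ustat -/(usum u x).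
have -> : usum (fun=> D) x = (n * n.-1)%:R * D.
  rewrite /usum; under eq_bigr do rewrite sumr_const cardC1 card_ord.
  by rewrite sumr_const card_ord -mulrnA mulnC mulr_natl.
move: q2 q0; rewrite /scale; move: (Num.sqrt _) => q <- q0'; field; rewrite !gt_eqF//.
Qed.

Lemma gauss_quad_gquad (Om : Type) (tau : forall K, 'I_K -> R) (xi : nat -> Om -> R) K w :
  scale * gauss_quad n D tau xi K w =
  sigma^-1 * gquad (@tau K) [tuple xi k w | k < K] + scale * D.
Proof.
rewrite /gauss_quad -/(scale) mulrDr; congr (_ + _).
have -> : gquad (@tau K) [tuple xi k w | k < K] = \sum_(k < K) tau K k * (xi k w ^+ 2 - 1).
  by apply: eq_bigr => k _; rewrite tnth_mktuple.
move: q0; rewrite /scale; move: (Num.sqrt _) => q q0'; field; rewrite !gt_eqF//.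
Qed.
End Statistic.

Section Samples.
Context dOm (Om : measurableType dOm) (R : realType) (P : probability Om R).

Lemma gauss_sample (xi : nat -> {RV P >-> R}) K (B : set (K.-tuple R)) :
  iid_with_law xi (normal_prob 0 1) -> measurable B ->
  P [set w | B [tuple xi k w | k < K]] = (Pr (pw (gauss R) K) B)%:E.
Proof.
move=> hxi mB; rewrite PrE//.
have hxi' : iid_with_law xi (gauss R) by [].
pose s : K.-tuple nat := [tuple val i | i < K].
have us : uniq s by rewrite /s /= map_inj_uniq ?enum_uniq//; exact: val_inj.
rewrite -(iid_sample hxi' us mB); congr (P _); apply/seteqP; split => w /=; rewrite /sample.
  by congr B; apply: eq_from_tnth => i; rewrite !tnth_mktuple.
by congr B; apply: eq_from_tnth => i; rewrite !tnth_mktuple.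
Qed.

Context d (T : measurableType d) (rho : probability T R) (n : nat).
Variable X : 'I_n -> {RV P >-> T}.
Hypothesis hX : iid_with_law X rho.

Lemma ae_all_RV (G : set T) : measurable G -> rho (~` G) = 0%E ->
  \forall w \ae P, forall i, G (X i w).
Proof.
move=> mG G1; suff h (s : seq 'I_n) : \forall w \ae P, forall i, i \in s -> G (X i w).
  by apply: filterS (h (enum 'I_n)) => w hw i; apply: hw; rewrite mem_enum.
elim: s => [|i s IH]; first by apply: filterE.
apply: filterS2 IH (ae_RV hX mG G1 i i) => w h1 [h2 _] j; rewrite inE => /orP[/eqP->//|].
exact: h1.
Qed.

(** Almost surely all sample points lie in [G], where the two kernels agree; the rest is the product
    law of the sample. *)
Lemma Ustat_law (u u' : T * T -> R) (G : set T) (c t : R) : measurable G -> rho (~` G) = 0%E ->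
  measurable_fun [set: T * T] u -> measurable_fun [set: T * T] u' ->
  (forall z, G z.1 -> G z.2 -> u z = u' z) ->
  P [set w | t < c * Ustat u (fun i => X i w)] =
  (Pr (pw rho n) [set x | t < c * Ustat u' (tnth x)])%:E.
Proof.
move=> mG G1 mu mu' uu'.
have mUst (v : T * T -> R) : measurable_fun [set: T * T] v ->
    measurable_fun [set: n.-tuple T] (fun x => Ustat v (tnth x)).
  by move=> mv; apply: measurable_funM => //; exact: (@measurable_usum _ _ _ v n mv).
have mB v : measurable_fun [set: T * T] v -> measurable [set x : n.-tuple T | t < c * Ustat v (tnth x)].
  by move=> mv; apply: measurable_gt; apply: measurable_funM => //; exact: mUst.
have e v : [set w | t < c * Ustat v (fun i => X i w)] =
    [set w | [set x : n.-tuple T | t < c * Ustat v (tnth x)] [tuple X i w | i < n]].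
  apply/seteqP; split => w /=.
    congr (_ < _ * (_ * _)); apply: eq_bigr => i _; apply: eq_bigr => j _; by rewrite !tnth_mktuple.
  congr (_ < _ * (_ * _)); apply: eq_bigr => i _; apply: eq_bigr => j _; by rewrite !tnth_mktuple.
rewrite PrE; last exact: mB.
rewrite -(sample_law hX (mB u' mu')) -e.
have mE v : measurable_fun [set: T * T] v -> measurable [set w | t < c * Ustat v (fun i => X i w)].
  move=> mv; apply: measurable_gt; do 2 apply: measurable_funM => //; apply: measurable_sum => i /=.
  under eq_fun do rewrite big_mkcond /=.
  by apply: measurable_sum => j; case: (j != i) => //; exact: (measurableT_comp mv (measurable_pair X i j)).
have i1 := integral_indic P measurableT (mE u mu); have i2 := integral_indic P measurableT (mE u' mu').
rewrite setIT in i1; rewrite setIT in i2; rewrite -i1 -i2.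
apply: ae_eq_integral => //.
- by apply/measurable_EFinP; exact: (@measurable_indic _ _ R [set: Om] _ (mE u mu)).
- by apply/measurable_EFinP; exact: (@measurable_indic _ _ R [set: Om] _ (mE u' mu')).
- apply: filterS (ae_all_RV mG G1) => w hw _ /=; congr EFin; rewrite !indicE.
  have eU : Ustat u (fun i => X i w) = Ustat u' (fun i => X i w).
    by rewrite /Ustat; congr (_ * _); apply: eq_bigr => i _; apply: eq_bigr => j _; apply: uu'; exact: hw.
  by congr (_%:R); congr nat_of_bool; apply/idP/idP; rewrite !inE /= eU.
Qed.
End Samples.

Section SampleMoments.
Context dOm (Om : measurableType dOm) (R : realType) (P : probability Om R).
Context d (T : measurableType d) (rho : probability T R) (n : nat).
Variable X : 'I_n -> {RV P >-> T}.
Hypothesis hX : iid_with_law X rho.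
Local Notation rr := (pprod rho rho).

Lemma sq_pair i j (u : T * T -> R) (D : R) : i != j -> measurable_fun [set: T * T] u ->
  (centered_norm P (fun w => u (X i w, X j w)) D 2 < +oo)%E -> sq rr u.
Proof.
move=> ij mu; rewrite /centered_norm Lnorm_absmoment// => h.
have {h} : (absmoment P 2 (fun w => u (X i w, X j w) - D)%R < +oo)%E.
  by apply: lty_poweRy h; rewrite invr_eq0.
have muD : measurable_fun [set: T * T] (fun z => u z - D) by apply: measurable_funB.
have mu2 : measurable_fun [set: T * T] (fun z => ((u z - D) ^+ 2)%:E).
  by apply/measurable_EFinP; exact: measurable_funX.
have p2 z : (0 <= ((u z - D) ^+ 2)%:E)%E by rewrite lee_fin sqr_ge0.
rewrite absmoment2 -(ge0_integral_law P (measurable_pair X i j) mu2 p2) (pair_law hX ij mu2 p2) => h.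
have s : sq rr (fun z => u z - D).
  by split => //; apply/(intg_ge0P rr (measurable_funX 2 muD) (fun z => sqr_ge0 _)).
rewrite (_ : u = fun z => (u z - D) + D); first exact: sqD s (sq_cst _ _).
by apply/funext => z; rewrite subrK.
Qed.

Lemma sq_single i (f : T -> R) : measurable_fun [set: T] f ->
  ('E_P[fun w => (f (X i w) ^+ 2)%R] < +oo)%E -> sq rho f.
Proof.
move=> mf h; split => //; apply/(intg_ge0P rho (measurable_funX 2 mf) (fun z => sqr_ge0 _)).
have mf2 : measurable_fun [set: T] (fun x => (f x ^+ 2)%:E).
  by apply/measurable_EFinP; exact: measurable_funX.
have p2 x : (0 <= (f x ^+ 2)%:E)%E by rewrite lee_fin sqr_ge0.
rewrite -(single_law hX i mf2 p2) (ge0_integral_law P (measurable_RV X i) mf2 p2).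
by move: h; rewrite unlock.
Qed.

Lemma covariance_Ex i (f h : T -> R) : measurable_fun [set: T] f -> measurable_fun [set: T] h ->
  fine (covariance P (f \o X i) (h \o X i)) =
  Ex rho (fun x => (f x - Ex rho f) * (h x - Ex rho h)).
Proof.
move=> mf mh.
have e (k : T -> R) : measurable_fun [set: T] k -> fine 'E_P[k \o X i] = Ex rho k.
  by move=> mk; rewrite -(same_law_Ex (single_law hX i) mk) Ex_law// unlock.
rewrite covariance.unlock e// e// -(e (fun x => (f x - Ex rho f) * (h x - Ex rho h)))//.
by apply: measurable_funM; apply: measurable_funB.
Qed.

Variable G : set T.
Hypotheses (mG : measurable G) (G1 : rho (~` G) = 0%E).

Lemma pair_norm i j (nu : R) (f f' : T * T -> R) : i != j -> 0 < nu ->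
  measurable_fun [set: T * T] f -> measurable_fun [set: T * T] f' ->
  (forall z, G z.1 -> G z.2 -> f z = f' z) ->
  ('N[P]_nu%:E[EFin \o (fun w => f (X i w, X j w))] = absmoment rr nu f' `^ nu^-1)%E.
Proof.
move=> ij nu0 mf mf' ff'; rewrite Lnorm_absmoment//; congr (_ `^ _)%E.
apply: (transfer hX mG G1 (f := fun z => (`|f z| `^ nu)%:E) (f' := fun z => (`|f' z| `^ nu)%:E) ij).
- by apply/measurable_EFinP; exact: measurable_abspow.
- by apply/measurable_EFinP; exact: measurable_abspow.
- by move=> z; rewrite lee_fin powR_ge0.
- by move=> z; rewrite lee_fin powR_ge0.
- by move=> z g1 g2; rewrite ff'.
Qed.
End SampleMoments.

Lemma cvgn_EFin (R : realType) (a : nat -> R) : cvgn a -> cvgn (EFin \o a).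
Proof.
move=> h; apply/cvg_ex; exists (limn a)%:E; apply: cvg_EFin; first exact: nearW.
exact: h.
Qed.

Theorem proposition9 (R : realType) :
  exists2 C : R, 0 < C &
  forall (d : nat) (law : probability (d.-tuple R) R)
    (u : d.-tuple R * d.-tuple R -> R)
    (hu : measurable_fun setT u) (usym : forall x y, u (x, y) = u (y, x))
    (n : nat) (hn : (1 < n)%N)
    (dOm : measure_display) (Om : measurableType dOm) (P : probability Om R)
    (X : 'I_n -> {RV P >-> d.-tuple R}) (hX : iid_with_law X law),
  let X1 := X (Ordinal (ltnW hn)) in
  let X2 := X (Ordinal hn) in
  let U12 := fun w : Om => u (X1 w, X2 w) in
  let D := mean P U12 in
  forall (Ucond : Om -> R) (hUcond : is_cond_expectation P U12 X2 Ucond),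
  let M_cond := centered_norm P Ucond D in
  let M_full := centered_norm P U12 D in
  let sigma_cond := M_cond 2 in
  let sigma_full := M_full 2 in
  forall (hfull0 : (0 < sigma_full)%E) (hfulloo : (sigma_full < +oo)%E)
    (nu : R) (hnu2 : 2 < nu) (hnu3 : nu <= 3)
    (phi : nat -> d.-tuple R -> R) (lam : nat -> R)
    (mphi : forall k, measurable_fun setT (phi k))
    (phi2 : forall k, ('E_P[fun w => (phi k (X1 w) ^+ 2)%R] < +oo)%E)
    (herr : expansion_error P X1 X2 phi lam u nu K @[K --> \oo] --> 0%E)
    (sqrtSigma : forall K, 'M[R]_K)
    (hsqrtSigma : forall K, is_psd_sqrt (feature_cov P X1 phi K) (sqrtSigma K))
    (tau : forall K, 'I_K -> R)
    (htau : forall K, eigenvalues_are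
       (sqrtSigma K *m weight_mx lam K *m sqrtSigma K) (tau K))
    (dOm' : measure_display) (Om' : measurableType dOm') (Q : probability Om' R)
    (xi : nat -> {RV Q >-> R}) (hxi : iid_with_law xi (normal_prob 0 1)),
  let scale := Num.sqrt (n * n.-1)%:R / fine sigma_full in
  let pD := fun t : R => P [set w | t < scale * Ustat u (fun i => X i w)] in
  let pW := fun (t : R) (K : nat) =>
    Q [set w | t < scale * gauss_quad n D tau xi K w] in
  (* The limit in K exists, with one possible exception: if the degenerate part
     of u vanishes (that is, sigma_full^2 = 2 sigma_cond^2) then W_n^K tends to
     the constant D, and the probabilities may oscillate at the atom. *)
  (forall t, (sigma_full ^+ 2 <> 2%:E * sigma_cond ^+ 2)%E \/ t <> scale * D ->
     cvgn (pW t)) /\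
  (* F t is the limit of pW t wherever it exists, and any value between the
     lower and the upper limit at the possible exception. *)
  forall F : R -> \bar R,
    (forall t, (limn_einf (pW t) <= F t <= limn_esup (pW t))%E) ->
  (ereal_sup [set `|pD t - F t| | t in [set: R]] <=
   C%:E *
   (((n.-1)%:R `^ (5^-1))^-1%:E
    + ((Num.sqrt (n.-1)%:R)%:E * sigma_cond / sigma_full) `^ (2 / 5)
    + (n%:R `^ (- ((nu - 2) / (4 * nu + 2))))%:E
      * (M_full nu `^ nu / sigma_full `^ nu
         + ((n.-1%:R `^ (2^-1))%:E * M_cond nu) `^ nu / sigma_full `^ nu)
        `^ ((2 * nu + 1)^-1)))%E.
Proof.
(* The constant of [main_bound], fixed before d, the law, the kernel, n and nu. *)
exists (2 ^+ 31); first by rewrite exprn_gt0.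
move=> d rho u hu usym n hn dOm Om P X hX X1 X2 U12 D Z hZ M_cond M_full sigma_cond sigma_full
  hf0 hfoo nu hnu2 hnu3 phi lam mphi phi2 herr S hS tau htau dOm' Om' Q xi hxi scale pD pW.
pose rr := pprod rho rho.
have i01 : Ordinal (ltnW hn) != Ordinal hn by [].
have nu23 : 2 <= nu <= 3 by rewrite (ltW hnu2) hnu3.
have nu0 : 0 < nu by apply: lt_trans hnu2.
have u2 : sq rr u := sq_pair hX i01 hu hfoo.
have mG := measurable_good u2; have G1 := good_full u2.
(* From here on [u'] stands in for [u]: they agree at almost all sample points, so the law of the
   statistic and all moments are unchanged. *)
pose u' := truncated rho u; have ku : kernel rho u' := kernel_truncated usym u2.
have su' : sq rr u' by case: ku.
have uu' z : good rho u z.1 -> good rho u z.2 -> u z = u' z.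
  by move=> g1 g2; rewrite /u' truncatedE.
have DE : D = Ex rr u'.
  rewrite -(transfer_Ex hX mG G1 i01 hu su'.1 uu') /D /mean unlock; reflexivity.
have mu'D : measurable_fun [set: d.-tuple R * d.-tuple R] (fun z => u' z - D).
  by apply: measurable_funB => //; exact: su'.1.
have muD : measurable_fun [set: d.-tuple R * d.-tuple R] (fun z => u z - D).
  by apply: measurable_funB.
have cn p : 0 < p -> M_full p = (absmoment rr p (fun z => u' z - D)%R `^ p^-1)%E.
  move=> p0; apply: (pair_norm hX mG G1 i01 p0 muD mu'D) => z g1 g2.
  by rewrite uu'.
pose s2 := Ex rr (fun z => (u' z - D) ^+ 2); pose sigma := Num.sqrt s2.
have s20 : 0 <= s2 by apply: Ex_ge0 => z; exact: sqr_ge0.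
have sfE : sigma_full = sigma%:E.
  by rewrite /sigma_full cn// absmoment2 -(ExE (sqB su' (sq_cst _ D)).2) poweR_EFin powR12_sqrt.
have s0 : 0 < sigma by rewrite -lte_fin -sfE.
have sE : Ex rr (fun z => (u' z - Ex rr u') ^+ 2) = sigma ^+ 2 by rewrite -DE sqr_sqrtr.
pose c2 := Ex rho (fun x => (wbar rho u' x - Ex rr u') ^+ 2).
have c20 : 0 <= c2 by apply: Ex_ge0 => z; exact: sqr_ge0.
have scE : sigma_cond = (Num.sqrt c2)%:E.
  rewrite /sigma_cond /M_cond /centered_norm Lnorm_absmoment// absmoment2.
  rewrite (cond_expectation_sqr (u' := u') ku (single_law hX (Ordinal hn)) _ hZ) => [|B mB].
    by rewrite poweR_EFin DE powR12_sqrt.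
  have mB2 : measurable_fun [set: d.-tuple R * d.-tuple R] (fun z => \1_B z.2 : R).
    exact: (measurableT_comp (@measurable_indic _ _ R [set: d.-tuple R] B mB) measurable_snd).
  apply: (transfer_Ex hX mG G1 (f := fun z => \1_B z.2 * u z) i01).
  - exact: measurable_funM.
  - by apply: measurable_funM => //; exact: su'.1.
  - by move=> z g1 g2; rewrite uu'.
have phi2' k : sq rho (phi k) := sq_single hX (mphi k) (phi2 k).
have cvg0 eta : 0 < eta -> exists K0, forall K, (K0 <= K)%N ->
    (absmoment rr nu (fun z => expansion (fun k : 'I_K => phi k) (fun k => lam k) z - u' z)%R <= eta%:E)%E.
  move=> e0; apply: (eventually_small_power nu0 _ _ e0) => [K|]; first exact: absmoment_ge0.
  rewrite (_ : (fun K => _) = expansion_error P X1 X2 phi lam u nu)//; apply/funext => K; apply/esym.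
  have me : measurable_fun [set: d.-tuple R * d.-tuple R]
      (expansion (fun k : 'I_K => phi k) (fun k => lam k)).
    apply: measurable_sum => k; apply: measurable_funM; first apply: measurable_funM => //.
      exact: (measurableT_comp (mphi k) measurable_fst).
    exact: (measurableT_comp (mphi k) measurable_snd).
  apply: (pair_norm hX mG G1 (f := fun z => expansion (fun k : 'I_K => phi k) (fun k => lam k) z - u z) i01 nu0).
  - exact: measurable_funB.
  - by apply: measurable_funB => //; exact: su'.1.
  - by move=> z g1 g2; rewrite uu'.
have St K : (S K)^T = S K by case: (hS K).
have SS K i j : (S K *m S K) i j =
    Ex rho (fun x => centered rho (fun k : 'I_K => phi k) i x * centered rho (fun k : 'I_K => phi k) j x).
  by have [_ _ ->] := hS K; rewrite mxE (covariance_Ex hX).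
have Stau K : char_poly (S K *m diag_mx (\row_k lam (k : 'I_K)) *m S K) = \prod_(k < K) ('X - (tau K k)%:P).
  exact: htau.
have scaleE : scale = Num.sqrt (n * n.-1)%:R / sigma by rewrite /scale sfE.
have pDE t : pD t = (Pr (pw rho n) [set w | t - scale * D <
    (sigma * Num.sqrt (n * n.-1)%:R)^-1 * usum (fun z => u' z - Ex rr u') w])%:E.
  rewrite /pD (Ustat_law hX scale t mG G1 hu su'.1 uu'); congr (Pr _ _)%:E; apply/seteqP.
  by split => w /=; rewrite scaleE (Ustat_usum hn D s0) -scaleE -DE ltrBlDr.
have pWE t : pW t = EFin \o (fun K => Pr (pw (gauss R) K) [set y | t - scale * D < sigma^-1 * gquad (@tau K) y]).
  apply/funext => K /=; rewrite -(gauss_sample hxi).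
    congr (Q _); apply/seteqP; split => w /=; rewrite scaleE (gauss_quad_gquad hn D s0) -scaleE ltrBlDr//.
  apply: measurable_gt; apply: measurable_funM => //; exact: measurable_gquad.
split=> [t ht|F hF].
  rewrite pWE; apply: cvgn_EFin; apply: cvg_of_cauchy => eps e0.
  (* By the Hoeffding identity the degenerate variance is sigma_full^2 - 2 sigma_cond^2, and the
     threshold of the quadratic form is 0 exactly at t = scale D. *)
  have x0 : 0 < Ex rr (fun z => dcenter rho u' z ^+ 2) \/ sigma * (t - scale * D) <> 0.
    case: ht => [h|h]; [left|right].
      rewrite lt_neqAle Ex_ge0 ?andbT//; last by move=> z; exact: sqr_ge0.
      apply/eqP => v0; apply: h; have := Ex_hoeffding ku; rewrite -/rr -v0 addr0 sE => e.
      by rewrite sfE scE -!EFin_expe e sqr_sqrtr.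
    by move/eqP; rewrite mulf_eq0 gt_eqF//= subr_eq0 => /eqP.
  have [K0 hK] := gquad_cauchy phi2' St SS Stau ku (exp_error_cvg0 phi2' ku nu23 cvg0) x0 e0.
  exists K0 => K L kK kL; have := hK K L kK kL.
  have e K' : [set y | sigma * (t - scale * D) < gquad (@tau K') y] =
      [set y | t - scale * D < sigma^-1 * gquad (@tau K') y].
    by apply/seteqP; split => y /=; rewrite ltr_pdivlMl.
  by rewrite !e.
set A := absmoment rr nu (fun z => u' z - D).
have A0 : (0 <= A)%E by exact: absmoment_ge0.
have MA : (M_full nu `^ nu = A)%E by rewrite cn// poweRVK.
pose p : R := (n.-1%:R `^ (5^-1))^-1; pose s : R := (n.-1%:R * c2 / sigma ^+ 2) `^ (5^-1).
pose r := (2 * nu + 1)^-1; pose q : R := n%:R `^ (- ((nu - 2) / (4 * nu + 2))).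
have q0 : 0 < q by rewrite powR_gt0// ltr0n ltnW.
have r0 : 0 < r by rewrite invr_gt0; lra.
have sV : ((sigma%:E `^ nu)^-1 = (sigma `^ nu)^-1%:E)%E.
  by rewrite poweR_EFin inver gt_eqF// powR_gt0.
have sn0 : 0 < (sigma `^ nu)^-1 by rewrite invr_gt0 powR_gt0.
apply: (@le_trans _ _ ((2 ^+ 31)%:E * (p%:E + s%:E + q%:E * (A * (sigma `^ nu)^-1%:E) `^ r))%E); last first.
  apply: lee_wpmul2l; first by rewrite lee_fin exprn_ge0.
  apply: leeD; first apply: leeD => //.
    (* (sqrt y)^(2/5) = y^(1/5) for y = (n-1) sigma_cond^2 / sigma_full^2. *)
    rewrite sfE scE inver gt_eqF// -!EFinM poweR_EFin lee_fin le_eqVlt; apply/orP; left; apply/eqP.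
    have e : Num.sqrt n.-1%:R * Num.sqrt c2 / sigma = Num.sqrt (n.-1%:R * c2 / sigma ^+ 2).
      by rewrite sqrtrM ?mulr_ge0// sqrtrM// sqrtrV ?sqr_ge0// sqrtr_sqr gtr0_norm.
    rewrite e /s -[in LHS](@sqr_sqrtr _ (n.-1%:R * c2 / sigma ^+ 2)); last first.
      by rewrite divr_ge0 ?sqr_ge0// mulr_ge0.
    by rewrite -powR_mulrn ?sqrtr_ge0// -powRrM.
  apply: lee_wpmul2l; first by rewrite lee_fin ltW.
  apply: gt0_ler_poweR; first exact: ltW.
  - by rewrite in_itv/= leey andbT mule_ge0// lee_fin ltW.
  - by rewrite in_itv/= leey andbT sfE sV adde_ge0// mule_ge0 ?poweR_ge0// lee_fin ltW.
  - by rewrite sfE sV MA leeDl// mule_ge0 ?poweR_ge0// lee_fin ltW.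
apply: ge_ereal_sup => _ [t _ <-].
have p0 : 0 <= p by rewrite invr_ge0 powR_ge0.
have s'0 : 0 <= s by rewrite powR_ge0.
(* If the [nu]-th moment is infinite, so is the right-hand side. *)
case EA : A A0 => [N| |]// N0; last first.
  rewrite gt0_mulye ?lte_fin// poweRyr ?gt_eqF// gt0_muley ?lte_fin//.
  by rewrite addey// gt0_muley ?lte_fin ?exprn_gt0// leey.
have e : (q%:E * (N%:E * (sigma `^ nu)^-1%:E) `^ r = (q * (N * (sigma `^ nu)^-1) `^ r)%:E)%E.
  by rewrite -(EFinM N) poweR_EFin.
rewrite e -!EFinD -EFinM pDE.
apply: (dist_between_limits (b := fun K => Pr (pw (gauss R) K) [set y | t - scale * D < sigma^-1 * gquad (@tau K) y])).
  have NE : absmoment rr nu (fun z => u' z - Ex rr u') = N%:E by rewrite -DE.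
  have [K0 hK] := main_bound phi2' St SS Stau ku nu23 cvg0 hn s0 sE NE.
  by exists K0 => K kK; exact: hK.
by rewrite -pWE; exact: hF.
Qed.
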